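(* If $\big(k,\ell,r,\delta,(n_0,u_0,\kappa_0,\lambda_0)\big)$ is a $p$-adic exponent datum, then $$\left(\frac k{2(k+1)},\ \frac{k+\ell+1}{2(k+1)},\ \tilde r,\ \tilde\delta,\ (\tilde n_0,\tilde u_0,\tilde\kappa_0,\tilde\lambda_0)\right)$$ is also a $p$-adic exponent datum, where the new components are as follows. (1) If $0<k\le\frac12\le\ell<1$: denote $\tilde\lambda=\min(\kappa-\rho_p(y),\lambda)$ and (in the formulas below) $r=\max\big(r(y+1,p,\kappa,\tilde\lambda),\,r(y^{-1}+1,p,\kappa,\tilde\lambda)\big)$. Then $$\tilde r(y,p,\kappa,\lambda)=\frac{r+k\big(1-\kappa-\min(\iota'(y+1),\iota'(y^{-1}+1))\big)}{2(k+1)},\qquad\tilde\delta=\frac{\max(1,\delta)}2,$$ \begin{align*} \tilde\kappa_0(y,p)&=\max\big(1+\iota'(4),\ \kappa_0(y^{\pm}+1,p),\ \rho_p(y)+\lambda_0(y^{\pm}+1,p),\ \rho_p(y)+2\rho_p\big),\\ \tilde\lambda_0(y,p)&=\max\big(\lambda_0(y^{\pm}+1,p),\ 2\rho_p\big),\\ \tilde u_0(y,p,\kappa,\lambda)&=\max\big(1,\ u_0(y+1,p,\kappa,\tilde\lambda)+\kappa-\lfloor\lambda\rfloor+\iota'(y),\\ &\qquad u_0(y^{-1}+1,p,\kappa,\tilde\lambda)+\kappa+\lceil\tilde\lambda\rceil-\lfloor\lambda\rfloor-\lfloor\tilde\lambda\rfloor+\iota'(y),\\ &\qquad 2\kappa-\lfloor\lambda\rfloor-\lfloor\tilde\lambda\rfloor+\iota'(y(y+1))+1,\\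 &\qquad 2\kappa+\lceil\tilde\lambda\rceil-\lfloor\lambda\rfloor-2\lfloor\tilde\lambda\rfloor+\iota'(y)+\iota'(y^{-1}+1)+1\big),\\ \tilde n_0(y,p,\kappa,\lambda)&=\kappa+\iota'(y)+\Big\lceil\max\Big(2\kappa+2\iota'(y^{\pm}+1)+2\iota'(12),\\ &\qquad n_0(y^{\pm}+1,p,\kappa,\tilde\lambda)+\kappa+\iota'(y^{\pm}+1)-1,\\ &\qquad \tfrac32n_0(y^{\pm}+1,p,\kappa,\tilde\lambda)-\tfrac12\kappa-\tfrac12\iota'(y^{\pm}+1)-\tfrac32,\\ &\qquad n_0(y^{\pm}+1,p,\kappa,\tilde\lambda)+\iota'(2)+\iota'(y^{\pm}+1)+\varepsilon(y^{\pm})-\lfloor\tilde\lambda\rfloor,\\ &\qquad \frac{2(r+\kappa+\iota'(y^{\pm}+1))+(k-1)}{1-\ell},\\ &\qquad \varepsilon_u\Big(\frac{2k+1-\ell}{k}\big(u_0(y^{\pm}+1,p,\kappa,\tilde\lambda)-\kappa+\iota'(2)+\varepsilon(y^{\pm})\big)\\ &\qquad\qquad\qquad-\frac{r-1}{k(k+1)}+\frac{\kappa+\iota'(y^{\pm}+1)}{k+1}\Big)\Big)\Big\rceil, \end{align*} where $\varepsilon_u=0$ if $u_0(y^{\pm}+1,p,\kappa,\tilde\lambda)-\kappa+\iota'(2)+\varepsilon(y^{\pm})\le0$, and $\varepsilon_u=1$ otherwise. (If $\tilde\kappa_0(y,p)$ is not an integer it is to be rounded up.) (2) If $k=0$, the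 statement holds with $\tilde r=r/2$, $\tilde\delta=\delta/2$, $\tilde\kappa_0=\kappa_0$, $\tilde\lambda_0=\lambda_0$, $\tilde n_0=n_0$, $\tilde u_0=u_0$ (as functions of $y,p,\kappa,\lambda$). (3) If $\ell=1$, the statement holds with $\tilde r=0$, $\tilde\delta=\frac{k}{k+1}$, $\tilde\kappa_0=1+\iota'(4)$, $\tilde\lambda_0=\rho_p$, $\tilde n_0=\kappa+\iota'(y)+1+\iota'(12)$, $\tilde u_0=\max\big(\kappa-\lfloor\lambda\rfloor+\iota'(y)+1,\,1\big)$.
   Context: Notation. $\mathbb N=\{1,2,\dots\}$, $\mathbb Q^+$ is the set of positive rationals, $\mathbb R^+_0=[0,\infty)$, $P$ is the set of primes. For a prime $p$: $\rho_p=1/(p-1)$; $e(x)=e^{2\pi i x}$, also extended from $\mathbb Z[1/p]$ to the unique $\mathbb Z_p$-periodic function on $\mathbb Q_p$. For $y\in\mathbb Q^+$: $\iota(y)=\max(0,-\mathrm{ord}_p y)$, $\iota'(y)=\max(0,\mathrm{ord}_p y)$ (these depend on $p$); $\iota,\iota'$ stand for $\iota(y),\iota'(y)$ when $y$ is clear. $\rho_p(y)=\rho_p$ if $\mathrm{ord}_py\ne0$, and $\rho_p(y)=0$ otherwise. $\varepsilon(y)=1$ if $\mathrm{ord}_py\ne0$, and $\varepsilon(y)=0$ otherwise. For an expression $g$, $g(y^{\pm})$ denotes $\max(g(y),g(y^{-1}))$; that is, any of the listed expressions (entries of a maximum, or the quantity in the definition of $\varepsilon_u$) containing $y^{\pm}$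 denotes the larger of its two values with all occurrences of $y^{\pm}$ replaced by $y$, respectively all replaced by $y^{-1}$. Power series. $\mathbf I_0(\mathbb Z_p)$ is the set of power series $\sum_{k\ge0}a_kt^k$ with $a_k\in\mathbb Z_p$ and $|a_k|_p\to0$; for real $\lambda\ge 0$, $\mathbf I_0[\lambda](\mathbb Z_p)=\{a\in\mathbf I_0(\mathbb Z_p):\mathrm{ord}_pa_k\ge\lceil k\lambda\rceil\ \forall k\ge0\}$. $(1+x)^y=\sum_k\binom yk x^k$. Class $\mathbf F$. Let $w\in\mathbb Z$, $u,\kappa\in\mathbb N$ with $\kappa\ge1+\iota'(2)$, $\lambda\in\rho_p\mathbb N$, $y\in\mathbb Q^+$, $\omega,\omega'\in\mathbb Z_p^\times$. A power series $f\in\mathbb Q_p^\times\mathbf I_0(\mathbb Z_p)$ belongs to $\mathbf F(w,y,\kappa,\lambda,u,\omega,\omega')$ if $$f'(t)=p^w\omega'(1+p^{\iota+\kappa}\omega t)^{-y}+p^w\gamma_0+p^{u+w}g(t)$$ for some $\gamma_0\in\mathbb Z_p$ and $g\in\mathbf I_0[\lambda](\mathbb Z_p)$. $f\in\mathbf F(w,y,\kappa,\lambda,u)$ means $f\in\mathbf F(w,y,\kappa,\lambda,u,\omega,\omega')$ for some $\omega,\omega'\in\mathbb Z_p^\times$. Parameter functions. For a set $Y$, $\mathbf J(Y)$ is the set of functions $g:\mathbb Q^+\times P\to Y$ such that for every $y$ there are a finite $P_0(y)\subset P$ and a function $g_0:P\setminus P_0(y)\to Y$ with $g(y,p)=g_0(p)$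 for all $p\in P\setminus P_0(y)$. Similarly $\mathbf J_1(Y)$ is the set of functions $g(y,p,\kappa,\lambda)\in Y$ defined for $y\in\mathbb Q^+$, $p\in P$, $\kappa\in\iota'(2)+\mathbb N$, $\lambda\in\rho_p\mathbb N$, such that for every $y$ there are a finite $P_0(y)\subset P$ and a function $g_0$ on $(P\setminus P_0(y))\times X$, $X=\mathbb N\times\mathbb R^+$, with $g(y,p,\kappa,\lambda)=g_0(p,\kappa,\lambda)$ for all $p\in P\setminus P_0(y)$ and all admissible $\kappa,\lambda$. $p$-adic exponent data. Let $q=(k,\ell,r,\delta,(n_0,u_0,\kappa_0,\lambda_0))$ with $k,\ell\in\mathbb R$, $0\le k\le\frac12\le\ell\le1$, $r\in\mathbf J_1(\mathbb R)$, $\delta\in\mathbb R_0^+$, $n_0,u_0\in\mathbf J_1(\mathbb N)$, $\kappa_0\in\mathbf J(\mathbb N)$, $\lambda_0\in\mathbf J(\mathbb R_0^+)$, and $n_0(y,p,\kappa,\lambda)>\kappa+\iota'(y)$. Such $q$ is a $p$-adic exponent datum if, for every $p\in P$, $y\in\mathbb Q^+$, $w\in\mathbb Z$, $\kappa\in\mathbb N$ with $\kappa\ge1+\iota'(2)$, $\lambda\in\rho_p\mathbb N$, $n,u\in\mathbb N$ with $$\kappa\ge\kappa_0(y,p),\quad\lambda\ge\lambda_0(y,p),\quad n\ge w+n_0(y,p,\kappa,\lambda),\quad u\ge u_0(y,p,\kappa,\lambda),$$ and for every $f\in\mathbf F(w,y,\kappa,\lambda,u)$, $M\in\mathbb Z$,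 and $0<B\le p^{n-w-\kappa-\iota'}$, $$\sum_{M<m\le M+B}e\left(\frac{f(m)}{p^n}\right)\ll p^{r}\left(\frac{p^{n-w-\kappa-\iota'}}B\right)^kB^{\ell}\big(\log p^{n-w-\kappa-\iota'}\big)^{\delta},$$ where $r=r(y,p,\kappa,\lambda)$ and the implied constant depends only on the datum $q$. *)

(* Defs.v *)
From HB Require Import structures.
From mathcomp Require Import all_boot all_order all_algebra.
From mathcomp Require Import all_classical all_reals all_analysis.
From mathcomp Require Import complex.
Set Implicit Arguments.
Unset Strict Implicit.
Unset Printing Implicit Defensive.
Import Order.TTheory GRing.Theory Num.Theory.
Local Open Scope ring_scope.

(* The p-adic integers as the inverse limit of the rings Z/p^n: the n-th       *)
(* component is the canonical representative, in [0, p^n), of the residue      *)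
(* modulo p^n (the range follows from the coherence condition).                *)
Record padicZ (p : nat) (pr : prime p) := PadicZ {
  resid :> nat -> int;
  residP : forall n, resid n = (resid n.+1 %% (p ^ n)%N%:Z)%Z }.

Section PadicIntegers.
Variables (p : nat) (pr : prime p).
Notation Zp := (padicZ pr).
Notation q n := ((p ^ n)%N%:Z).

HB.instance Definition _ := gen_eqMixin Zp.
HB.instance Definition _ := gen_choiceMixin Zp.

Lemma padicZ_ext (x y : Zp) : resid x =1 resid y -> x = y.
Proof.
case: x y => [x hx] [y hy] /= /funext exy.
by rewrite -exy in hy *; congr PadicZ; exact: Prop_irrelevance.
Qed.

Lemma resid_mod (x : Zp) n : (resid x n %% q n)%Z = resid x n.
Proof. by rewrite residP modz_mod. Qed.

Lemma modz_q (m : int) n : ((m %% q n.+1)%Z %% q n)%Z = (m %% q n)%Z.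
Proof.
by rewrite [in RHS](divz_eq m (q n.+1)) expnSr PoszM mulrA mulrAC modzMDl.
Qed.

Lemma of_int_coh (m : nat -> int) :
  (forall n, m n = m n.+1 %[mod q n])%Z ->
  forall n, (m n %% q n)%Z = ((m n.+1 %% q n.+1)%Z %% q n)%Z.
Proof. by move=> h n; rewrite modz_q h. Qed.

Definition mkZp m (h : (forall n, m n = m n.+1 %[mod q n])%Z) : Zp :=
  @PadicZ p pr _ (of_int_coh h).

Lemma resid_step (x : Zp) n : (resid x n = resid x n.+1 %[mod q n])%Z.
Proof. by rewrite [in LHS]residP modz_mod. Qed.

Fact int_coh (m : int) n : (m = m %[mod q n])%Z. Proof. by []. Qed.
Fact add_coh (x y : Zp) n :
  (resid x n + resid y n = resid x n.+1 + resid y n.+1 %[mod q n])%Z.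
Proof. by rewrite -modzDm !(resid_step _ n) modzDm. Qed.
Fact opp_coh (x : Zp) n : (- resid x n = - resid x n.+1 %[mod q n])%Z.
Proof. by rewrite -modzNm resid_step modzNm. Qed.
Fact mul_coh (x y : Zp) n :
  (resid x n * resid y n = resid x n.+1 * resid y n.+1 %[mod q n])%Z.
Proof. by rewrite -modzMm !(resid_step _ n) modzMm. Qed.

Definition intZp (m : int) : Zp := mkZp (int_coh m).
Definition addZp x y : Zp := mkZp (add_coh x y).
Definition oppZp x : Zp := mkZp (opp_coh x).
Definition mulZp x y : Zp := mkZp (mul_coh x y).

Fact addZpA : associative addZp.
Proof. by move=> x y z; apply: padicZ_ext => n /=; rewrite modzDml modzDmr addrA. Qed.
Fact addZpC : commutative addZp.
Proof. by move=> x y; apply: padicZ_ext => n /=; rewrite addrC. Qed.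
Fact add0Zp : left_id (intZp 0) addZp.
Proof. by move=> x; apply: padicZ_ext => n /=; rewrite mod0z add0r resid_mod. Qed.
Fact addNZp : left_inverse (intZp 0) oppZp addZp.
Proof. by move=> x; apply: padicZ_ext => n /=; rewrite modzDml addNr. Qed.
HB.instance Definition _ := GRing.isZmodule.Build Zp addZpA addZpC add0Zp addNZp.

Fact mulZpA : associative mulZp.
Proof. by move=> x y z; apply: padicZ_ext => n /=; rewrite modzMml modzMmr mulrA. Qed.
Fact mulZpC : commutative mulZp.
Proof. by move=> x y; apply: padicZ_ext => n /=; rewrite mulrC. Qed.
Fact mul1Zp : left_id (intZp 1) mulZp.
Proof. by move=> x; apply: padicZ_ext => n /=; rewrite modzMml mul1r resid_mod. Qed.
Fact mulZpDl : left_distributive mulZp addZp.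
Proof. by move=> x y z; apply: padicZ_ext => n /=; rewrite modzMml modzDm mulrDl. Qed.
Fact oneZp_neq0 : intZp 1 != 0.
Proof.
apply/eqP => /(congr1 (fun x : Zp => resid x 1)) /=.
by rewrite expn1 mod0z modz_small// ltz_nat prime_gt1.
Qed.
HB.instance Definition _ :=
  GRing.Zmodule_isComNzRing.Build Zp mulZpA mulZpC mul1Zp mulZpDl oneZp_neq0.

Definition unitZp : pred Zp := fun x => `[< exists y, y * x = 1 >].
Definition invZp (x : Zp) : Zp :=
  if pselect (exists y, y * x = 1) is left h then projT1 (cid h) else x.
Fact mulVZp : {in unitZp, left_inverse 1 invZp *%R}.
Proof.
move=> x /asboolP ux; rewrite /invZp; case: pselect => // h.
exact: projT2 (cid h).
Qed.
Fact unitZpP (x y : Zp) : y * x = 1 -> unitZp x.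
Proof. by move=> yx; apply/asboolP; exists y. Qed.
Fact invZp_out : {in [predC unitZp], invZp =1 id}.
Proof.
move=> x /asboolP ux; rewrite /invZp; by case: pselect.
Qed.
HB.instance Definition _ :=
  GRing.ComNzRing_hasMulInverse.Build Zp mulVZp unitZpP invZp_out.

Lemma resid_add (x : Zp) n k : (resid x (n + k) %% q n)%Z = resid x n.
Proof.
elim: k => [|k IH]; first by rewrite addn0 resid_mod.
rewrite -IH addnS (residP x (n + k)) expnD PoszM.
by rewrite [in LHS](divz_eq (resid x (n + k).+1) (q n * q k)) mulrA mulrAC modzMDl.
Qed.

Fact mulZp_eq0 (x y : Zp) : x * y = 0 -> (x == 0) || (y == 0).
Proof.
have ex (z : Zp) : z != 0 -> exists n, resid z n != 0.
  move=> z0; apply: contrapT => /forallNP h; move/eqP: z0; apply.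
  apply: padicZ_ext => n /=; rewrite mod0z; apply/eqP/negPn/negP; exact: h.
have [-> //|/ex[n xn]] := eqVneq x 0; have [-> //|/ex[m ym]] := eqVneq y 0.
move=> /(congr1 (fun z : Zp => resid z (n + m)%N)) /=; rewrite mod0z.
move=> /dvdz_mod0P; rewrite dvdzE abszM.
have {}xn : ~~ (p ^ n %| `|resid x (n + m)|)%N.
  apply: contra xn => dx; rewrite -(resid_add x n m); exact/eqP/dvdz_mod0P.
have {}ym : ~~ (p ^ m %| `|resid y (n + m)|)%N.
  apply: contra ym => dy; rewrite -(resid_add y m n) addnC; exact/eqP/dvdz_mod0P.
have x0 : (0 < `|resid x (n + m)|)%N.
  by rewrite lt0n; apply: contra xn => /eqP ->; rewrite dvdn0.
have y0 : (0 < `|resid y (n + m)|)%N.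
  by rewrite lt0n; apply: contra ym => /eqP ->; rewrite dvdn0.
move: xn ym; rewrite !pfactor_dvdn ?muln_gt0 ?x0// lognM// -!ltnNge => xn ym.
by rewrite leqNgt -addnS leq_add// ltnW.
Qed.
HB.instance Definition _ := GRing.ComUnitRing_isIntegral.Build Zp mulZp_eq0.
End PadicIntegers.

Notation padicQ pr := {fraction padicZ pr}.

Section PadicNumbers.
Variables (p : nat) (pr : prime p).
Notation Zp := (padicZ pr).
Notation Qp := (padicQ pr).

Definition is_Zp (x : Qp) : Prop := exists a : Zp, x = tofrac a.

(* [ord_ge x N] is ord_p x >= N, that is x \in p^N Z_p (so ord_p 0 = +oo).     *)
Definition ord_ge (x : Qp) (N : int) : Prop :=
  exists a : Zp, x = p%:R ^ N * tofrac a.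

Definition tends_to0 (x : nat -> Qp) : Prop :=
  forall N : int, exists K : nat, forall k, (K <= k)%N -> ord_ge (x k) N.

(* Power series are represented by their sequences of coefficients.            *)
Definition I0 (a : nat -> Zp) : Prop := tends_to0 (fun k => tofrac (a k)).

Definition I0_slope (R : realType) (lam : R) (a : nat -> Zp) : Prop :=
  I0 a /\ forall k, ord_ge (tofrac (a k)) (Num.ceil (k%:R * lam)).

Definition QpI0 (f : nat -> Qp) : Prop :=
  exists c : Qp, c != 0 /\
  exists a : nat -> Zp, I0 a /\ forall k, f k = c * tofrac (a k).

Definition pseries_deriv (f : nat -> Qp) (k : nat) : Qp := k.+1%:R * f k.+1.

Definition gen_binom (z : rat) (k : nat) : rat :=
  (\prod_(i < k) (z - i%:R)) / k`!%:R.

(* The k-th coefficient of (1 + c t)^z.                                        *)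
Definition binom_series (c : Qp) (z : rat) (k : nat) : Qp :=
  ratr (gen_binom z k) * c ^+ k.

(* The value at t of a power series converging at t (junk value 0 otherwise).  *)
Definition pseries_eval (f : nat -> Qp) (t : Qp) : Qp :=
  xget 0 [set v | tends_to0 (fun K => v - \sum_(k < K) f k * t ^+ k)].

End PadicNumbers.

Definition e (R : realType) (x : R) : R[i] :=
  Complex (cos (2 * pi * x)) (sin (2 * pi * x)).

(* The Z_p-periodic extension of [e] from Z[1/p] to Q_p: every x in Q_p is     *)
(* congruent modulo Z_p to some a / p^N, which is unique modulo Z.             *)
Definition e_padic (R : realType) p (pr : prime p) (x : padicQ pr) : R[i] :=
  xget 0 [set z | exists (a : int) (N : nat),
    is_Zp (x - a%:~R / p%:R ^+ N) /\ z = e (a%:~R / p%:R ^+ N)].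

Definition ordp (p : nat) (y : rat) : int :=
  (logn p `|numq y|)%:Z - (logn p `|denq y|)%:Z.

Definition iota_ (p : nat) (y : rat) : int := Num.max 0 (- ordp p y).
Definition iota' (p : nat) (y : rat) : int := Num.max 0 (ordp p y).

Definition eps (p : nat) (y : rat) : int := (ordp p y != 0 : nat)%:Z.

Section ExponentData.
Variable R : realType.

Definition rho (p : nat) : R := (p%:R - 1)^-1.
Definition rhoy (p : nat) (y : rat) : R := if ordp p y != 0 then rho p else 0.

Definition in_rhoN (p : nat) (lam : R) : Prop :=
  exists j : nat, (0 < j)%N /\ lam = rho p * j%:R.

Definition in_F p (pr : prime p) (w : int) (y : rat) (kappa : nat) (lam : R)
    (u : nat) (omega omega' : padicZ pr) (f : nat -> padicQ pr) : Prop :=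
  QpI0 f /\
  exists (gamma0 : padicZ pr) (g : nat -> padicZ pr), I0_slope lam g /\
  forall k, pseries_deriv f k =
    p%:R ^ w * tofrac omega' *
      binom_series (p%:R ^ (iota_ p y + kappa%:Z) * tofrac omega) (- y) k
    + (if k == 0%N then p%:R ^ w * tofrac gamma0 else 0)
    + p%:R ^ (u%:Z + w) * tofrac (g k).

Definition class_F p (pr : prime p) w y kappa lam u (f : nat -> padicQ pr) :=
  exists omega omega' : padicZ pr,
    [/\ omega \is a GRing.unit, omega' \is a GRing.unit &
        in_F w y kappa lam u omega omega' f].

Definition admissible (y : rat) (p kappa : nat) (lam : R) : Prop :=
  [/\ 0 < y, prime p, 1 + iota' p 2 <= kappa%:Z & in_rhoN p lam].

(* Functions of (y, p) and of (y, p, kappa, lambda) with values in Y; values   *)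
(* at non-admissible arguments are irrelevant.  The function g0 giving the     *)
(* generic values does not depend on y, only the finite exceptional set P0     *)
(* does (otherwise the condition would be vacuous).                            *)
Definition J (T : Type) (Y : T -> Prop) (g : rat -> nat -> T) : Prop :=
  (forall y p, 0 < y -> prime p -> Y (g y p)) /\
  exists g0 : nat -> T, forall y, 0 < y -> exists P0 : seq nat,
    forall p, prime p -> p \notin P0 -> g y p = g0 p.

Definition J1 (T : Type) (Y : T -> Prop) (g : rat -> nat -> nat -> R -> T) :
    Prop :=
  (forall y p kappa lam, admissible y p kappa lam -> Y (g y p kappa lam)) /\
  exists g0 : nat -> nat -> R -> T, forall y, 0 < y -> exists P0 : seq nat,
    forall p kappa lam, admissible y p kappa lam -> p \notin P0 ->
      g y p kappa lam = g0 p kappa lam.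

(* The components n0, u0, kappa0 take positive integer values; they are typed  *)
(* in [int] so that no truncated subtraction occurs in formulas.               *)
Record exponent_tuple := ExponentTuple {
  ek : R; el : R;
  er : rat -> nat -> nat -> R -> R;
  edelta : R;
  en0 : rat -> nat -> nat -> R -> int;
  eu0 : rat -> nat -> nat -> R -> int;
  ekappa0 : rat -> nat -> int;
  elambda0 : rat -> nat -> R }.

Definition well_formed (q : exponent_tuple) : Prop :=
  [/\ 0 <= ek q <= 2^-1, 2^-1 <= el q <= 1 & 0 <= edelta q] /\
  [/\ J1 (fun _ : R => True) (er q),
      J1 (fun n : int => 0 < n) (en0 q), J1 (fun n : int => 0 < n) (eu0 q),
      J (fun n : int => 0 < n) (ekappa0 q) & J (fun x : R => 0 <= x) (elambda0 q)] /\
  forall y p kappa lam, admissible y p kappa lam ->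
    kappa%:Z + iota' p y < en0 q y p kappa lam.

(* \sum_{M < m <= M + B} e(f(m) / p^n), for real B >= 0.                       *)
Definition exp_sum p (pr : prime p) (f : nat -> padicQ pr) (n : nat) (M : int)
    (B : R) : R[i] :=
  \sum_(j < Num.truncn B)
    e_padic R (pseries_eval f (M + j.+1%:Z)%:~R / p%:R ^+ n).

Definition padic_exponent_datum (q : exponent_tuple) : Prop :=
  well_formed q /\
  exists2 C : R, 0 < C &
  forall p (pr : prime p) (y : rat) (w : int) (kappa : nat) (lam : R) (n u : nat),
    admissible y p kappa lam -> (0 < n)%N -> (0 < u)%N ->
    ekappa0 q y p <= kappa%:Z -> elambda0 q y p <= lam ->
    w + en0 q y p kappa lam <= n%:Z -> eu0 q y p kappa lam <= u%:Z ->
  forall f : nat -> padicQ pr, class_F w y kappa lam u f ->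
  forall (M : int) (B : R),
    let X : R := p%:R ^ (n%:Z - w - kappa%:Z - iota' p y) in
    0 < B -> B <= X ->
    `|exp_sum f n M B| <=
      (C * (p%:R `^ er q y p kappa lam * (X / B) `^ ek q * B `^ el q
            * ln X `^ edelta q))%:C%C.

(* g(y^{\pm}), the larger of g(y) and g(1/y).                                  *)
Definition pm (T : orderType ring_display) (g : rat -> T) (y : rat) : T :=
  Num.max (g y) (g y^-1).

(* The maximum of x and of the elements of s.                                  *)
Definition maxl (T : orderType ring_display) (x : T) (s : seq T) : T :=
  foldr Num.max x s.

Section Transform.
Variable q : exponent_tuple.
Notation k := (ek q).
Notation l := (el q).
Notation n0 := (en0 q).
Notation u0 := (eu0 q).

Definition k_new : R := k / (2 * (k + 1)).
Definition l_new : R := (k + l + 1) / (2 * (k + 1)).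

Section Generic.
Variables (y : rat) (p kappa : nat) (lam : R).

(* \tilde\lambda; it is not affected by replacing y with 1/y.                  *)
Definition lamt : R := Num.min (kappa%:R - rhoy p y) lam.
Definition r_pm : R := pm (fun z => er q (z + 1) p kappa lamt) y.

Definition r_new : R :=
  (r_pm + k * (1 - kappa%:R
     - (Num.min (iota' p (y + 1)) (iota' p (y^-1 + 1)))%:~R))
  / (2 * (k + 1)).

Definition u0_new : int :=
  maxl 1 [::
    u0 (y + 1) p kappa lamt + kappa%:Z - Num.floor lam + iota' p y;
    u0 (y^-1 + 1) p kappa lamt + kappa%:Z + Num.ceil lamt - Num.floor lam
      - Num.floor lamt + iota' p y;
    2 * kappa%:Z - Num.floor lam - Num.floor lamt + iota' p (y * (y + 1)) + 1;
    2 * kappa%:Z + Num.ceil lamt - Num.floor lam - 2 * Num.floor lamt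
      + iota' p y + iota' p (y^-1 + 1) + 1].

Definition u_excess (z : rat) : int :=
  u0 (z + 1) p kappa lamt - kappa%:Z + iota' p 2 + eps p z.

(* The test uses the larger of the two values for y and 1/y.                   *)
Definition eps_u : R := if pm u_excess y <= 0 then 0 else 1.

Definition n0_new : int :=
  kappa%:Z + iota' p y + Num.ceil (maxl
    (pm (fun z => 2 * kappa%:R + 2 * (iota' p (z + 1))%:~R
                  + 2 * (iota' p 12)%:~R : R) y)
    [::
      pm (fun z => (n0 (z + 1) p kappa lamt)%:~R + kappa%:R
                   + (iota' p (z + 1))%:~R - 1) y;
      pm (fun z => 3 / 2 * (n0 (z + 1) p kappa lamt)%:~R - 1 / 2 * kappa%:R
                   - 1 / 2 * (iota' p (z + 1))%:~R - 3 / 2) y;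
      pm (fun z => (n0 (z + 1) p kappa lamt)%:~R + (iota' p 2)%:~R
                   + (iota' p (z + 1))%:~R + (eps p z)%:~R
                   - (Num.floor lamt)%:~R) y;
      pm (fun z => (2 * (r_pm + kappa%:R + (iota' p (z + 1))%:~R) + (k - 1))
                   / (1 - l)) y;
      pm (fun z => eps_u *
            ((2 * k + 1 - l) / k * (u_excess z)%:~R
             - (r_pm - 1) / (k * (k + 1))
             + (kappa%:R + (iota' p (z + 1))%:~R) / (k + 1))) y]).

End Generic.

Definition kappa0_new (y : rat) (p : nat) : int :=
  Num.ceil (maxl (1 + iota' p 4)%:~R
    [:: pm (fun z => (ekappa0 q (z + 1) p)%:~R) y;
        pm (fun z => rhoy p y + elambda0 q (z + 1) p) y;
        rhoy p y + 2 * rho p]).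

Definition lambda0_new (y : rat) (p : nat) : R :=
  Num.max (pm (fun z => elambda0 q (z + 1) p) y) (2 * rho p).

(* The transformed data for 0 < k <= 1/2 <= l < 1, for k = 0 and for l = 1.    *)
Definition transform_generic : exponent_tuple :=
  ExponentTuple k_new l_new r_new (Num.max 1 (edelta q) / 2)
    n0_new u0_new kappa0_new lambda0_new.

Definition transform_k0 : exponent_tuple :=
  ExponentTuple k_new l_new
    (fun y p kappa lam => er q y p kappa lam / 2) (edelta q / 2)
    n0 u0 (ekappa0 q) (elambda0 q).

Definition transform_l1 : exponent_tuple :=
  ExponentTuple k_new l_new (fun _ _ _ _ => 0) (k / (k + 1))
    (fun y p kappa _ => kappa%:Z + iota' p y + 1 + iota' p 12)
    (fun y p kappa lam =>
       Num.max (kappa%:Z - Num.floor lam + iota' p y + 1) 1)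
    (fun _ p => 1 + iota' p 4) (fun _ p => rho p).

End Transform.

End ExponentData.

(* Main.v *)
Require Import Defs.
From HB Require Import structures.
From mathcomp Require Import all_boot all_order all_algebra generic_quotient.
From mathcomp Require Import all_classical all_reals all_analysis.
From mathcomp Require Import complex zify ring lra.
Set Implicit Arguments.
Unset Strict Implicit.
Unset Printing Implicit Defensive.
Import Order.TTheory GRing.Theory Num.Theory.
Local Open Scope ring_scope.

(** The estimate is Weyl differencing at the prime p.  Write g(m) = e(f(m)/p^n)
    and N = n - w - kappa - iota'(y).  Up to units the second difference of the
    phase is ab/p^N and the third one is abc/p^(N-D) with
    D = kappa + iota'(y+1).  For h = 2 tau the symmetric difference
    f(t + tau) - f(t - tau) belongs to the class F for the exponent y + 1, so the
    given datum bounds the correlations of g at every even shift h that is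
    divisible by a high enough power of p.

    The bound to be proved for a sum of length b is about (b d)^(1/2) with d a
    power of p. In van der Corput's inequality with shifts that are multiples
    of d, the correlation at a shift of p-adic order j is estimated in one of
    two ways. If the period p^(N-D-j) of its main part is long, the datum
    applies. Otherwise the correlation is p^(N-j)-periodic, its Fourier
    coefficients are at most p^(N-j) p^(-(N-D-j)/2) and live on a single
    residue class modulo p^D, and for different shifts these classes are
    disjoint, so that they can be summed over all shifts of order j at once.
    At the lowest order there is a loss of a fixed power of p; it is recovered
    by removing one residue class modulo p from the sum and by counting
    lattice points for the remaining classes. The assumptions on the datum
    enter through two lower bounds for its right-hand side, which come from
    its application to the series with derivative (1 + c t)^(-y-1) + gamma,
    for a single term and in mean square over gamma.

    For k = 0 the new bound is the geometric mean of the old one and of the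
    trivial one.  For l = 1 it is an interpolation between the trivial bound and
    the Polya-Vinogradov inequality, for which only the second differences
    matter. *)

(** * Norms and additive characters *)

(** The spacing d = p^th is fixed by equating p^th with the datum at a shift of order th - 1;
    rounding th to an integer order is the source of the summand k in (k + 1) th = r + k + k (N - D)
    + (l - k) log_p b. Since d H is always comparable with b, the boundary terms of the shifting
    step cannot be estimated trivially; they are shorter sums of the same phase, and the proof is a
    strong induction on b. The constant and the logarithms of the datum form one factor p^ell.
    Either N is at most a multiple of ell, and then p^N is bounded, or ell is small against N and
    disturbs none of the comparisons of exponents. The loss at the lowest order occurs only for chi
    < D, D close to N/4 and b within a factor p^(1/2) of p^(N/2). There the pairs (shift h,
    frequency a) have determinants h a' - h' a divisible by a power K of p. So they are few, or they
    lie on one line through the origin and then all come from one residue class modulo p. Removing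
    that class kills them, and the class itself, being thinner by the factor p, may be treated with
    the loss. *)

Section ComplexNorm.
Variable R : realType.
Local Notation C := (R[i]).

Definition nrm (z : C) : R := Normc.normc z.

Lemma nrmE (z : C) : `|z| = (nrm z)%:C%C.
Proof. by case: z. Qed.

Lemma nrm_ge0 (z : C) : 0 <= nrm z.
Proof. by case: z => a b; rewrite /nrm /= sqrtr_ge0. Qed.

Lemma nrmM (x y : C) : nrm (x * y) = nrm x * nrm y.
Proof. exact: Normc.normcM. Qed.

Lemma nrm0 : nrm 0 = 0. Proof. exact: Normc.normc0. Qed.

Lemma nrm1 : nrm 1 = 1. Proof. exact: Normc.normc1. Qed.

Lemma nrmD (x y : C) : nrm (x + y) <= nrm x + nrm y.
Proof. exact: (@le_normcD R x y). Qed.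

Lemma nrmN (x : C) : nrm (- x) = nrm x.
Proof. exact: (@normcN R x). Qed.

Lemma nrmR (x : R) : nrm x%:C%C = `|x|.
Proof. by rewrite /nrm /= expr0n /= addr0 sqrtr_sqr. Qed.

Lemma nrm_nat (n : nat) : nrm n%:R = n%:R.
Proof. by rewrite -(@rmorph_nat R C (real_complex R)) nrmR normr_nat. Qed.

Lemma nrm_conj (x : C) : nrm x^*%C = nrm x.
Proof. by case: x => a b; rewrite /nrm /= sqrrN. Qed.

Lemma nrm_sqr (z : C) : (nrm z ^+ 2)%:C%C = z * z^*%C.
Proof. by rewrite -sqr_normc nrmE -rmorphXn. Qed.

Lemma nrm_sum (I : Type) (r : seq I) (P : pred I) (F : I -> C) :
  nrm (\sum_(i <- r | P i) F i) <= \sum_(i <- r | P i) nrm (F i).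
Proof.
elim/big_ind2: _ => [|x y z t xy zt|//]; first by rewrite nrm0.
exact: le_trans (nrmD _ _) (lerD xy zt).
Qed.

Lemma cauchy_schwarz (I : Type) (r : seq I) (P : pred I) (f g : I -> R) :
  (\sum_(i <- r | P i) f i * g i) ^+ 2 <=
  (\sum_(i <- r | P i) f i ^+ 2) * (\sum_(i <- r | P i) g i ^+ 2).
Proof.
set A := \sum_(i <- r | P i) f i ^+ 2; set B := \sum_(i <- r | P i) g i ^+ 2.
set S := \sum_(i <- r | P i) f i * g i.
have quad t : 0 <= A * t ^+ 2 - 2 * S * t + B.
  have -> : A * t ^+ 2 - 2 * S * t + B =
            \sum_(i <- r | P i) (f i * t - g i) ^+ 2.
    rewrite /A /B /S mulr_suml mulr_sumr mulr_suml -sumrB -big_split /=.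
    by apply: eq_bigr => i _; ring.
  by apply: sumr_ge0 => i _; exact: sqr_ge0.
have A0 : 0 <= A by apply: sumr_ge0 => i _; exact: sqr_ge0.
have B0 : 0 <= B by apply: sumr_ge0 => i _; exact: sqr_ge0.
have [A0'|An0] := eqVneq A 0.
  have := quad (B + 1); have := quad (- (B + 1)); rewrite A0' !mul0r => h1 h2.
  have S0 : S = 0.
    apply/eqP; rewrite -[_ == _]negbK; apply/negP => /negP Sn0.
    (* With A = 0 the quadratic takes the value -1 at this point. *)
    have := quad ((B + 1) / (2 * S)); rewrite A0' mul0r.
    have {}Sn0 : S != 0 by apply/negP.
    by rewrite mulrC divfK ?mulf_neq0 ?pnatr_eq0//; lra.
  by rewrite S0 expr0n.
have {}A0 : 0 < A by rewrite lt_def An0.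
have := quad (S / A).
have -> : A * (S / A) ^+ 2 - 2 * S * (S / A) + B = (A * B - S ^+ 2) / A.
  by field.
by rewrite pmulr_lge0 ?invr_gt0// subr_ge0.
Qed.

Lemma cauchy_schwarz_sqrt (I : Type) (r : seq I) (P : pred I) (f g : I -> R) :
  \sum_(i <- r | P i) f i * g i <=
  Num.sqrt ((\sum_(i <- r | P i) f i ^+ 2) * (\sum_(i <- r | P i) g i ^+ 2)).
Proof.
apply: le_trans (ler_norm _) _; rewrite -sqrtr_sqr.
by apply: ler_wsqrtr; exact: cauchy_schwarz.
Qed.

End ComplexNorm.

Section Characters.
Variable R : realType.
Local Notation C := (R[i]).
Local Notation e := (@e R).

Lemma eD (x y : R) : e (x + y) = e x * e y.
Proof.
rewrite /Defs.e mulrDr cosD sinD.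
by rewrite [RHS]/GRing.mul /= addrC [X in (_ +i* X)%C]addrC [X in (X +i* _)%C]addrC.
Qed.

Lemma e0 : e 0 = 1.
Proof. by rewrite /Defs.e mulr0 cos0 sin0. Qed.

Lemma nrm_e (x : R) : nrm (e x) = 1.
Proof. by rewrite /nrm /= cos2Dsin2 sqrtr1. Qed.

Lemma eN (x : R) : e (- x) = (e x)^*%C.
Proof. by rewrite /Defs.e mulrN cosN sinN. Qed.

Lemma e_nat (n : nat) : e n%:R = 1.
Proof.
elim: n => [|n IH]; first by rewrite e0.
rewrite -natr1 eD IH mul1r /Defs.e mulr1.
by rewrite mulr_natl cos2pi sin2pi.
Qed.

Lemma e_int (n : int) : e n%:~R = 1.
Proof.
case: n => n; first exact: e_nat.
by rewrite NegzE mulrNz eN e_nat; apply/eqP; rewrite eq_complex /= oppr0 !eqxx.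
Qed.

Lemma e_inj1 (x : R) : e x = 1 -> exists n : int, x = n%:~R.
Proof.
pose y := x - (Num.floor x)%:~R.
have xy : x = (Num.floor x)%:~R + y by rewrite /y addrC subrK.
rewrite xy eD e_int mul1r => ey.
have y0 : 0 <= y by rewrite subr_ge0 floor_le.
have y1 : y < 1.
  by rewrite /y ltrBlDl -[1]/(1%:~R : R) -intrD lt_succ_floor.
have [->|yn0] := eqVneq y 0; first by exists (Num.floor x); rewrite addr0.
exfalso; have {y0} y0 : 0 < y by rewrite lt_def yn0.
case: ey => c1 s1.
have s0 : sin (pi * y) ^+ 2 = 0.
  have := c1; have -> : 2 * pi * y = pi * y + pi * y by ring.
  rewrite cosD -!expr2; have := cos2Dsin2 (pi * y); lra.
have : 0 < sin (pi * y).
  by apply: sin_gt0_pi; rewrite mulr_gt0 ?pi_gt0//= gtr_pMr ?pi_gt0.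
by move: s0 => /eqP; rewrite sqrf_eq0 => /eqP ->; rewrite ltxx.
Qed.

End Characters.

Section PeriodicSums.
Variable V : zmodType.

Lemma sum_period1 (Q : nat) (g : int -> V) :
  (forall m, g (m + Q%:Z) = g m) ->
  \sum_(i < Q) g (i%:Z + 1) = \sum_(i < Q) g i%:Z.
Proof.
case: Q => [|Q] per; first by rewrite !big_ord0.
rewrite big_ord_recr [RHS]big_ord_recl /= addrC; congr (_ + _).
  by rewrite -[RHS]per add0r; congr g; lia.
by apply: eq_bigr => i _; congr g; rewrite /bump /=; lia.
Qed.

Lemma sum_period_shift (Q : nat) (g : int -> V) (c : int) :
  (forall m, g (m + Q%:Z) = g m) ->
  \sum_(i < Q) g (i%:Z + c) = \sum_(i < Q) g i%:Z.
Proof.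
move=> per.
have nn (n : nat) h : (forall m, h (m + Q%:Z) = h m) ->
    \sum_(i < Q) h (i%:Z + n%:Z) = \sum_(i < Q) h i%:Z :> V.
  elim: n h => [|n IH] h ph; first by apply: eq_bigr => i _; rewrite addr0.
  rewrite -(IH _ ph) -[RHS](@sum_period1 Q (fun m => h (m + n%:Z))).
    by apply: eq_bigr => i _; congr h; lia.
  by move=> m; rewrite -[RHS]ph; congr h; lia.
case: c => n; first exact: nn.
rewrite -(nn n.+1 (fun m => g (m + Negz n))).
  by apply: eq_bigr => i _; congr g; rewrite NegzE; lia.
by move=> m; rewrite -[RHS]per; congr g; lia.
Qed.

Lemma sum_ord_add (n m : nat) (F : nat -> V) :
  \sum_(i < n + m) F i = \sum_(i < n) F i + \sum_(i < m) F (n + i)%N.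
Proof. by rewrite big_split_ord. Qed.

End PeriodicSums.

(** Within a residue class modulo Y the quotient by Y determines the element. *)
Lemma card_residue (n Y r : nat) : (0 < Y)%N ->
  (\sum_(i < n) (i == r %[mod Y]) <= n %/ Y + 1)%N.
Proof.
move=> Y0; rewrite -big_mkcond /= sum1_card addn1.
rewrite -[X in (_ <= X)%N]card_ord.
pose f (i : 'I_n) : 'I_(n %/ Y).+1 := inord (i %/ Y).
rewrite -(@card_in_imset _ _ f) ?max_card// => i j.
rewrite !unfold_in => /eqP hi /eqP hj.
move=> /(congr1 val) /=; rewrite !inordK ?ltnS ?leq_div2r ?(ltnW (ltn_ord _))//.
by move=> hd; apply: val_inj; rewrite /= (divn_eq i Y) (divn_eq j Y) hd hi hj.
Qed.

(** * Geometric sums modulo Q *)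

Section ExpSums.
Variable R : realType.
Local Notation C := (R[i]).
Local Notation e := (@e R).

Definition ez (Q : nat) (z : int) : C := e (z%:~R / Q%:R).

Lemma ezD Q x y : ez Q (x + y) = ez Q x * ez Q y.
Proof. by rewrite /ez intrD mulrDl eD. Qed.

Lemma ez0 Q : ez Q 0 = 1. Proof. by rewrite /ez mul0r e0. Qed.

Lemma nrm_ez Q x : nrm (ez Q x) = 1. Proof. exact: nrm_e. Qed.

Lemma ez_neq0 Q x : ez Q x != 0.
Proof.
by apply/eqP => h; have := nrm_ez Q x; rewrite h nrm0 => /esym/eqP; rewrite oner_eq0.
Qed.

Lemma ezN Q x : ez Q (- x) = (ez Q x)^*%C.
Proof. by rewrite /ez intrN mulNr eN. Qed.

Lemma ez_mulV Q x : ez Q x * ez Q (- x) = 1.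
Proof. by rewrite -ezD subrr ez0. Qed.

Lemma ez_mul (Q : nat) (k : int) : ez Q (Q%:Z * k) = 1.
Proof.
have [->|Q0] := eqVneq Q 0%N; first by rewrite mul0r ez0.
by rewrite /ez intrM mulrAC divff ?mul1r ?e_int// pnatr_eq0.
Qed.

Lemma ez_eq1 (Q : nat) (x : int) : (0 < Q)%N ->
  ez Q x = 1 -> exists k, x = Q%:Z * k.
Proof.
move=> Q0 /e_inj1[k hk]; exists k; apply/eqP.
rewrite -(@eqr_int R) intrM mulrC -hk divfK//.
by rewrite pnatr_eq0 -lt0n.
Qed.

Lemma ez_cong (Q : nat) (x y k : int) : x = y + Q%:Z * k -> ez Q x = ez Q y.
Proof. by move=> ->; rewrite ezD ez_mul mulr1. Qed.

Lemma ez_scale (Q k : nat) (x : int) : (0 < k)%N ->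
  ez (k * Q) (k%:Z * x) = ez Q x.
Proof.
move=> k0; rewrite /ez natrM intrM -mulf_div divff ?mul1r// pnatr_eq0 -lt0n//.
Qed.

Lemma ezXn Q x (n : nat) : ez Q (x * n%:Z) = ez Q x ^+ n.
Proof.
elim: n => [|n IH]; first by rewrite mulr0 ez0.
by rewrite exprS -IH -ezD; congr ez; lia.
Qed.

Lemma ez_orth (Q : nat) (z : int) : (0 < Q)%N ->
  \sum_(a < Q) ez Q (a%:Z * z) = if (Q%:Z %| z)%Z then Q%:R else 0.
Proof.
move=> Q0; case: ifP => [/dvdzP[k ->]|nd].
  rewrite (eq_bigr (fun=> 1)) ?sumr_const ?card_ord// => i _.
  by rewrite mulrA mulrC ez_mul.
have zn1 : ez Q z != 1.
  apply/negP => /eqP /(ez_eq1 Q0)[k zk]; move: nd.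
  by rewrite zk dvdz_mulr.
apply: (mulIf (x := ez Q z - 1)); first by rewrite subr_eq0.
rewrite mul0r mulrBr mulr1 mulr_suml.
rewrite -[X in _ - X](@sum_period1 _ Q (fun a => ez Q (a * z))).
  by apply/eqP; rewrite subr_eq0; apply/eqP/eq_bigr => i _; rewrite -ezD; congr ez; lia.
by move=> m; apply: (@ez_cong _ _ _ z); lia.
Qed.

Definition esum (Q n : nat) (a : int) : C := \sum_(i < n) ez Q (a * i%:Z).

Lemma nrm_esum_le Q n a : nrm (esum Q n a) <= n%:R.
Proof.
apply: le_trans (nrm_sum _ _ _) _; rewrite (eq_bigr (fun=> 1)) => [|i _].
  by rewrite sumr_const card_ord.
exact: nrm_ez.
Qed.

Lemma conj_sum (I : Type) (r : seq I) (P : pred I) (F : I -> C) :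
  ((\sum_(i <- r | P i) F i)^*)%C = \sum_(i <- r | P i) ((F i)^*)%C.
Proof. exact: (rmorph_sum (@conjc R)). Qed.

Lemma conjM (x y : C) : ((x * y)^*)%C = (x^*)%C * (y^*)%C.
Proof. exact: (rmorphM (@conjc R)). Qed.

(** Parseval along a residue class of frequencies: summation over c keeps only the pairs i, j
    congruent modulo Y, with weight Y, and each i has at most n/Y + 1 partners. *)
Lemma esum_class (K Y n : nat) (a0 : int) : (0 < K)%N -> (0 < Y)%N ->
  \sum_(c < Y) nrm (esum (K * Y) n (a0 + K%:Z * c%:Z)) ^+ 2 <=
  n%:R * (n%:R + Y%:R).
Proof.
move=> K0 Y0; rewrite -[leLHS]ger0_norm; last first.
  by apply: sumr_ge0 => c _; exact: sqr_ge0.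
rewrite -nrmR rmorph_sum /=.
have -> : \sum_(c < Y) ((nrm (esum (K * Y) n (a0 + K%:Z * c%:Z)) ^+ 2)%:C)%C =
  \sum_(i < n) \sum_(j < n) ez (K * Y) (a0 * (i%:Z - j%:Z)) *
     \sum_(c < Y) ez Y (c%:Z * (i%:Z - j%:Z)) :> C.
  under eq_bigr => c _.
    rewrite nrm_sqr /esum conj_sum mulr_suml.
    under eq_bigr => i _.
      rewrite mulr_sumr; under eq_bigr => j _.
        rewrite -ezN -ezD.
        have -> : (a0 + K%:Z * c%:Z) * i%:Z - (a0 + K%:Z * c%:Z) * j%:Z =
          a0 * (i%:Z - j%:Z) + K%:Z * (c%:Z * (i%:Z - j%:Z)) by ring.
        rewrite ezD ez_scale//; over.
      over.
    over.
  rewrite /= exchange_big; apply: eq_bigr => i _; rewrite exchange_big.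
  by apply: eq_bigr => j _; rewrite mulr_sumr.
apply: le_trans (nrm_sum _ _ _) _.
have -> : n%:R * (n%:R + Y%:R) = \sum_(i < n) (n%:R + Y%:R) :> R.
  by rewrite sumr_const card_ord mulr_natl.
apply: ler_sum => i _; apply: le_trans (nrm_sum _ _ _) _.
apply: (@le_trans _ _ (\sum_(j < n) (Y * (j == i %[mod Y]))%:R)).
  apply: ler_sum => j _; rewrite nrmM nrm_ez mul1r ez_orth//.
  case: ifP => [d|_]; last by rewrite nrm0 ler0n.
  rewrite nrm_nat ler_nat; suff -> : (j == i %[mod Y])%N by rewrite muln1.
  move: d => /dvdzP[k hk].
  rewrite -eqz_nat -!modz_nat; apply/eqP.
  have -> : i%:Z = j%:Z + k * Y%:Z by lia.
  by rewrite addrC modzMDl.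
rewrite -natr_sum -big_distrr /= -natrD ler_nat.
apply: leq_trans (leq_mul (leqnn Y) (card_residue n i Y0)) _.
by rewrite mulnDr muln1 leq_add2r mulnC leq_trunc_div.
Qed.

End ExpSums.

(** * The smoothing kernel and its Fourier multiplier *)

Section Kernel.
Variable R : realType.
Local Notation C := (R[i]).
Local Notation e := (@e R).

Lemma nrm_1Be_half (t : R) : 4^-1 <= t <= 2^-1 -> 1 <= nrm (1 - e t).
Proof.
move=> /andP[t1 t2].
have c0 : cos (2 * pi * t) <= 0.
  have -> : 2 * pi * t = (2 * pi * t - pi) + pi :> R by ring.
  rewrite cosDpi oppr_le0; apply: cos_ge0_pihalf.
  have := pi_gt0 R; nra.
rewrite -(@ler_sqr _ 1) ?nnegrE ?nrm_ge0 ?ler01// expr1n.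
have -> : nrm (1 - e t) ^+ 2 = (1 - cos (2 * pi * t)) ^+ 2 + (sin (2 * pi * t)) ^+ 2.
  rewrite /nrm /= sqr_sqrtr ?addr_ge0 ?sqr_ge0//.
  by rewrite add0r sqrrN.
have := cos2Dsin2 (2 * pi * t); nra.
Qed.

(** Doubling: |1 - e(2t)| <= 2 |1 - e(t)| carries the bound from 2t down to t. The induction starts
    in [1/4, 1/2], where the cosine is nonpositive. *)
Lemma nrm_1Be (t : R) : 0 < t <= 2^-1 -> 2 * t <= nrm (1 - e t).
Proof.
move=> /andP[t0 t2].
have [n hn] : exists n, 4^-1 <= 2 ^+ n * t.
  exists (Num.bound t^-1); have t'0 : 0 <= t^-1 by rewrite invr_ge0 ltW.
  have h1 : t^-1 < 2 ^+ Num.bound t^-1.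
    apply: lt_trans (archi_boundP t'0) _.
    by rewrite -natrX ltr_nat ltn_expl.
  have : 1 < 2 ^+ Num.bound t^-1 * t by rewrite -ltr_pdivrMr// div1r.
  lra.
elim: n t t0 t2 hn => [|n IH] t t0 t2 hn.
  rewrite expr0 mul1r in hn.
  by apply: le_trans (nrm_1Be_half _); [lra|rewrite hn t2].
have [t4|t4] := leP 4^-1 t.
  by apply: le_trans (nrm_1Be_half _); [lra|rewrite t4 t2].
have := IH (2 * t); rewrite mulrA -exprSr => /(_ _ _ hn) h.
have {}h : 2 * (2 * t) <= nrm (1 - e (2 * t)) by apply: h; lra.
have : nrm (1 - e (2 * t)) <= 2 * nrm (1 - e t).
  have -> : 1 - e (2 * t) = (1 + e t) * (1 - e t).
    have -> : 2 * t = t + t by ring.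
    by rewrite eD; ring.
  rewrite nrmM ler_wpM2r ?nrm_ge0//; apply: le_trans (nrmD _ _) _.
  by rewrite nrm1 nrm_e; lra.
lra.
Qed.

Lemma nrm_esum_decay (Q n : nat) (a : int) : (0 < Q)%N -> a != 0 ->
  (`|a| * 2 <= Q)%N -> nrm (esum R Q n a) <= Q%:R / `|a|%:R.
Proof.
move=> Q0 a0 a2.
have tele : esum R Q n a * (1 - ez R Q a) = 1 - ez R Q (a * n%:Z).
  rewrite /esum; elim: n => [|n IH]; first by rewrite big_ord0 mul0r mulr0 ez0 subrr.
  rewrite big_ord_recr /= mulrDl IH.
  have -> : a * n.+1%:Z = a * n%:Z + a by lia.
  by rewrite ezD; ring.
have low : 2 * (`|a|%:R / Q%:R) <= nrm (1 - ez R Q a).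
  have ap : 0 < (`|a|%:R / Q%:R : R) <= 2^-1.
    rewrite divr_gt0 ?ltr0n ?absz_gt0//=.
    by rewrite ler_pdivrMr ?ltr0n// mulrC ler_pdivlMr// -natrM ler_nat.
  apply: le_trans (nrm_1Be ap) _.
  case: (ltrP a 0) => sa; last by rewrite /ez natr_absz ger0_norm.
  have -> : ez R Q a = ((e (`|a|%:R / Q%:R))^*)%C.
    by rewrite natr_absz ltr0_norm// -[in LHS](opprK a) ezN.
  have J (z : C) : nrm (1 - z^*%C) = nrm (1 - z).
    by case: z => u v; rewrite /nrm /= !sub0r opprK sqrrN.
  by rewrite J.
have up : nrm (esum R Q n a) * nrm (1 - ez R Q a) <= 2.
  rewrite -nrmM tele; apply: le_trans (nrmD _ _) _.
  by rewrite nrmN nrm1 nrm_ez; lra.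
have q0 : 0 < (`|a|%:R / Q%:R : R) by rewrite divr_gt0 ?ltr0n ?absz_gt0.
rewrite -[leRHS]invrK invf_div -[_^-1]mul1r ler_pdivlMr//.
have := nrm_ge0 (esum R Q n a); nra.
Qed.

(** Complete periods cancel, so a sum longer than Q behaves like one of length below Q. *)
Lemma esum_full (Q n : nat) (a : int) : (0 < Q)%N -> ~~ (Q%:Z %| a)%Z ->
  esum R Q n a = esum R Q (n %% Q) a.
Proof.
move=> Q0 na; rewrite {1}(divn_eq n Q) addnC /esum.
elim: (n %/ Q)%N => [|k IH]; first by rewrite mul0n addn0.
rewrite mulSn addnCA addnC -IH.
rewrite (@sum_ord_add _ (n %% Q + k * Q) Q (fun i => ez R Q (a * i%:Z))).
rewrite [X in _ + X](_ : _ = 0) ?addr0//.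
have := ez_orth R a Q0; rewrite (negbTE na) => h.
transitivity (ez R Q (a * (n %% Q + k * Q)%N) * \sum_(i < Q) ez R Q (i%:Z * a)).
  rewrite mulr_sumr; apply: eq_bigr => i _; rewrite -ezD; congr (ez _ _ _).
  by rewrite !PoszD; ring.
by rewrite h mulr0.
Qed.

Lemma sqrtr_le (A y : R) : 0 <= y -> A <= y ^+ 2 -> Num.sqrt A <= y.
Proof.
by move=> y0 /ler_wsqrtr; rewrite sqrtr_sqr ger0_norm.
Qed.

(* The Fourier multiplier of the averages [Wsum]. *)
Definition kap (Q b : nat) (a : int) : R :=
  nrm (esum R Q (2 * b) a) * nrm (esum R Q b a) / b%:R.

Lemma kap_ge0 Q b a : 0 <= kap Q b a.
Proof. by rewrite divr_ge0// mulr_ge0 ?nrm_ge0. Qed.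

Lemma kap_le Q b a : (0 < b)%N -> kap Q b a <= 2 * b%:R.
Proof.
move=> b0; rewrite /kap ler_pdivrMr ?ltr0n//.
have := nrm_esum_le R Q (2 * b) a; have := nrm_esum_le R Q b a.
rewrite natrM => h1 h2; apply: ler_pM => //; exact: nrm_ge0.
Qed.

Lemma kap_decay Q b a : (0 < b)%N -> (0 < Q)%N -> a != 0 ->
  (`|a| * 2 <= Q)%N -> kap Q b a <= (Q%:R / `|a|%:R) ^+ 2 / b%:R.
Proof.
move=> b0 Q0 a0 aQ; rewrite /kap ler_pM2r ?invr_gt0 ?ltr0n// expr2.
by apply: ler_pM; rewrite ?nrm_ge0 ?nrm_esum_decay.
Qed.

(** Cauchy-Schwarz separates the two geometric sums in [kap], and [esum_class] bounds both mean
    squares. *)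
Lemma kap_class (K Y b : nat) (a0 : int) : (0 < K)%N -> (0 < Y)%N -> (0 < b)%N ->
  \sum_(c < Y) kap (K * Y) b (a0 + K%:Z * c%:Z) <= 2 * (2 * b%:R + Y%:R).
Proof.
move=> K0 Y0 b0; rewrite /kap -mulr_suml ler_pdivrMr ?ltr0n//.
apply: le_trans (cauchy_schwarz_sqrt _ _ _ _) _.
have b0' : 0 < (b%:R : R) by rewrite ltr0n.
have Y0' : 0 < (Y%:R : R) by rewrite ltr0n.
apply: sqrtr_le; first by nra.
apply: le_trans (ler_pM _ _ (esum_class R _ _ K0 Y0) (esum_class R _ _ K0 Y0)) _.
- by rewrite sumr_ge0// => i _; exact: sqr_ge0.
- by rewrite sumr_ge0// => i _; exact: sqr_ge0.
rewrite natrM; nra.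
Qed.

(** The frequency 0 has to be left out: [kap] equals 2b there, while the bound does not involve b.
    For b > Q both geometric sums are reduced to lengths below Q by [esum_full]. *)
Lemma kap_nonzero (Q b : nat) : (0 < Q)%N -> (0 < b)%N ->
  \sum_(a < Q | (a != 0 :> nat)) kap Q b a%:Z <= 6 * Q%:R.
Proof.
move=> Q0 b0; have b0' : 0 < (b%:R : R) by rewrite ltr0n.
have Q0' : 0 < (Q%:R : R) by rewrite ltr0n.
have [bQ|Qb] := leqP b Q.
  have := kap_class 0 (ltn0Sn 0) Q0 b0; rewrite mul1n => h.
  apply: (@le_trans _ _ (\sum_(c < Q) kap Q b (0 + 1%:Z * c%:Z))).
    rewrite [leRHS](bigID (fun c : 'I_Q => (c != 0 :> nat))) /=.
    rewrite ler_wpDr ?sumr_ge0// => [i _|]; first exact: kap_ge0.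
    by apply: ler_sum => i _; rewrite add0r mul1r.
  apply: le_trans h _; have : (b%:R : R) <= Q%:R by rewrite ler_nat.
  lra.
have bQ : (Q%:R : R) < b%:R by rewrite ltr_nat.
apply: (@le_trans _ _ (2 * (2 * Q%:R + Q%:R) * Q%:R / b%:R)); last first.
  by rewrite ler_pdivrMr//; nra.
rewrite ler_pdivlMr// /kap -mulr_suml divfK ?gt_eqF//.
have key n : \sum_(a < Q | (a != 0 :> nat)) nrm (esum R Q n a%:Z) ^+ 2 <= Q%:R * (Q%:R + Q%:R).
  have := esum_class R (n %% Q) 0 (ltn0Sn 0) Q0; rewrite mul1n => h.
  apply: (@le_trans _ _ (\sum_(c < Q) nrm (esum R Q (n %% Q) (0 + 1%:Z * c%:Z)) ^+ 2)).
    rewrite [leRHS](bigID (fun c : 'I_Q => (c != 0 :> nat))) /=.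
    rewrite ler_wpDr ?sumr_ge0// => [i _|]; first exact: sqr_ge0.
    apply: ler_sum => i i0; rewrite add0r mul1r esum_full//.
    by apply/negP => /dvdz_mod0P; rewrite modz_small ?ltz_nat ?ltn_ord//=; lia.
  apply: le_trans h _.
  have : ((n %% Q)%N%:R : R) <= Q%:R by rewrite ler_nat ltnW// ltn_pmod.
  have : 0 <= ((n %% Q)%N%:R : R) by [].
  nra.
apply: le_trans (cauchy_schwarz_sqrt _ _ _ _) _.
apply: sqrtr_le; first by nra.
apply: le_trans (ler_pM _ _ (key _) (key _)) _.
- by rewrite sumr_ge0// => i _; exact: sqr_ge0.
- by rewrite sumr_ge0// => i _; exact: sqr_ge0.
nra.
Qed.

(* Up to a shift, the average over s of sums of length 2b majorizes the sum of
   length b, and its Fourier coefficients decay quadratically. *)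
Definition Wsum (V : unitRingType) (g : int -> V) (M : int) (b : nat) : V :=
  b%:R^-1 * \sum_(s < b) \sum_(i < 2 * b) g (M + i%:Z + s%:Z).


(** Each of the b windows of length 2b, starting at M - b + s with s < b, contains the interval of
    length b that starts at M. *)
Lemma Wsum_majorant (g : int -> R) (M : int) (b : nat) :
  (forall m, 0 <= g m) -> (0 < b)%N ->
  \sum_(i < b) g (M + i%:Z) <= Wsum g (M - b%:Z) b.
Proof.
move=> g0 b0; rewrite /Wsum mulrC ler_pdivlMr ?ltr0n// mulr_natr.
rewrite -[X in _ *+ X]card_ord -sumr_const; apply: ler_sum => s _.
have -> : (2 * b = (b - s) + (b + s))%N by have := ltn_ord s; lia.
rewrite (@sum_ord_add _ _ _ (fun i => g (M - b%:Z + i%:Z + s%:Z))).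
rewrite (@sum_ord_add _ b s (fun i => g (M - b%:Z + (b - s + i)%N%:Z + s%:Z))).
rewrite ler_wpDl ?sumr_ge0// ler_wpDr ?sumr_ge0//.
by apply: ler_sum => i _; rewrite le_eqVlt; apply/orP; left; apply/eqP; congr g; have := ltn_ord s; lia.
Qed.

Lemma Wsum_nrm_le (g : int -> C) (B : R) (M : int) (b : nat) : (0 < b)%N ->
  (forall M', nrm (\sum_(i < 2 * b) g (M' + i%:Z)) <= B) ->
  nrm (Wsum g M b) <= B.
Proof.
move=> b0 hB; rewrite /Wsum nrmM.
have -> : nrm (b%:R^-1 : C) = b%:R^-1.
  by rewrite /nrm Normc.normcV -/(nrm _) nrm_nat.
rewrite mulrC ler_pdivrMr ?ltr0n//; apply: le_trans (nrm_sum _ _ _) _.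
rewrite mulr_natr -[X in _ *+ X]card_ord -sumr_const; apply: ler_sum => s _.
rewrite (eq_bigr (fun i : 'I_(2 * b) => g (M + s%:Z + i%:Z))) => [|i _]; first exact: hB.
by congr g; ring.
Qed.

Definition fhat (Q : nat) (g : int -> C) (a : int) : C :=
  \sum_(m < Q) g m%:Z * ez R Q (- (a * m%:Z)).

Lemma fourier_inv (Q : nat) (g : int -> C) (m : int) : (0 < Q)%N ->
  (forall m, g (m + Q%:Z) = g m) ->
  g m = Q%:R^-1 * \sum_(a < Q) fhat Q g a%:Z * ez R Q (a%:Z * m).
Proof.
move=> Q0 per; have QC : (Q%:R : C) != 0 by rewrite pnatr_eq0 -lt0n.
apply: (mulfI QC); rewrite mulrA divff// mul1r.
under eq_bigr => a _.
  rewrite /fhat mulr_suml; under eq_bigr => n _.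
    rewrite -mulrA -ezD.
    have -> : - (a%:Z * n%:Z) + a%:Z * m = a%:Z * (m - n%:Z) by ring.
    over.
  over.
rewrite exchange_big /=.
(* Recentring the summation at m makes n = 0 the only term that survives orthogonality. *)
rewrite -(@sum_period_shift _ Q (fun n => \sum_(a < Q) g n * ez R Q (a%:Z * (m - n))) m).
  under eq_bigr => n _.
    rewrite -mulr_sumr.
    have -> : m - (n%:Z + m) = - n%:Z by ring.
    rewrite ez_orth//; over.
  case: Q Q0 per QC => // Q _ per QC.
  rewrite big_ord_recl big1 ?addr0 /=; last first.
    move=> i _; rewrite ifF ?mulr0//; apply/negP; rewrite dvdzE abszN /=.
    by move=> /dvdn_leq; rewrite /bump /=; have := ltn_ord i; lia.
  by rewrite add0r mulrC.
move=> n; rewrite per; apply: eq_bigr => a _; congr (_ * _).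
by apply: (@ez_cong _ _ _ _ (- a%:Z)); ring.
Qed.

Lemma Wsum_fourier (Q : nat) (g : int -> C) (M : int) (b : nat) :
  (0 < Q)%N -> (0 < b)%N -> (forall m, g (m + Q%:Z) = g m) ->
  nrm (Wsum g M b) <= Q%:R^-1 * \sum_(a < Q) nrm (fhat Q g a%:Z) * kap Q b a%:Z.
Proof.
move=> Q0 b0 per.
have Vn (n : nat) : nrm (n%:R^-1 : C) = n%:R^-1.
  by rewrite /nrm Normc.normcV -/(nrm _) nrm_nat.
have -> : Wsum g M b = Q%:R^-1 * \sum_(a < Q) fhat Q g a%:Z * (ez R Q (a%:Z * M) *
   (esum R Q (2 * b) a%:Z * esum R Q b a%:Z * b%:R^-1)).
  rewrite /Wsum.
  under eq_bigr => s _.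
    under eq_bigr => i _.
      rewrite (fourier_inv _ Q0 per).
      under eq_bigr => a _.
        have -> : a%:Z * (M + i%:Z + s%:Z) = a%:Z * M + a%:Z * i%:Z + a%:Z * s%:Z by ring.
        rewrite !ezD; over.
      over.
    rewrite -mulr_sumr exchange_big; over.
  rewrite -mulr_sumr /= exchange_big /= mulrCA; congr (_ * _).
  rewrite mulr_sumr; apply: eq_bigr => a _.
  rewrite (eq_bigr (fun i : 'I_b => fhat Q g a%:Z * ez R Q (a%:Z * M) *
      esum R Q (2 * b) a%:Z * ez R Q (a%:Z * i%:Z))) => [|i _].
    by rewrite -mulr_sumr -/(esum R Q b a%:Z); ring.
  by rewrite mulr_sumr mulr_suml; apply: eq_bigr => j _; ring.
rewrite nrmM Vn ler_wpM2l ?invr_ge0//.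
apply: le_trans (nrm_sum _ _ _) _; apply: ler_sum => a _.
by rewrite !nrmM nrm_ez mul1r Vn.
Qed.

End Kernel.

(** * Phases with prescribed differences *)

Section Phases.
Variable R : realType.
Local Notation C := (R[i]).

Definition uni (g : int -> C) := forall m, nrm (g m) = 1.

(** The multiplicative derivative: for g = e(f) it is e of the finite difference of f with step
    a. *)
Definition dm (a : int) (g : int -> C) (m : int) : C := g (m + a) * (g m)^*%C.

Lemma uni_mulV (g : int -> C) m : uni g -> g m * (g m)^*%C = 1.
Proof. by move=> ug; rewrite -nrm_sqr ug expr1n. Qed.

Lemma dm_uni a g : uni g -> uni (dm a g).
Proof. by move=> ug m; rewrite /dm nrmM nrm_conj !ug mulr1. Qed.

Lemma dm_shift a g m : uni g -> g (m + a) = dm a g m * g m.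
Proof. by move=> ug; rewrite /dm -mulrA [_^*%C * _]mulrC uni_mulV ?mulr1. Qed.

Lemma conjCK (x : C) : (x^*%C)^*%C = x.
Proof. exact: conjcK. Qed.

Lemma dmC a b g m : dm a (dm b g) m = dm b (dm a g) m.
Proof.
rewrite /dm !conjM !conjCK.
have -> : m + a + b = m + b + a by ring.
by ring.
Qed.

Lemma dmD a b g m : uni g -> dm (a + b) g m = dm a g (m + b) * dm b g m.
Proof.
move=> ug; rewrite /dm.
have -> : m + (a + b) = m + b + a by ring.
by rewrite -!mulrA; congr (_ * _); rewrite mulrCA mulrA uni_mulV ?mul1r.
Qed.

Lemma dm_eq (g : int -> C) h1 h2 : uni g ->
  dm h1 g 0 = dm h2 g 0 -> dm (h1 - h2) g h2 = 1.
Proof.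
move=> ug; rewrite /dm !add0r => /(congr1 (fun z => z * g 0)).
rewrite -!mulrA ![_^*%C * _]mulrC uni_mulV// !mulr1 => h12.
have -> : h2 + (h1 - h2) = h1 by ring.
by rewrite h12 uni_mulV.
Qed.

(* The phase of g has second (resp. third) differences a b th / p^N (resp.
   a b c th / p^V) to leading order, with th a p-adic unit. *)
Definition C2 (p N : nat) (g : int -> C) := exists2 th : int,
  ~~ (p%:Z %| th)%Z & forall a b m, exists t : int,
    dm a (dm b g) m = ez R (p ^ N) (a * b * (th + p%:Z * t)).

Definition C3 (p V : nat) (g : int -> C) := exists2 th : int,
  ~~ (p%:Z %| th)%Z & forall a b c m, exists t : int,
    dm a (dm b (dm c g)) m = ez R (p ^ V) (a * b * c * (th + p%:Z * t)).

Lemma C2_triv p N g a b m k : C2 p N g -> a * b = (p ^ N)%N%:Z * k ->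
  dm a (dm b g) m = 1.
Proof.
by case=> th _ h ab; have [t ->] := h a b m; rewrite ab -mulrA ez_mul.
Qed.

Lemma C3_triv p V g a b c m k : C3 p V g -> a * b * c = (p ^ V)%N%:Z * k ->
  dm a (dm b (dm c g)) m = 1.
Proof.
by case=> th _ h ab; have [t ->] := h a b c m; rewrite ab -mulrA ez_mul.
Qed.

Lemma ez_unit p (z t : int) (n : nat) : (0 < p)%N -> (0 < n)%N ->
  ez R (p ^ n) ((p ^ n.-1)%N%:Z * (z + p%:Z * t)) = ez R p z.
Proof.
case: n => // n p0 _ /=.
rewrite expnSr ez_scale ?expn_gt0 ?p0//.
exact: (@ez_cong _ _ _ _ t).
Qed.

(** One factor p below triviality the unknown t drops out and a p-th root of unity remains,
    nontrivial unless p divides z. The vanishing of complete sums comes from this root of unity. *)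
Lemma C2_unit p N g : prime p -> (0 < N)%N -> C2 p N g ->
  exists2 th : int, ~~ (p%:Z %| th)%Z & forall a b m z,
    a * b = (p ^ N.-1)%N%:Z * z -> dm a (dm b g) m = ez R p (z * th).
Proof.
move=> pp N0 [th nth h]; exists th => // a b m z ab.
have [t ->] := h a b m; rewrite ab -mulrA mulrDr.
have -> : z * (p%:Z * t) = p%:Z * (z * t) by ring.
by rewrite ez_unit// prime_gt0.
Qed.

Lemma C3_unit p V g : prime p -> (0 < V)%N -> C3 p V g ->
  exists2 th : int, ~~ (p%:Z %| th)%Z & forall a b c m z,
    a * b * c = (p ^ V.-1)%N%:Z * z -> dm a (dm b (dm c g)) m = ez R p (z * th).
Proof.
move=> pp N0 [th nth h]; exists th => // a b c m z ab.
have [t ->] := h a b c m; rewrite ab -mulrA mulrDr.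
have -> : z * (p%:Z * t) = p%:Z * (z * t) by ring.
by rewrite ez_unit// prime_gt0.
Qed.

Lemma Euclid_dvdzM p (a b : int) : prime p ->
  (p%:Z %| a * b)%Z = (p%:Z %| a)%Z || (p%:Z %| b)%Z.
Proof. by move=> pp; rewrite !dvdzE abszM Euclid_dvdM. Qed.

Lemma ez_p_neq1 p (z : int) : prime p -> ~~ (p%:Z %| z)%Z -> ez R p z != 1.
Proof.
move=> pp nz; apply/negP => /eqP /(ez_eq1 (prime_gt0 pp))[k zk].
by move: nz; rewrite zk dvdz_mulr.
Qed.

Lemma C2_inj p N g a b m : prime p -> C2 p N g ->
  dm a (dm b g) m = 1 -> ((p ^ N)%N%:Z %| a * b)%Z.
Proof.
move=> pp [th nth h]; have [t ->] := h a b m.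
move=> /ez_eq1; rewrite expn_gt0 prime_gt0// => /(_ isT)[k hk].
have : ((p ^ N)%N%:Z %| a * b * (th + p%:Z * t))%Z by rewrite hk dvdz_mulr.
rewrite Gauss_dvdzl//; rewrite coprimezE /=.
apply: coprimeXl; rewrite prime_coprime//.
apply: contra nth => d.
have -> : th = (th + p%:Z * t) - p%:Z * t by ring.
by rewrite rpredB ?dvdz_mulr.
Qed.

(** Used in both directions: if w <> 1 the sum vanishes, and if the sum does not vanish then w = 1,
    which restricts the frequency contained in w. *)
Lemma sum_shift_zero (Q : nat) (G : int -> C) (c : int) (w : C) :
  (forall m, G (m + Q%:Z) = G m) -> (forall m, G (m + c) = w * G m) ->
  \sum_(i < Q) G i%:Z = w * \sum_(i < Q) G i%:Z.
Proof.
move=> per sh; rewrite -[LHS](sum_period_shift c per) mulr_sumr.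
by apply: eq_bigr => i _; exact: sh.
Qed.

Lemma nrm_sqr_sum_period (Q : nat) (G : int -> C) :
  (forall m, G (m + Q%:Z) = G m) ->
  nrm (\sum_(i < Q) G i%:Z) ^+ 2 <=
  \sum_(t < Q) nrm (\sum_(m < Q) G (m%:Z + t%:Z) * (G m%:Z)^*%C).
Proof.
move=> per; apply: le_trans (nrm_sum _ _ _).
rewrite -[leLHS]ger0_norm ?sqr_ge0// -nrmR nrm_sqr conj_sum mulr_sumr.
rewrite [X in _ <= nrm X]exchange_big /= le_eqVlt; apply/orP; left; apply/eqP.
congr nrm; apply: eq_bigr => m _; rewrite mulr_suml.
transitivity (\sum_(t < Q) G (t%:Z + m%:Z) * ((G m%:Z)^*)%C); last first.
  by apply: eq_bigr => t _; rewrite addrC.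
rewrite (@sum_period_shift _ Q (fun t => G t * ((G m%:Z)^*)%C))//.
by move=> n; rewrite per.
Qed.

Lemma sum_dvd (K Y : nat) : (0 < Y)%N -> (\sum_(t < K * Y) (Y %| t) = K)%N.
Proof.
move=> Y0; elim: K => [|K IH]; first by rewrite big_ord0.
rewrite mulSn addnC big_split_ord /= IH.
case: Y Y0 {IH} => // Y _; rewrite big_ord_recl /= addn0 dvdn_mull// big1 ?addn0 ?addn1//.
move=> i _; rewrite /bump /= dvdn_addr ?dvdn_mull//.
by rewrite gtnNdvd// ltnS.
Qed.

Section Level.
Variables (p N V j : nat) (g : int -> C) (h h' : int).
Hypotheses (pp : prime p) (VN : (V <= N)%N) (jN : (j < N)%N) (ug : uni g)
  (hC2 : C2 p N g) (hC3 : C3 p V g)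
  (hE : h = (p ^ j)%N%:Z * h') (nh' : ~~ (p%:Z %| h')%Z).
(** Q is a period of gam, translation by Y multiplies gam by a constant, and K = Q / Y. The
    subtraction V - j is truncated, so that Y = 1 once j >= V. *)
Let Q := (p ^ (N - j))%N.
Let Y := (p ^ (V - j))%N.
Let K := (p ^ (N - j - (V - j)))%N.
Let gam := dm h g.

Let p0 : (0 < p)%N. Proof. exact: prime_gt0. Qed.

Let ugam : uni gam. Proof. exact: dm_uni. Qed.

Lemma levelQ : Q = (K * Y)%N.
Proof. by rewrite /Q /K /Y -expnD; congr expn; move: VN jN; clear; lia. Qed.

Lemma level_gt0 : [/\ (0 < Q)%N, (0 < K)%N & (0 < Y)%N].
Proof. by rewrite /Q /K /Y !expn_gt0 p0. Qed.

Lemma level_per m : gam (m + Q%:Z) = gam m.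
Proof.
rewrite (dm_shift _ _ ugam) (C2_triv (k := h') _ hC2) ?mul1r//.
by rewrite hE mulrA -PoszM -expnD subnK// ltnW.
Qed.

Lemma ez_per (a : int) m : ez R Q (- (a * (m + Q%:Z))) = ez R Q (- (a * m)).
Proof. by apply: (@ez_cong _ _ _ _ (- a)); ring. Qed.

(** Translation by p^(N-j-1) multiplies gam by a nontrivial p-th root of unity. *)
Lemma level_fhat0 : fhat Q gam 0 = 0.
Proof.
have N0 : (0 < N)%N by lia.
have [th nth hth] := C2_unit pp N0 hC2.
rewrite /fhat.
have w1 : ez R p (h' * th) != 1 by rewrite ez_p_neq1// Euclid_dvdzM// negb_or nh'.
set G := fun m : int => gam m * ez R Q (- (0 * m)).
have perG m : G (m + Q%:Z) = G m by rewrite /G level_per ez_per.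
have sh m : G (m + (p ^ (N - j).-1)%N%:Z) = ez R p (h' * th) * G m.
  rewrite /G !mul0r oppr0 ez0 !mulr1 (dm_shift _ _ ugam); congr (_ * _).
  apply: hth; rewrite hE mulrA -PoszM -expnD; congr (Posz (p ^ _) * _); lia.
have := sum_shift_zero perG sh; rewrite -/(fhat Q gam 0).
move=> /eqP; rewrite -subr_eq0 -[X in X - _]mul1r -mulrBl mulf_eq0 subr_eq0 eq_sym.
by rewrite (negbTE w1) /= => /eqP.
Qed.

(** Only the correlations with Y | t survive in the expanded square, K of them and each at most Q.
    For the other t, moving m by a suitable power of p multiplies [dm t gam] by a nontrivial p-th
    root of unity, by the third differences. *)
Lemma level_fhat_le (a : int) :
  nrm (fhat Q gam a) ^+ 2 <= Q%:R * K%:R.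
Proof.
have [Q0 K0 Y0] := level_gt0.
set G := fun m : int => gam m * ez R Q (- (a * m)).
have perG m : G (m + Q%:Z) = G m by rewrite /G level_per ez_per.
apply: le_trans (nrm_sqr_sum_period perG) _.
apply: (@le_trans _ _ (\sum_(t < Q) (Q * (Y %| t))%:R)); last first.
  by rewrite -natr_sum -big_distrr /= natrM levelQ sum_dvd.
apply: ler_sum => t _.
have GE m : G (m%:Z + t%:Z) * (G m%:Z)^*%C = dm t%:Z gam m%:Z * ez R Q (- (a * t%:Z)) :> C.
  rewrite /G /dm conjM -ezN opprK.
  have -> : ez R Q (- (a * t%:Z)) = ez R Q (- (a * (m%:Z + t%:Z))) * ez R Q (a * m%:Z).
    by rewrite -ezD; congr ez; ring.
  by ring.
rewrite (eq_bigr _ (fun (m : 'I_Q) _ => GE m)) -mulr_suml nrmM nrm_ez mulr1.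
case: (boolP (Y %| t)%N) => [_|nYt].
  rewrite muln1; apply: le_trans (nrm_sum _ _ _) _.
  rewrite (eq_bigr (fun=> 1)) => [|m _]; last exact: (dm_uni t%:Z ugam).
  by rewrite sumr_const card_ord.
suff -> : \sum_(i < Q) dm t gam i = 0 by rewrite nrm0.
have t0 : (0 < t)%N by rewrite lt0n; apply: contra nYt => /eqP ->; rewrite dvdn0.
have vt : (logn p t < V - j)%N by rewrite ltnNge -pfactor_dvdn.
have [t' nt' tE] : exists2 t', ~~ (p %| t')%N & (t = p ^ logn p t * t' :> nat)%N.
  have [t' c tE] := pfactor_coprime pp t0.
  by exists t'; rewrite -?prime_coprime// mulnC.
have V0 : (0 < V)%N by lia.
have [th nth hth] := C3_unit pp V0 hC3.
pose c := (p ^ (V - j - logn p t).-1)%N.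
have w1 : ez R p (t'%:Z * h' * th) != 1.
  by rewrite ez_p_neq1// !Euclid_dvdzM// !negb_or nh' nth dvdzE !andbT.
have per m : dm t%:Z gam (m + Q%:Z) = dm t%:Z gam m.
  rewrite /dm level_per.
  by have -> : m + Q%:Z + t%:Z = m + t%:Z + Q%:Z by [ring]; rewrite level_per.
have sh m : dm t%:Z gam (m + c%:Z) = ez R p (t'%:Z * h' * th) * dm t%:Z gam m.
  rewrite (dm_shift _ _ (dm_uni _ ugam)); congr (_ * _).
  apply: hth; rewrite hE {1}tE /c PoszM.
  have -> : ((p ^ (V - j - logn p t).-1)%N%:Z * ((p ^ logn p t)%N%:Z * t'%:Z) * ((p ^ j)%N%:Z * h')
     = ((p ^ (V - j - logn p t).-1) * p ^ logn p t * p ^ j)%N%:Z * (t'%:Z * h'))%R.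
    by rewrite !PoszM; ring.
  have eqV : ((V - j - logn p t).-1 + logn p t + j = V.-1)%N by move: vt; clear; lia.
  by rewrite -2!expnD eqV.
have := sum_shift_zero per sh.
move=> /eqP; rewrite -subr_eq0 -[X in X - _]mul1r -mulrBl mulf_eq0 subr_eq0 eq_sym.
by rewrite (negbTE w1) /= => /eqP.
Qed.

Lemma level_const m : dm Y%:Z gam m = dm Y%:Z gam 0.
Proof.
rewrite -[m in LHS]add0r (dm_shift _ _ (dm_uni _ ugam)).
rewrite (C3_triv (k := (p ^ (j + (V - j) - V))%N%:Z * (m * h')) _ hC3) ?mul1r//.
have -> : m * Y%:Z * h = (p ^ (V - j) * p ^ j)%N%:Z * (m * h').
  by rewrite hE /Y PoszM; ring.
rewrite [RHS]mulrA -PoszM -2!expnD.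
by have -> : (V - j + j = V + (j + (V - j) - V))%N by clear; lia.
Qed.

(** Since translation by Y multiplies gam by a constant, all frequencies of gam lie in one class
    modulo K, and the constant identifies the class. *)
Lemma level_supp (a : int) : fhat Q gam a != 0 ->
  dm Y%:Z gam 0 = ez R K a.
Proof.
have [Q0 K0 Y0] := level_gt0.
move=> f0; set G := fun m : int => gam m * ez R Q (- (a * m)).
have perG m : G (m + Q%:Z) = G m by rewrite /G level_per ez_per.
have sh m : G (m + Y%:Z) = (dm Y%:Z gam 0 * ez R K (- a)) * G m.
  rewrite /G (dm_shift _ _ ugam) level_const.
  have -> : ez R Q (- (a * (m + Y%:Z))) = ez R K (- a) * ez R Q (- (a * m)).
    rewrite -(@ez_scale _ K Y (- a))// mulnC -levelQ -ezD; congr ez; ring.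
  by ring.
have := sum_shift_zero perG sh; rewrite -/(fhat Q gam a) => /eqP.
rewrite -subr_eq0 -[X in X - _]mul1r -mulrBl mulf_eq0 subr_eq0 (negbTE f0) orbF.
by move=> /eqP h1; rewrite -[LHS]mulr1 -(ez_mulV R K a) mulrCA -h1 mulr1.
Qed.

End Level.
End Phases.

(** * Fourier bounds for one shift and for all shifts of an order *)

Section Spectral.
Variable R : realType.
Local Notation C := (R[i]).

Lemma sum_classes (V : zmodType) (K Y : nat) (f : nat -> V) :
  \sum_(a < K * Y) f a = \sum_(r < K) \sum_(c < Y) f (r + K * c)%N.
Proof.
elim: Y => [|Y IH].
  by rewrite muln0 big_ord0 big1// => i _; rewrite big_ord0.
rewrite mulnS addnC sum_ord_add IH -big_split /=; apply: eq_bigr => r _.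
by rewrite big_ord_recr /= [(K * Y + r)%N]addnC.
Qed.

Lemma ez_inj (K : nat) (a a' : int) : (0 < K)%N -> ez R K a = ez R K a' ->
  (K%:Z %| a - a')%Z.
Proof.
move=> K0 h; have : ez R K (a - a') = 1 by rewrite ezD h ez_mulV.
by move=> /(ez_eq1 K0)[k ->]; rewrite dvdz_mulr.
Qed.

(** The coefficients are at most K sqrt Y and live on one class modulo K, over which [kap_class]
    sums the multiplier. *)
Lemma spec_single (K Y b : nat) (phi : int -> C) :
  (0 < K)%N -> (0 < Y)%N -> (0 < b)%N ->
  (forall a, nrm (phi a) ^+ 2 <= (K * Y)%:R * K%:R) ->
  (forall a a', phi a != 0 -> phi a' != 0 -> (K%:Z %| a - a')%Z) ->
  (K * Y)%:R^-1 * \sum_(a < K * Y) nrm (phi a%:Z) * kap R (K * Y) b a%:Z <=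
  2 * (2 * b%:R + Y%:R) / Num.sqrt Y%:R.
Proof.
move=> K0 Y0 b0 hA hS.
have K0' : 0 < (K%:R : R) by rewrite ltr0n.
have Y0' : 0 < (Y%:R : R) by rewrite ltr0n.
have sY0 : 0 < Num.sqrt (Y%:R : R) by rewrite sqrtr_gt0.
have rhs0 : 0 <= 2 * (2 * b%:R + Y%:R) / Num.sqrt (Y%:R : R).
  by rewrite divr_ge0 ?mulr_ge0 ?addr_ge0// ltW.
have [/existsP[a0 ha0]|/existsPn h0] := boolP [exists a : 'I_(K * Y), phi a%:Z != 0]; last first.
  rewrite big1 ?mulr0// => a _; have := h0 a; rewrite negbK => /eqP ->.
  by rewrite nrm0 mul0r.
have bnd a : nrm (phi a) <= K%:R * Num.sqrt Y%:R.
  rewrite -[leLHS]ger0_norm ?nrm_ge0// -sqrtr_sqr; apply: sqrtr_le.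
    by rewrite mulr_ge0// ltW.
  apply: le_trans (hA a) _; rewrite exprMn sqr_sqrtr ?ler0n// natrM.
  by rewrite le_eqVlt; apply/orP; left; apply/eqP; ring.
rewrite (@sum_classes _ K Y (fun a => nrm (phi a%:Z) * kap R (K * Y) b a%:Z)).
have rK : (a0 %% K < K)%N by rewrite ltn_pmod.
rewrite (bigD1 (Ordinal rK)) //= [X in _ + X]big1 ?addr0; last first.
  move=> r hr; apply: big1 => c _.
  suff /eqP -> : phi (r + K * c)%N%:Z == 0 by rewrite nrm0 mul0r.
  apply: contraNT hr => hr; apply/eqP/val_inj => /=.
  have /dvdzP[k hk] := hS _ _ hr ha0.
  have : ((r + K * c)%N%:Z = a0%:Z + k * K%:Z)%R by move: hk => /eqP; rewrite subr_eq => /eqP ->; rewrite addrC.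
  move=> /(congr1 (fun z => (z %% K%:Z)%Z)); rewrite addrC modzMDl PoszD PoszM addrC.
  rewrite mulrC modzMDl !modz_nat modn_small//.
  by case.
apply: (@le_trans _ _ ((K * Y)%:R^-1 * (K%:R * Num.sqrt Y%:R * (2 * (2 * b%:R + Y%:R))))).
  rewrite ler_wpM2l ?invr_ge0//.
  apply: le_trans (ler_wpM2l _ (kap_class R (a0 %% K)%N%:Z K0 Y0 b0)); last first.
    by rewrite mulr_ge0// ltW.
  rewrite mulr_sumr; apply: ler_sum => c _.
  by rewrite PoszD PoszM ler_wpM2r ?kap_ge0.
rewrite ler_pdivlMr// natrM.
have -> : (K%:R * Y%:R)^-1 * (K%:R * Num.sqrt Y%:R * (2 * (2 * b%:R + Y%:R))) * Num.sqrt Y%:R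
  = (2 * (2 * b%:R + Y%:R)) * (Num.sqrt Y%:R ^+ 2 / Y%:R) :> R.
  by field; rewrite !gt_eqF.
by rewrite sqr_sqrtr ?ler0n// divff ?gt_eqF// mulr1.
Qed.

(** Summing over the shifts first, each frequency is counted at most cnt times and the frequency 0
    never, so that [kap_nonzero] applies. *)
Lemma spec_avg (K Y b H : nat) (P : pred 'I_H) (phi : 'I_H -> int -> C) (cnt : nat) :
  (0 < K)%N -> (0 < Y)%N -> (0 < b)%N ->
  (forall h a, P h -> nrm (phi h a) ^+ 2 <= (K * Y)%:R * K%:R) ->
  (forall h, P h -> phi h 0 = 0) ->
  (forall a, \sum_(h | P h) (phi h a != 0%R) <= cnt)%N ->
  \sum_(h | P h) ((K * Y)%:R^-1 *
     \sum_(a < K * Y) nrm (phi h a%:Z) * kap R (K * Y) b a%:Z) <=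
  6 * (K%:R * Num.sqrt Y%:R) * cnt%:R.
Proof.
move=> K0 Y0 b0 hA h00 hc.
have bnd h a : P h -> nrm (phi h a) <= K%:R * Num.sqrt Y%:R * (phi h a != 0)%:R.
  move=> Ph; case: eqP => [->|_]; first by rewrite nrm0 mulr0.
  rewrite mulr1 -[leLHS]ger0_norm ?nrm_ge0// -sqrtr_sqr; apply: sqrtr_le.
    by rewrite mulr_ge0// sqrtr_ge0.
  apply: le_trans (hA h a Ph) _; rewrite exprMn sqr_sqrtr ?ler0n// natrM.
  by rewrite le_eqVlt; apply/orP; left; apply/eqP; ring.
have KY0 : 0 < ((K * Y)%:R : R) by rewrite ltr0n muln_gt0 K0.
rewrite -mulr_sumr ler_pdivrMl// exchange_big /=.
apply: (@le_trans _ _ (\sum_(a < K * Y | (a != 0 :> nat))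
    K%:R * Num.sqrt Y%:R * cnt%:R * kap R (K * Y) b a%:Z)).
  rewrite [leLHS](bigID (fun a : 'I_(K * Y) => (a != 0 :> nat))) /=.
  rewrite [X in _ + X]big1 ?addr0; last first.
    move=> a; rewrite negbK => /eqP ->; apply: big1 => h Ph.
    by rewrite h00// nrm0 mul0r.
  apply: ler_sum => a _; rewrite -mulr_suml ler_wpM2r ?kap_ge0//.
  apply: (@le_trans _ _ (\sum_(h | P h) K%:R * Num.sqrt Y%:R * (phi h a%:Z != 0)%:R)).
    by apply: ler_sum => h Ph; exact: bnd.
  rewrite -mulr_sumr ler_wpM2l ?mulr_ge0 ?sqrtr_ge0//.
  by rewrite -natr_sum ler_nat.
rewrite -mulr_sumr.
have := kap_nonzero R (_ : 0 < K * Y)%N b0; rewrite muln_gt0 K0 Y0 => /(_ isT) h.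
have c0 : 0 <= K%:R * Num.sqrt (Y%:R : R) * cnt%:R by rewrite !mulr_ge0 ?sqrtr_ge0.
by apply: le_trans (ler_wpM2l c0 h) _; rewrite le_eqVlt; apply/orP; left; apply/eqP; ring.
Qed.

Section Levels.
Variables (p N V : nat) (g : int -> C).
Hypotheses (pp : prime p) (VN : (V <= N)%N) (ug : uni g)
  (hC2 : C2 p N g) (hC3 : C3 p V g).

(** A common frequency means a common constant in [level_supp]. After commuting the differences this
    is an equality between two values of [dm Y g], which [dm_eq] and [C2_inj] turn into
    divisibility. *)
Lemma level_pair (j : nat) (h1 h2 h1' h2' a : int) : (j < N)%N ->
  h1 = (p ^ j)%N%:Z * h1' -> ~~ (p%:Z %| h1')%Z ->
  h2 = (p ^ j)%N%:Z * h2' -> ~~ (p%:Z %| h2')%Z ->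
  fhat (p ^ (N - j)) (dm h1 g) a != 0 -> fhat (p ^ (N - j)) (dm h2 g) a != 0 ->
  ((p ^ N)%N%:Z %| (h1 - h2) * (p ^ (V - j))%N%:Z)%Z.
Proof.
move=> jN e1 n1 e2 n2 f1 f2.
have s1 := level_supp pp VN jN ug hC2 hC3 e1 f1.
have s2 := level_supp pp VN jN ug hC2 hC3 e2 f2.
set Y := (p ^ (V - j))%N in s1 s2 *.
have uY := dm_uni Y%:Z ug.
apply: (C2_inj (m := h2) pp hC2).
rewrite dm_eq// ![dm _ (dm Y%:Z g) 0]dmC.
by rewrite s1 s2.
Qed.

(* Fourier majorant of the averages of [dm h g] when p^j divides h. *)
Definition spec (b j : nat) (h : int) : R :=
  (p ^ (N - j))%:R^-1 * \sum_(a < p ^ (N - j))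
    nrm (fhat (p ^ (N - j)) (dm h g) a%:Z) * kap R (p ^ (N - j)) b a%:Z.

Lemma Wsum_spec (b j : nat) (h h' M : int) : (0 < b)%N -> (j < N)%N ->
  h = (p ^ j)%N%:Z * h' ->
  nrm (Wsum (dm h g) M b) <= spec b j h.
Proof.
move=> b0 jN hE; apply: Wsum_fourier => //; first by rewrite expn_gt0 prime_gt0.
by move=> m; exact: (level_per jN ug hC2 hE).
Qed.

Lemma spec_le (b j : nat) (h h' : int) : (0 < b)%N -> (j < N)%N ->
  h = (p ^ j)%N%:Z * h' -> ~~ (p%:Z %| h')%Z ->
  spec b j h <= 2 * (2 * b%:R + (p ^ (V - j))%:R) / Num.sqrt (p ^ (V - j))%:R.
Proof.
move=> b0 jN hE nh'; have [Q0 K0 Y0] := level_gt0 N V j pp.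
rewrite /spec (levelQ p VN jN) ; apply: spec_single => //.
  by move=> a; rewrite -(levelQ p VN jN); exact: (level_fhat_le pp VN jN ug hC2 hC3 hE nh').
move=> a a'; rewrite -(levelQ p VN jN) => f1 f2; apply: ez_inj => //.
by rewrite -(level_supp pp VN jN ug hC2 hC3 hE f1) (level_supp pp VN jN ug hC2 hC3 hE f2).
Qed.

(** By [level_pair] the h whose shifts share a frequency are congruent modulo p^e, where e = N - chi
    - (V - j) and j = chi + v; hence the count H / p^e + 1. *)
Lemma spec_sum (b chi nu v H : nat) : (0 < b)%N -> (chi + v < N)%N ->
  ~~ (p %| nu)%N ->
  \sum_(h < H | (0 < h)%N && (logn p h == v)) spec b (chi + v) (p ^ chi * nu * h)%N%:Z <=
  6 * ((p ^ (N - (chi + v) - (V - (chi + v))))%:R * Num.sqrt (p ^ (V - (chi + v)))%:R)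
    * (H %/ p ^ (N - chi - (V - (chi + v))) + 1)%:R.
Proof.
move=> b0 jN nnu; set j := (chi + v)%N.
have [Q0 K0 Y0] := level_gt0 N V j pp.
have lev (h : 'I_H) : (0 < h)%N && (logn p h == v) ->
    exists2 h' : int, (p ^ chi * nu * h)%N%:Z = (p ^ j)%N%:Z * h' & ~~ (p%:Z %| h')%Z.
  move=> /andP[h0 /eqP hv]; have [h' ch' hE] := pfactor_coprime pp h0.
  exists (nu * h')%N%:Z.
    by rewrite -PoszM {1}hE hv /j expnD; congr Posz; ring.
  by rewrite dvdzE /= Euclid_dvdM// negb_or nnu -prime_coprime.
rewrite /spec -/j (levelQ p VN jN).
apply: (@spec_avg _ _ b H _ (fun h => fhat (p ^ (N - j - (V - j)) * p ^ (V - j)) (dm (p ^ chi * nu * h)%N%:Z g)))=> //.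
- move=> h a /lev[h' hE nh']; rewrite -(levelQ p VN jN).
  exact: (level_fhat_le pp VN jN ug hC2 hC3 hE nh').
- move=> h /lev[h' hE nh']; rewrite -(levelQ p VN jN).
  exact: (level_fhat0 pp VN jN ug hC2 hE nh').
move=> a; rewrite -(levelQ p VN jN).
have [/existsP[h0 /andP[P0 f0]]|/existsPn hn] := boolP [exists h : 'I_H,
    ((0 < h)%N && (logn p h == v)) && (fhat (p ^ (N - j)) (dm (p ^ chi * nu * h)%N%:Z g) a != 0)]; last first.
  rewrite big1// => h Ph; have := hn h; rewrite Ph /= negbK => /eqP ->.
  by rewrite eqxx.
set e := (N - chi - (V - j))%N.
apply: (leq_trans _ (card_residue H h0 (_ : 0 < p ^ e)%N)); last first.
  by rewrite expn_gt0 prime_gt0.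
rewrite [leqLHS]big_mkcond /=; apply: leq_sum => h _.
case: ifP => // Ph; case: eqP => //= /eqP fh.
have [h1 e1 n1] := lev _ Ph; have [h2 e2 n2] := lev _ P0.
have := level_pair jN e1 n1 e2 n2 fh f0.
suff pe : ((p ^ N)%N%:Z %| ((p ^ chi * nu * h)%N%:Z - (p ^ chi * nu * h0)%N%:Z) * (p ^ (V - j))%N%:Z)%Z ->
    ((p ^ e)%N%:Z %| h%:Z - h0%:Z)%Z.
  move=> /pe; rewrite -eqz_mod_dvd -eqz_nat -!modz_nat => ->.
  by [].
have -> : ((p ^ chi * nu * h)%N%:Z - (p ^ chi * nu * h0)%N%:Z) * (p ^ (V - j))%N%:Z =
  (p ^ (chi + (V - j)))%N%:Z * (nu%:Z * (h%:Z - h0%:Z)).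
  by rewrite expnD !PoszM; ring.
have [le|lt] := leqP (chi + (V - j)) N.
  have -> : (p ^ N)%N%:Z = (p ^ (chi + (V - j)))%N%:Z * (p ^ e)%N%:Z.
    by rewrite -PoszM -expnD; congr (Posz (p ^ _)); move: le; rewrite /e; clear; lia.
  rewrite dvdz_mul2l ?mulf_eq0//; last by rewrite eqz_nat expn_eq0 gtn_eqF// prime_gt0.
  by rewrite Gauss_dvdzr// coprimezE /= coprimeXl// prime_coprime.
have -> : e = 0%N by move: lt; rewrite /e; clear; lia.
by rewrite expn0 dvd1z.
Qed.

End Levels.
End Spectral.

(** * Van der Corput's inequality *)

Section VanDerCorput.
Variable R : realType.
Local Notation C := (R[i]).

Definition isum (g : int -> C) (M : int) (b : nat) : C := \sum_(i < b) g (M + i%:Z).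

Lemma isum_le g M b : uni g -> nrm (isum g M b) <= b%:R.
Proof.
move=> ug; apply: le_trans (nrm_sum _ _ _) _; rewrite (eq_bigr (fun=> 1)) => [|i _].
  by rewrite sumr_const card_ord.
exact: ug.
Qed.

Lemma isum_cat g M n m : isum g M (n + m) = isum g M n + isum g (M + n%:Z) m.
Proof.
rewrite /isum (@sum_ord_add _ n m (fun i => g (M + i%:Z))); congr (_ + _).
by apply: eq_bigr => i _; rewrite PoszD addrA.
Qed.

Lemma isum_shift g M b (t : nat) :
  isum g M b - isum g (M + t%:Z) b = isum g M t - isum g (M + b%:Z) t.
Proof.
have h1 := isum_cat g M b t; have h2 := isum_cat g M t b.
rewrite addnC h2 in h1.
by apply/eqP; rewrite subr_eq addrAC eq_sym subr_eq; apply/eqP; rewrite h1 addrC.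
Qed.

(** Every positive distance from k is attained at most twice, once on each side. *)
Lemma sum_dist_le (H : nat) (B : nat -> R) (c0 : R) (k : 'I_H) :
  (forall n, 0 <= B n) ->
  \sum_(h < H) (if h == k then c0 else B `|h - k|%N) <=
  c0 + 2 * \sum_(h < H | (0 < h)%N) B h.
Proof.
move=> B0; rewrite (bigD1 k)//= eqxx lerD2l.
rewrite (eq_bigr (fun h : 'I_H => B `|h - k|%N)) => [|h /negbTE ->//].
rewrite (bigID (fun h : 'I_H => (h < k)%N)) /= [2 * _]mulrDl mul1r.
have im (P : pred 'I_H) (f : 'I_H -> 'I_H) : {in P &, injective f} ->
    (forall h, P h -> (0 < f h)%N /\ f h = `|h - k|%N :> nat) ->
    \sum_(h | P h) B `|h - k|%N <= \sum_(h < H | (0 < h)%N) B h.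
  move=> finj fP.
  have -> : \sum_(h | P h) B `|h - k|%N = \sum_(i in [set f h | h in [set h | P h]]) B i.
    rewrite big_imset /=; last by move=> x y; rewrite !inE; exact: finj.
    by apply: eq_big => [h|h Ph]; rewrite ?inE//; have [_ ->] := fP h Ph.
  rewrite [leRHS](bigID (fun i => i \in [set f h | h in [set h | P h]])) /=.
  rewrite ler_wpDr ?sumr_ge0//; rewrite le_eqVlt; apply/orP; left; apply/eqP.
  apply: eq_bigl => i; apply/idP/andP => [hi|[]//]; split=> //.
  by move/imsetP: hi => [h]; rewrite inE => /fP[h0 _] ->.
apply: lerD.
- apply: (im _ (fun h => Ordinal (leq_ltn_trans (leq_subr h k) (ltn_ord k)))).
    move=> x y; rewrite !unfold_in => /andP[_ hx] /andP[_ hy] [] e.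
    by apply: val_inj => /=; lia.
  by move=> h /andP[_ hk] /=; split; lia.
- apply: (im _ (fun h => Ordinal (leq_ltn_trans (leq_subr k h) (ltn_ord h)))).
    move=> x y; rewrite !unfold_in => /andP[_ hx] /andP[_ hy] [] e.
    by apply: val_inj => /=; lia.
  move=> h /andP[hn hk] /=; have : h != k :> nat by [].
  by split; lia.
Qed.

Variables (g : int -> C) (ug : uni g).

Definition Tsum (d H : nat) (m : int) : C := \sum_(h < H) g (m + (d * h)%N%:Z).

Lemma Wsum_sum (I : Type) (r : seq I) (P : pred I) (f : I -> int -> C) M b :
  Wsum (fun m => \sum_(i <- r | P i) f i m) M b = \sum_(i <- r | P i) Wsum (f i) M b.
Proof.
rewrite /Wsum -mulr_sumr; congr (_ * _).
rewrite [RHS]exchange_big /=; apply: eq_bigr => s _; rewrite [RHS]exchange_big /=.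
by [].
Qed.

Lemma Wsum_real (f : int -> R) M b :
  ((Wsum f M b)%:C)%C = Wsum (fun m => ((f m)%:C)%C) M b.
Proof.
rewrite /Wsum rmorphM fmorphV rmorph_nat; congr (_ * _).
by rewrite rmorph_sum; apply: eq_bigr => s _; rewrite rmorph_sum.
Qed.

Lemma Wsum_conj (f : int -> C) M b :
  nrm (Wsum (fun m => (f m)^*%C) M b) = nrm (Wsum f M b).
Proof.
rewrite -[RHS]nrm_conj; congr nrm; rewrite /Wsum conjM; congr (_ * _).
  by rewrite -[RHS]/(conjc _) fmorphV rmorph_nat.
by rewrite conj_sum; apply: eq_bigr => s _; rewrite conj_sum.
Qed.

Lemma Wsum_trans (f : int -> C) (c : int) M b :
  Wsum (fun m => f (m + c)) M b = Wsum f (M + c) b.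
Proof.
rewrite /Wsum; congr (_ * _); apply: eq_bigr => s _; apply: eq_bigr => i _.
by congr f; ring.
Qed.

Lemma conj_pair (a : bool) (x y : C) :
  (a%:R * (x * y^*%C))^*%C = a%:R * (y * (x^*)%C).
Proof.
case: a; rewrite ?mul1r ?mul0r; first last.
  exact: (rmorph0 (@conjc R)).
transitivity (x^*%C * (y^*%C)^*%C); first exact: conjM.
have -> : (y^*%C)^*%C = y by exact: conjCK.
by rewrite mulrC.
Qed.

(** Expanding the square gives correlations at the shifts d (h - k). The weight w is d-periodic and
    hence moves along with them; it will be either 1 or the indicator of the complement of a class
    modulo p. *)
Lemma vdc_mean (w : int -> bool) (d H b : nat) (M : int) (B : nat -> R) :
  (0 < b)%N -> (forall n, 0 <= B n) -> (forall m, w (m + d%:Z) = w m) ->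
  (forall h M', (0 < h)%N -> (h < H)%N ->
     nrm (Wsum (fun m => (w m)%:R * dm (d * h)%N%:Z g m) M' b) <= B h) ->
  Wsum (fun m => nrm ((w m)%:R * Tsum d H m) ^+ 2) M b <=
  H%:R * (2 * b%:R + 2 * \sum_(h < H | (0 < h)%N) B h).
Proof.
move=> b0 B0 wd hB.
apply: le_trans (ler_norm _) _; rewrite -nrmR Wsum_real.
have wdn n m : w (m + (d * n)%N%:Z) = w m.
  elim: n m => [|n IH] m; first by rewrite muln0 addr0.
  by rewrite mulnS PoszD addrA IH wd.
pose F (h k : 'I_H) m : C := (w m)%:R * (g (m + (d * h)%N%:Z) * (g (m + (d * k)%N%:Z))^*%C).
have -> : Wsum (fun m => ((nrm ((w m)%:R * Tsum d H m) ^+ 2)%:C)%C) M b =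
    \sum_(k < H) \sum_(h < H) Wsum (F h k) M b.
  rewrite -[RHS](eq_bigr _ (fun k _ => Wsum_sum _ _ (fun h => F h k) M b)).
  rewrite -Wsum_sum; congr (Wsum _ M b); apply/funext => m.
  rewrite nrm_sqr /F; case: (w m); last first.
    by rewrite !mul0r; symmetry; apply: big1 => k _; apply: big1 => h _; rewrite mul0r.
  rewrite mul1r /Tsum conj_sum exchange_big /= mulr_suml; apply: eq_bigr => h _.
  by rewrite mulr_sumr; apply: eq_bigr => k _; rewrite mul1r.
apply: le_trans (nrm_sum _ _ _) _.
have -> : H%:R * (2 * b%:R + 2 * \sum_(h < H | (0 < h)%N) B h) =
  \sum_(k < H) (2 * b%:R + 2 * \sum_(h < H | (0 < h)%N) B h) :> R.
  by rewrite sumr_const card_ord mulr_natl.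
apply: ler_sum => k _; apply: le_trans (nrm_sum _ _ _) _.
apply: le_trans (sum_dist_le (2 * b%:R) k B0); apply: ler_sum => h _.
have sub (x y : nat) : (y <= x)%N -> (d * x)%N%:Z = (d * y)%N%:Z + (d * (x - y))%N%:Z.
  by move=> xy; rewrite -PoszD -mulnDr subnKC.
case: eqP => [->|/eqP hk].
  apply: Wsum_nrm_le => // M'; apply: le_trans (nrm_sum _ _ _) _.
  have -> : 2 * b%:R = \sum_(i < 2 * b) 1 :> R by rewrite sumr_const card_ord natrM.
  apply: ler_sum => i _; rewrite /F uni_mulV// mulr1 nrm_nat.
  by case: (w _).
have hk' : h != k :> nat by [].
have [hlk|klh] := ltnP h k.
  have -> : `|h - k|%N = (k - h)%N by move: hlk; clear; lia.
  (* Conjugation exchanges h and k and makes the shift positive. *)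
  rewrite -Wsum_conj.
  have -> : (fun m => (F h k m)^*%C) = (fun m => (fun m' => (w m')%:R * dm (d * (k - h))%N%:Z g m') (m + (d * h)%N%:Z)).
    apply/funext => m; rewrite /F conj_pair wdn /dm -addrA -sub//.
    exact: ltnW.
  rewrite (Wsum_trans (fun m' => (w m')%:R * dm (d * (k - h))%N%:Z g m')).
  apply: hB; first by rewrite subn_gt0.
  by apply: leq_ltn_trans (leq_subr _ _) _.
have -> : `|h - k|%N = (h - k)%N by move: klh; clear; lia.
have -> : F h k = (fun m => (fun m' => (w m')%:R * dm (d * (h - k))%N%:Z g m') (m + (d * k)%N%:Z)).
  by apply/funext => m; rewrite /F wdn /dm -addrA -sub.
rewrite (Wsum_trans (fun m' => (w m')%:R * dm (d * (h - k))%N%:Z g m')).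
apply: hB; first by move: klh hk'; clear; lia.
by apply: leq_ltn_trans (leq_subr _ _) _.
Qed.

(** The sum is compared with its H translates; by [isum_shift] each comparison costs two boundary
    sums of length at most d H. *)
Lemma vdc_shift (d H b : nat) (M : int) (e : R) : (0 < H)%N ->
  (forall M' t, (t <= d * H)%N -> nrm (isum g M' t) <= e) ->
  nrm (isum g M b) <= 2 * e + nrm (\sum_(i < b) Tsum d H (M + i%:Z)) / H%:R.
Proof.
move=> H0 he; have H0' : 0 < (H%:R : R) by rewrite ltr0n.
have E : \sum_(i < b) Tsum d H (M + i%:Z) = \sum_(h < H) isum g (M + (d * h)%N%:Z) b.
  rewrite /Tsum exchange_big /=; apply: eq_bigr => h _; apply: eq_bigr => i _.
  by congr g; ring.
have -> : isum g M b = (\sum_(h < H) (isum g M b - isum g (M + (d * h)%N%:Z) b)) / H%:R +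
   (\sum_(i < b) Tsum d H (M + i%:Z)) / H%:R.
  rewrite -mulrDl E -big_split /= (eq_bigr (fun=> isum g M b)) => [|h _]; last by rewrite subrK.
  by rewrite sumr_const card_ord -[isum g M b *+ H]mulr_natr mulfK// pnatr_eq0 -lt0n.
apply: le_trans (nrmD _ _) _; rewrite !nrmM.
have -> : nrm (H%:R^-1 : C) = H%:R^-1.
  by rewrite /nrm Normc.normcV -/(nrm _) nrm_nat.
rewrite lerD2r ler_pdivrMr//; apply: le_trans (nrm_sum _ _ _) _.
rewrite mulr_natr -[X in _ *+ X]card_ord -sumr_const; apply: ler_sum => h _.
rewrite isum_shift; apply: le_trans (nrmD _ _) _; rewrite nrmN.
have dh : (d * h <= d * H)%N by rewrite leq_mul// ltnW.
by have := he M _ dh; have := he (M + b%:Z) _ dh; lra.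
Qed.

End VanDerCorput.

(** * Plane points whose determinants are divisible by Q *)

Section Lattice.

Lemma card_inj_le (T : finType) (P : {set T}) (n1 n2 : nat) (f1 f2 : T -> nat) :
  (forall t, t \in P -> (f1 t < n1)%N && (f2 t < n2)%N) ->
  (forall t u, t \in P -> u \in P -> f1 t = f1 u -> f2 t = f2 u -> t = u) ->
  (#|P| <= n1 * n2)%N.
Proof.
move=> hb hi; have [->|[t0 t0P]] := set_0Vmem P; first by rewrite cards0.
have /andP[h1 h2] := hb _ t0P.
have -> : (n1 * n2 = #|{: 'I_n1 * 'I_n2}|)%N by rewrite card_prod !card_ord.
pose f t : 'I_n1 * 'I_n2 := (insubd (Ordinal h1) (f1 t), insubd (Ordinal h2) (f2 t)).
rewrite -(@card_in_imset _ _ f) ?max_card// => t u tP uP [].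
have /andP[a1 a2] := hb _ tP; have /andP[b1 b2] := hb _ uP.
move=> /(congr1 val) /=; rewrite !val_insubd a1 b1 => e1.
move=> /(congr1 val) /=; rewrite !val_insubd a2 b2 => e2.
exact: hi.
Qed.

(** Let (q, c) be a difference of two points, the origin included, with q > 0 minimal. The
    determinants k of the points with (q, c) are multiples of Q. If they all vanish, the points lie
    on one line through the origin. Otherwise one counts the values of k and, for each of them, the
    points on a line of direction (q, c). *)
Lemma lattice_count (T : finType) (P : {set T}) (x : T -> nat) (s : T -> int)
    (H A Q : nat) : (0 < Q)%N ->
  (forall t, t \in P -> (0 < x t)%N && (x t <= H)%N) ->
  (forall t, t \in P -> (`|s t| <= A)%N) ->
  (forall t u, t \in P -> u \in P -> x t = x u -> s t = s u -> t = u) ->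
  (forall t u, t \in P -> u \in P ->
     (Q%:Z %| (x t)%:Z * s u - (x u)%:Z * s t)%Z) ->
  (forall t u, t \in P -> u \in P -> (x t)%:Z * s u = (x u)%:Z * s t) \/
  (#|P| * Q <= 24 * H * A)%N.
Proof.
move=> Q0 hx hs hinj hQ.
have [P0|[t0 t0P]] := set_0Vmem P; first by left => t u; rewrite P0 inE.
(* [None] stands for the origin; it ensures that a positive difference of abscissas exists. *)
pose X (o : option T) := if o is Some t then x t else 0%N.
pose S (o : option T) := if o is Some t then s t else 0.
pose PP (o : option T) := if o is Some t then t \in P else true.
pose good q := [exists o : option T * option T, [&& PP o.1, PP o.2 & X o.1 == X o.2 + q.+1]%N].
have exq : exists q, good q.
  exists (x t0).-1; apply/existsP; exists (Some t0, None) => /=.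
  by rewrite t0P /=; have := hx _ t0P; lia.
case: (ex_minnP exq) => q0 /existsP[] [v1 v2] /= /and3P [P1 P2 /eqP X12] qmin.
pose q := q0.+1; pose c := S v1 - S v2.
have Xle o : PP o -> (X o <= H)%N.
  by case: o => [t|] //= tP; have := hx _ tP; lia.
have Sle o : PP o -> (`|S o| <= A)%N.
  by case: o => [t|] //= tP; have := hs _ tP.
have qH : (q <= H)%N by have := Xle _ P1; rewrite X12 /q; lia.
have cA : (`|c| <= 2 * A)%N.
  by have := Sle _ P1; have := Sle _ P2; rewrite /c; lia.
pose k t := q%:Z * s t - c * (x t)%:Z.
have kQ t : t \in P -> (Q%:Z %| k t)%Z.
  move=> tP.
  have d o : PP o -> (Q%:Z %| (X o)%:Z * s t - (x t)%:Z * S o)%Z.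
    by case: o => [u|] /= uP; [exact: hQ|rewrite mul0r mulr0 subr0 dvdz0].
  have -> : k t = ((X v1)%:Z * s t - (x t)%:Z * S v1) - ((X v2)%:Z * s t - (x t)%:Z * S v2).
    by rewrite /k /c X12 /q PoszD; ring.
  by rewrite rpredB ?d.
have far t u : t \in P -> u \in P -> (x u < x t)%N -> (x u + q <= x t)%N.
  move=> tP uP ut; have : good (x t - x u).-1.
    by apply/existsP; exists (Some t, Some u); rewrite /= tP uP /=; apply/eqP; lia.
  by move=> /qmin; rewrite /q; lia.
have same t u : t \in P -> u \in P -> k t = k u ->
    q%:Z * (s t - s u) = c * ((x t)%:Z - (x u)%:Z).
  by move=> _ _; rewrite /k => e; lia.
have samex t u : t \in P -> u \in P -> k t = k u -> x t = x u -> t = u.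
  move=> tP uP kk xx; apply: hinj => //; have := same _ _ tP uP kk.
  rewrite xx subrr mulr0 => /eqP; rewrite mulf_eq0 /= => /eqP; lia.
have [/existsP[t1 /andP[t1P k1]]|/existsPn all0] := boolP [exists t, (t \in P) && (k t != 0)]; last first.
  left=> t u tP uP; have kt : k t = 0 by have := all0 t; rewrite tP /= negbK => /eqP.
  have ku : k u = 0 by have := all0 u; rewrite uP /= negbK => /eqP.
  have q0' : q%:Z != 0 by [].
  apply: (mulfI q0').
  have -> : q%:Z * ((x t)%:Z * s u) = (x t)%:Z * (k u + c * (x u)%:Z) by rewrite /k; ring.
  have -> : q%:Z * ((x u)%:Z * s t) = (x u)%:Z * (k t + c * (x t)%:Z) by rewrite /k; ring.
  by rewrite kt ku; ring.
right; pose W := (q * A + `|c| * H)%N.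
have kW t : t \in P -> (`|k t| <= W)%N.
  move=> tP; have := hs _ tP; have := hx _ tP => /andP[_ xt] st.
  apply: (@leq_trans (`|(q%:Z * s t)%R| + `|(c * (x t)%:Z)%R|)%N).
    by rewrite /k; lia.
  by rewrite !abszM /= leq_add// leq_mul.
have QW : (Q <= W)%N.
  apply: leq_trans (kW _ t1P); have := kQ _ t1P; rewrite dvdzE /=.
  by move=> /dvdn_leq; rewrite absz_gt0; apply.
pose f1 t := `|((k t + W%:Z) %/ Q%:Z)%Z|%N.
have f1E t : t \in P -> exists2 z : int, k t = z * Q%:Z & (f1 t)%:Z = z + (W%:Z %/ Q%:Z)%Z.
  move=> tP; have /dvdzP[z kz] := kQ _ tP; exists z => //.
  have h0 : 0 <= k t + W%:Z by have := kW _ tP; lia.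
  rewrite /f1 gez0_abs; last by rewrite divz_ge0.
  by rewrite kz divzMDl// eqz_nat -lt0n.
have f1lt t : t \in P -> (f1 t < (2 * W) %/ Q + 1)%N.
  move=> tP; rewrite /f1 addn1 ltnS.
  have h0 : 0 <= k t + W%:Z by have := kW _ tP; lia.
  have -> : k t + W%:Z = `|(k t + W%:Z)%R|%N%:Z by rewrite gez0_abs.
  rewrite divz_nat /=; apply: leq_div2r; have := kW _ tP; lia.
have f1inj t u : t \in P -> u \in P -> f1 t = f1 u -> k t = k u.
  move=> tP uP ff; have [z -> hz] := f1E _ tP; have [z' -> hz'] := f1E _ uP.
  by congr (_ * _); move: hz hz'; rewrite ff => -> /addIr.
have n1 : (((2 * W) %/ Q + 1) * Q <= 3 * W)%N.
  by rewrite mulnDl mul1n; have := leq_trunc_div (2 * W) Q; lia.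
have [qA|qA] := leqP (`|c| * H) (q * A).
  have hc : (#|P| <= ((2 * W) %/ Q + 1) * (H %/ q + 1))%N.
  apply: (@card_inj_le _ P _ _ f1 (fun t => x t %/ q)%N) => [t tP|t u tP uP e1 e2].
  - rewrite f1lt//= addn1 ltnS leq_div2r//; by have := hx _ tP; lia.
  - have kk := f1inj _ _ tP uP e1; apply: samex => //.
    have := far _ _ tP uP; have := far _ _ uP tP.
    have := divn_eq (x t) q; have := divn_eq (x u) q; rewrite e2.
    have := ltn_pmod (x t) (ltn0Sn q0); have := ltn_pmod (x u) (ltn0Sn q0).
    rewrite -/q; set y := (x u %/ q * q)%N; clearbody y; clear; lia.
  have n2 : ((H %/ q + 1) * q <= 2 * H)%N.
    by rewrite mulnDl mul1n; have := leq_trunc_div H q; lia.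
  have : (#|P| * Q * q <= 12 * H * A * q)%N.
    apply: (@leq_trans ((((2 * W) %/ Q + 1) * Q) * ((H %/ q + 1) * q))%N).
      by rewrite mulnACA -[leqLHS]mulnA leq_mul2r hc orbT.
    apply: leq_trans (leq_mul n1 n2) _; rewrite /W in n1 *; nia.
  by rewrite leq_pmul2r// => h; apply: leq_trans h _; nia.
have c0 : (0 < `|c|)%N by rewrite lt0n; apply/eqP => c0; move: qA; rewrite c0; lia.
have hc : (#|P| <= ((2 * W) %/ Q + 1) * ((2 * A) %/ `|c| + 1))%N.
apply: (@card_inj_le _ P _ _ f1 (fun t => `|(s t + A%:Z)%R| %/ `|c|)%N) => [t tP|t u tP uP e1 e2].
- rewrite f1lt//= addn1 ltnS leq_div2r//; by have := hs _ tP; lia.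
- have kk := f1inj _ _ tP uP e1; apply: samex => //.
  have sm := same _ _ tP uP kk.
  apply/eqP; rewrite eqn_leq; apply/negPn/negP => ne.
  have xd : (q <= `|((x t)%:Z - (x u)%:Z)%R|)%N.
    by have := far _ _ tP uP; have := far _ _ uP tP; move: ne; clear; lia.
  have sd : (`|c| <= `|(s t - s u)%R|)%N.
    have e : (q * `|(s t - s u)%R| = `|c| * `|((x t)%:Z - (x u)%:Z)%R|)%N.
      by rewrite -[q]/`|q%:Z|%N -!abszM sm.
    by rewrite -(@leq_pmul2l q)// e mulnC leq_mul2l xd orbT.
  have := divn_eq `|(s t + A%:Z)%R| `|c|; have := divn_eq `|(s u + A%:Z)%R| `|c|; rewrite e2.
  have := ltn_pmod `|(s t + A%:Z)%R| c0; have := ltn_pmod `|(s u + A%:Z)%R| c0.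
  have := hs _ tP; have := hs _ uP.
  set y := (_ %/ `|c| * `|c|)%N; clearbody y; move: sd; clear; lia.
have n2 : (((2 * A) %/ `|c| + 1) * `|c| <= 4 * A)%N.
  by rewrite mulnDl mul1n; have := leq_trunc_div (2 * A) `|c|; lia.
have : (#|P| * Q * `|c| <= 24 * H * A * `|c|)%N.
  apply: (@leq_trans ((((2 * W) %/ Q + 1) * Q) * (((2 * A) %/ `|c| + 1) * `|c|))%N).
    by rewrite mulnACA -[leqLHS]mulnA leq_mul2r hc orbT.
  apply: leq_trans (leq_mul n1 n2) _; rewrite /W in n1 *; nia.
by rewrite leq_pmul2r.
Qed.

End Lattice.

(** * Removal of a residue class *)

Section Restricted.
Variable R : realType.
Local Notation C := (R[i]).

Definition cls (p : nat) (rho m : int) : bool := (p%:Z %| m - rho)%Z.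

Lemma clsD p rho m c : (p%:Z %| c)%Z -> cls p rho (m + c) = cls p rho m.
Proof.
by move=> pc; rewrite /cls; have -> : m + c - rho = c + (m - rho) by [ring]; rewrite rpredDl.
Qed.

(* f with one residue class modulo p removed. *)
Definition res (p : nat) (rho : int) (f : int -> C) (m : int) : C :=
  (~~ cls p rho m)%:R * f m.

Section ResLevel.
Variables (p N V j : nat) (g : int -> C) (h h' : int).
Hypotheses (pp : prime p) (VN : (V <= N)%N) (jV : (j.+2 <= V)%N) (ug : uni g)
  (hC2 : C2 p N g) (hC3 : C3 p V g)
  (hE : h = (p ^ j)%N%:Z * h') (nh' : ~~ (p%:Z %| h')%Z).
Let Q := (p ^ (N - j))%N.
(** One factor p less than the step Y: the factor that gam acquires under translation by c0 is no
    longer constant, but it depends only on m modulo p and differs from class to class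
    ([res_ratio]). Here K' = Q / c0. *)
Let c0 := (p ^ (V - j).-1)%N.
Let K' := (p ^ (N - V).+1)%N.
Let gam := dm h g.
Let ugam : uni gam. Proof. exact: dm_uni. Qed.
Let p0 : (0 < p)%N. Proof. exact: prime_gt0. Qed.
Let jN : (j < N)%N. Proof. by move: jV VN; clear; lia. Qed.

Let Frho (rho a : int) := fhat Q (fun m => (cls p rho m)%:R * gam m) a.

Let pQ : (p%:Z %| Q%:Z)%Z.
Proof. by rewrite dvdzE /= /Q -(@prednK (N - j)) ?subn_gt0// expnS dvdn_mulr. Qed.

(** Translations by c0 have to preserve the classes modulo p, hence the hypothesis [j.+2 <= V]. *)
Let pc0 : (p%:Z %| c0%:Z)%Z.
Proof.
rewrite dvdzE /= /c0 -(@prednK (V - j).-1) ?expnS ?dvdn_mulr//.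
by move: jV; clear; lia.
Qed.

Let perg m : gam (m + Q%:Z) = gam m.
Proof. exact: (level_per jN ug hC2 hE). Qed.

Lemma res_per rho m : res p rho gam (m + Q%:Z) = res p rho gam m.
Proof. by rewrite /res clsD// perg. Qed.

Let supp rho a : Frho rho a != 0 -> dm c0%:Z gam rho = ez R K' a.
Proof.
move=> f0; set G := fun m : int => (cls p rho m)%:R * gam m * ez R Q (- (a * m)).
have perG m : G (m + Q%:Z) = G m.
  by rewrite /G clsD// perg (ez_per R p N j a m).
have sh m : G (m + c0%:Z) = (dm c0%:Z gam rho * ez R K' (- a)) * G m.
  rewrite /G clsD//; case: (boolP (cls p rho m)) => [|_]; last by rewrite !mul0r mulr0.
  rewrite /cls => /dvdzP[k km]; rewrite !mul1r (dm_shift _ _ ugam).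
  have -> : dm c0%:Z gam m = dm c0%:Z gam rho.
    have -> : m = rho + (m - rho) by ring.
    rewrite (dm_shift _ _ (dm_uni _ ugam)) (C3_triv (k := k * h') _ hC3) ?mul1r//.
    have eV : ((V - j).-1 + j).+1 = V by move: jV; clear; lia.
    by rewrite hE km -eV expnS expnD !PoszM; ring.
  have -> : ez R Q (- (a * (m + c0%:Z))) = ez R K' (- a) * ez R Q (- (a * m)).
    rewrite -(@ez_scale _ K' c0 (- a)) ?expn_gt0 ?p0//.
    have -> : (c0 * K' = Q)%N.
      by rewrite /c0 /K' /Q -expnD; congr expn; move: jV VN; clear; lia.
    by rewrite -ezD; congr ez; ring.
  by ring.
have := sum_shift_zero perG sh; rewrite -[X in X = _]/(Frho rho a) -[X in _ = _ * X]/(Frho rho a) => /eqP.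
rewrite -subr_eq0 -[X in X - _]mul1r -mulrBl mulf_eq0 subr_eq0 (negbTE f0) orbF.
by move=> /eqP h1; rewrite -[LHS]mulr1 -(ez_mulV R K' a) mulrCA -h1 mulr1.
Qed.

Lemma res_ratio rho rho' : exists2 th : int, ~~ (p%:Z %| th)%Z &
  dm c0%:Z gam rho = ez R p ((rho - rho') * th) * dm c0%:Z gam rho'.
Proof.
have V0 : (0 < V)%N by move: jV; clear; lia.
have [th nth hth] := C3_unit pp V0 hC3.
exists (h' * th); first by rewrite Euclid_dvdzM// negb_or nh'.
have {1}-> : rho = rho' + (rho - rho') by ring.
rewrite (dm_shift _ _ (dm_uni _ ugam)); congr (_ * _).
rewrite mulrA; apply: hth; rewrite hE.
have -> : V.-1 = ((V - j).-1 + j)%N by move: jV; clear; lia.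
by rewrite expnD !PoszM; ring.
Qed.

Let uniq_cls rho rho' a : dm c0%:Z gam rho = ez R K' a -> dm c0%:Z gam rho' = ez R K' a ->
  (p%:Z %| rho - rho')%Z.
Proof.
move=> e1 e2; have [th nth] := res_ratio rho rho'; rewrite e1 e2 => h1.
apply/negPn/negP => nd.
have : ez R p ((rho - rho') * th) != 1.
  by rewrite ez_p_neq1// Euclid_dvdzM// negb_or nth nd.
by rewrite -(inj_eq (mulIf (ez_neq0 R K' a))) -h1 mul1r eqxx.
Qed.

Let cls_cong rho rho' m : (p%:Z %| rho - rho')%Z -> cls p rho m = cls p rho' m.
Proof.
move=> d; rewrite /cls; have -> : m - rho' = (rho - rho') + (m - rho) by ring.
by rewrite [RHS]rpredDl.
Qed.

Let split_cls a : fhat Q gam a = \sum_(r < p) Frho r%:Z a.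
Proof.
rewrite /Frho /fhat exchange_big /=; apply: eq_bigr => m _.
rewrite -mulr_suml -mulr_suml; congr (_ * _); rewrite -[LHS]mul1r; congr (_ * _).
have mp : (m %% p < p)%N by rewrite ltn_pmod.
rewrite (bigD1 (Ordinal mp))//= big1 ?addr0.
  have -> : cls p (m %% p)%N%:Z m => //.
  by rewrite /cls -eqz_mod_dvd !modz_nat modn_mod.
move=> r hr; case: (boolP (cls _ _ _)) => //; rewrite /cls -eqz_mod_dvd !modz_nat => /eqP[] e.
by move: hr => /eqP; case; apply: val_inj; rewrite /= e modn_small.
Qed.

Let res_compl a rho : fhat Q (res p rho gam) a = fhat Q gam a - Frho rho a.
Proof.
rewrite /Frho /fhat -sumrB; apply: eq_bigr => m _; rewrite /res.
by case: (cls p rho m); rewrite ?mul1r ?mul0r ?subrr ?subr0.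
Qed.

(** A frequency determines the class modulo p that it comes from, so the other classes contribute
    nothing to it. *)
Let full rho a : Frho rho a != 0 -> fhat Q gam a = Frho rho a.
Proof.
move=> f0; have mp : (`|(rho %% p%:Z)%Z| < p)%N.
  by have := ltz_pmod rho (_ : 0 < p%:Z); have := modz_ge0 rho (_ : p%:Z != 0); move: p0; clear; lia.
have rE : (p%:Z %| (Ordinal mp)%:Z - rho)%Z.
  rewrite -eqz_mod_dvd /= gez0_abs ?modz_mod// modz_ge0//.
  by move: p0; clear; lia.
rewrite split_cls (bigD1 (Ordinal mp))//= big1 ?addr0.
  rewrite /Frho; congr (fhat Q _ a); apply/funext => m.
  by rewrite (cls_cong _ rE).
move=> r hr; apply/eqP; apply: contraNT hr => fr.
have := uniq_cls (supp fr) (supp f0) => d.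
apply/eqP/val_inj => /=; move: rE d; rewrite -!eqz_mod_dvd => /eqP <- /eqP /=.
by rewrite !modz_nat !modn_small// => -[].
Qed.

(** Thus removing a class creates no new frequency, and the bounds and the support of the
    coefficients are inherited. *)
Lemma res_fhat rho a : fhat Q (res p rho gam) a = fhat Q gam a \/
  fhat Q (res p rho gam) a = 0.
Proof.
rewrite res_compl; have [->|f0] := eqVneq (Frho rho a) 0; first by left; rewrite subr0.
by right; rewrite (full f0) subrr.
Qed.

Lemma res_exists a : fhat Q gam a != 0 -> exists rho, dm c0%:Z gam rho = ez R K' a.
Proof.
move=> f0; suff [r /supp hr] : exists r : 'I_p, Frho r%:Z a != 0 by exists r%:Z.
apply/existsP; rewrite -[X in is_true X]negbK negb_exists; apply: contra f0 => /forallP h0.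
rewrite split_cls big1// => r _; apply/eqP; have := h0 r; by rewrite negbK.
Qed.

Lemma res_kill a rho : fhat Q gam a != 0 -> dm c0%:Z gam rho = ez R K' a ->
  fhat Q (res p rho gam) a = 0.
Proof.
move=> f0 e1; suff fr : Frho rho a != 0 by rewrite res_compl (full fr) subrr.
have [r fr] : exists r : 'I_p, Frho r%:Z a != 0.
  apply/existsP; rewrite -[X in is_true X]negbK negb_exists; apply: contra f0 => /forallP h0.
  by rewrite split_cls big1// => r _; apply/eqP; have := h0 r; rewrite negbK.
suff <- : Frho r%:Z a = Frho rho a by [].
rewrite /Frho; congr (fhat Q _ a); apply/funext => m.
by rewrite (cls_cong _ (uniq_cls (supp fr) e1)).
Qed.

End ResLevel.
End Restricted.

(** * The lowest order after removal of one class modulo p *)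

Section UnitSum.
Variable R : realType.
Local Notation C := (R[i]).

(** Along multiples of d the difference with step c is a character, which makes the relation between
    a shift d h and its frequencies linear in h. *)
Lemma dm_pow p V (g : int -> C) (c d m0 k : int) (n : nat) : uni g -> C3 p V g ->
  d * d * c = (p ^ V)%N%:Z * k ->
  dm (d * n%:Z) (dm c g) m0 = dm d (dm c g) m0 ^+ n.
Proof.
move=> ug hC3 hd; have uc := dm_uni c ug; elim: n => [|n IH].
  by rewrite mulr0 expr0 [LHS]/dm addr0 uni_mulV.
have -> : d * n.+1%:Z = d + d * n%:Z by rewrite intS; ring.
rewrite dmD// IH exprS; congr (_ * _).
rewrite (dm_shift _ _ (dm_uni _ uc)) (C3_triv (k := k * n%:Z) _ hC3) ?mul1r//.
by rewrite mulrA -hd; ring.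
Qed.

(** The residue of least absolute value: the lattice count needs frequencies close to 0 modulo Q to
    be small integers. *)
Definition srep (Q : nat) (a : nat) : int := if (2 * a <= Q)%N then a%:Z else a%:Z - Q%:Z.

Lemma srepE Q a : exists k : int, a%:Z = srep Q a + Q%:Z * k.
Proof.
by rewrite /srep; case: leqP => _; [exists 0; ring|exists 1; ring].
Qed.

Lemma srep_le Q a : (a < Q)%N -> (`|srep Q a| * 2 <= Q)%N.
Proof. rewrite /srep; case: (leqP (2 * a)) => h aQ; first by rewrite /= mulnC.
by rewrite distnEr; move: h aQ; clear; lia. Qed.

Lemma kap_srep Q b a : kap R Q b a%:Z = kap R Q b (srep Q a).
Proof.
have [k ->] := srepE Q a; rewrite /kap /esum.
by congr (nrm _ * nrm _ / _); apply: eq_bigr => i _; apply: (@ez_cong _ _ _ _ (k * i%:Z)); ring.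
Qed.

(** A majorant by steps. Take the least i with |s| b <= 2^i Q; for i = 0 the bound 2b is enough, for
    i > 0 the quadratic decay gives b 4^(1-i). *)
Lemma kap_dyadic Q b (s : int) : (0 < Q)%N -> (0 < b)%N -> (`|s| * 2 <= Q)%N ->
  kap R Q b s <= \sum_(i < b.+1) 4 * b%:R * 4^-1 ^+ i * (`|s| <= (2 ^ i * Q) %/ b)%:R.
Proof.
move=> Q0 b0 sQ; have b0' : 0 < (b%:R : R) by rewrite ltr0n.
have Q0' : 0 < (Q%:R : R) by rewrite ltr0n.
have exi : exists i, (`|s| * b <= 2 ^ i * Q)%N.
  exists b; rewrite mulnC leq_mul//; first by rewrite ltnW// ltn_expl.
  by apply: leq_trans sQ; rewrite leq_pmulr.
case: (ex_minnP exi) => i hi imin.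
have ib : (i < b.+1)%N.
  apply: imin; rewrite mulnC leq_mul//; first by rewrite ltnW// ltn_expl.
  by apply: leq_trans sQ; rewrite leq_pmulr.
apply: (@le_trans _ _ (4 * b%:R * 4^-1 ^+ i)); last first.
  rewrite (bigD1 (Ordinal ib))//= leq_divRL// hi mulr1 lerDl sumr_ge0// => k _.
case: i hi imin {ib exi} => [|i] hi imin.
  by rewrite expr0 mulr1; apply: le_trans (kap_le _ _ _ b0) _; rewrite ler_pM2r// ler_nat.
have lt : (2 ^ i * Q < `|s| * b)%N by rewrite ltnNge; apply/negP => /imin; rewrite ltnn.
have s0 : (0 < `|s|)%N by rewrite lt0n; apply/eqP => s0; move: lt; rewrite s0 mul0n.
apply: le_trans (kap_decay _ b0 Q0 _ sQ) _; first by rewrite -absz_gt0.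
rewrite ler_pdivrMr//.
have s0' : 0 < (`|s|%:R : R) by rewrite ltr0n.
have h1 : Q%:R / `|s|%:R <= b%:R / 2 ^+ i :> R.
  rewrite ler_pdivrMr// mulrAC ler_pdivlMr ?exprn_gt0// -natrX -!natrM ler_nat ltnW//.
  by rewrite mulnC [X in (_ < X)%N]mulnC.
have -> : 4 * b%:R * 4^-1 ^+ i.+1 * b%:R = (b%:R / 2 ^+ i) ^+ 2 :> R.
  have -> : 4^-1 ^+ i.+1 = 4^-1 * (2 ^+ i) ^- 2 :> R.
    rewrite exprS -exprM mulnC exprM exprVn; congr (_ * (_ ^+ i)^-1).
    by rewrite expr2 -natrM.
  by field; rewrite expf_neq0.
by rewrite lerXn2r ?nnegrE ?divr_ge0.
Qed.

Lemma geom_half (n : nat) : \sum_(i < n) (2^-1 : R) ^+ i <= 2.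
Proof.
have -> : \sum_(i < n) (2^-1 : R) ^+ i = 2 - 2 * 2^-1 ^+ n.
  elim: n => [|n IH]; first by rewrite big_ord0 expr0; ring.
  by rewrite big_ord_recr /= IH exprS; field.
by rewrite gerBl mulr_ge0// exprn_ge0.
Qed.

Section Unit.
Variables (p N V chi nu b H : nat) (g : int -> C).
Hypotheses (pp : prime p) (VN : (V <= N)%N) (ug : uni g)
  (hC2 : C2 p N g) (hC3 : C3 p V g) (chi1 : (0 < chi)%N) (chiV : (chi.+2 <= V)%N)
  (nnu : ~~ (p %| nu)%N) (b0 : (0 < b)%N).
Let Q := (p ^ (N - chi))%N.
Let Y := (p ^ (V - chi))%N.
Let K := (p ^ (N - chi - (V - chi)))%N.
Let c0 := (p ^ (V - chi).-1)%N.
Let K' := (p ^ (N - V).+1)%N.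
Let d := (p ^ chi * nu)%N.
Let fh (h a : nat) := fhat Q (dm (d * h)%N%:Z g) a%:Z.
Let fw (rho : int) (h a : nat) := fhat Q (res p rho (dm (d * h)%N%:Z g)) a%:Z.
Let chiN : (chi < N)%N. Proof. by move: chiV VN; clear; lia. Qed.

Let lev h : ~~ (p %| h)%N ->
  (d * h)%N%:Z = (p ^ chi)%N%:Z * (nu * h)%N%:Z /\ ~~ (p%:Z %| (nu * h)%N%:Z)%Z.
Proof.
move=> nh; split; first by rewrite -PoszM /d mulnA.
by rewrite dvdzE /= Euclid_dvdM// negb_or nnu.
Qed.

Let QKY : Q = (K * Y)%N. Proof. exact: levelQ. Qed.

Let Kdvd : exists k, Q = (K * k)%N. Proof. by exists Y. Qed.

Let K'dvd : exists k, Q = (K' * k)%N.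
Proof.
exists c0; rewrite /Q /K' /c0 -expnD; congr expn; move: chiV VN; clear; lia.
Qed.

Let ez_srep J a : (exists k, Q = (J * k)%N) -> ez R J (srep Q a) = ez R J a%:Z.
Proof.
case=> k Qk; have [z ->] := srepE Q a; symmetry.
by apply: (@ez_cong _ _ _ _ (k%:Z * z)); rewrite [X in X%:Z]Qk PoszM; ring.
Qed.

Let powY h : dm (d * h)%N%:Z (dm Y%:Z g) 0 = dm d%:Z (dm Y%:Z g) 0 ^+ h.
Proof.
rewrite PoszM; apply: (@dm_pow p V g _ _ _ (p ^ chi * nu * nu)%N%:Z _ ug hC3).
rewrite /d /Y -!PoszM; congr Posz.
have {2}-> : V = (V - chi + chi)%N by move: chiV; clear; lia.
by rewrite expnD; ring.
Qed.

Let powc h rho : dm (d * h)%N%:Z (dm c0%:Z g) rho = dm d%:Z (dm c0%:Z g) rho ^+ h.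
Proof.
rewrite PoszM; apply: (@dm_pow p V g _ _ _ (p ^ chi.-1 * nu * nu)%N%:Z _ ug hC3).
rewrite /d /c0 -!PoszM; congr Posz.
have {2}-> : V = ((V - chi).-1 + 1 + chi)%N by move: chiV; clear; lia.
by rewrite -{2}(prednK chi1) !expnD expn1 !expnS; ring.
Qed.

(** By [powY] one number has h1-th power e(a1/K) and h2-th power e(a2/K); compare its h1 h2-th
    powers. *)
Let det h1 a1 h2 a2 : ~~ (p %| h1)%N -> ~~ (p %| h2)%N -> fh h1 a1 != 0 -> fh h2 a2 != 0 ->
  (K%:Z %| h1%:Z * srep Q a2 - h2%:Z * srep Q a1)%Z.
Proof.
move=> n1 n2 f1 f2; have [_ K0 _] := level_gt0 N V chi pp.
have [e1 m1] := lev n1; have [e2 m2] := lev n2.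
have := level_supp pp VN chiN ug hC2 hC3 e1 f1; rewrite dmC powY => s1.
have := level_supp pp VN chiN ug hC2 hC3 e2 f2; rewrite dmC powY => s2.
apply: (@ez_inj R) => //; rewrite ![_%:Z * srep _ _]mulrC !ezXn !ez_srep//.
by rewrite -s1 -s2 -!exprM mulnC.
Qed.

(** By [powc] the factors under translation by c0 are powers of one number. Collinearity then gives
    the root of unity that separates the classes of the two points the h1-th power 1, and h1 is
    prime to p. *)
Let same_class rho h1 a1 h2 a2 : ~~ (p %| h1)%N -> ~~ (p %| h2)%N ->
  fh h1 a1 != 0 -> fh h2 a2 != 0 ->
  h1%:Z * srep Q a2 = h2%:Z * srep Q a1 ->
  dm c0%:Z (dm (d * h1)%N%:Z g) rho = ez R K' a1 ->
  dm c0%:Z (dm (d * h2)%N%:Z g) rho = ez R K' a2.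
Proof.
move=> n1 n2 f1 f2 col hr1; have [e2 m2] := lev n2.
have [rho' hr'] := res_exists pp VN chiV ug hC2 hC3 e2 f2.
have [th nth hth] := res_ratio pp chiV ug hC3 e2 m2 rho rho'.
rewrite hr' -/c0 -/K' in hth.
have hr2 := hth; rewrite dmC powc in hth; rewrite dmC powc in hr1.
have : ez R p ((rho - rho') * th * h1%:Z) = 1.
  move: hth hr1; move: (dm d%:Z (dm c0%:Z g) rho) => be hth hr1.
  move/(congr1 (fun z : C => z ^+ h1)): (hth) => /=; rewrite exprMn -!ezXn -exprM mulnC exprM hr1.
  rewrite -ezXn.
  have -> : ez R K' (a1%:Z * h2%:Z) = ez R K' (a2%:Z * h1%:Z).
    by rewrite !ezXn -!(ez_srep _ K'dvd) -!ezXn mulrC -col mulrC.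
  rewrite -[X in X = _]mul1r => h1E; apply/esym/(mulIf (ez_neq0 R K' _)); exact: h1E.
move=> /(ez_eq1 (prime_gt0 pp))[k hk].
have dd : (p%:Z %| rho - rho')%Z.
  have : (p%:Z %| (rho - rho') * th * h1%:Z)%Z by rewrite hk dvdz_mulr.
  rewrite !Euclid_dvdzM// (negbTE nth) orbF => /orP[//|].
  by rewrite dvdzE /= (negbTE n1).
rewrite hr2; move/dvdzP: dd => [q' ->].
have -> : q' * p%:Z * th = p%:Z * (q' * th) by ring.
by rewrite ez_mul mul1r.
Qed.

Let fw_fh rho h a : ~~ (p %| h)%N -> fw rho h a != 0 -> fh h a != 0 /\ fw rho h a = fh h a.
Proof.
move=> nh; have [e1 m1] := lev nh.
have [e|e] := res_fhat pp VN chiV ug hC2 hC3 e1 m1 rho a%:Z.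
  by rewrite /fw /fh -e.
by move=> /eqP; rewrite /fw [fhat _ _ _]e.
Qed.

(** For each dyadic bound A i the points (h, a) are either few, by [lattice_count], or on one line
    through the origin and hence of one class modulo p. The class rho is taken from the largest i at
    which they are not few; since the sets grow with i, it disposes of all smaller i as well. *)
Lemma unit_sum : exists rho : int,
  \sum_(h < H | (0 < h)%N && ~~ (p %| h)%N) (Q%:R^-1 *
    \sum_(a < Q) nrm (fhat Q (res p rho (dm (p ^ chi * nu * h)%N%:Z g)) a%:Z)
       * kap R Q b a%:Z) <= 192 * H%:R * Num.sqrt (Y%:R : R).
Proof.
have [Q0 K0 Y0] := level_gt0 N V chi pp; rewrite -/Q -/K -/Y in Q0 K0 Y0.
pose A i := ((2 ^ i * Q) %/ b)%N.
pose Pt i := [set t : 'I_H * 'I_Q | [&& (0 < t.1)%N, ~~ (p %| t.1)%N, fh t.1 t.2 != 0 & (`|srep Q t.2| <= A i)%N]].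
pose Kp rho i := [set t : 'I_H * 'I_Q | (t \in Pt i) && (fw rho t.1 t.2 != 0)].
pose good i := (#|Pt i| * K <= 24 * H * A i)%N.
have PtW i j : (i <= j)%N -> Pt i \subset Pt j.
  move=> ij; apply/fintype.subsetP => t; rewrite !inE => /and4P[-> -> -> /=] h; apply: leq_trans h _.
  by rewrite leq_div2r// leq_mul2r leq_exp2l// ij orbT.
have [rho kept] : exists rho, forall i, (i < b.+1)%N ->
    (#|Kp rho i| * K <= 24 * H * A i)%N.
  have gk rho i : good i -> (#|Kp rho i| * K <= 24 * H * A i)%N.
    apply: leq_trans; rewrite leq_mul2r; apply/orP; right; apply: subset_leq_card.
    by apply/fintype.subsetP => t; rewrite inE => /andP[].
  have [/existsP[i0 bad0]|/existsPn allg] := boolP [exists i : 'I_b.+1, ~~ good i]; last first.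
    by exists 0 => i ib; apply: gk; have := allg (Ordinal ib); rewrite negbK.
  have exb : exists i, (i < b.+1)%N && ~~ good i by exists i0; rewrite ltn_ord.
  have bnd i : (i < b.+1)%N && ~~ good i -> (i <= b)%N by case/andP.
  case: (ex_maxnP exb bnd) => im /andP[imb imbad] immax.
  have [||||col|] := @lattice_count _ (Pt im) (fun t => t.1 : nat) (fun t => srep Q t.2) H (A im) K K0.
  - by move=> t; rewrite inE => /and4P[-> _ _ _]; rewrite ltnW.
  - by move=> t; rewrite inE => /and4P[].
  - move=> [h1 a1] [h2 a2] _ _ /= eh es; congr (_, _); apply: val_inj => //=.
    move: es (ltn_ord a1) (ltn_ord a2); rewrite /srep.
    by case: (leqP (2 * a1)); case: (leqP (2 * a2)); clear; lia.
  - by move=> t u; rewrite !inE => /and4P[_ n1 f1 _] /and4P[_ n2 f2 _]; exact: det.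
  - have [P0|[t0 t0P]] := set_0Vmem (Pt im).
      by move: imbad; rewrite /good P0 cards0 mul0n leq0n.
    have := t0P; rewrite inE => /and4P[_ n0 f0 _].
    have [e0 m0] := lev n0.
    have [rho hrho] := res_exists pp VN chiV ug hC2 hC3 e0 f0.
    exists rho => i ib; have [iim|imi] := leqP i im; last first.
      apply: gk; apply/negPn/negP => bad; have := immax i; rewrite ib bad => /(_ isT).
      by rewrite leqNgt imi.
    have -> : Kp rho i = finset.set0; last by rewrite cards0.
    apply/finset.setP => t; rewrite finset.in_set0 inE.
    apply/negP => /andP[/(fintype.subsetP (PtW _ _ iim)) tP']; have := tP'; rewrite inE => /and4P[_ n1 f1 _].
    have [e1 m1] := lev n1.
    suff -> : fw rho t.1 t.2 = 0 by rewrite eqxx.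
    apply: (res_kill pp VN chiV ug hC2 hC3 e1 m1 f1).
    exact: (same_class n0 n1 f0 f1 (col _ _ t0P tP') hrho).
  - by move=> h; move: imbad; rewrite /good h.
exists rho.
have K0' : 0 < (K%:R : R) by rewrite ltr0n.
have Y0' : 0 < (Y%:R : R) by rewrite ltr0n.
have b0' : 0 < (b%:R : R) by rewrite ltr0n.
have Q0' : 0 < (Q%:R : R) by rewrite ltr0n.
have sY0 : 0 < Num.sqrt (Y%:R : R) by rewrite sqrtr_gt0.
pose wt i : R := 4 * b%:R * 4^-1 ^+ i.
have wt0 i : 0 <= wt i by rewrite /wt !mulr_ge0// exprn_ge0// invr_ge0.
have bnd h a : ~~ (p %| h)%N -> nrm (fw rho h a) <= K%:R * Num.sqrt Y%:R * (fw rho h a != 0)%:R.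
  move=> nh; case: eqP => [->|/eqP f0]; first by rewrite nrm0 mulr0.
  have [f1 ->] := fw_fh nh f0; have [e1 m1] := lev nh.
  rewrite mulr1 -[leLHS]ger0_norm ?nrm_ge0// -sqrtr_sqr; apply: sqrtr_le.
    by rewrite mulr_ge0// ltW.
  apply: le_trans (level_fhat_le pp VN chiN ug hC2 hC3 e1 m1 a) _.
  rewrite -/Q -/K QKY exprMn sqr_sqrtr ?ler0n// natrM.
  by rewrite le_eqVlt; apply/orP; left; apply/eqP; ring.
rewrite -mulr_sumr ler_pdivrMl//.
apply: (@le_trans _ _ (\sum_(h < H | (0 < h)%N && ~~ (p %| h)%N) \sum_(a < Q) \sum_(i < b.+1)
   K%:R * Num.sqrt Y%:R * wt i * ((h, a) \in Kp rho i)%:R)).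
  apply: ler_sum => h /andP[h0 nh]; apply: ler_sum => a _.
  rewrite -/(fw rho h a).
  apply: le_trans (ler_wpM2r (kap_ge0 _ _ _ _) (bnd h a nh)) _.
  have [f0|f0] := eqVneq (fw rho h a) 0.
    by rewrite mulr0 mul0r sumr_ge0// => i _; rewrite !mulr_ge0// ltW.
  have [f1 _] := fw_fh nh f0.
  rewrite mulr1 kap_srep.
  apply: (@le_trans _ _ (K%:R * Num.sqrt Y%:R * \sum_(i < b.+1) wt i * (`|srep Q a| <= A i)%:R)).
    by rewrite ler_wpM2l ?mulr_ge0 ?(ltW sY0)// kap_dyadic// srep_le.
  rewrite mulr_sumr; apply: ler_sum => i _.
  by rewrite !inE /= h0 nh f1 f0 /= andbT mulrA.
rewrite [leLHS](_ : _ = \sum_(i < b.+1) K%:R * Num.sqrt Y%:R * wt i *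
    (#|Kp rho i|)%:R); last first.
  rewrite pair_big_dep /= exchange_big /=; apply: eq_bigr => i _.
  rewrite -mulr_sumr; congr (_ * _); rewrite -natr_sum -sum1_card; congr _%:R.
  rewrite [RHS]big_mkcond [LHS]big_mkcond /=; apply: eq_bigr => [[h a]] _ /=.
  by rewrite !inE /= -!andbA; case: (0 < h)%N => //=; case: (p %| h)%N.
(* 96 = 4 * 24, from the weights [wt] and from the lattice count; 2^i points against the weight
   4^(-i) leave a geometric series. *)
apply: (@le_trans _ _ (\sum_(i < b.+1) 96 * H%:R * Num.sqrt Y%:R * Q%:R * 2^-1 ^+ i)).
  apply: ler_sum => i _.
  have := kept i (ltn_ord i); rewrite -(ler_nat R) !natrM => hk.
  have hA : (A i)%:R <= 2 ^+ i * Q%:R / b%:R :> R.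
    by rewrite ler_pdivlMr// -natrX -!natrM ler_nat leq_trunc_div.
  set n := (#|_|)%:R in hk *.
  have -> : K%:R * Num.sqrt Y%:R * wt i * n = Num.sqrt Y%:R * wt i * (n * K%:R) by ring.
  apply: (@le_trans _ _ (Num.sqrt Y%:R * wt i * (24 * H%:R * (2 ^+ i * Q%:R / b%:R)))).
    rewrite ler_wpM2l ?mulr_ge0 ?(ltW sY0)//; apply: le_trans hk _.
    by rewrite ler_wpM2l// mulr_ge0.
  rewrite le_eqVlt; apply/orP; left; apply/eqP; rewrite /wt.
  have -> : 4^-1 ^+ i = (2 ^+ i) ^- 2 :> R.
    by rewrite -exprM mulnC exprM exprVn; congr (_ ^+ i)^-1; rewrite expr2 -natrM.
  by rewrite exprVn; field; rewrite expf_neq0// gt_eqF.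
rewrite -mulr_sumr.
have c0' : 0 <= 96 * H%:R * Num.sqrt Y%:R * Q%:R :> R by rewrite !mulr_ge0// ltW.
apply: le_trans (ler_wpM2l c0' (geom_half _)) _.
by rewrite le_eqVlt; apply/orP; left; apply/eqP; ring.
Qed.

End Unit.
End UnitSum.

(** * Inequalities between exponents *)

Section Exponents.
Variable R : realType.
(** Logarithms to the base p: B of the length b, ell of the constant and the logarithms of the
    datum, th of the spacing d. N0 is n0(y + 1) - D. [LB1] and [LB2] express the lower bounds for
    the datum at the lengths 1 and p^N0, and [thE] equates p^th with the datum at order th - 1. *)
Variables (k m l r N D N0 B ell th : R).
Hypotheses (lE : l = m + 1 / 2) (k0 : 0 < k) (k2 : 2 * k <= 1) (m0 : 0 <= m) (m2 : 2 * m < 1)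
  (ell0 : 0 <= ell) (D1 : 1 <= D) (N01 : 1 <= N0)
  (g1 : 2 * D <= N) (g2 : N0 + 2 * D <= N + 1) (g3 : 3 * N0 + 2 * D <= 2 * N + 3)
  (g5 : 2 * (r + D) + k - 1 <= (1 - l) * N)
  (LB1 : 0 <= ell + r + k * N0) (LB2 : 0 <= ell + r + m * N0)
  (B0 : 0 <= B)
  (thE : (k + 1) * th = r + k + k * (N - D) + (l - k) * B).

Ltac ctx := have := lE; have := k0; have := k2; have := m0; have := m2; have := ell0; have := D1; have := N01; have := g1; have := g2; have := g3; have := B0; move=> ? ? ? ? ? ? ? ? ? ? ? ?.
Ltac nl := move: (thE) (g5) (LB1) (LB2) => ? ? ? ?.

Let lk : 0 <= l - k. Proof. ctx; by rewrite lE; lra. Qed.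
Let lk1 : l - k <= 1. Proof. ctx; by rewrite lE; lra. Qed.

Lemma exp_total_ge0 : 0 <= th + ell.
Proof.
ctx.
have h1 := mulr_ge0 lk B0.
have h2 : 0 <= k * (N - D + 1 - N0) by apply: mulr_ge0; lra.
have h3 := mulr_ge0 (ltW k0) ell0.
have : 0 <= (k + 1) * (th + ell) by rewrite mulrDr thE; nl; lra.
by rewrite pmulr_rge0//; lra.
Qed.

Lemma exp_ge0 : ell * 6 <= k * N -> 0 <= th.
Proof.
ctx.
move=> big; have h1 := mulr_ge0 lk B0.
have h2 : 0 <= k * (2 * (N - D) + 3 - 3 * N0) by apply: mulr_ge0; lra.
have h3 : 0 <= k * (N - 2 * D) by apply: mulr_ge0; lra.
have : 0 <= (k + 1) * th by rewrite thE; nl; lra.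
by rewrite pmulr_rge0//; lra.
Qed.

(** With c = log_p 2 this says sqrt Y <= 2 Z for a period Y = p^y between p^N0 and 2b. The datum
    does not go below the square root of a full period, by [LB2], and th is balanced against the
    datum. *)
Lemma exp_sqrt (chi y c : R) : th <= chi + 1 -> N0 <= y -> y <= B + c -> 0 <= c ->
  y + chi <= N - D -> y / 2 <= th + ell + c.
Proof.
ctx.
move=> h1 h2 h3 c0 h4.
have a1 : 0 <= k * (N - D - y - chi) by apply: mulr_ge0; lra.
have a2 : 0 <= (l - k) * (B + c - y) by apply: mulr_ge0; lra.
have a3 : 0 <= m * (y - N0) by apply: mulr_ge0; lra.
have a4 : 0 <= k * (chi + 1 - th) by apply: mulr_ge0; lra.
have a5 : 0 <= (1 - (l - k)) * c by apply: mulr_ge0; lra.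
by nl; move: thE a2 a5; rewrite lE; lra.
Qed.

(** For D beyond N/4 the upper bound [g5] for r and the lower bound [LB2] conflict unless ell makes
    up the difference. *)
Lemma exp_ell : N + 2 <= 4 * D -> (4 * D - N - 2) / 4 + k / 2 <= ell.
Proof.
ctx.
move=> s2.
have a1 : 0 <= m * (N + 1 - 2 * D - N0) by apply: mulr_ge0; lra.
have a2 : 0 <= m * (4 * D - N - 2) by apply: mulr_ge0; lra.
by nl; move: g5; rewrite lE; lra.
Qed.

(** The exponent (chi + D)/2 - |B - N/2| of the Fourier estimate is compared with the target th +
    ell. Even with only half of |B - N/2| subtracted, the excess is at most a/2 + 1/4; so a real
    loss requires |B - N/2| < 1/2. *)
Lemma exp_mid (chi a : R) : 0 <= a -> chi <= th + a ->
  (chi + D) / 2 - `|B - N / 2| / 2 <= th + ell + a / 2 + 1 / 4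
  /\ (N / 2 <= B -> (chi + D) / 2 <= th + ell + a / 2 + 1 / 4).
Proof.
ctx.
move=> a0 ca; set be := B - N / 2.
have BE : B = N / 2 + be by rewrite /be; lra.
have tau : (l - k) * `|be| <= (k + 1) * `|be|.
  by apply: ler_wpM2r => //; rewrite lE; lra.
have nb : - ((l - k) * `|be|) <= (l - k) * be.
  by rewrite -mulrN ler_wpM2l// lerNl -normrN ler_norm.
have key : (k + 1) * ((chi + D) / 2 - 1 / 4 - a / 2) + (l - k) * be / 2 <= (k + 1) * (th + ell).
  have c1 : (k + 1) * chi <= (k + 1) * (th + a) by apply: ler_wpM2l => //; lra.
  (* The upper bounds for N0 given by [g2] and [g3] cross at N = 4D, hence the distinction of
     cases. *)
  have [s2|s2] := lerP (N + 2) (4 * D).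
    have a1 : 0 <= m * (N + 1 - 2 * D - N0) by apply: mulr_ge0; lra.
    have a2 : 0 <= m * (4 * D - N - 2) by apply: mulr_ge0; lra.
    have e1 : (4 * D - N - 2) * (1 / 2 + m) / 2 + k / 2 <= ell by nl; move: g5; rewrite lE; lra.
    have e2 : 0 <= k * (ell - ((4 * D - N - 2) * (1 / 2 + m) / 2 + k / 2)) by apply: mulr_ge0; lra.
    have a3 : 0 <= k * (m * (4 * D - N - 2)) by apply: mulr_ge0; lra.
    have kk : 0 <= k * k by apply: mulr_ge0; lra.
    nl; move: thE c1 e1 e2; rewrite BE lE => *; lra.
  have e2 : 0 <= k * ell by apply: mulr_ge0; lra.
  have [s1|s1] := lerP N (4 * D).
    have a1 : 0 <= m * (N + 1 - 2 * D - N0) by apply: mulr_ge0; lra.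
    have a2 : 0 <= (1 / 2 - m) * (4 * D - N) by apply: mulr_ge0; lra.
    have a3 : 0 <= (1 / 2 - m) * (N + 2 - 4 * D) by apply: mulr_ge0; lra.
    have a4 : 0 <= k * (N + 2 - 4 * D) by apply: mulr_ge0; lra.
    nl; move: thE c1; rewrite BE lE => *; lra.
  have a1 : 0 <= m * (2 * N + 3 - 2 * D - 3 * N0) by apply: mulr_ge0; lra.
  have a2 : 0 <= (1 / 2 - m) * (N - 4 * D) by apply: mulr_ge0; lra.
  have a4 : 0 <= k * (N - 4 * D) by apply: mulr_ge0; lra.
  nl; move: thE c1; rewrite BE lE => *; lra.
have k1 : 0 < k + 1 by lra.
split.
  rewrite -(ler_pM2l k1); lra.
move=> NB; have be0 : 0 <= (l - k) * be by apply: mulr_ge0 => //; rewrite /be; lra.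
rewrite -(ler_pM2l k1); lra.
Qed.

(** For integral parameters this excludes a loss unless chi < D and N + 2 <= 4D. *)
Lemma exp_far (chi a : R) : 0 <= a -> chi <= th + a ->
  (4 * D <= N + 1 /\ chi + 1 <= D) \/ D <= chi ->
  (chi + D) / 2 - `|B - N / 2| <= th + ell + a.
Proof.
ctx.
move=> a0 ca [[s1 cD]|Dc]; last by have := normr_ge0 (B - N / 2); lra.
set be := B - N / 2.
have BE : B = N / 2 + be by rewrite /be; lra.
have tau : (l - k) * `|be| <= (k + 1) * `|be|.
  by apply: ler_wpM2r => //; rewrite lE; lra.
have nb : - ((l - k) * `|be|) <= (l - k) * be.
  by rewrite -mulrN ler_wpM2l// lerNl -normrN ler_norm.
have e2 : 0 <= k * ell by apply: mulr_ge0; lra.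
have k1 : 0 < k + 1 by lra.
suff : (k + 1) * (D - 1 / 2) + (l - k) * be <= (k + 1) * (th + ell).
  move=> key; rewrite -(ler_pM2l k1).
  have c1 : 0 <= (k + 1) * (D - 1 - chi) by apply: mulr_ge0; lra.
  have c2 : 0 <= (k + 1) * a by apply: mulr_ge0; lra.
  lra.
have [s0|s0] := lerP N (4 * D).
  have a1 : 0 <= m * (N + 1 - 2 * D - N0) by apply: mulr_ge0; lra.
  have a2 : 0 <= (1 / 2 - m) * (4 * D - N) by apply: mulr_ge0; lra.
  have a3 : 0 <= (1 / 2 - m) * (N + 1 - 4 * D) by apply: mulr_ge0; lra.
  have a4 : 0 <= k * (N + 1 - 4 * D) by apply: mulr_ge0; lra.
  nl; move: thE; rewrite BE lE => *; lra.
have a1 : 0 <= m * (2 * N + 3 - 2 * D - 3 * N0) by apply: mulr_ge0; lra.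
have a2 : 0 <= (1 / 2 - m) * (N - 4 * D) by apply: mulr_ge0; lra.
have a4 : 0 <= k * (N - 4 * D) by apply: mulr_ge0; lra.
nl; move: thE; rewrite BE lE => *; lra.
Qed.

(** The coefficient of N left over in [exp_excess], by which ell has to be absorbed. At k = 1/2 the
    first summand vanishes and it is m < 1/2 that keeps it positive. *)
Definition slack (k m : R) : R := k * (1 / 4 - k / 2) + (2 * k + 1) * (k - Num.min k m) / 4.

Lemma slack_gt0 : 0 < slack k m.
Proof.
have := k0; have := k2; have := m0; have := m2; move=> ? ? ? ?.
have c : 0 <= k - Num.min k m by rewrite subr_ge0 ge_min lexx.
have c' : 0 <= (2 * k + 1) * (k - Num.min k m) by apply: mulr_ge0 => //; lra.
have [h|h] := ltrP (2 * k) 1.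
  have : 0 < k * (1 / 4 - k / 2) by apply: mulr_gt0; lra.
  by rewrite /slack; lra.
have -> : k = 1 / 2 by lra.
rewrite /slack min_r; last by lra.
lra.
Qed.

(** The last entry of the new n0 serves this purpose: e is half of [u_excess], and the order that
    the condition on u imposes on the shifts must not exceed th by more than a constant. *)
Lemma exp_excess (e : R) : (2 * k + 1) * ell <= slack k m * N -> th <= B ->
  (2 * k + 1 - l) * (2 * e) - (r - 1) / (k + 1) + k * D / (k + 1) <= k * N ->
  e <= th.
Proof.
ctx.
move=> big thB g6.
have k1 : 0 < k + 1 by lra.
have k21 : 0 < 2 * k + 1 by lra.
set mu := Num.min k m; have muk : mu <= k by rewrite ge_min lexx.
have mu0 : 0 <= mu by rewrite le_min m0 ltW.
have LB : 0 <= ell + r + mu * N0 by rewrite /mu; case: (leP k m).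
have c0 : 0 < 2 * k + 1 - l by rewrite lE; lra.
suff : 2 * ((2 * k + 1 - l) * e) <= 2 * ((2 * k + 1 - l) * th).
  by rewrite ler_pM2l// ler_pM2l.
have h1 : 0 <= (l - k) * (B - th) by apply: mulr_ge0; lra.
have h2 : r + k + k * (N - D) <= (2 * k + 1 - l) * th by nl; lra.
rewrite -(ler_pM2l k1).
have g6' : (k + 1) * (2 * ((2 * k + 1 - l) * e)) <= (k + 1) * (k * N) + (r - 1) - k * D.
  move: g6 => /(ler_wpM2l (ltW k1)).
  have -> : (k + 1) * ((2 * k + 1 - l) * (2 * e) - (r - 1) / (k + 1) + k * D / (k + 1))
    = (k + 1) * (2 * ((2 * k + 1 - l) * e)) - (r - 1) + k * D.
    by field; rewrite gt_eqF.
  lra.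
apply: le_trans g6' _.
apply: (@le_trans _ _ ((k + 1) * (2 * (r + k + k * (N - D))))); last first.
  by rewrite ler_pM2l// ler_pM2l.
have h3 : 0 <= (2 * k + 1) * (ell + r + mu * N0) by apply: mulr_ge0; lra.
(* The inner inequality is a quarter of the sum of [g2] and [g3]. *)
have h4 : 0 <= (2 * k + 1) * (mu * (3 * N / 4 + 1 - N0 - D)).
  by apply: mulr_ge0; [lra|apply: mulr_ge0; lra].
have h5 : 0 <= (2 * k + 1) * ((k - mu) * (N / 2 - D)).
  by apply: mulr_ge0; [lra|apply: mulr_ge0; lra].
have h6 : (2 * k + 1) * mu <= (2 * k + 1) * k by apply: ler_wpM2l => //; lra.
move: big; rewrite /slack -/mu => big; lra.
Qed.

End Exponents.

(** * Sums over shifts of a given order *)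

Section LevelSums.
Variable R : realType.
Local Notation C := (R[i]).

Lemma geom_tail (x : R) (n v0 : nat) : 0 <= x -> 4 * x <= 3 ->
  \sum_(v < n | (v0 <= v)%N) x ^+ v <= 4 * x ^+ v0.
Proof.
move=> x0 x1; suff -> : \sum_(v < n | (v0 <= v)%N) x ^+ v =
    if (v0 <= n)%N then (x ^+ v0 - x ^+ n) / (1 - x) else 0.
  case: ifP => _; last by rewrite mulr_ge0// exprn_ge0.
  rewrite ler_pdivrMr; last by lra.
  have h1 : 0 <= x ^+ n by rewrite exprn_ge0.
  have h2 : 0 <= x ^+ v0 by rewrite exprn_ge0.
  have h3 : 0 <= (3 / 4 - x) * x ^+ v0 by apply: mulr_ge0 => //; lra.
  lra.
have x1' : 1 - x != 0 by apply/eqP => h; lra.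
elim: n => [|n IH]; first by rewrite big_ord0 leqn0; case: eqP => // ->; rewrite subrr mul0r.
rewrite big_mkcond big_ord_recr /= -big_mkcond IH; case: (ltngtP v0 n.+1) => h.
- rewrite -ltnS h; rewrite exprS; field; exact: x1'.
- by rewrite ifN ?ifN ?addr0// -ltnNge// ltnW.
- by rewrite h ltnn subrr mul0r addr0.
Qed.

Lemma sum_levels (p H : nat) (F : nat -> R) :
  \sum_(h < H | (0 < h)%N) F h =
  \sum_(v < H) \sum_(h < H | (0 < h)%N && (logn p h == v)) F h.
Proof.
(* The default h of [insubd] is never taken, because [logn p h < H]. *)
rewrite (partition_big (fun h : 'I_H => insubd h (logn p h)) xpredT)//=.
apply: eq_bigr => v _; apply: eq_bigl => h; congr (_ && _).
have hl : (logn p h < H)%N.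
  case: (nat_of_ord h) (ltn_ord h) => [|m] hH; first by rewrite logn0.
  by apply: leq_ltn_trans hH; rewrite ltnW// ltn_logl.
by apply/eqP/eqP => [<-|e]; [rewrite val_insubd hl|apply: val_inj; rewrite val_insubd hl].
Qed.

Lemma count_level (p H v : nat) : prime p ->
  (\sum_(h < H | (0 < h)%N && (logn p h == v)) p ^ v <= H)%N.
Proof.
move=> pp; rewrite sum_nat_cond_const.
have pv0 : (0 < p ^ v)%N by rewrite expn_gt0 prime_gt0.
rewrite -leq_divRL//.
(* The quotients run from 1 to H / p^v; the predecessor avoids an extra summand 1 in the count. *)
pose f (h : 'I_H) := (h %/ p ^ v).-1.
have fi : {in [pred h : 'I_H | (0 < h)%N && (logn p h == v)] &, injective f}.
  move=> x y; rewrite !inE => /andP[x0 /eqP lx] /andP[y0 /eqP ly].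
  have dx : (p ^ v %| x)%N by rewrite pfactor_dvdn// lx.
  have dy : (p ^ v %| y)%N by rewrite pfactor_dvdn// ly.
  have x1 : (0 < x %/ p ^ v)%N by rewrite divn_gt0// dvdn_leq.
  have y1 : (0 < y %/ p ^ v)%N by rewrite divn_gt0// dvdn_leq.
  move=> e; apply: val_inj; rewrite /= -(divnK dx) -(divnK dy); congr (_ * _)%N.
  by rewrite -(prednK x1) -(prednK y1) -!/(f _) e.
have fb (h : 'I_H) : (0 < h)%N && (logn p h == v) -> (f h < H %/ p ^ v)%N.
  move=> /andP[h0 /eqP lh].
  have dh : (p ^ v %| h)%N by rewrite pfactor_dvdn// lh.
  have h1 : (0 < h %/ p ^ v)%N by rewrite divn_gt0// dvdn_leq.
  by rewrite /f prednK// leq_div2r// ltnW.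
have [P0|P0] := posnP (H %/ p ^ v).
  rewrite eq_card0 // => h; apply/negP => Ph.
  by move: Ph; rewrite inE => /fb; rewrite P0.
rewrite -[X in (_ <= X)%N]card_ord.
rewrite -(@card_in_imset _ _ (fun h : 'I_H => insubd (Ordinal P0) (f h))) ?max_card//.
move=> x y; rewrite !inE => Px Py /(congr1 val); rewrite !val_insubd !fb// => e.
by apply: fi => //; rewrite inE.
Qed.

Section Level.
Variables (p N D chi nu b H : nat) (g : int -> C) (B : R).
Hypotheses (pp : prime p) (DN : (D <= N)%N) (ug : uni g)
  (hC2 : C2 p N g) (hC3 : C3 p (N - D) g) (nnu : ~~ (p %| nu)%N)
  (b0 : (0 < b)%N) (H0 : (0 < H)%N) (HN : (p ^ chi * H < p ^ N)%N)
  (bB : b%:R = p%:R `^ B) (bH : (b <= 64 * (p ^ chi * H))%N).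
Let V := (N - D)%N.
Local Notation pw x := (p%:R `^ x).

Let p0 : 0 < (p%:R : R). Proof. by rewrite ltr0n prime_gt0. Qed.
Let p1 : 1 <= (p%:R : R). Proof. by rewrite ler1n prime_gt0. Qed.

Lemma pwD (x y : R) : pw (x + y) = pw x * pw y :> R.
Proof. by rewrite powRD//; apply/implyP => _; rewrite gt_eqF. Qed.

Lemma pwn (n : nat) : pw n%:R = p%:R ^+ n :> R.
Proof. by rewrite powR_mulrn// ltW. Qed.

Lemma pwN (x : R) : pw (- x) = (pw x)^-1 :> R.
Proof. by rewrite powRN. Qed.

Lemma pw_gt0 (x : R) : 0 < pw x :> R.
Proof. exact: powR_gt0. Qed.

Lemma pw_le (x y : R) : x <= y -> pw x <= pw y :> R.
Proof. by move=> xy; apply: ler_powR. Qed.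

Lemma pw_sqrt (x : R) : Num.sqrt (pw x) = pw (x / 2) :> R.
Proof. by rewrite -powR12_sqrt ?powR_ge0// -powRrM; congr powR; rewrite mulrC. Qed.

Definition Yv v := (p ^ (V - (chi + v)))%N.
Definition SL v : R := \sum_(h < H | (0 < h)%N && (logn p h == v))
  spec p N g b (chi + v) (p ^ chi * nu * h)%N%:Z.

Let sq v : R := Num.sqrt (Yv v)%:R.

Lemma sq_ge1 v : 1 <= sq v.
Proof. by rewrite -[1]sqrtr1 ler_wsqrtr// ler1n expn_gt0 prime_gt0. Qed.

Let sq0 v : 0 < sq v. Proof. by apply: lt_le_trans (sq_ge1 v). Qed.

Lemma sq_lb v : pw ((V%:R - chi%:R) / 2 - v%:R / 2) <= sq v :> R.
Proof.
rewrite /sq /Yv natrX -pwn pw_sqrt; apply: pw_le.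
have : V%:R <= (V - (chi + v))%N%:R + (chi%:R + v%:R) :> R.
  by rewrite -!natrD ler_nat; clear; lia.
by lra.
Qed.

Lemma sq_mono v w : (v <= w)%N -> sq w <= sq v.
Proof.
move=> vw; rewrite ler_wsqrtr// ler_nat leq_pexp2l ?prime_gt0//.
by move: vw; clear; lia.
Qed.

Let b0' : 0 < (b%:R : R). Proof. by rewrite ltr0n. Qed.
Let H0' : 0 < (H%:R : R). Proof. by rewrite ltr0n. Qed.

Lemma b_sq v : b%:R / sq v <= pw (B - (V%:R - chi%:R) / 2 + v%:R / 2).
Proof.
rewrite ler_pdivrMr// bB.
apply: le_trans (ler_wpM2l (powR_ge0 _ _) (sq_lb v)).
by rewrite -pwD; apply: pw_le; lra.
Qed.

Let lt_level (h : 'I_H) v : (0 < h)%N && (logn p h == v) -> (chi + v < N)%N.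
Proof.
move=> /andP[h0 /eqP hv]; rewrite -(ltn_exp2l _ _ (prime_gt1 pp)).
apply: leq_ltn_trans HN; rewrite expnD leq_mul2l; apply/orP; right.
by apply: leq_trans (ltnW (ltn_ord h)); rewrite dvdn_leq// pfactor_dvdn// hv.
Qed.

Lemma level_sum_le (F : nat -> R) (c : R) v : 0 <= c ->
  (forall h : 'I_H, (0 < h)%N -> logn p h = v -> F h <= c) ->
  \sum_(h < H | (0 < h)%N && (logn p h == v)) F h <= H%:R * (p%:R ^- v * c).
Proof.
move=> c0 hF; apply: (@le_trans _ _ (\sum_(h < H | (0 < h)%N && (logn p h == v)) c)).
  by apply: ler_sum => h /andP[h0 /eqP hv]; apply: hF.
have cnt := count_level H v pp; rewrite -(ler_nat R) natr_sum in cnt.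
have c1 : 0 <= p%:R ^- v * c by rewrite mulr_ge0// invr_ge0 exprn_ge0// ltW.
apply: le_trans (ler_wpM2r c1 cnt); rewrite mulr_suml; apply: ler_sum => h _.
by rewrite natrX mulrA divff ?mul1r// expf_neq0// gt_eqF.
Qed.

Lemma SL_le v : SL v <= H%:R * (p%:R ^- v * (4 * (b%:R / sq v) + 2 * sq v)).
Proof.
apply: (@level_sum_le (fun h => spec p N g b (chi + v) (p ^ chi * nu * h)%N%:Z)) => [|h h0 hv].
  by rewrite addr_ge0// mulr_ge0// ?divr_ge0// ltW.
have jN : (chi + v < N)%N by apply: (@lt_level h); rewrite h0 hv eqxx.
have [h' ch' hE] := pfactor_coprime pp h0.
have e1 : (p ^ chi * nu * h)%N%:Z = (p ^ (chi + v))%N%:Z * (nu * h')%N%:Z.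
  by rewrite -PoszM {1}hE hv expnD; congr Posz; ring.
have n1 : ~~ (p%:Z %| (nu * h')%N%:Z)%Z.
  by rewrite dvdzE /= Euclid_dvdM// negb_or nnu -prime_coprime.
apply: le_trans (spec_le pp (leq_subr D N) ug hC2 hC3 b0 jN e1 n1) _.
rewrite -/V -/(Yv v) -/(sq v) mulrDr mulrDl.
have -> : 2 * (Yv v)%:R / sq v = 2 * sq v.
  rewrite -{1}[(Yv v)%:R]sqr_sqrtr ?ler0n// -/(sq v).
  by field; rewrite gt_eqF.
by rewrite mulrA -natrM !mulrA.
Qed.

Lemma SL_le1 v : SL v / H%:R <=
  2 * (p%:R ^- v * sq v) + 4 * pw (B - (V%:R - chi%:R) / 2 - v%:R / 2).
Proof.
rewrite ler_pdivrMr// mulrC; apply: le_trans (SL_le v) _; rewrite ler_pM2l//.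
rewrite mulrDr addrC lerD//; first by rewrite mulrCA.
rewrite mulrCA ler_pM2l//.
have -> : p%:R ^- v = pw (- v%:R) :> R by rewrite pwN pwn.
apply: le_trans (ler_wpM2l (powR_ge0 _ _) (b_sq v)) _.
by rewrite -pwD; apply: pw_le; lra.
Qed.

(** All shifts of one order are treated together. The second term decreases with b, while that of
    [SL_le1] increases; up to constants they agree at b = p^(N/2). *)
Lemma SL_le2 v : SL v / H%:R <=
  6 * (p%:R ^- v * sq v) + 384 * pw ((V%:R + chi%:R) / 2 + D%:R - B - v%:R / 2).
Proof.
have [jN|jN] := ltnP (chi + v) N; last first.
  rewrite /SL big1 ?mul0r; last by move=> h /lt_level; rewrite ltnNge jN.
  apply: addr_ge0; apply: mulr_ge0; rewrite ?ler0n ?powR_ge0//.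
  by apply: mulr_ge0; [rewrite invr_ge0 exprn_ge0// ltW|exact: ltW].
rewrite ler_pdivrMr// /SL; apply: le_trans (spec_sum pp (leq_subr D N) ug hC2 hC3 H b0 jN nnu) _.
rewrite -/V -/(Yv v) -/(sq v).
set e := (N - chi - (V - (chi + v)))%N; set K := (p ^ (N - (chi + v) - (V - (chi + v))))%N.
have Ke : (K * p ^ v = p ^ e)%N.
  by rewrite /K /e -expnD; congr expn; move: jN; rewrite /V; clear; lia.
have pe0 : 0 < (p ^ e)%N%:R :> R by rewrite ltr0n expn_gt0 prime_gt0.
have h1 : (H %/ p ^ e + 1)%N%:R <= H%:R / (p ^ e)%N%:R + 1 :> R.
  rewrite natrD lerD2r ler_pdivlMr// -natrM ler_nat; exact: leq_trunc_div.
apply: (@le_trans _ _ (6 * (K%:R * sq v) * (H%:R / (p ^ e)%N%:R + 1))).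
  by rewrite ler_wpM2l// mulr_ge0// mulr_ge0// ltW.
have K0 : 0 < K%:R :> R by rewrite ltr0n expn_gt0 prime_gt0.
rewrite [leRHS]mulrDl mulrDr mulr1 lerD//.
  rewrite -Ke natrM natrX le_eqVlt; apply/orP; left; apply/eqP.
  by field; rewrite expf_neq0 gt_eqF.
have h2 : K%:R * sq v <= pw (D%:R + (V%:R - chi%:R - v%:R) / 2).
  rewrite /sq /Yv /K !natrX -!pwn pw_sqrt -pwD; apply: pw_le.
  have [jV|jV] := leqP (chi + v) V.
    have -> : (N - (chi + v) - (V - (chi + v)) = D)%N.
      by move: jV jN DN; rewrite /V; clear; lia.
    have -> : (V - (chi + v))%N%:R = V%:R - (chi%:R + v%:R) :> R by rewrite natrB// natrD.
    lra.
  have -> : (V - (chi + v) = 0)%N by move: jV; clear; lia.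
  rewrite subn0 (natrB _ (ltnW jN)).
  have : N%:R = D%:R + V%:R :> R by rewrite -natrD /V subnKC.
  have : V%:R < chi%:R + v%:R :> R by rewrite -natrD ltr_nat.
  rewrite natrD; lra.
(* This pays for the summand 1 in the count H / p^e + 1. *)
have h3 : 1 <= 64 * pw chi%:R * H%:R / b%:R :> R.
  by rewrite ler_pdivlMr// mul1r pwn -natrX -!natrM ler_nat -mulnA.
have -> : 384 * pw ((V%:R + chi%:R) / 2 + D%:R - B - v%:R / 2) * H%:R =
   6 * pw (D%:R + (V%:R - chi%:R - v%:R) / 2) * (64 * pw chi%:R * H%:R / b%:R) :> R.
  have -> : (V%:R + chi%:R) / 2 + D%:R - B - v%:R / 2 = (D%:R + (V%:R - chi%:R - v%:R) / 2) + chi%:R - B :> R by lra.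
  by rewrite !pwD pwN -bB; ring.
apply: (@le_trans _ _ (6 * pw (D%:R + (V%:R - chi%:R - v%:R) / 2) * 1)).
  by rewrite mulr1 ler_pM2l.
by rewrite ler_wpM2l// mulr_ge0// powR_ge0.
Qed.

Lemma inv_le2 : 2 * p%:R^-1 <= 1 :> R.
Proof. by rewrite ler_pdivrMr// mul1r (ler_nat R 2) prime_gt1. Qed.

Lemma inv_le : 4 * p%:R^-1 <= 3 :> R.
Proof. by have := inv_le2; lra. Qed.

Lemma half_le : 4 * pw (- (1 / 2)) <= 3 :> R.
Proof.
have h0 := pw_gt0 (- (1 / 2)).
have : 2 * (pw (- (1 / 2)) * pw (- (1 / 2))) <= 1 :> R.
  rewrite -pwD; have -> : - (1 / 2) + - (1 / 2) = - 1 :> R by lra.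
  by rewrite pwN powRr1 ?inv_le2// ltW.
by nra.
Qed.

Lemma sum_sq (n v0 : nat) :
  \sum_(v < n | (v0 <= v)%N) p%:R ^- v * sq v <= 4 * (p%:R ^- v0 * sq v0).
Proof.
apply: (@le_trans _ _ (\sum_(v < n | (v0 <= v)%N) p%:R^-1 ^+ v * sq v0)).
  apply: ler_sum => v hv; rewrite exprVn ler_wpM2l ?sq_mono//.
rewrite -mulr_suml mulrA ler_pM2r// -exprVn geom_tail ?inv_le//.
Qed.

Lemma sum_half (n v0 : nat) (x : R) :
  \sum_(v < n | (v0 <= v)%N) pw (x - v%:R / 2) <= 4 * pw (x - v0%:R / 2).
Proof.
have E (v : nat) : pw (x - v%:R / 2) = pw x * pw (- (1 / 2)) ^+ v :> R.
  by rewrite pwD -powR_mulrn ?powR_ge0// -powRrM; congr (_ * powR _ _); lra.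
rewrite (eq_bigr _ (fun (v : 'I_n) _ => E v)) E -mulr_sumr mulrCA ler_pM2l ?pw_gt0//.
by rewrite geom_tail ?powR_ge0 ?half_le.
Qed.

(** Below vc the period is at least 2b, so b / sqrt Y is dominated by sqrt Y. From vc on the better
    of [SL_le1] and [SL_le2] is taken, which produces the distance |B - N/2|. *)
Lemma bad_sum (vb vc : nat) : (vb <= vc)%N ->
  (forall v, (vb <= v)%N -> (v < vc)%N -> (2 * b <= Yv v)%N) ->
  (\sum_(v < H | (vb <= v)%N) SL v) / H%:R <=
  24 * (p%:R ^- vb * sq vb) +
  1536 * pw ((chi%:R + D%:R) / 2 - `|B - N%:R / 2| - vc%:R / 2).
Proof.
move=> bc hY; pose X : R := (chi%:R + D%:R) / 2 - `|B - N%:R / 2|.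
have NE : N%:R = D%:R + V%:R :> R by rewrite -natrD /V subnKC.
have pwX v : SL v / H%:R <= 6 * (p%:R ^- v * sq v) + 384 * pw (X - v%:R / 2).
  have [|] := lerP 0 (B - N%:R / 2) => hb.
    apply: le_trans (SL_le2 v) _; rewrite lerD2l; apply: ler_wpM2l; first exact: ler0n.
    apply: pw_le.
    by rewrite /X (ger0_norm hb) NE; lra.
  apply: le_trans (SL_le1 v) _; apply: lerD.
    apply: ler_wpM2r; last by rewrite ler_nat.
    by apply: mulr_ge0; [rewrite invr_ge0 exprn_ge0// ltW|exact: ltW].
  apply: ler_pM; rewrite ?ler0n ?powR_ge0 ?ler_nat//; apply: pw_le.
  by rewrite /X (ltr0_norm hb) NE; lra.
have pwY v : (vb <= v)%N -> (v < vc)%N -> SL v / H%:R <= 6 * (p%:R ^- v * sq v).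
  move=> h1 h2; rewrite ler_pdivrMr// mulrC; apply: le_trans (SL_le v) _; rewrite ler_pM2l//.
  rewrite [leRHS]mulrCA; apply: ler_wpM2l; first by rewrite invr_ge0 exprn_ge0// ltW.
  have : b%:R / sq v <= sq v.
    rewrite ler_pdivrMr// -expr2 sqr_sqrtr ?ler0n// ler_nat.
    by apply: leq_trans (hY _ h1 h2); rewrite leq_pmull.
  by lra.
rewrite mulr_suml.
apply: (@le_trans _ _ (\sum_(v < H | (vb <= v)%N) (6 * (p%:R ^- v * sq v) +
    if (vc <= v)%N then 384 * pw (X - v%:R / 2) else 0))).
  apply: ler_sum => v hv; case: ifP => hc; first exact: pwX.
  by rewrite addr0 pwY// ltnNge hc.
rewrite big_split /= lerD//.
  rewrite -mulr_sumr; have := sum_sq H vb; lra.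
rewrite -big_mkcondr /=.
apply: (@le_trans _ _ (\sum_(v < H | (vc <= v)%N) 384 * pw (X - v%:R / 2))).
  rewrite le_eqVlt; apply/orP; left; apply/eqP; apply: eq_bigl => v.
  by apply/andP/idP => [[]//|h]; split=> //; exact: leq_trans h.
rewrite -mulr_sumr; have := sum_half H vc X; lra.
Qed.

End Level.
End LevelSums.

(** * Correlations with one residue class modulo p removed *)

Section RestrictedLevels.
Variable R : realType.
Local Notation C := (R[i]).

Section Level.
Variables (p N D chi nu b H : nat) (g : int -> C) (B : R).
Hypotheses (pp : prime p) (DN : (D <= N)%N) (ug : uni g)
  (hC2 : C2 p N g) (hC3 : C3 p (N - D) g) (nnu : ~~ (p %| nu)%N)
  (b0 : (0 < b)%N) (H0 : (0 < H)%N)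
  (bB : b%:R = p%:R `^ B) (chi1 : (0 < chi)%N) (chiV : (chi.+2 <= N - D)%N).
Let V := (N - D)%N.
Local Notation pw x := (p%:R `^ x).
Local Notation sq v := (Num.sqrt (Yv p N D chi v)%:R : R).
Let p0 : 0 < (p%:R : R). Proof. by rewrite ltr0n prime_gt0. Qed.
Let sq0 v : 0 < sq v.
Proof. by apply: lt_le_trans (sq_ge1 R N D chi pp v). Qed.
Let H0' : 0 < (H%:R : R). Proof. by rewrite ltr0n. Qed.
Let b0' : 0 < (b%:R : R). Proof. by rewrite ltr0n. Qed.

Lemma res_single (j : nat) (h h' rho M : int) : (j.+2 <= N - D)%N ->
  h = (p ^ j)%N%:Z * h' -> ~~ (p%:Z %| h')%Z ->
  nrm (Wsum (res p rho (dm h g)) M b) <=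
  2 * (2 * b%:R + (p ^ (N - D - j))%:R) / Num.sqrt (p ^ (N - D - j))%:R.
Proof.
move=> jV hE nh'; have VN := leq_subr D N; have [Q0 K0 Y0] := level_gt0 N (N - D) j pp.
have jN : (j < N)%N by move: jV; clear; lia.
have per := res_per VN jV ug hC2 hE rho.
apply: le_trans (Wsum_fourier M Q0 b0 per) _.
have QE := levelQ p VN jN; rewrite QE; apply: spec_single => //.
  move=> a; rewrite -QE.
  have [->|->] := res_fhat pp VN jV ug hC2 hC3 hE nh' rho a.
    exact: (level_fhat_le pp VN jN ug hC2 hC3 hE nh').
  by rewrite nrm0 expr0n /= mulr_ge0.
move=> a a'; rewrite -QE => f1 f2.
have nz z : fhat (p ^ (N - j)) (res p rho (dm h g)) z != 0 -> fhat (p ^ (N - j)) (dm h g) z != 0.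
  by have [->|->] := res_fhat pp VN jV ug hC2 hC3 hE nh' rho z; rewrite ?eqxx.
apply: (@ez_inj R) => //.
by rewrite -(level_supp pp VN jN ug hC2 hC3 hE (nz _ f1)) (level_supp pp VN jN ug hC2 hC3 hE (nz _ f2)).
Qed.

(** Order 0 is [unit_sum]. Positive orders are treated shift by shift and gain p^(-1/2) over order
    0. The last orders, at which the step c0 would no longer be divisible by p, are rare enough for
    the trivial bound. *)
Lemma res_sum : exists rho : int, exists2 Bs : nat -> R,
  (forall h, 0 <= Bs h) /\
  (forall h M, (0 < h)%N -> (h < H)%N ->
     nrm (Wsum (res p rho (dm (p ^ chi * nu * h)%N%:Z g)) M b) <= Bs h) &
  (\sum_(h < H | (0 < h)%N) Bs h) / H%:R <=
    200%:R * sq 0 + 16%:R * pw ((chi%:R + D%:R) / 2 + (B - N%:R / 2) - 1 / 2)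
    + 16%:R * (b%:R * p%:R ^- (N - D - chi).-1).
Proof.
have VN := leq_subr D N.
have chiN : (chi < N)%N by move: chiV; clear; lia.
have [Q0 K0 Y0] := level_gt0 N (N - D) chi pp.
have [rho hrho] := unit_sum H pp VN ug hC2 hC3 chi1 chiV nnu b0.
pose U h : R := (p ^ (N - chi))%:R^-1 * \sum_(a < p ^ (N - chi))
   nrm (fhat (p ^ (N - chi)) (res p rho (dm (p ^ chi * nu * h)%N%:Z g)) a%:Z)
     * kap R (p ^ (N - chi)) b a%:Z.
pose s v : R := 2 * (2 * b%:R + (Yv p N D chi v)%:R) / sq v.
pose Bs h := if logn p h == 0%N then U h else
   if ((chi + logn p h).+2 <= N - D)%N then s (logn p h) else 4 * b%:R.
have U0 h : 0 <= U h.
  by rewrite mulr_ge0 ?invr_ge0// sumr_ge0// => a _; rewrite mulr_ge0 ?nrm_ge0 ?kap_ge0.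
have s0 v : 0 <= s v by rewrite divr_ge0 ?(ltW (sq0 v))// mulr_ge0// addr_ge0// mulr_ge0.
have lev h : (0 < h)%N -> exists2 h' : int,
    (p ^ chi * nu * h)%N%:Z = (p ^ (chi + logn p h))%N%:Z * h' & ~~ (p%:Z %| h')%Z.
  move=> h0; have [h' ch' hE] := pfactor_coprime pp h0.
  exists (nu * h')%N%:Z; last by rewrite dvdzE /= Euclid_dvdM// negb_or nnu -prime_coprime.
  by rewrite -PoszM {1}hE expnD; congr Posz; ring.
exists rho, Bs; first split.
- by move=> h; rewrite /Bs; case: ifP => // _; case: ifP => // _; rewrite mulr_ge0.
- move=> h M h0 hH; have [h' hE nh'] := lev _ h0; rewrite /Bs; case: eqP => [l0|_].
    rewrite l0 addn0 in hE; apply: Wsum_fourier => //.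
    exact: (res_per VN chiV ug hC2 hE rho).
  case: ifP => [jV|_]; first exact: res_single jV hE nh'.
  apply: Wsum_nrm_le => // M'; apply: le_trans (nrm_sum _ _ _) _.
  apply: (@le_trans _ _ (\sum_(i < 2 * b) 1)).
    apply: ler_sum => i _; rewrite /res nrmM (dm_uni _ ug) mulr1 nrm_nat.
    by case: (cls _ _ _).
  by rewrite sumr_const card_ord natrM ler_pM2r// ler_nat.
rewrite (sum_levels p) ler_pdivrMr//.
have H1 : (0 < H)%N := H0.
rewrite (bigD1 (Ordinal H1))//=.
have p2 : 2 * p%:R^-1 <= 1 :> R := inv_le2 R pp.
have first : \sum_(h < H | (0 < h)%N && (logn p h == 0%N)) Bs h <= 192 * H%:R * sq 0.
  have -> : sq 0 = Num.sqrt (p ^ (N - D - chi))%:R by rewrite /Yv addn0.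
  apply: le_trans hrho; rewrite -mulr_sumr le_eqVlt; apply/orP; left; apply/eqP.
  rewrite mulr_sumr; apply: eq_big => h.
    case h0 : (0 < h)%N => //=; rewrite -[p in RHS]expn1 pfactor_dvdn//.
    by rewrite lt0n negbK.
  by move=> /andP[_ l0]; rewrite /Bs l0.
have bs v : s v = 4 * (b%:R / sq v) + 2 * sq v.
  have e : (Yv p N D chi v)%:R / sq v = sq v.
    by rewrite -{1}[(Yv p N D chi v)%:R]sqr_sqrtr// expr2 mulfK ?gt_eqF.
  by rewrite /s mulrDr mulrDl -!mulrA e; ring.
have rest : \sum_(v < H | v != Ordinal H1) \sum_(h < H | (0 < h)%N && (logn p h == v)) Bs h <=
    \sum_(v < H | (1 <= v)%N) H%:R * (p%:R ^- v * (4 * (b%:R / sq v) + 2 * sq v)) +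
    \sum_(v < H | ((N - D - chi).-1 <= v)%N) H%:R * (p%:R ^- v * (4 * b%:R)).
  rewrite [leLHS](_ : _ = \sum_(v < H | (1 <= v)%N) \sum_(h < H | (0 < h)%N && (logn p h == v)) Bs h); last first.
    by apply: eq_bigl => v; rewrite lt0n.
  rewrite (bigID (fun v : 'I_H => ((chi + v).+2 <= N - D)%N)) /=; apply: lerD.
    rewrite [leRHS](bigID (fun v : 'I_H => ((chi + v).+2 <= N - D)%N)) /=.
    apply: ler_wpDr.
      apply: sumr_ge0 => v _; rewrite mulr_ge0// mulr_ge0 ?invr_ge0 ?exprn_ge0//.
    apply: ler_sum => v /andP[v0 vV]; apply: (level_sum_le pp) => [|h h0 lh].
      by rewrite -bs.
    by rewrite /Bs lh vV -bs gtn_eqF.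
  rewrite [leRHS](bigID (fun v : 'I_H => (1 <= v)%N && ~~ ((chi + v).+2 <= N - D)%N)) /=.
  apply: ler_wpDr.
    by apply: sumr_ge0 => v _; rewrite mulr_ge0// mulr_ge0 ?invr_ge0 ?exprn_ge0// mulr_ge0.
  rewrite [leRHS](_ : _ = \sum_(v < H | (1 <= v)%N && ~~ ((chi + v).+2 <= N - D)%N)
     H%:R * (p%:R ^- v * (4 * b%:R))); last first.
    apply: eq_bigl => v; case: (ltnP 0 v) => v0 /=; last by rewrite andbF.
    case: leqP => hv /=; rewrite ?andbF ?andbT//.
    by move: hv chiV; clear; lia.
  apply: ler_sum => v /andP[v0 vV]; apply: (level_sum_le pp) => [|h h0 lh].
    by rewrite mulr_ge0.
  by rewrite /Bs lh (negbTE vV) gtn_eqF.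
have r1 : \sum_(v < H | (1 <= v)%N) p%:R ^- v * (4 * (b%:R / sq v) + 2 * sq v) <=
    16 * pw ((chi%:R + D%:R) / 2 + (B - N%:R / 2) - 1 / 2) + 8 * sq 0.
  apply: (@le_trans _ _ (\sum_(v < H | (1 <= v)%N)
     (4 * pw ((chi%:R + D%:R) / 2 + (B - N%:R / 2) - v%:R / 2) + 2 * (p%:R ^- v * sq v)))).
    apply: ler_sum => v _; rewrite mulrDr; apply: lerD; last by rewrite mulrCA.
    rewrite mulrCA; apply: ler_wpM2l; first exact: ler0n.
    have -> : p%:R ^- v = pw (- v%:R) :> R by rewrite pwN pwn.
    apply: le_trans (ler_wpM2l (powR_ge0 _ _) (b_sq N D chi pp bB v)) _.
    rewrite -(pwD pp) (natrB R DN); apply: (pw_le pp); lra.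
  rewrite big_split /= -!mulr_sumr; apply: lerD.
    have := @sum_half R p pp H 1 ((chi%:R + D%:R) / 2 + (B - N%:R / 2)); lra.
  have h1 := sum_sq R N D chi pp H 1.
  have h2 := sq_mono R N D chi pp (isT : (0 <= 1)%N).
  have h3 : 2 * (p%:R ^- 1 * sq 1) <= sq 0.
    rewrite expr1 mulrA; apply: le_trans h2; apply: ler_piMl => //; exact: ltW.
  by have := sq0 0; lra.
have r2 : \sum_(v < H | ((N - D - chi).-1 <= v)%N) p%:R ^- v * (4 * (b%:R : R)) <=
    16 * (b%:R * p%:R ^- (N - D - chi).-1).
  rewrite -mulr_suml (eq_bigr (fun v : 'I_H => p%:R^-1 ^+ v)); last by move=> v _; rewrite exprVn.
  have p'0 : 0 <= p%:R^-1 :> R by rewrite invr_ge0 ltW.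
  have := geom_tail H (N - D - chi).-1 p'0 (inv_le R pp); rewrite exprVn => gt.
  have -> : 16 * (b%:R * p%:R ^- (N - D - chi).-1) = 4 * p%:R ^- (N - D - chi).-1 * (4 * b%:R) :> R by ring.
  by rewrite ler_wpM2r// mulr_ge0.
move: rest; rewrite -!mulr_sumr => rest.
have := ler_wpM2l (ltW H0') r1; have := ler_wpM2l (ltW H0') r2; lra.
Qed.

End Level.
End RestrictedLevels.

(** * One differencing step *)

Section Step.
Variable R : realType.
Local Notation C := (R[i]).

(** The constant 4 * 384 of [bad_sum]; the smaller numerical constants of the step are replaced by
    it. *)
Definition Kb : R := 1536%:R.
Lemma Kb_ge (n : nat) : (n <= 1536)%N -> n%:R <= Kb.
Proof. by move=> h; rewrite ler_nat. Qed.
Opaque Kb.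

Lemma pw_le_inv (p : nat) (x y : R) : prime p -> p%:R `^ x <= p%:R `^ y -> x <= y.
Proof.
move=> pp; have p0 : 0 < p%:R :> R by rewrite ltr0n prime_gt0.
move=> h; have : ln (p%:R `^ x) <= ln (p%:R `^ y) by rewrite ler_ln ?posrE ?powR_gt0.
rewrite !ln_powR ler_pM2r//.
by rewrite ln_gt0// ltr1n prime_gt1.
Qed.

Lemma card_cls (p b : nat) (rho M : int) : (0 < p)%N ->
  (\sum_(i < b) cls p rho (M + i%:Z) <= b %/ p + 1)%N.
Proof.
move=> p0; have p0' : p%:Z != 0 by rewrite eqz_nat -lt0n.
apply: leq_trans (card_residue b `|((rho - M) %% p%:Z)%Z| p0).
apply: leq_sum => i _; rewrite /cls.
have -> : M + i%:Z - rho = i%:Z - (rho - M) by ring.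
have zE : (`|((rho - M) %% p%:Z)%Z|%N)%:Z = ((rho - M) %% p%:Z)%Z.
  by rewrite gez0_abs// modz_ge0.
by rewrite -eqz_mod_dvd -[X in (_ <= nat_of_bool X)%N]eqz_nat -!modz_nat zE modz_mod.
Qed.

(** The correlations carry the weight w, whereas Cauchy-Schwarz counts only the n points of the
    subset w' in the interval. For w' a class modulo p this saves a factor p. *)
Lemma mean_sq (g : int -> C) (w w' : int -> bool) (d H b : nat) (c : R) (Bs : nat -> R)
    (M : int) (n : nat) : uni g -> (0 < b)%N -> (forall h, 0 <= Bs h) ->
  (forall m, w (m + d%:Z) = w m) ->
  (forall h M', (0 < h)%N -> (h < H)%N ->
     nrm (Wsum (fun m => (w m)%:R * dm (d * h)%N%:Z g m) M' b) <= Bs h) ->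
  \sum_(h < H | (0 < h)%N) Bs h <= H%:R * c -> b%:R <= H%:R * c ->
  (forall m, w' m -> w m) -> (\sum_(i < b) w' (M + i%:Z)%R <= n)%N ->
  nrm (\sum_(i < b) (w' (M + i%:Z))%:R * Tsum g d H (M + i%:Z)) ^+ 2 <=
    n%:R * (4 * H%:R ^+ 2 * c).
Proof.
move=> ug b0 B0 wd hB hS hb ww hn.
pose f m := nrm ((w m)%:R * Tsum g d H m).
have F0 m : 0 <= f m ^+ 2 by rewrite exprn_ge0 ?nrm_ge0.
have h1 : \sum_(i < b) f (M + i%:Z) ^+ 2 <= 4 * H%:R ^+ 2 * c.
  have maj := Wsum_majorant M F0 b0.
  apply: (le_trans maj).
  apply: le_trans (vdc_mean ug (M - b%:Z) b0 B0 wd hB) _.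
  have -> : 4 * H%:R ^+ 2 * c = H%:R * (2 * (H%:R * c) + 2 * (H%:R * c)) by ring.
  by rewrite ler_wpM2l// lerD// ler_wpM2l.
have := cauchy_schwarz (index_enum 'I_b) xpredT (fun i => (w' (M + i%:Z))%:R) (fun i => f (M + i%:Z)).
move=> cs; apply: le_trans (le_trans _ cs) _.
  rewrite ler_sqr ?nnegrE ?nrm_ge0//; last first.
    by apply: sumr_ge0 => i _; rewrite mulr_ge0 ?nrm_ge0.
  apply: le_trans (nrm_sum _ _ _) _; apply: ler_sum => i _; rewrite /f.
  case: (boolP (w' _)) => [/ww ->|_]; first by rewrite !mul1r.
  by rewrite !mul0r nrm0.
apply: ler_pM => //.
- by apply: sumr_ge0 => i _; rewrite exprn_ge0.
- by apply: sumr_ge0 => i _.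
- rewrite (eq_bigr (fun i : 'I_b => (w' (M + i%:Z) : nat)%:R)); last first.
    by move=> i _; case: (w' _); rewrite ?expr1n// expr0n.
  by rewrite -natr_sum ler_nat.
Qed.

Section Fixed.
Variables (p N D N0 chi nu b H : nat) (g : int -> C) (k m l r B ell th a A : R).
Hypotheses (pp : prime p) (D1 : (1 <= D)%N) (N01 : (1 <= N0)%N)
  (g1 : (2 * D <= N)%N) (g2 : (N0 + 2 * D <= N + 1)%N)
  (g3 : (3 * N0 + 2 * D <= 2 * N + 3)%N)
  (lE : l = m + 1 / 2) (k0 : 0 < k) (k2 : 2 * k <= 1) (m0 : 0 <= m) (m2 : 2 * m < 1)
  (ell0 : 0 <= ell) (g5 : 2 * (r + D%:R) + k - 1 <= (1 - l) * N%:R)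
  (LB1 : 0 <= ell + r + k * N0%:R) (LB2 : 0 <= ell + r + m * N0%:R) (B0 : 0 <= B)
  (thE : (k + 1) * th = r + k + k * (N%:R - D%:R) + (l - k) * B)
  (th0 : 0 <= th) (thc : th <= chi%:R + 1) (cth : chi%:R <= th + a) (a0 : 0 <= a)
  (aA : p%:R `^ a = A) (A2 : 2 <= A) (big : 100 * ell <= k * N%:R)
  (ug : uni g) (hC2 : C2 p N g) (hC3 : C3 p (N - D) g) (nnu : ~~ (p %| nu)%N)
  (b0 : (0 < b)%N) (H0 : (0 < H)%N) (HN : (p ^ chi * H < p ^ N)%N)
  (bB : b%:R = p%:R `^ B) (bH : (b <= 64 * (p ^ chi * H))%N).
Local Notation pw x := (p%:R `^ x).
Local Notation sq v := (Num.sqrt (Yv p N D chi v)%:R : R).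
Let Z : R := pw (th + ell).
Hypothesis hdat : forall h M, (0 < h)%N -> (h < H)%N ->
  (2 * b <= Yv p N D chi (logn p h))%N -> (p ^ N0 <= Yv p N D chi (logn p h))%N ->
  nrm (Wsum (dm (p ^ chi * nu * h)%N%:Z g) M b) <= 2 * Z.

Let p0 : 0 < (p%:R : R). Proof. by rewrite ltr0n prime_gt0. Qed.
Let DN : (D <= N)%N. Proof. by move: g1 D1; clear; lia. Qed.
Let H0' : 0 < (H%:R : R). Proof. by rewrite ltr0n. Qed.
Let b0' : 0 < (b%:R : R). Proof. by rewrite ltr0n. Qed.
Let Z0 : 0 < Z. Proof. exact: (pw_gt0 pp). Qed.
Let NE : N%:R = D%:R + (N - D)%N%:R :> R. Proof. by rewrite -natrD subnKC. Qed.
Let A1 : 1 <= A. Proof. by apply: le_trans A2; rewrite ler1n. Qed.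
Let AZ x : x <= th + ell + a -> pw x <= A * Z.
Proof. by move=> h; rewrite -aA /Z mulrC -(pwD pp); apply: (pw_le pp). Qed.
Let Z1 : 1 <= Z.
Proof. by rewrite -(powRr0 p%:R) /Z; apply: (pw_le pp); have := addr_ge0 th0 ell0. Qed.
Let D1' : 1 <= D%:R :> R. Proof. by rewrite ler1n. Qed.
Let N01' : 1 <= N0%:R :> R. Proof. by rewrite ler1n. Qed.
Let g1' : 2 * D%:R <= N%:R :> R. Proof. by rewrite -natrM ler_nat. Qed.
Let g2' : N0%:R + 2 * D%:R <= N%:R + 1 :> R.
Proof. by move: g2; rewrite -(ler_nat R) (natrD R N0) (natrM R 2) (natrD R N). Qed.
Let g3' : 3 * N0%:R + 2 * D%:R <= 2 * N%:R + 3 :> R.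
Proof. by move: g3; rewrite -(ler_nat R) (natrD R (3 * N0)) (natrD R (2 * N)) !natrM. Qed.

Let chiZ : (p ^ chi)%:R <= A * Z.
Proof. by rewrite natrX -pwn; apply: AZ; have := cth; have := ell0; lra. Qed.

Let bHZ : b%:R <= H%:R * (64 * A * Z).
Proof.
apply: (@le_trans _ _ (64 * (p ^ chi)%:R * H%:R)).
  by rewrite -!natrM ler_nat -mulnA.
by rewrite mulrC ler_wpM2l// -mulrA ler_wpM2l.
Qed.

(** At the orders where the datum does not apply, the part sqrt Y of the Fourier estimate is still
    within the target. *)
Let sq_bad v : (Yv p N D chi v < 2 * b)%N || (Yv p N D chi v < p ^ N0)%N ->
  p%:R ^- v * sq v <= A * Z.
Proof.
have pv : p%:R ^- v = pw (- v%:R) :> R by rewrite pwN pwn.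
have sqE : sq v = pw ((N - D - (chi + v))%N%:R / 2) by rewrite /Yv natrX -pwn pw_sqrt.
have [Y0|Y0] := ltnP (Yv p N D chi v) (p ^ N0).
  move=> _; have [cv|cv] := leqP (chi + v) (N - D); last first.
    have -> : sq v = 1.
      rewrite /Yv; have -> : (N - D - (chi + v) = 0)%N by move: cv; clear; lia.
      by rewrite expn0 sqrtr1.
    apply: (@le_trans _ _ 1); last by rewrite -[1]mulr1; apply: ler_pM.
    by rewrite mulr1 invf_le1 ?exprn_gt0// exprn_ege1// ler1n prime_gt0.
  (* With Y = p^y the exponent is chi + 3y/2 - (N - D), at most chi by y + 1 <= N0 and [g3']. *)
  rewrite sqE pv -(pwD pp); apply: AZ.
  have yN0 : (N - D - (chi + v)).+1%:R <= N0%:R :> R.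
    by rewrite ler_nat; move: Y0; rewrite /Yv ltn_exp2l ?prime_gt1.
  have := cth; have := ell0; have := NE; have := g3'; move: yN0.
  by rewrite -natr1 (natrB _ cv) natrD => *; lra.
rewrite orbF => Yb.
have cv : (chi + v <= N - D)%N.
  rewrite leqNgt; apply/negP => lt; move: Y0; rewrite /Yv.
  have -> : (N - D - (chi + v) = 0)%N by move: lt; clear; lia.
  by rewrite leq_exp2l ?prime_gt1// leqNgt N01.
pose c := ln 2 / ln (p%:R : R).
have lnp : 0 < ln (p%:R : R) by rewrite ln_gt0// ltr1n prime_gt1.
have c0 : 0 <= c by rewrite divr_ge0 ?(ltW lnp)// ln_ge0// ler1n.
have c2 : pw c = 2 :> R.
  by rewrite /powR gt_eqF// /c divfK ?gt_eqF// lnK// posrE.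
pose y : R := (N - D - (chi + v))%N%:R.
have yE : y = (N - D)%N%:R - (chi%:R + v%:R) by rewrite /y (natrB _ cv) natrD.
have h1 : N0%:R <= y by rewrite ler_nat; move: Y0; rewrite /Yv leq_exp2l ?prime_gt1.
have h2 : y <= B + c.
  have : pw y <= pw (B + c).
    by rewrite (pwD pp) -bB c2 /y pwn -natrX -natrM ler_nat mulnC ltnW.
  exact: (pw_le_inv pp).
have h3 : y + chi%:R <= N%:R - D%:R by have := ler0n R v; have := NE; lra.
have := exp_sqrt lE k0 k2 m0 m2 ell0 D1' N01' g1' g2' g3' g5 LB1 LB2 B0 thE thc h1 h2 c0 h3.
move=> hy; rewrite sqE -/y.
apply: (@le_trans _ _ (1 * (pw (th + ell + c)))).
  apply: ler_pM; rewrite ?powR_ge0 ?invr_ge0 ?exprn_ge0//; last exact: (pw_le pp).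
  by rewrite invf_le1 ?exprn_gt0// exprn_ege1// ler1n prime_gt0.
by rewrite mul1r (pwD pp) c2 -/Z mulrC ler_pM2r.
Qed.

Let badv v := (Yv p N D chi v < 2 * b)%N || (Yv p N D chi v < p ^ N0)%N.

Let Ymono v w : (v <= w)%N -> (Yv p N D chi w <= Yv p N D chi v)%N.
Proof.
by move=> vw; rewrite /Yv leq_exp2l ?prime_gt1//; move: vw; clear; lia.
Qed.

Lemma step_all (t : R) : 1 <= t ->
  (forall v, (Yv p N D chi v < 2 * b)%N ->
     pw ((chi%:R + D%:R) / 2 - `|B - N%:R / 2| - v%:R / 2) <= A * Z * t) ->
  exists2 Bs : nat -> R, (forall h, 0 <= Bs h) /\
    (forall h M, (0 < h)%N -> (h < H)%N ->
       nrm (Wsum (dm (p ^ chi * nu * h)%N%:Z g) M b) <= Bs h) &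
    \sum_(h < H | (0 < h)%N) Bs h <= H%:R * (4 * Kb * A * Z * t).
Proof.
move=> t1 hX.
have exc : exists v, (Yv p N D chi v < 2 * b)%N.
  exists (N - D)%N; rewrite /Yv; have -> : (N - D - (chi + (N - D)) = 0)%N by clear; lia.
  by rewrite expn0 mul2n -addnn; move: b0; clear; lia.
case: (ex_minnP exc) => vc hc cmin.
have exb : exists v, badv v by exists vc; rewrite /badv hc.
case: (ex_minnP exb) => vb hb bmin.
have bc : (vb <= vc)%N by apply: bmin; rewrite /badv hc.
have bup v : (vb <= v)%N -> badv v.
  move=> vv; move: hb; rewrite /badv => /orP[h|h]; apply/orP; [left|right];
    exact: leq_ltn_trans (Ymono vv) h.
pose Bs h := if badv (logn p h) then spec p N g b (chi + logn p h) (p ^ chi * nu * h)%N%:Z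
  else 2 * Z.
have sp0 j h : 0 <= spec p N g b j h.
  by rewrite mulr_ge0 ?invr_ge0// sumr_ge0// => i _; rewrite mulr_ge0 ?nrm_ge0 ?kap_ge0.
exists Bs; first split.
- by move=> h; rewrite /Bs; case: ifP => // _; rewrite mulr_ge0// ltW.
- move=> h M h0 hH; rewrite /Bs; case: ifP => [_|/negbT]; last first.
    by rewrite /badv negb_or -!leqNgt => /andP[h1 h2]; apply: hdat.
  have [h' ch' hE] := pfactor_coprime pp h0.
  apply: (@Wsum_spec _ _ _ _ pp _ hC2 _ _ _ (nu * h')%N%:Z) => //.
    rewrite -(ltn_exp2l _ _ (prime_gt1 pp)); apply: leq_ltn_trans HN.
    rewrite expnD leq_mul2l; apply/orP; right.
    by apply: leq_trans (ltnW hH); rewrite dvdn_leq// pfactor_dvdn.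
  by rewrite -PoszM {1}hE expnD; congr Posz; ring.
have S1 : \sum_(h < H | (0 < h)%N) Bs h <= H%:R * (2 * Z) + \sum_(v < H | (vb <= v)%N) SL p N chi nu b H g v.
  rewrite (bigID (fun h : 'I_H => badv (logn p h))) /= addrC; apply: lerD.
    apply: (@le_trans _ _ (\sum_(h < H) (2 * Z))).
      rewrite big_mkcond /=; apply: ler_sum => h _; case: ifP => [/andP[_ /negbTE hb']|_].
        by rewrite /Bs hb'.
      by rewrite mulr_ge0// ltW.
    by rewrite sumr_const card_ord [leRHS]mulr_natl.
  pose F h := if badv (logn p h) then Bs h else 0.
  rewrite [leLHS](_ : _ = \sum_(h < H | (0 < h)%N) F h); last first.
    by rewrite big_mkcondr; apply: eq_bigr => h _; rewrite /F.
  rewrite (sum_levels p) big_mkcond [leRHS]big_mkcond /=; apply: ler_sum => v _.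
  case: ifP => hv.
    rewrite /SL; apply: ler_sum => h /andP[_ /eqP lh].
    by rewrite /F /Bs lh (bup _ hv).
  rewrite big1// => h /andP[_ /eqP lh]; rewrite /F lh.
  by case: ifP => // /bmin; rewrite hv.
have S2 := bad_sum pp DN ug hC2 hC3 nnu b0 H0 HN bB bH bc.
have {}S2 : (\sum_(v < H | (vb <= v)%N) SL p N chi nu b H g v) / H%:R <=
    24%:R * (p%:R ^- vb * sq vb) +
    1536%:R * pw ((chi%:R + D%:R) / 2 - `|B - N%:R / 2| - vc%:R / 2).
  apply: S2 => v h1 h2; rewrite leqNgt; apply/negP => /cmin; by rewrite leqNgt h2.
rewrite ler_pdivrMr// in S2.
have T1 : 24%:R * (p%:R ^- vb * sq vb) <= Kb * (A * Z * t).
  apply: ler_pM; [exact: ler0n| |exact: Kb_ge|].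
    by apply: mulr_ge0; rewrite ?sqrtr_ge0// invr_ge0 exprn_ge0// ltW.
  apply: le_trans (sq_bad hb) _; rewrite -[leLHS]mulr1 ler_wpM2l// ltW// mulr_gt0//.
  exact: lt_le_trans A1.
have T2 : 1536%:R * pw ((chi%:R + D%:R) / 2 - `|B - N%:R / 2| - vc%:R / 2) <= Kb * (A * Z * t).
  by apply: ler_pM; [exact: ler0n|exact: powR_ge0|exact: Kb_ge|exact: hX].
have T3 : 2 * Z <= 2 * (Kb * (A * Z * t)).
  rewrite ler_wpM2l//; have K1 := Kb_ge (isT : (1 <= 1536)%N).
  have z : Z <= Z * t by rewrite -[leLHS]mulr1 ler_wpM2l// ltW.
  have z' : Z * t <= A * Z * t by rewrite -mulrA -[leLHS]mul1r ler_wpM2r// (le_trans _ z)// ltW.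
  apply: (le_trans z); apply: (le_trans z'); rewrite -[leLHS]mul1r ler_wpM2r//.
  by apply: (le_trans _ z'); apply: (le_trans _ z); exact: ltW.
apply: le_trans S1 _; apply: (@le_trans _ _ (H%:R * (2 * (Kb * (A * Z * t))) + (2 * (Kb * (A * Z * t))) * H%:R)).
  apply: lerD; first by rewrite ler_wpM2l.
  by apply: le_trans S2 _; rewrite ler_wpM2r//; lra.
by rewrite le_eqVlt; apply/orP; left; apply/eqP; ring.
Qed.

Let pw_ge1 : 2 <= (p%:R : R). Proof. by rewrite (ler_nat R 2) prime_gt1. Qed.
Let K1 : 1 <= Kb. Proof. exact: (Kb_ge (n := 1)). Qed.
Let KAZ : 0 < Kb * A * Z.
Proof. by apply: mulr_gt0 => //; apply: mulr_gt0; [apply: lt_le_trans K1|apply: lt_le_trans A1]. Qed.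

Let final (x : C) : nrm x ^+ 2 <= 256%:R * (Kb * A * Z) * (b%:R * H%:R ^+ 2) ->
  nrm x ^+ 2 <= Kb ^+ 2 * A * (b%:R * H%:R ^+ 2 * Z).
Proof.
move=> h; apply: (le_trans h).
have -> : Kb ^+ 2 * A * (b%:R * H%:R ^+ 2 * Z) = Kb * (Kb * A * Z) * (b%:R * H%:R ^+ 2) by ring.
apply: ler_wpM2r; first by rewrite mulr_ge0// exprn_ge0.
by apply: ler_wpM2r; [exact: ltW|exact: Kb_ge].
Qed.

Lemma step_good (M : int) :
  (forall v, (Yv p N D chi v < 2 * b)%N ->
     pw ((chi%:R + D%:R) / 2 - `|B - N%:R / 2| - v%:R / 2) <= A * Z) ->
  nrm (\sum_(i < b) Tsum g (p ^ chi * nu) H (M + i%:Z)) ^+ 2 <=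
    256%:R * (Kb * A * Z) * (b%:R * H%:R ^+ 2).
Proof.
move=> hX; have [|Bs [Bs0 hB] hS] := step_all (lexx 1); first by move=> v /hX; rewrite mulr1.
have tr (x : int) : Tsum g (p ^ chi * nu) H x = (true : bool)%:R * Tsum g (p ^ chi * nu) H x.
  by rewrite mul1r.
rewrite (eq_bigr _ (fun (i : 'I_b) _ => tr _)).
apply: le_trans (mean_sq (w := xpredT) (w' := xpredT) (c := 64%:R * (Kb * A * Z)) (M := M) (n := b) ug b0 Bs0 _ _ _ _ _ _) _ => //.
- move=> h M' h0 hH; apply: le_trans (hB h M' h0 hH).
  rewrite le_eqVlt; apply/orP; left; apply/eqP; congr (nrm (Wsum _ _ _)).
  by apply/funext => m'; rewrite mul1r.
- apply: le_trans hS _; rewrite ler_wpM2l// mulr1 -!mulrA; apply: ler_wpM2r; last by rewrite ler_nat.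
  by rewrite mulrA ltW.
- apply: le_trans bHZ _; rewrite ler_wpM2l//; have := KAZ; have := K1.
  have : 0 < A * Z by apply: mulr_gt0 => //; apply: lt_le_trans A1.
  by move=> az k1 _; have : 0 <= (Kb - 1) * (A * Z) by [apply: mulr_ge0; lra]; lra.
- by rewrite sum_nat_const card_ord muln1.
- by rewrite le_eqVlt; apply/orP; left; apply/eqP; ring.
Qed.

(** If the period at order 0 is at least 2b, the critical term begins at order 1, and the gain 1/2
    there covers the excess in [exp_mid]. If the critical exponent is within the target, nothing is
    lost. In the remaining case [exp_ell], [exp_mid] and [big] give N >= 50, D well below N/2 and B
    within 1/2 of N/2; then [res_sum] applies. *)
Lemma step_bound (M : int) :
  nrm (\sum_(i < b) Tsum g (p ^ chi * nu) H (M + i%:Z)) ^+ 2 <=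
    Kb ^+ 2 * A * (b%:R * H%:R ^+ 2 * Z).
Proof.
have [mid1 mid2] := exp_mid lE k0 k2 m0 m2 ell0 D1' N01' g1' g2' g3' g5 LB1 LB2 B0 thE a0 cth.
have n0 := normr_ge0 (B - N%:R / 2).
have [Y0|Y0] := leqP (2 * b) (Yv p N D chi 0).
  apply/final/step_good => -[|v] Yv'; first by move: Yv'; rewrite ltnNge Y0.
  apply: AZ; have : 1 <= v.+1%:R :> R by rewrite ler1n.
  by have := a0; lra.
have [Xs|Xs] := lerP ((chi%:R + D%:R) / 2 - `|B - N%:R / 2|) (th + ell + a).
  apply/final/step_good => v _; apply: AZ; have := ler0n R v; lra.
have [cD s2] : (chi < D)%N /\ (N + 2 <= 4 * D)%N.
  have nf := exp_far lE k0 k2 m0 m2 ell0 D1' N01' g1' g2' g3' g5 LB1 LB2 B0 thE a0 cth.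
  split; rewrite leqNgt; apply/negP => hh.
    have : (chi%:R + D%:R) / 2 - `|B - N%:R / 2| <= th + ell + a.
      by apply: nf; right; rewrite ler_nat.
    by rewrite leNgt Xs.
  have [Dc|cD] := leqP D chi.
    have : (chi%:R + D%:R) / 2 - `|B - N%:R / 2| <= th + ell + a.
      by apply: nf; right; rewrite ler_nat.
    by rewrite leNgt Xs.
  have : (chi%:R + D%:R) / 2 - `|B - N%:R / 2| <= th + ell + a.
    apply: nf; left; split.
      by move: hh; rewrite addn2 ltnS -(ler_nat R) natrM -[N.+1]addn1 natrD.
    by rewrite natr1 ler_nat.
  by rewrite leNgt Xs.
have cD' : chi%:R + 1 <= D%:R :> R by rewrite natr1 ler_nat.
have s2' : N%:R + 2 <= 4 * D%:R :> R by move: s2; rewrite -(ler_nat R) natrM natrD.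
have ell1 := exp_ell lE k0 k2 m0 m2 ell0 D1' N01' g1' g2' g3' g5 LB1 LB2 B0 thE s2'.
have N50 : 50 <= N%:R :> R.
  have : k * 50 <= k * N%:R by have := big; have := s2'; lra.
  by rewrite ler_pM2l.
have kN : 2 * (k * N%:R) <= N%:R.
  have : 0 <= (1 - 2 * k) * N%:R by apply: mulr_ge0 => //; have := k2; lra.
  by lra.
have ND : D%:R + 11 <= N%:R / 2 :> R by have := big; have := k0; lra.
set be := B - N%:R / 2 in mid1 mid2 n0 Xs.
have BE : B = N%:R / 2 + be by rewrite /be; lra.
have be_hi : be <= 1 / 4.
  have [bn|bp] := lerP be 0; first by lra.
  have NB : N%:R / 2 <= B by lra.
  by have := mid2 NB; have := a0; rewrite (gtr0_norm bp) in Xs *; lra.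
have be_lo : - (1 / 2) <= be.
  have [bn|bp] := ltrP be 0; last by lra.
  by rewrite (ltr0_norm bn) in mid1 Xs; have := a0; lra.
have b_p : (p <= b)%N.
  rewrite -(ler_nat R) bB -[leLHS]powRr1//; apply: (pw_le pp); lra.
have VcB : (N - D)%N%:R - chi%:R <= B + 1.
  have [cV|cV] := leqP chi (N - D); last first.
    have : (N - D)%N%:R <= chi%:R :> R by rewrite ler_nat ltnW.
    by have := B0; lra.
  have e : (N - D)%N%:R - chi%:R = (N - D - chi)%N%:R :> R by rewrite (natrB _ cV).
  rewrite e; apply: (pw_le_inv pp).
  rewrite (pwD pp) powRr1// -bB pwn -natrX -natrM ler_nat.
  move: Y0; rewrite /Yv addn0 => /ltnW h; apply: (leq_trans h).
  by rewrite mulnC leq_mul2l prime_gt1// orbT.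
have chi1 : (0 < chi)%N.
  rewrite -(ltr_nat R); have := NE; lra.
have chiV : (chi.+2 <= N - D)%N.
  rewrite -(ler_nat R) -[chi.+2]addn2 natrD; have := NE; lra.
have [rho [Br [Br0 hBr] hSr]] := res_sum pp DN ug hC2 hC3 nnu b0 H0 bB chi1 chiV.
have pd : (p%:Z %| (p ^ chi * nu)%N%:Z)%Z.
  by rewrite dvdzE /= dvdn_mulr// -(prednK chi1) expnS dvdn_mulr.
have az : 0 < A * Z by apply: mulr_gt0 => //; apply: lt_le_trans A1.
have KK : A * Z <= Kb * A * Z.
  by rewrite -mulrA -[leLHS]mul1r ler_wpM2r// ltW.
have K200 : 200%:R * (A * Z) <= Kb * A * Z.
  by rewrite -mulrA ler_wpM2r ?Kb_ge// ltW.
have R1 : nrm (\sum_(i < b) (~~ cls p rho (M + i%:Z))%:R * Tsum g (p ^ chi * nu) H (M + i%:Z)) ^+ 2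
   <= 256%:R * (Kb * A * Z) * (b%:R * H%:R ^+ 2).
  apply: le_trans (mean_sq (w := fun m => ~~ cls p rho m) (w' := fun m => ~~ cls p rho m)
     (c := 64%:R * (Kb * A * Z)) (M := M) (n := b) ug b0 Br0 _ hBr _ _ _ _) _ => //.
  - by move=> m'; rewrite clsD.
  - move: hSr; rewrite ler_pdivrMr// mulrC => hSr; apply: (le_trans hSr); rewrite ler_wpM2l//.
    have q0 := @sq_bad 0%N; rewrite Y0 expr0 invr1 mul1r in q0; have {}q0 := q0 isT.
    have q1 : pw ((chi%:R + D%:R) / 2 + (B - N%:R / 2) - 1 / 2) <= A * Z.
      apply: AZ; rewrite -/be; have [bn|bp] := ltrP be 0.
        by rewrite (ltr0_norm bn) in mid1; have := a0; lra.
      have NB : N%:R / 2 <= B by lra.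
      by have := mid2 NB; have := a0; lra.
    have q2 : b%:R * p%:R ^- (N - D - chi).-1 <= A * Z.
      rewrite bB -pwn -pwN -(pwD pp); apply: AZ.
      have e : (N - D - chi).-1%:R = (N - D)%N%:R - chi%:R - 1 :> R.
        have cV : (chi < N - D)%N by apply: leq_trans chiV.
        by rewrite -subn1 natrB ?subn_gt0// (natrB _ (ltnW cV)).
      by rewrite e; have := NE; have := cth; have := ell0; lra.
    by lra.
  - by apply: le_trans bHZ _; rewrite ler_wpM2l//; lra.
  - have h : (\sum_(i < b) ~~ cls p rho (M + i%:Z) <= \sum_(i < b) 1)%N.
      by apply: leq_sum => i _; case: (cls _ _ _).
    by apply: leq_trans h _; rewrite sum_nat_const card_ord muln1.
  - by rewrite le_eqVlt; apply/orP; left; apply/eqP; ring.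
(* The class rho itself: its correlations are taken over all integers with the loss t = p, and its
   b/p + 1 points compensate for that loss. *)
have R2 : nrm (\sum_(i < b) (cls p rho (M + i%:Z))%:R * Tsum g (p ^ chi * nu) H (M + i%:Z)) ^+ 2
   <= 2 * (256%:R * (Kb * A * Z) * (b%:R * H%:R ^+ 2)).
  have pt : 1 <= p%:R :> R by have := pw_ge1; lra.
  have [|Bs [Bs0 hB] hS] := step_all pt.
    move=> v _; rewrite -aA /Z -{4}[p%:R : R]powRr1// -!(pwD pp); apply: (pw_le pp).
    by rewrite -/be; have := ler0n R v; have := a0; lra.
  apply: le_trans (mean_sq (w := xpredT) (w' := cls p rho) (c := 64%:R * (Kb * A * Z) * p%:R)
      (M := M) (n := (b %/ p + 1)%N) ug b0 Bs0 _ _ _ _ _ _) _ => //.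
  - move=> h M' h0 hH; apply: le_trans (hB h M' h0 hH).
    rewrite le_eqVlt; apply/orP; left; apply/eqP; congr (nrm (Wsum _ _ _)).
    by apply/funext => m'; rewrite mul1r.
  - apply: le_trans hS _; rewrite ler_wpM2l// ler_wpM2r// -!mulrA; apply: ler_wpM2r; last by rewrite ler_nat.
    by rewrite mulrA ltW.
  - apply: le_trans bHZ _; rewrite ler_wpM2l//; apply: (@le_trans _ _ (64%:R * (Kb * A * Z) * 1)); first by lra.
    by rewrite ler_wpM2l// mulr_ge0// ltW.
  - exact/card_cls/prime_gt0.
  - have np : (b %/ p + 1)%N%:R * p%:R <= 2 * b%:R :> R.
      rewrite -natrM -(natrM R 2) ler_nat mulnDl mul1n mul2n -addnn leq_add//.
      exact: leq_trunc_div.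
    have c0 : 0 <= 4 * H%:R ^+ 2 * (64%:R * (Kb * A * Z)).
      apply: mulr_ge0; first by apply: mulr_ge0; rewrite ?ler0n ?exprn_ge0.
      by apply: mulr_ge0; [exact: ler0n|exact: ltW].
    have := ler_wpM2r c0 np.
    set x := H%:R ^+ 2; set y := Kb * A * Z; set n := (b %/ p + 1)%N%:R.
    by move=> hh; apply: (le_trans (le_trans _ hh)); rewrite le_eqVlt; apply/orP; left; apply/eqP; ring.
rewrite (eq_bigr (fun i : 'I_b => (~~ cls p rho (M + i%:Z))%:R * Tsum g (p ^ chi * nu) H (M + i%:Z)
   + (cls p rho (M + i%:Z))%:R * Tsum g (p ^ chi * nu) H (M + i%:Z))); last first.
  by move=> i _; case: (cls _ _ _); rewrite ?mul1r ?mul0r ?addr0 ?add0r.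
rewrite big_split /=; set u := \sum_(i < b) _; set v := \sum_(i < b) _.
have uv := nrmD u v; have u0 := nrm_ge0 u; have v0 := nrm_ge0 v; have uv0 := nrm_ge0 (u + v).
have sq2 : nrm (u + v) ^+ 2 <= 2 * nrm u ^+ 2 + 2 * nrm v ^+ 2.
  have : nrm (u + v) ^+ 2 <= (nrm u + nrm v) ^+ 2 by rewrite ler_sqr ?nnegrE ?addr_ge0.
  by have := sqr_ge0 (nrm u - nrm v); lra.
apply: (le_trans sq2).
have -> : Kb ^+ 2 * A * (b%:R * H%:R ^+ 2 * Z) = Kb * ((Kb * A * Z) * (b%:R * H%:R ^+ 2)) by ring.
apply: (@le_trans _ _ (1536%:R * ((Kb * A * Z) * (b%:R * H%:R ^+ 2)))).
  rewrite -mulrA -/u in R1; rewrite -[256%:R * _ * _]mulrA -/v in R2.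
  move: R1 R2; set W := Kb * A * Z * _ => R1 R2; lra.
by apply: ler_wpM2r; [rewrite mulr_ge0 ?(ltW KAZ)// mulr_ge0// exprn_ge0|exact: Kb_ge].
Qed.

End Fixed.
End Step.

(** * The bound for an abstract phase *)

Section MainBound.
Variable R : realType.
Local Notation C := (R[i]).

Definition lg (p : nat) (x : R) : R := ln x / ln p%:R.

Lemma ln_p_gt0 (p : nat) : prime p -> 0 < ln (p%:R : R).
Proof. by move=> pp; rewrite ln_gt0// ltr1n prime_gt1. Qed.

Lemma pw_lg (p : nat) (x : R) : prime p -> 0 < x -> p%:R `^ lg p x = x.
Proof.
move=> pp x0; have lp := ln_p_gt0 pp.
rewrite /powR gt_eqF ?ltr0n ?prime_gt0// /lg divfK ?gt_eqF// lnK// posrE.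
Qed.

Lemma lg_ge0 (p : nat) (x : R) : prime p -> 1 <= x -> 0 <= lg p x.
Proof. by move=> pp x1; exact: divr_ge0 (ln_ge0 x1) (ltW (ln_p_gt0 pp)). Qed.

Lemma ln_le_self (x : R) : 0 < x -> ln x <= x.
Proof.
move=> x0; have := le_ln1Dx (_ : -1 < x - 1); rewrite addrCA subrr addr0.
by move=> h; have : -1 < x - 1 by [lra]; move=> /h; lra.
Qed.

Lemma ln2_ge : 1 <= 2 * ln (2 : R).
Proof.
have := le_ln1Dx (_ : -1 < - (1 / 2) :> R) => h; have {h} : ln (1 + - (1 / 2)) <= - (1 / 2) :> R.
  by apply: h; lra.
have -> : 1 + - (1 / 2) = 2^-1 :> R by lra.
by rewrite lnV ?posrE//; lra.
Qed.

(** For L = N ln p the hypothesis reads L <= cc ln Cd + s ln L with s = cc delta, which bounds L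
    uniformly in p and N. *)
Lemma small_bounded (Cd delta cc : R) : 1 <= Cd -> 0 <= delta -> 0 <= cc ->
  exists2 X : R, 1 <= X & forall p N : nat, prime p -> (2 <= N)%N ->
    N%:R <= cc * lg p (Cd * (N%:R * ln p%:R) `^ delta) -> p%:R ^+ N <= X.
Proof.
move=> Cd1 d0 cc0; pose s := cc * delta.
have s0 : 0 <= s by apply: mulr_ge0.
have s2 : 0 < 2 * s + 2 by lra.
pose G := cc * ln Cd + s * ln (2 * s + 2).
have G0 : 0 <= G by rewrite addr_ge0// mulr_ge0// ln_ge0//; lra.
exists (expR (2 * G)); first by have := expR_ge1Dx (2 * G); lra.
move=> p N pp N2 h; have lp := ln_p_gt0 pp.
set L := N%:R * ln p%:R in h.
have L0 : 0 < L by rewrite mulr_gt0// ltr0n; apply: leq_trans N2.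
have hL : L <= cc * (ln Cd + delta * ln L).
  move: h; rewrite /lg mulrA ler_pdivlMr// -/L lnM ?posrE ?powR_gt0//; last by lra.
  by rewrite ln_powR.
(* From ln x <= x at x = L / (2s + 2); the divisor keeps s ln L below L/2 plus a constant. *)
have h2 : ln L <= L / (2 * s + 2) + ln (2 * s + 2).
  have -> : ln L = ln (L / (2 * s + 2)) + ln (2 * s + 2).
    by rewrite -lnM ?posrE ?divr_gt0// divfK ?gt_eqF.
  by rewrite lerD2r ln_le_self// divr_gt0.
have h3 : s * ln L <= s * (L / (2 * s + 2)) + s * ln (2 * s + 2).
  by rewrite -mulrDr ler_wpM2l.
have h4 : s * (L / (2 * s + 2)) <= L / 2.
  rewrite mulrA ler_pdivrMr//; have : 0 <= L * s by [apply: mulr_ge0 => //; exact: ltW]; lra.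
have LG : L <= 2 * G by rewrite /G; move: hL h3 h4; rewrite mulrDr mulrA -/s; lra.
rewrite -[leLHS]lnK ?posrE ?exprn_gt0 ?ltr0n ?prime_gt0// ler_expR.
by rewrite lnXn ?ltr0n ?prime_gt0// -[_ *+ N]mulr_natl.
Qed.

Lemma main_bound (k m l delta Cd : R) : 0 < k -> 2 * k <= 1 -> 0 <= m -> 2 * m < 1 ->
  l = m + 1 / 2 -> 0 <= delta -> 1 <= Cd ->
  exists2 K : R, 0 < K & forall (p N D N0 chi0 : nat) (r : R) (g : int -> C),
  let Lam := Cd * (N%:R * ln p%:R) `^ delta in
  prime p -> (1 <= D)%N -> (1 <= N0)%N -> (2 * D <= N)%N -> (N0 + 2 * D <= N + 1)%N ->
  (3 * N0 + 2 * D <= 2 * N + 3)%N -> 2 * (r + D%:R) + k - 1 <= (1 - l) * N%:R ->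
  1 <= Lam * p%:R `^ (r + k * N0%:R) -> 1 <= Lam * p%:R `^ (r + m * N0%:R) ->
  uni g -> C2 p N g -> C3 p (N - D) g ->
  (forall (h B : nat) (M : int), (0 < h)%N -> ~~ odd h -> (chi0 <= logn p h)%N ->
     (N0 + logn p h <= N - D)%N -> (0 < B)%N -> (B <= p ^ (N - D - logn p h))%N ->
     nrm (isum (dm h%:Z g) M B) <=
       Lam * p%:R `^ r * ((p ^ (N - D - logn p h))%:R / B%:R) `^ k * B%:R `^ l) ->
  (exists2 ex : R, (p ^ chi0)%:R <= 81%:R * p%:R `^ ex &
     ex <= 0 \/ (2 * k + 1 - l) * (2 * ex) - (r - 1) / (k + 1) + k * D%:R / (k + 1)
       <= k * N%:R) ->
  forall (M : int) (b : nat), (0 < b)%N -> (b <= p ^ N)%N ->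
  nrm (isum g M b) ^+ 2 <= K * (b%:R * (Lam * (p%:R `^ ((r + k + k * (N%:R - D%:R)) / (k + 1))
     * b%:R `^ ((l - k) / (k + 1))))).
Proof.
move=> k0 k2 m0 m2 lE d0 Cd1; have sl0 := slack_gt0 k0 k2 m0 m2.
(* Chosen such that N > cc ell gives both [big1], for the step, and [big2], for [exp_excess]. *)
pose cc := 100 / k + (2 * k + 1) / slack k m.
have cc0 : 0 <= cc by apply: addr_ge0; apply: divr_ge0; lra.
have [X X1 hX] := small_bounded Cd1 d0 cc0.
(* The solution of 2 (Cm / 4) + 9 Kb = Cm: boundary sums of length at most b/16 contribute Cm / 4
   each, and 9 = sqrt 81 comes from the main term. *)
pose Cm : R := 18%:R * Kb R.
have K1 : 1 <= Kb R := Kb_ge R (isT : (1 <= 1536)%N).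
have Cm0 : 0 < Cm by rewrite /Cm; lra.
have Cm2 : 2592%:R <= Cm ^+ 2.
  have K8 : 8 <= Kb R := Kb_ge R (isT : (8 <= 1536)%N).
  have : 8 * Kb R <= Kb R * Kb R by apply: ler_wpM2r => //; lra.
  by rewrite /Cm; lra.
have k1 : 0 < k + 1 by lra.
exists (X + Cm ^+ 2); first by rewrite addr_gt0 ?exprn_gt0//; lra.
move=> p N D N0 chi0 r g Lam pp D1 N01 g1 g2 g3 g5 LB1 LB2 ug hC2 hC3 hdat hex M b b0 bN.
have p0 : 0 < p%:R :> R by rewrite ltr0n prime_gt0.
have p2 : 2 <= p%:R :> R by rewrite (ler_nat R 2) prime_gt1.
have lp := ln_p_gt0 pp.
have lp2 : ln 2 <= ln (p%:R : R) by rewrite ler_ln ?posrE.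
have N2 : (2 <= N)%N by move: g1 D1; clear; lia.
have L1 : 1 <= N%:R * ln (p%:R : R).
  have := ln2_ge; have : 2 * ln (p%:R : R) <= N%:R * ln p%:R by rewrite ler_wpM2r ?(ler_nat R 2)// ltW.
  by move=> h1 h2; clear -lp2 h1 h2; lra.
have Lam1 : 1 <= Lam.
  rewrite /Lam; apply: mulr_ege1 => //.
  by rewrite -[leLHS](powRr0 (N%:R * ln p%:R)); apply: ler_powR.
have Lam0 : 0 < Lam by apply: lt_le_trans Lam1.
pose ell := lg p Lam; have ell0 : 0 <= ell by exact: lg_ge0.
have LamE : p%:R `^ ell = Lam by exact: pw_lg.
have LB1' : 0 <= ell + r + k * N0%:R.
  by apply: (pw_le_inv pp); rewrite powRr0 -addrA (pwD pp) LamE.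
have LB2' : 0 <= ell + r + m * N0%:R.
  by apply: (pw_le_inv pp); rewrite powRr0 -addrA (pwD pp) LamE.
pose Bf (c : nat) : R := lg p c%:R.
pose th (c : nat) : R := (r + k + k * (N%:R - D%:R) + (l - k) * Bf c) / (k + 1).
have BfE c : (0 < c)%N -> c%:R = p%:R `^ Bf c by move=> c0; rewrite pw_lg ?ltr0n.
have Bf0 c : (0 < c)%N -> 0 <= Bf c by move=> c0; apply: lg_ge0; rewrite ?ler1n.
have thE c : (k + 1) * th c = r + k + k * (N%:R - D%:R) + (l - k) * Bf c.
  by rewrite /th mulrC divfK ?gt_eqF.
pose Z c : R := p%:R `^ (th c + ell).
have ZE c : (0 < c)%N -> Lam * (p%:R `^ ((r + k + k * (N%:R - D%:R)) / (k + 1)) * c%:R `^ ((l - k) / (k + 1))) = Z c.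
  move=> c0; rewrite /Z /th (BfE c c0) -powRrM -LamE -!(pwD pp); congr powR.
  by field; rewrite gt_eqF.
rewrite ZE//.
have Z0 c : 0 < Z c := pw_gt0 pp _.
have D1' : 1 <= D%:R :> R by rewrite ler1n.
have N01' : 1 <= N0%:R :> R by rewrite ler1n.
have g1' : 2 * D%:R <= N%:R :> R by rewrite -natrM ler_nat.
have g2' : N0%:R + 2 * D%:R <= N%:R + 1 :> R.
  by move: g2; rewrite -(ler_nat R) (natrD R N0) (natrM R 2) (natrD R N).
have g3' : 3 * N0%:R + 2 * D%:R <= 2 * N%:R + 3 :> R.
  by move: g3; rewrite -(ler_nat R) (natrD R (3 * N0)) (natrD R (2 * N)) !natrM.
have triv M' c : nrm (isum g M' c) ^+ 2 <= c%:R * c%:R.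
  by rewrite -expr2 ler_sqr ?nnegrE ?nrm_ge0// isum_le.
have [small|big] := lerP N%:R (cc * ell).
  have pX := hX p N pp N2 small.
  have ZZ : 1 <= Z b.
    rewrite -(powRr0 p%:R); apply: (pw_le pp).
    exact: (exp_total_ge0 lE k0 k2 m0 m2 ell0 D1' N01' g1' g2' g3' g5 LB1' LB2' (Bf0 b b0) (thE b)).
  apply: (le_trans (triv M b)); rewrite mulrCA ler_wpM2l//.
  apply: (@le_trans _ _ (X * 1)).
    by rewrite mulr1; apply: le_trans pX; rewrite -natrX ler_nat.
  have C2 := exprn_ge0 2 (ltW Cm0).
  apply: ler_pM; [by clear -X1; lra|exact: ler01|by clear -C2; lra|exact: ZZ].
have slN : slack k m * cc = 100 * slack k m / k + (2 * k + 1).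
  by rewrite /cc; field; rewrite !gt_eqF.
have kcc : k * cc = 100 + k * (2 * k + 1) / slack k m.
  by rewrite /cc; field; rewrite !gt_eqF.
have big1 : 100 * ell <= k * N%:R.
  have h1 : k * (cc * ell) <= k * N%:R by rewrite ler_wpM2l// ltW.
  have h2 : 0 <= k * (2 * k + 1) / slack k m * ell.
    by apply: mulr_ge0 ell0; apply: divr_ge0 (ltW sl0); apply: mulr_ge0; clear -k0; lra.
  by rewrite mulrA kcc in h1; clear -h1 h2; lra.
have big2 : (2 * k + 1) * ell <= slack k m * N%:R.
  have h1 : slack k m * (cc * ell) <= slack k m * N%:R by rewrite ler_wpM2l// ltW.
  have h2 : 0 <= 100 * slack k m / k * ell.
    by apply: mulr_ge0 ell0; apply: divr_ge0 (ltW k0); clear -sl0; lra.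
  by rewrite mulrA slN in h1; clear -h1 h2; lra.
suff rec c M' : (0 < c)%N -> (c <= p ^ N)%N -> nrm (isum g M' c) <= Cm * Num.sqrt (c%:R * Z c).
  have h := rec b M b0 bN.
  have bZ : 0 <= b%:R * Z b by rewrite mulr_ge0// ltW.
  apply: (@le_trans _ _ ((Cm * Num.sqrt (b%:R * Z b)) ^+ 2)).
    by rewrite ler_sqr ?nnegrE ?nrm_ge0// mulr_ge0 ?sqrtr_ge0// ltW.
  rewrite exprMn (sqr_sqrtr bZ); apply: (ler_wpM2r bZ); clear -X1; lra.
clear M b b0 bN.
elim/ltn_ind: c M' => b IH M b0 bN.
have bZ0 : 0 < b%:R * Z b by rewrite mulr_gt0// ltr0n.
have sbZ : 0 < Num.sqrt (b%:R * Z b) by rewrite sqrtr_gt0.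
have th0 : 0 <= th b.
  apply: (exp_ge0 lE k0 k2 m0 m2 ell0 D1' N01' g1' g2' g3' g5 LB1' LB2' (Bf0 b b0) (thE b)); clear -big1 ell0; lra.
have Z1 : 1 <= p%:R `^ th b :> R by rewrite -[leLHS](powRr0 p%:R); apply: (pw_le pp).
have pZ : p%:R `^ th b <= Z b by apply: (pw_le pp); rewrite lerDl.
(* Up to this length the trivial bound suffices; beyond it 2592 = 16 * 2 * 81 ensures 16 d <= b. *)
have [bs|bl] := lerP b%:R (2592%:R * p%:R `^ th b).
  have : nrm (isum g M b) ^+ 2 <= (Cm * Num.sqrt (b%:R * Z b)) ^+ 2.
    apply: (le_trans (triv M b)); rewrite exprMn (sqr_sqrtr (ltW bZ0)) mulrCA ler_wpM2l//.
    apply: (le_trans bs); apply: ler_pM; rewrite ?ler0n ?powR_ge0//.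
  by rewrite ler_sqr ?nnegrE ?nrm_ge0// mulr_ge0 ?ltW.
have thB : th b <= Bf b.
  apply: (pw_le_inv pp); rewrite -BfE//; apply: le_trans (ltW bl).
  by rewrite -[leLHS]mul1r; apply: ler_wpM2r; [exact: powR_ge0|rewrite ler1n].
have e81 : (p ^ chi0)%:R <= 81%:R * p%:R `^ th b :> R.
  case: hex => ex h81 hex; apply: (le_trans h81); rewrite ler_wpM2l//; apply: (pw_le pp).
  case: hex => [|hex]; first by move=> h; apply: le_trans h th0.
  exact: (exp_excess lE k0 k2 m0 m2 ell0 D1' N01' g1' g2' g3' g5 LB1' LB2' (Bf0 b b0) (thE b) big2 thB hex).
have exn : exists n : nat, th b <= n%:R + 1.
  by exists (Num.bound (th b)); apply/ltW/(lt_trans (archi_boundP th0)); rewrite ltrDl.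
case: (ex_minnP exn) => chi1 hchi1 chimin.
(* The order must reach th - 1 for the balance and chi0 for the condition on u. Shifts must also be
   even: for p = 2 the order is at least 1, for odd p the factor nu = 2 is used. *)
pose chi := maxn chi1 (maxn chi0 (p == 2%N)).
have chiP : (p ^ chi)%:R <= 81%:R * p%:R `^ th b :> R.
  have c1 : (p ^ chi1)%:R <= 81%:R * p%:R `^ th b :> R.
    rewrite natrX -pwn; apply: (@le_trans _ _ (1 * p%:R `^ th b)); last first.
      by rewrite ler_wpM2r ?powR_ge0// ler1n.
    rewrite mul1r; apply: (pw_le pp).
    clear chi hchi1; case: chi1 chimin => [//|n] chimin.
    rewrite leNgt; apply/negP => lt; have := chimin n; rewrite ltnn; apply/implyP.
    by rewrite natr1 ltW.
  have c2 : (p ^ (p == 2%N))%:R <= 81%:R * p%:R `^ th b :> R.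
    case: eqP => [e2|_]; last by rewrite expn0; clear -Z1; lra.
    have pE : p%:R = 2 :> R by rewrite e2.
    by rewrite expn1; clear -Z1 pE; lra.
  rewrite /chi; case: (leqP chi1) => _; last by [].
  by case: leqP.
pose nu := if p == 2%N then 1%N else 2%N.
have nu2 : (0 < nu <= 2)%N by rewrite /nu; case: eqP.
have nnu : ~~ (p %| nu)%N.
  rewrite /nu; case: (eqVneq p 2%N) => [->//|n2].
  by rewrite dvdn_prime2.
pose d := (p ^ chi * nu)%N.
have pc0 : (0 < p ^ chi)%N by rewrite expn_gt0 prime_gt0.
have d0' : (0 < d)%N by rewrite muln_gt0 pc0; case/andP: nu2.
have d2 : (d <= 2 * p ^ chi)%N by rewrite /d mulnC leq_mul2r; case/andP: nu2 => _ ->; rewrite orbT.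
pose H := (b %/ (16 * d))%N.
have b16 : (16 * d <= b)%N.
  rewrite -(ler_nat R); apply: le_trans (ltW bl).
  apply: (@le_trans _ _ (32%:R * (p ^ chi)%:R)).
    by rewrite -natrM ler_nat -[32%N]/(16 * 2)%N -mulnA leq_mul2l d2 orbT.
  have -> : 2592%:R * p%:R `^ th b = 32%:R * (81%:R * p%:R `^ th b) :> R by rewrite mulrA -natrM.
  by rewrite ler_wpM2l.
have H0 : (0 < H)%N by rewrite divn_gt0// muln_gt0.
have Hb : (H * (16 * d) <= b)%N by exact: leq_trunc_div.
have HbL : (b < (H + 1) * (16 * d))%N.
  by rewrite addn1 ltn_ceil// muln_gt0.
have HN : (p ^ chi * H < p ^ N)%N.
  apply: leq_trans bN; apply: leq_trans Hb; rewrite /d.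
  rewrite mulnC ltn_pmul2l//.
  have : (p ^ chi <= p ^ chi * nu)%N by rewrite leq_pmulr//; case/andP: nu2.
  by move: pc0; clear; lia.
have bH : (b <= 64 * (p ^ chi * H))%N.
  apply: ltnW; apply: (leq_trans HbL).
  have -> : (64 * (p ^ chi * H) = (2 * H) * (16 * (2 * p ^ chi)))%N by ring.
  by apply: leq_mul; [move: H0; clear; lia|rewrite leq_mul2l d2 orbT].
pose a : R := lg p 81%:R.
have a0 : 0 <= a by apply: lg_ge0; rewrite ?ler1n.
have aA : p%:R `^ a = 81%:R by rewrite pw_lg.
have cth : chi%:R <= th b + a.
  by apply: (pw_le_inv pp); rewrite (pwD pp) aA pwn -natrX mulrC.
have thc : th b <= chi%:R + 1.
  by apply: (le_trans hchi1); rewrite lerD2r ler_nat leq_maxl.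
have hd h M' : (0 < h)%N -> (h < H)%N ->
    (2 * b <= Yv p N D chi (logn p h))%N -> (p ^ N0 <= Yv p N D chi (logn p h))%N ->
    nrm (Wsum (dm (p ^ chi * nu * h)%N%:Z g) M' b) <= 2 * p%:R `^ (th b + ell).
  move=> h0 hH Y1 Y2; apply: Wsum_nrm_le => // M''.
  have lg' : logn p (p ^ chi * nu * h) = (chi + logn p h)%N.
    have nu0 : (0 < nu)%N by case/andP: nu2.
    by rewrite !lognM ?muln_gt0 ?pc0 ?nu0// pfactorK// (lognE p nu) (negbTE nnu) !andbF addn0.
  have v0 : (N0 <= N - D - (chi + logn p h))%N.
    by move: Y2; rewrite /Yv leq_exp2l ?prime_gt1.
  have := hdat (p ^ chi * nu * h)%N (2 * b)%N M''; rewrite lg'.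
  have od : ~~ odd (p ^ chi * nu * h).
    rewrite !oddM !negb_and /nu; case: (eqVneq p 2%N) => [e2|_]; last by rewrite orbT.
    by rewrite e2 oddX /= orbF orbF -lt0n /chi e2 !leq_max /= !orbT.
  move=> /(_ _ od _ _ _ Y1) hd; apply: (le_trans (hd _ _ _ _)).
  - by rewrite !muln_gt0 pc0 h0 andbT; case/andP: nu2.
  - by rewrite /chi; apply: leq_trans (leq_addr _ _); rewrite leq_max leq_maxl orbT.
  - by move: v0 N01; clear; lia.
  - by rewrite muln_gt0.
  pose c2 := lg p 2.
  have c20 : 0 <= c2 by apply: lg_ge0; rewrite ?ler1n.
  have E2 : (2 * b)%:R = p%:R `^ (Bf b + c2) :> R by rewrite (pwD pp) -BfE// pw_lg// mulrC natrM.
  have EY : (p ^ (N - D - (chi + logn p h)))%:R = p%:R `^ (N%:R - D%:R - (chi%:R + (logn p h)%:R)) :> R.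
    rewrite natrX -pwn; congr powR.
    have h1 : (chi + logn p h <= N - D)%N by move: v0 N01; clear; lia.
    have h2 : (D <= N)%N by move: g1; clear; lia.
    by rewrite (natrB _ h1) (natrB _ h2) natrD.
  rewrite E2 EY -pwN -(pwD pp) -!powRrM -LamE -!(pwD pp).
  have -> : 2 * p%:R `^ (th b + ell) = p%:R `^ (c2 + (th b + ell)) :> R by rewrite [RHS](pwD pp) (pw_lg pp).
  apply: (pw_le pp).
  (* The rounding of th to chi, paid by the summand k in [thE]. *)
  have kt : 0 <= k * (chi%:R + 1 - th b) by apply: mulr_ge0 (ltW k0) _; clear -thc; lra.
  have kv : 0 <= k * (logn p h)%:R by apply: mulr_ge0 => //; exact: ltW.
  have kc : 0 <= (1 - (l - k)) * c2 by apply: mulr_ge0 c20; clear -lE k0 m2; lra.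
  have := thE b; clear -kt kv kc; lra.
have A2 : 2 <= 81%:R :> R by rewrite ler_nat.
have step := step_bound pp D1 N01 g1 g2 g3 lE k0 k2 m0 m2 ell0 g5 LB1' LB2' (Bf0 b b0) (thE b)
  th0 thc cth a0 aA A2 big1 ug hC2 hC3 nnu b0 H0 HN (BfE b b0) bH hd M.
rewrite -/(Z b) in step.
have H0' : 0 < H%:R :> R by rewrite ltr0n.
have step' : nrm (\sum_(i < b) Tsum g d H (M + i%:Z)) / H%:R <= 9%:R * Kb R * Num.sqrt (b%:R * Z b).
  have n0 := nrm_ge0 (\sum_(i < b) Tsum g d H (M + i%:Z)).
  have r0 : 0 <= 9%:R * Kb R * Num.sqrt (b%:R * Z b) by apply: mulr_ge0 (ltW sbZ); clear -K1; lra.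
  rewrite ler_pdivrMr// -[leLHS]ger0_norm// -sqrtr_sqr; apply: sqrtr_le.
    by rewrite mulr_ge0.
  apply: (le_trans step); rewrite !exprMn (sqr_sqrtr (ltW bZ0)) le_eqVlt; apply/orP; left; apply/eqP.
  by ring.
apply: le_trans (@vdc_shift _ g d H b M (Cm / 4 * Num.sqrt (b%:R * Z b)) H0 _) _.
  move=> M' t td; have t16 : (16 * t <= b)%N.
    by apply: (leq_trans _ Hb); rewrite mulnCA leq_mul2l /= (leq_trans td)// mulnC.
  have [->|t0] := posnP t.
    rewrite /isum big_ord0 nrm0; apply: mulr_ge0 (ltW sbZ).
    by apply: divr_ge0 (ltW Cm0) _; exact: ler0n.
  have tb : (t < b)%N by move: t16 t0; clear; lia.
  have tN : (t <= p ^ N)%N by apply: leq_trans bN; exact: ltnW.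
  apply: (le_trans (IH t tb M' t0 tN)); rewrite -mulrA ler_wpM2l ?(ltW Cm0)//.
  apply: sqrtr_le; first by rewrite mulr_ge0 ?invr_ge0 ?sqrtr_ge0.
  have Zm : Z t <= Z b.
    apply: (pw_le pp); rewrite lerD2r /th ler_wpM2r ?invr_ge0 ?(ltW k1)// lerD2l; apply: ler_wpM2l; first by clear -lE k2 m0; lra.
    by rewrite ler_wpM2r ?invr_ge0 ?(ltW lp)// ler_ln ?posrE ?ltr0n// ler_nat ltnW.
  rewrite exprMn (sqr_sqrtr (ltW bZ0)).
  have h16 : 16 * t%:R <= b%:R :> R by rewrite -natrM ler_nat.
  have hh : 16 * t%:R * Z t <= b%:R * Z b by apply: ler_pM => //; exact: ltW.
  have -> : 4^-1 ^+ 2 * (b%:R * Z b) = (b%:R * Z b) / 16 :> R by field.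
  by rewrite ler_pdivlMr//; clear -hh; lra.
apply: (@le_trans _ _ (2 * (Cm / 4 * Num.sqrt (b%:R * Z b)) + 9%:R * Kb R * Num.sqrt (b%:R * Z b))).
  by rewrite lerD2l.
by rewrite /Cm le_eqVlt; apply/orP; left; apply/eqP; field.
Qed.

End MainBound.

(** * The p-adic numbers *)

Section FieldIdentities.
Variable F : fieldType.
Implicit Types (x y a b P Q u : F).

Lemma fid_unit x P u : P != 0 -> u != 0 -> x = P^-1 * (x * (P * u) / u).
Proof. by move=> P0 u0; field; rewrite P0 u0. Qed.

Lemma fid_approx a P u : P != 0 -> P^-1 * (a + P * u) - a / P = u.
Proof. by move=> P0; field. Qed.

Lemma fid_diff x a b P Q : P != 0 -> Q != 0 ->
  b * P - a * Q = P * Q * ((x - a / P) - (x - b / Q)).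
Proof. by move=> P0 Q0; field; rewrite P0 Q0. Qed.

Lemma fid_add x y a b P Q : P != 0 -> Q != 0 ->
  x + y - (a * Q + b * P) / (P * Q) = (x - a / P) + (y - b / Q).
Proof. by move=> P0 Q0; field; rewrite P0 Q0. Qed.

Lemma fid_opp x a P : - x - (- a) / P = - (x - a / P).
Proof. by rewrite mulNr opprB opprK addrC. Qed.

End FieldIdentities.

Section Padic.
Variables (p : nat) (pr : prime p).
Local Notation Zp := (padicZ pr).
Local Notation Qp := (padicQ pr).
Local Notation q n := ((p ^ n)%N%:Z).

Lemma q_neq0 n : q n != 0.
Proof. by rewrite eqz_nat expn_eq0 negb_and -lt0n prime_gt0. Qed.

Lemma intZp_add (a b : int) : intZp pr (a + b) = intZp pr a + intZp pr b.
Proof. by apply: padicZ_ext => n /=; rewrite modzDm. Qed.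

Lemma intZpE (m : int) : m%:~R = intZp pr m :> Zp.
Proof.
have nat_case (k : nat) : k%:R = intZp pr k%:Z :> Zp.
  elim: k => [|k IH]; first by apply: padicZ_ext.
  by rewrite -addn1 natrD IH PoszD intZp_add.
case: m => k; first exact: nat_case.
rewrite NegzE mulrNz -[_%:~R]/(k.+1%:R : Zp) nat_case.
by apply: padicZ_ext => n /=; rewrite modzNm.
Qed.

Lemma resid_le (x : Zp) n k : (n <= k)%N -> (resid x k %% q n)%Z = resid x n.
Proof. by move=> nk; rewrite -(subnKC nk) resid_add. Qed.

(** The n-th residue of the quotient is read off from the residue of x modulo p^(n+v). *)
Lemma dvdp_resid (x : Zp) v : resid x v = 0 -> exists u : Zp, x = (p ^ v)%N%:R * u.
Proof.
move=> xv; pose m n := (resid x (n + v)%N %/ q v)%Z.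
have dv n : (q v %| resid x (n + v)%N)%Z.
  by apply/dvdz_mod0P; rewrite (resid_le x (leq_addl n v)).
have mE n : resid x (n + v)%N = m n * q v by rewrite /m divzK.
have coh n : (m n = m n.+1 %[mod q n])%Z.
  apply/eqP; rewrite eqz_mod_dvd -(@dvdz_mul2r (q v)) ?q_neq0// mulrBl -!mE.
  rewrite -PoszM -expnD -eqz_mod_dvd addSn.
  by apply/eqP; exact: resid_step.
exists (mkZp pr coh); apply: padicZ_ext => n.
have -> : (p ^ v)%N%:R = intZp pr (q v) :> Zp by rewrite -intZpE.
rewrite /= modzMml modzMmr mulrC -mE.
by rewrite resid_add.
Qed.

(** Bezout gives an inverse modulo every p^n, and uniqueness of inverses makes them coherent. *)
Lemma unit_resid (x : Zp) : ~~ (p%:Z %| resid x 1)%Z -> x \is a GRing.unit.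
Proof.
move=> nx.
have cop n : coprimez (resid x n.+1) (q n.+1).
  rewrite coprimezE /=; apply: coprimeXr; rewrite coprime_sym prime_coprime//.
  apply: contra nx => d; rewrite -(@resid_le x 1 n.+1)// expn1.
  by apply/dvdz_mod0P; rewrite modz_mod; apply/dvdz_mod0P.
have inv n : exists u : int, (u * resid x n.+1 == 1 %[mod q n.+1])%Z.
  have /coprimezP[[u v] /= uv] := cop n.
  exists u; rewrite -uv eqz_mod_dvd.
  have -> : u * resid x n.+1 - (u * resid x n.+1 + v * q n.+1) = - v * q n.+1 by ring.
  by rewrite dvdz_mull.
pose u n := projT1 (cid (inv n)).
have uP n : (u n * resid x n.+1 = 1 %[mod q n.+1])%Z by apply/eqP/(projT2 (cid (inv n))).
(* Modulo p^0 = 1 any integer is an inverse, so the value at 0 is arbitrary. *)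
pose m n := if n is n'.+1 then u n' else u 0%N.
have mP n : (m n * resid x n = 1 %[mod q n])%Z.
  case: n => [|n]; first by rewrite expn0 !modz1.
  exact: uP.
have uniq n (a b : int) : (a * resid x n = 1 %[mod q n])%Z -> (b * resid x n = 1 %[mod q n])%Z ->
    (a = b %[mod q n])%Z.
  move=> ha hb; apply/eqP; rewrite eqz_mod_dvd.
  case: n ha hb => [|n] ha hb; first by rewrite expn0 dvd1z.
  rewrite -(@Gauss_dvdzl _ _ (resid x n.+1)); last by rewrite coprimez_sym.
  by rewrite mulrBl -eqz_mod_dvd ha hb.
have coh n : (m n = m n.+1 %[mod q n])%Z.
  apply: uniq; first exact: mP.
  rewrite residP -modzMmr modz_mod modzMmr.
  have := mP n.+1 => /(congr1 (fun z => (z %% q n)%Z)); by rewrite !modz_q.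
rewrite unfold_in; apply/asboolP; exists (mkZp pr coh).
by apply: padicZ_ext => n /=; rewrite modzMml mP.
Qed.

Lemma Zp_factor (x : Zp) : x != 0 -> exists (v : nat) (u : Zp),
  u \is a GRing.unit /\ x = p%:R ^+ v * u.
Proof.
move=> x0; have ex : exists n, resid x n != 0.
  apply: contrapT => /forallNP h; move/eqP: x0; apply.
  by apply: padicZ_ext => n /=; rewrite mod0z; apply/eqP/negPn/negP/h.
case: (ex_minnP ex) => -[|v] hv vmin.
  by move: hv; rewrite -(resid_mod x 0) expn0 modz1 eqxx.
have xv : resid x v = 0.
  by apply/eqP/negPn/negP => /vmin; rewrite ltnn.
have [u xE] := dvdp_resid xv; exists v, u; split; last by rewrite -natrX.
apply: unit_resid; apply: contra hv => du.
have -> : resid x v.+1 = resid ((p ^ v)%N%:R * u) v.+1 by rewrite -xE.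
have -> : (p ^ v)%N%:R = intZp pr (q v) :> Zp by rewrite -intZpE.
rewrite /= modzMml; apply/eqP/dvdz_mod0P; rewrite expnSr PoszM.
apply: dvdz_mul; first exact: dvdzz.
by apply/dvdz_mod0P; have /dvdz_mod0P := du; rewrite -(@resid_le u 1 v.+1)// expn1 modz_mod.
Qed.

Lemma int_unit (m : int) : ~~ (p%:Z %| m)%Z -> (m%:~R : Zp) \is a GRing.unit.
Proof.
move=> nm; apply: unit_resid; rewrite intZpE /= expn1; apply: contra nm => d.
by apply/dvdz_mod0P; have /dvdz_mod0P := d; rewrite modz_mod.
Qed.

Lemma int_dvd_Zp (m : int) n (z : Zp) : m%:~R = p%:R ^+ n * z -> (q n %| m)%Z.
Proof.
rewrite intZpE -natrX => /(congr1 (fun x : Zp => resid x n)).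
have -> : (p ^ n)%N%:R = intZp pr (q n) :> Zp by rewrite -intZpE.
by rewrite /= modzMml modzMr => /dvdz_mod0P.
Qed.

Lemma Zp_int_approx (z : Zp) n : exists (a : int) (u : Zp), z = a%:~R + p%:R ^+ n * u.
Proof.
have h : resid (z - intZp pr (resid z n)) n = 0.
  by rewrite /= modzDmr resid_mod subrr mod0z.
have [u hu] := dvdp_resid h; exists (resid z n), u.
by rewrite intZpE -natrX -hu addrC subrK.
Qed.

Lemma p_neq0 : (p%:R : Zp) != 0.
Proof.
apply/eqP => /(congr1 (fun x : Zp => resid x 2)).
have -> : p%:R = intZp pr p%:Z :> Zp by rewrite -intZpE.
rewrite /= mod0z modz_small.
  by move=> [e]; move: (prime_gt0 pr); rewrite e.
by rewrite lez_nat /= ltz_nat expnS expn1 ltn_Pmulr ?prime_gt1 ?prime_gt0.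
Qed.

Let pQ0 : (p%:R : Qp) != 0.
Proof. by rewrite -(rmorph_nat (@tofrac Zp)) tofrac_eq0 p_neq0. Qed.

Lemma pQ_neq0 : (p%:R : Qp) != 0. Proof. exact: pQ0. Qed.

Lemma natQ_neq0 (n : nat) : (0 < n)%N -> (n%:R : Qp) != 0.
Proof.
move=> n0; have [m cm ->] := pfactor_coprime pr n0.
rewrite natrM natrX; apply: mulf_neq0; last exact: expf_neq0.
rewrite -(rmorph_nat (@tofrac Zp)) tofrac_eq0; apply/eqP => h.
have : (m%:~R : Zp) \is a GRing.unit by rewrite int_unit// dvdzE /= -prime_coprime.
by rewrite -[m%:~R]/(m%:R : Zp) h unitr0.
Qed.

Lemma ratrE (x : rat) : (ratr x : Qp) = (numq x)%:~R / (denq x)%:~R.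
Proof. by []. Qed.

Lemma ord_ge0 N : ord_ge (0 : Qp) N.
Proof. by exists 0; rewrite rmorph0 mulr0. Qed.

Lemma ord_geD (x y : Qp) N : ord_ge x N -> ord_ge y N -> ord_ge (x + y) N.
Proof. by move=> [a ->] [b ->]; exists (a + b); rewrite rmorphD mulrDr. Qed.

Lemma ord_geN (x : Qp) N : ord_ge x N -> ord_ge (- x) N.
Proof. by move=> [a ->]; exists (- a); rewrite rmorphN mulrN. Qed.

Lemma ord_geB (x y : Qp) N : ord_ge x N -> ord_ge y N -> ord_ge (x - y) N.
Proof. by move=> hx /ord_geN; exact: ord_geD. Qed.

Lemma ord_geM (x y : Qp) N M : ord_ge x N -> ord_ge y M -> ord_ge (x * y) (N + M).
Proof.
move=> [a ->] [b ->]; exists (a * b); rewrite rmorphM expfzDr//.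
by rewrite mulrACA.
Qed.

Lemma ord_ge_sum (I : Type) (r : seq I) (P : pred I) (F : I -> Qp) N :
  (forall i, P i -> ord_ge (F i) N) -> ord_ge (\sum_(i <- r | P i) F i) N.
Proof.
by move=> h; elim/big_ind: _ => //; [exact: ord_ge0|move=> x y; exact: ord_geD].
Qed.

Lemma ord_geW (x : Qp) N M : M <= N -> ord_ge x N -> ord_ge x M.
Proof.
move=> MN [a ->]; have [k ->] : exists k : nat, N = M + k%:Z by exists `|N - M|%N; lia.
by exists (p%:R ^+ k * a); rewrite rmorphM rmorphXn /= rmorph_nat expfzDr// mulrA.
Qed.

Lemma ord_ge_pz (N : int) : ord_ge (p%:R ^ N : Qp) N.
Proof. by exists 1; rewrite rmorph1 mulr1. Qed.

Lemma ord_ge_Zp (a : Zp) : ord_ge (tofrac a) 0.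
Proof. by exists a; rewrite expr0z mul1r. Qed.

Lemma ord_ge_int (m : int) : ord_ge (m%:~R : Qp) 0.
Proof. by rewrite -(rmorph_int (@tofrac Zp)); exact: ord_ge_Zp. Qed.

Lemma ord_ge_nat (m : nat) : ord_ge (m%:R : Qp) 0.
Proof. exact: (ord_ge_int m%:Z). Qed.

Lemma ord_geX (x : Qp) N k : ord_ge x N -> ord_ge (x ^+ k) (k%:Z * N).
Proof.
move=> hx; elim: k => [|k IH]; first by rewrite mul0r expr0; exact: (ord_ge_nat 1).
by rewrite exprS intS mulrDl mul1r; exact: ord_geM.
Qed.

Lemma ord_ge_mulz (x : Qp) N M : ord_ge (p%:R ^ M * x) N <-> ord_ge x (N - M).
Proof.
split=> [h|h].
  have := ord_geM (ord_ge_pz (- M)) h; rewrite mulrA -expfzDr// addNr expr0z mul1r.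
  by rewrite addrC.
by have := ord_geM (ord_ge_pz M) h; rewrite addrC subrK.
Qed.

Lemma tofracV (u : Zp) : u \is a GRing.unit -> (tofrac u)^-1 = tofrac u^-1 :> Qp.
Proof.
move=> uu; have u0 : tofrac u != 0 by rewrite tofrac_eq0; apply: contraTneq uu => ->; rewrite unitr0.
by apply: (mulfI u0); rewrite divff// -rmorphM divrr// rmorph1.
Qed.

Lemma ord_ge_unitV (m : int) : ~~ (p%:Z %| m)%Z -> ord_ge ((m%:~R : Qp)^-1) 0.
Proof.
move=> /int_unit um; rewrite -(rmorph_int (@tofrac Zp)) tofracV//; exact: ord_ge_Zp.
Qed.

Lemma ord_ge_natV (n : nat) : (0 < n)%N -> ord_ge ((n%:R : Qp)^-1) (- (logn p n)%:Z).
Proof.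
move=> n0; have [m cm nE] := pfactor_coprime pr n0.
rewrite {1}nE natrM natrX invfM -[X in ord_ge _ X]add0r; apply: ord_geM.
  by apply: (ord_ge_unitV (m := m%:Z)); rewrite dvdzE /= -prime_coprime.
by rewrite exprnN; exact: ord_ge_pz.
Qed.

Lemma frac_numden (A : idomainType) (x : {fraction A}) :
  exists a b : A, b != 0 /\ x * tofrac b = tofrac a.
Proof.
elim/quotW: x => x; exists (frac x).1, (frac x).2; split; first exact: denom_ratioP.
unlock tofrac; rewrite -[LHS]FracField.pi_mul; apply/eqmodP => /=.
rewrite FracField.equivfE /FracField.mulf !numden_Ratio ?oner_neq0 ?mulf_neq0 ?denom_ratioP ?oner_eq0//.
by rewrite !mulr1 mulrC.
Qed.

Lemma Qp_decomp (x : Qp) : exists (N : nat) (z : Zp), x = p%:R ^- N * tofrac z.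
Proof.
have [a [b [b0 ab]]] := frac_numden x; have [v [u [uu bE]]] := Zp_factor b0.
have u0 : tofrac u != 0 :> Qp.
  by rewrite tofrac_eq0; apply: contraTneq uu => ->; rewrite unitr0.
exists v, (a * u^-1); rewrite tofracM -(tofracV uu) -ab bE tofracM tofracXn rmorph_nat.
by apply: fid_unit; rewrite ?expf_neq0 ?pQ_neq0.
Qed.

Lemma ord_ge_ex (x : Qp) : exists N : nat, ord_ge x (- N%:Z).
Proof. by have [N [z ->]] := Qp_decomp x; exists N, z; rewrite exprnN. Qed.

Lemma is_ZpE (x : Qp) : is_Zp x <-> ord_ge x 0.
Proof. by split=> -[a ->]; exists a; rewrite expr0z mul1r. Qed.

Lemma Qp_approx (x : Qp) : exists (a : int) (N : nat), ord_ge (x - a%:~R / p%:R ^+ N) 0.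
Proof.
have [N [z ->]] := Qp_decomp x; have [a [u ->]] := Zp_int_approx z N.
exists a, N; rewrite rmorphD rmorphM rmorphXn /= rmorph_nat rmorph_int.
have -> : p%:R ^- N * (a%:~R + p%:R ^+ N * tofrac u) - a%:~R / p%:R ^+ N = tofrac u :> Qp.
  by rewrite fid_approx// expf_neq0// pQ_neq0.
exact: ord_ge_Zp.
Qed.

Lemma ord_ge_int_dvd (m : int) (n : nat) : ord_ge (m%:~R : Qp) n%:Z -> (q n %| m)%Z.
Proof.
move=> [z hz]; apply: (@int_dvd_Zp _ _ z); apply/eqP; rewrite -tofrac_eq.
by rewrite rmorph_int rmorphM rmorphXn /= rmorph_nat hz -exprnP.
Qed.

Section Character.
Variable R : realType.
Local Notation C := (R[i]).

(** [e_padic] is defined through a choice of a / p^N. Two such approximations of x differ by an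
    element of Z[1/p] that lies in Z_p, hence by an integer. *)
Lemma e_padicE (x : Qp) (a : int) (N : nat) : ord_ge (x - a%:~R / p%:R ^+ N) 0 ->
  e_padic R x = ez R (p ^ N) a.
Proof.
move=> hx; rewrite /e_padic; set S := [set z | _]%classic.
have ex : exists z, S z.
  by exists (e (a%:~R / p%:R ^+ N)), a, N; split=> //; apply/is_ZpE.
have [a' [N' [/is_ZpE hx' ->]]] := xgetPex 0 ex.
rewrite -[e (a'%:~R / _)]/(e (a'%:~R / p%:R ^+ N' : R)) /ez natrX.
have pR0 : p%:R != 0 :> R by rewrite pnatr_eq0 -lt0n prime_gt0.
have : ord_ge ((a' * (p ^ N)%N%:Z - a * (p ^ N')%N%:Z)%:~R : Qp) (N + N')%N%:Z.
  have -> : (a' * (p ^ N)%N%:Z - a * (p ^ N')%N%:Z)%:~R =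
     p%:R ^ (N + N')%N%:Z * ((x - a%:~R / p%:R ^+ N) - (x - a'%:~R / p%:R ^+ N')) :> Qp.
    rewrite -exprnP rmorphB !rmorphM /= -!pmulrn !natrX exprD.
    by apply: fid_diff; rewrite expf_neq0// pQ_neq0.
  by apply/ord_ge_mulz; rewrite subrr; exact: ord_geB.
move=> /ord_ge_int_dvd/dvdzP[k hk].
have -> : a'%:~R / p%:R ^+ N' = a%:~R / p%:R ^+ N + k%:~R :> R.
  have := congr1 (fun z : int => z%:~R : R) hk.
  rewrite rmorphB !rmorphM /= -!pmulrn !natrX exprD => h.
  have pN n : p%:R ^+ n != 0 :> R by rewrite expf_neq0.
  apply: (mulIf (pN N)); apply: (mulIf (pN N')).
  have -> : a'%:~R / p%:R ^+ N' * p%:R ^+ N * p%:R ^+ N' = a'%:~R * p%:R ^+ N :> R by field; rewrite ?pN.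
  have -> : (a%:~R / p%:R ^+ N + k%:~R) * p%:R ^+ N * p%:R ^+ N' = a%:~R * p%:R ^+ N' + k%:~R * (p%:R ^+ N * p%:R ^+ N') :> R.
    by field; rewrite ?pN.
  by rewrite -h; ring.
by rewrite eD e_int mulr1.
Qed.

Lemma e_padicD (x y : Qp) : e_padic R (x + y) = e_padic R x * e_padic R y.
Proof.
have [a [N ha]] := Qp_approx x; have [b [M hb]] := Qp_approx y.
rewrite (e_padicE ha) (e_padicE hb).
have -> : ez R (p ^ N) a = ez R (p ^ (N + M)) (a * (p ^ M)%N%:Z).
  by rewrite expnD mulnC mulrC ez_scale ?expn_gt0 ?prime_gt0.
have -> : ez R (p ^ M) b = ez R (p ^ (N + M)) (b * (p ^ N)%N%:Z).
  by rewrite expnD mulrC ez_scale ?expn_gt0 ?prime_gt0.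
rewrite -ezD; apply: e_padicE.
have -> : x + y - (a * (p ^ M)%N%:Z + b * (p ^ N)%N%:Z)%:~R / p%:R ^+ (N + M) =
    (x - a%:~R / p%:R ^+ N) + (y - b%:~R / p%:R ^+ M) :> Qp.
  rewrite rmorphD !rmorphM /= -!pmulrn !natrX exprD.
  by apply: fid_add; rewrite expf_neq0// pQ_neq0.
exact: ord_geD.
Qed.

Lemma e_padic_ez (a : int) (N : nat) : e_padic R (a%:~R / p%:R ^+ N : Qp) = ez R (p ^ N) a.
Proof. by apply: e_padicE; rewrite subrr; exact: ord_ge0. Qed.

Lemma e_padic_Zp (x : Qp) : ord_ge x 0 -> e_padic R x = 1.
Proof.
move=> hx; rewrite (@e_padicE x 0 0) ?ez0//.
by rewrite mul0r subr0.
Qed.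

Lemma nrm_e_padic (x : Qp) : nrm (e_padic R x) = 1.
Proof. by have [a [N ha]] := Qp_approx x; rewrite (e_padicE ha) nrm_ez. Qed.

Lemma e_padicN (x : Qp) : e_padic R (- x) = (e_padic R x)^*%C.
Proof.
have [a [N ha]] := Qp_approx x; rewrite (e_padicE ha) -ezN; apply: e_padicE.
have -> : - x - (- a)%:~R / p%:R ^+ N = - (x - a%:~R / p%:R ^+ N) :> Qp.
  by rewrite rmorphN fid_opp.
exact: ord_geN.
Qed.

Lemma e_padic_cong (x y : Qp) : ord_ge (x - y) 0 -> e_padic R x = e_padic R y.
Proof. by move=> h; rewrite -(subrK y x) e_padicD (e_padic_Zp h) mul1r. Qed.

End Character.

(** The limit consists of the residues modulo p^n at which the sequence stabilizes. *)
Lemma Zp_complete (s : nat -> Zp) :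
  (forall n, exists K, forall k, (K <= k)%N -> exists u : Zp, s k - s K = p%:R ^+ n * u) ->
  exists v : Zp, forall n, exists K, forall k, (K <= k)%N -> exists u : Zp, v - s k = p%:R ^+ n * u.
Proof.
move=> hs; pose K n := projT1 (cid (hs n)).
have KP n k : (K n <= k)%N -> resid (s k) n = resid (s (K n)) n.
  move=> hk; have [u hu] := projT2 (cid (hs n)) k hk.
  have -> : s k = s (K n) + p%:R ^+ n * u by rewrite -hu addrC subrK.
  rewrite -natrX; have -> : (p ^ n)%N%:R = intZp pr (q n) :> Zp by rewrite -intZpE.
  by rewrite /= modzz mul0r mod0z addr0 resid_mod.
have coh n : (resid (s (K n)) n = resid (s (K n.+1)) n.+1 %[mod q n])%Z.
  rewrite resid_mod; have h := KP n (maxn (K n) (K n.+1)) (leq_maxl _ _).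
  rewrite -h -(KP n.+1 _ (leq_maxr (K n) (K n.+1))) resid_le//.
exists (mkZp pr coh) => n; exists (K n) => k hk.
have : resid (mkZp pr coh - s k) n = 0.
  by rewrite /= modzDmr (KP n k hk) resid_mod subrr mod0z.
by move=> /dvdp_resid[u hu]; exists u; rewrite hu natrX.
Qed.

Definition psum (f : nat -> Qp) (t : Qp) (K : nat) : Qp := \sum_(k < K) f k * t ^+ k.

Lemma QpI0_tends (f : nat -> Qp) : QpI0 f -> tends_to0 f.
Proof.
move=> [c [c0 [a [Ia fE]]]] N; have [M hM] := ord_ge_ex c.
have [K hK] := Ia (N + M%:Z); exists K => k kK; rewrite fE.
apply: ord_geW (ord_geM hM (hK k kK)); lia.
Qed.

(** Only finitely many coefficients lie outside Z_p, so there is a common denominator. *)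
Lemma tends_QpI0 (f : nat -> Qp) : tends_to0 f -> QpI0 f.
Proof.
move=> hf; have [K hK] := hf 0.
have [M hM] : exists M : nat, forall k, (k < K)%N -> ord_ge (f k) (- M%:Z).
  elim: K {hK} => [|K [M hM]]; first by exists 0%N.
  have [M' hM'] := ord_ge_ex (f K); exists (M + M')%N => k; rewrite ltnS leq_eqVlt => /orP[/eqP ->|kK].
    by apply: ord_geW hM'; lia.
  by apply: ord_geW (hM k kK); lia.
have all k : ord_ge (f k) (- M%:Z).
  have [kK|Kk] := ltnP k K; first exact: hM.
  by apply: ord_geW (hK k Kk); lia.
pose a k := projT1 (cid (all k)).
have aE k : f k = p%:R ^ (- M%:Z) * tofrac (a k) := projT2 (cid (all k)).
exists (p%:R ^ (- M%:Z)); split; first by rewrite expfz_neq0// pQ_neq0.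
exists a; split=> // N; have [K' hK'] := hf (N - M%:Z); exists K' => k kK.
by have := hK' k kK; rewrite aE => /ord_ge_mulz; rewrite opprK subrK.
Qed.

Lemma psum_cong (f : nat -> Qp) (t : int) (N : int) (K K' : nat) :
  (forall k, (K <= k)%N -> ord_ge (f k) N) -> (K <= K')%N ->
  ord_ge (psum f t%:~R K' - psum f t%:~R K) N.
Proof.
move=> hK KK; rewrite /psum -(subnKC KK) big_split_ord /= addrAC subrr add0r.
apply: ord_ge_sum => i _; rewrite -[N]addr0; apply: ord_geM; first by apply: hK; rewrite leq_addr.
by rewrite -[0](mulr0 (K + i)%N%:Z); apply: ord_geX; exact: ord_ge_int.
Qed.

Lemma pseries_evalP (f : nat -> Qp) (t : int) (N : int) (K : nat) :
  QpI0 f -> (forall k, (K <= k)%N -> ord_ge (f k) N) ->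
  ord_ge (pseries_eval f t%:~R - psum f t%:~R K) N.
Proof.
move=> If hK; have fT := QpI0_tends If.
have ex : exists v, [set v | tends_to0 (fun K => v - psum f t%:~R K)]%classic v.
  case: If => c [c0 [a [Ia fE]]].
  pose s n : Zp := \sum_(k < n) a k * t%:~R ^+ k.
  have sE n : psum f t%:~R n = c * tofrac (s n).
    rewrite /psum /s rmorph_sum mulr_sumr; apply: eq_bigr => k _.
    by rewrite fE rmorphM rmorphXn /= rmorph_int mulrA.
  have [n|v hv] := @Zp_complete s.
    have [L hL] := Ia n%:Z; exists L => k Lk.
    have hc : ord_ge (tofrac (s k - s L) : Qp) n%:Z.
      rewrite rmorphB; have : ord_ge (psum (fun k => tofrac (a k)) t%:~R k - psum (fun k => tofrac (a k)) t%:~R L) n%:Z.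
        exact: psum_cong.
      congr ord_ge; rewrite /psum /s !rmorph_sum; congr (_ - _); apply: eq_bigr => j _;
        by rewrite rmorphM rmorphXn /= rmorph_int.
    case: hc => u hu; exists u; apply/eqP; rewrite -tofrac_eq hu rmorphM rmorphXn /= rmorph_nat.
    by rewrite -exprnP.
  exists (c * tofrac v) => M /=; have [L hL] := ord_ge_ex c.
  have [K' hK'] := hv `|(M + L%:Z)%R|%N; exists K' => k kk; rewrite sE -mulrBr -rmorphB.
  have [u ->] := hK' k kk; rewrite rmorphM rmorphXn /= rmorph_nat exprnP mulrCA.
  apply/ord_ge_mulz; rewrite -[_ - _]addr0; apply: ord_geM; last exact: ord_ge_Zp.
  apply: ord_geW hL; lia.
have := xgetPex 0 ex; rewrite -/(pseries_eval f t%:~R) /= => lim.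
have [K' hK'] := lim N.
have -> : pseries_eval f t%:~R - psum f t%:~R K =
   (pseries_eval f t%:~R - psum f t%:~R (maxn K K')) + (psum f t%:~R (maxn K K') - psum f t%:~R K) by rewrite addrA subrK.
apply: ord_geD; first by apply: hK'; exact: leq_maxr.
by apply: psum_cong => //; exact: leq_maxl.
Qed.

End Padic.

(** * Differences of power series *)

(** Legendre's formula with a telescoping bound; the last quotient n / p^K, positive for K =
    [trunc_log p n], accounts for n - 1 instead of n. *)
Lemma logn_fact_le (p n : nat) : prime p -> (0 < n)%N ->
  (logn p n`! * p.-1 <= n.-1)%N.
Proof.
move=> pp n0; have p1 := prime_gt1 pp; have p0 := prime_gt0 pp.
have tel K : ((\sum_(1 <= k < K.+1) n %/ p ^ k) * p.-1 + n %/ p ^ K <= n)%N.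
  elim: K => [|K IH]; first by rewrite big_geq// mul0n expn0 divn1.
  rewrite big_nat_recr//= mulnDl -addnA; apply: leq_trans IH; rewrite leq_add2l.
  have h : (n %/ p ^ K.+1 * p <= n %/ p ^ K)%N by rewrite expnSr divnMA leq_trunc_div.
  by apply: leq_trans h; rewrite -[X in (_ <= _ * X)%N](prednK p0) mulnS addnC.
rewrite logn_fact//; set K := trunc_log p n.
have Kn : (K.+1 <= n.+1)%N.
  by rewrite ltnS ltnW//; apply: leq_trans (ltn_expl K p1) (trunc_logP p1 n0).
rewrite (big_cat_nat _ Kn)//= [X in ((_ + X) * _)%N]big1_seq ?addn0; last first.
  move=> k /andP[_]; rewrite mem_index_iota => /andP[Kk _].
  apply: divn_small; apply: leq_trans (trunc_log_ltn n p1) _.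
  by rewrite leq_exp2l.
have := tel K; have : (0 < n %/ p ^ K)%N by rewrite divn_gt0 ?expn_gt0 ?p0// trunc_logP.
by clear; lia.
Qed.

Lemma fid_final (G : fieldType) (c P Q t h q z : G) : P != 0 -> Q != 0 ->
  c * (P * (h + q * (t + Q * z))) / (P * Q) - c * (h + q * t) / Q = c * q * z.
Proof. by move=> P0 Q0; field; rewrite P0 Q0. Qed.

(* Differencing divides coefficients by factorials; this is the growth of the
   order of k! a_k that compensates for it. *)
Definition slope_floor (p k : nat) : nat := if k == 0%N then 0%N else (k %/ p.-1).+1.

Lemma logn_fact_div (p n : nat) : prime p -> (0 < n)%N ->
  (logn p n`! <= n.-1 %/ p.-1)%N.
Proof.
move=> pp n0; rewrite leq_divRL; first exact: logn_fact_le.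
by have := prime_gt1 pp; case: p {pp} => [|[]].
Qed.

Section Phase.
Variables (p : nat) (pr : prime p).
Local Notation Zp := (padicZ pr).
Local Notation Qp := (padicQ pr).
Local Notation F := (slope_floor p).

Lemma ord_ge_factV (n : nat) : (0 < n)%N -> ord_ge ((n`!%:R : Qp)^-1) (- (n.-1 %/ p.-1)%N%:Z).
Proof.
move=> n0; apply: ord_geW (ord_ge_natV pr (fact_gt0 n)).
by rewrite lerN2 lez_nat logn_fact_div.
Qed.

(** The j-th Taylor term loses the order of j!, at most (j - 1)/(p - 1). The maximum with 1 keeps
    the terms j >= 2 at k = 0 from disturbing the leading coefficient. *)
Lemma slope_step (k j : nat) : (0 < j)%N -> (0 < k)%N || (1 < j)%N ->
  (maxn 1 (F k) + j.-1 %/ p.-1 <= F (k + j.-1))%N.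
Proof.
rewrite /slope_floor => j0 kj; have [k0'|k0] := posnP k.
  rewrite k0' /= add0n ifN ?maxn0; first by rewrite add1n.
  by move: kj; rewrite k0' /=; case: (j) j0 => [|[|]].
case: eqP => [|_]; first by lia.
rewrite (maxn_idPr _)// addSn ltnS.
have p1 : (0 < p.-1)%N by have := prime_gt1 pr; case: (p) => [|[]].
by rewrite divnD// leq_addr.
Qed.

(** A lower bound for the orders of the derivatives of P at 0 from the i-th on. *)
Definition Good (P : {poly Qp}) (i : nat) (A : int) :=
  forall k, ord_ge ((i + k)`!%:R * P`_(i + k)) (A + (F k)%:Z).

(** The divided difference (P(x + a) - P(x)) / a, as a polynomial in x. *)
Definition Dp (a : int) (P : {poly Qp}) : {poly Qp} :=
  \sum_(1 <= j < size P) (a%:~R ^+ j.-1) *: P^`N(j).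

Lemma DpE a P (x : Qp) : P.[x + a%:~R] - P.[x] = a%:~R * (Dp a P).[x].
Proof.
have [->|P0] := eqVneq P 0.
  by rewrite /Dp size_poly0 big_geq// !horner0 subrr mulr0.
have sP : (0 < size P)%N by rewrite size_poly_gt0.
rewrite (nderiv_taylor _ (mulrC _ _)) -(big_mkord xpredT (fun i => P^`N(i).[x] * a%:~R ^+ i)).
rewrite big_ltn// nderivn0 expr0 mulr1 addrAC subrr add0r.
rewrite /Dp horner_sum mulr_sumr; apply: eq_big_nat => j /andP[j1 _].
by rewrite hornerZ mulrA -exprS prednK// mulrC.
Qed.

Lemma Dp_coef a P i : (Dp a P)`_i =
  \sum_(1 <= j < size P) a%:~R ^+ j.-1 * (P`_(i + j) * 'C(i + j, j)%:R).
Proof.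
rewrite /Dp coef_sum; apply: eq_bigr => j _.
by rewrite coefZ coef_nderivn mulr_natr addnC.
Qed.

(** Each divided difference lowers i by one and keeps A, so that i steps lead to a polynomial that
    is constant at integers modulo p^(A+1). *)
Lemma Good_Dp a P i A : Good P i.+1 A -> Good (Dp a P) i A /\
  ord_ge (i`!%:R * (Dp a P)`_i - i.+1`!%:R * P`_i.+1) (A + 1).
Proof.
move=> hG.
have term k j : (0 < j)%N -> (0 < k)%N || (1 < j)%N ->
    ord_ge ((i + k)`!%:R * (a%:~R ^+ j.-1 * (P`_(i + k + j) * 'C(i + k + j, j)%:R))) (A + (maxn 1 (F k))%:Z).
  move=> j0 kj; have ej : (i + k + j = i.+1 + (k + j.-1))%N by lia.
  have -> : (i + k)`!%:R * (a%:~R ^+ j.-1 * (P`_(i + k + j) * 'C(i + k + j, j)%:R)) =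
     a%:~R ^+ j.-1 * (((i.+1 + (k + j.-1))`!%:R * P`_(i.+1 + (k + j.-1))) * (j`!%:R)^-1) :> Qp.
    rewrite -ej; have cf : ('C(i + k + j, j)%:R * (i + k)`!%:R : Qp) = (i + k + j)`!%:R / j`!%:R.
      apply: (mulIf (natQ_neq0 pr (fact_gt0 j))); rewrite divfK ?natQ_neq0 ?fact_gt0//.
      rewrite -!natrM -(@bin_fact (i + k + j) j) ?leq_addl// addnK.
      by congr _%:R; rewrite -mulnA [(j`! * _)%N]mulnC.
    rewrite mulrCA; congr (_ * _); rewrite mulrCA [X in _ * X]mulrC cf.
    by rewrite mulrCA mulrA.
  rewrite -[_ + _]add0r; apply: ord_geM.
    by rewrite -[0](mulr0 j.-1%:Z); apply: ord_geX; exact: ord_ge_int.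
  apply: ord_geW (ord_geM (hG (k + j.-1)%N) (ord_ge_factV j0)).
  have := slope_step j0 kj; lia.
have lead : ord_ge (i`!%:R * (Dp a P)`_i - i.+1`!%:R * P`_i.+1) (A + 1).
  rewrite Dp_coef; have [s1|s1] := leqP (size P) 1.
    rewrite big_geq//; have -> : P`_i.+1 = 0 by rewrite nth_default//; apply: leq_trans s1 _.
    by rewrite !mulr0 subrr; exact: ord_ge0.
  rewrite big_ltn// mulrDr expr0 mul1r addn1 bin1.
  have -> : i`!%:R * (P`_i.+1 * i.+1%:R) = i.+1`!%:R * P`_i.+1 :> Qp.
    by rewrite mulrCA -natrM mulnC -factS mulrC.
  rewrite addrAC subrr add0r mulr_sumr big_nat; apply: ord_ge_sum => j /andP[j2 _].
  have := @term 0%N j (ltnW j2); rewrite j2 addn0 => /(_ isT).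
  by rewrite /slope_floor /=.
split=> // k; have [->|k0] := posnP k.
  rewrite addn0 -[X in ord_ge X](subrK (i.+1`!%:R * P`_i.+1)); apply: ord_geD.
    by apply: ord_geW lead; rewrite /slope_floor /=; lia.
  by have := hG 0%N; rewrite addn0.
rewrite Dp_coef mulr_sumr big_nat; apply: ord_ge_sum => j /andP[j1 _].
have := @term k j j1; rewrite k0 => /(_ isT); apply: ord_geW; lia.
Qed.

Lemma Good0_eval (Q : {poly Qp}) (A : int) (m : int) : Good Q 0 A ->
  ord_ge (Q.[m%:~R] - Q`_0) (A + 1).
Proof.
move=> hG; rewrite horner_coef; have [->|Q0] := eqVneq Q 0.
  by rewrite size_poly0 big_ord0 coef0 subrr; exact: ord_ge0.
have sP : (0 < size Q)%N by rewrite size_poly_gt0.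
rewrite -(big_mkord xpredT (fun i => Q`_i * m%:~R ^+ i)) big_ltn// expr0 mulr1 addrAC subrr add0r.
rewrite big_nat; apply: ord_ge_sum => k /andP[k1 _].
rewrite -[_ + _]addr0; apply: ord_geM; last first.
  by rewrite -[0](mulr0 k%:Z); apply: ord_geX; exact: ord_ge_int.
have := ord_geM (hG k) (ord_ge_factV k1).
rewrite add0n mulrAC divff ?natQ_neq0 ?fact_gt0// mul1r; apply: ord_geW.
rewrite /slope_floor gtn_eqF//.
have : (k.-1 %/ p.-1 <= k %/ p.-1)%N by rewrite leq_div2r// leq_pred.
lia.
Qed.

Section PhaseC.
Variable R : realType.
Local Notation C := (R[i]).

Lemma dm_poly (c a : int) (n : nat) (Q : {poly Qp}) (m : int) :
  dm a (fun m => e_padic R (c%:~R * Q.[m%:~R] / p%:R ^+ n)) m =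
  e_padic R ((c * a)%:~R * (Dp a Q).[m%:~R] / p%:R ^+ n).
Proof.
rewrite /dm -e_padicN -e_padicD; congr (e_padic R _).
by rewrite rmorphD /= -mulrBl -mulrBr DpE rmorphM /= mulrA.
Qed.

Lemma phase_final (Q : {poly Qp}) (A : int) (N n : nat) (th : Zp) :
  n%:Z = A + N%:Z -> Good Q 0 A -> th \is a GRing.unit ->
  ord_ge (Q`_0 - p%:R ^ A * tofrac th) (A + 1) ->
  forall th0 (u : Zp), th = th0%:~R + p%:R * u ->
  forall c m, exists t : int,
  e_padic R (c%:~R * Q.[m%:~R] / p%:R ^+ n) = ez R (p ^ N) (c * (th0 + p%:Z * t)).
Proof.
move=> nE hG uth hQ0 th0 u thE c m.
have h1 := ord_geD (Good0_eval m hG) hQ0; rewrite addrA subrK in h1.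
have [z hz] := h1.
have [t [z' zE]] := Zp_int_approx (u + z) N.
exists t; apply: e_padicE.
have pQ := pQ_neq0 pr.
have QE : Q.[m%:~R] = p%:R ^ A * (th0%:~R + p%:R * (t%:~R + p%:R ^+ N * tofrac z')).
  have -> : Q.[m%:~R] = p%:R ^ A * tofrac th + p%:R ^ (A + 1) * tofrac z.
    by rewrite -hz [RHS]addrC subrK.
  rewrite expfzDr// expr1z thE rmorphD rmorphM /= rmorph_nat rmorph_int -mulrA -mulrDr -addrA -mulrDr.
  by rewrite -rmorphD zE rmorphD rmorphM rmorphXn /= rmorph_nat rmorph_int.
have pn : p%:R ^+ n = p%:R ^ A * p%:R ^+ N :> Qp by rewrite !exprnP nE expfzDr.
rewrite QE pn rmorphM rmorphD rmorphM /= -!pmulrn.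
have pA : p%:R ^ A != 0 :> Qp by rewrite expfz_neq0.
have pN : p%:R ^+ N != 0 :> Qp by rewrite expf_neq0.
have -> : c%:~R * (p%:R ^ A * (th0%:~R + p%:R * (t%:~R + p%:R ^+ N * tofrac z'))) / (p%:R ^ A * p%:R ^+ N)
  - c%:~R * (th0%:~R + p%:R * t%:~R) / p%:R ^+ N = c%:~R * p%:R * tofrac z' :> Qp.
  exact: fid_final.
rewrite -[0]addr0; apply: ord_geM; last exact: ord_ge_Zp.
by rewrite -[0]addr0; apply: ord_geM; [exact: ord_ge_int|exact: ord_ge_nat].
Qed.

Definition phase (f : nat -> Qp) (n : nat) (m : int) : C :=
  e_padic R (pseries_eval f m%:~R / p%:R ^+ n).

Lemma phase_uni f n : uni (phase f n).
Proof. by move=> m; exact: nrm_e_padic. Qed.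

Lemma Good_trunc (f : nat -> Qp) K i A :
  (forall k, ord_ge ((i + k)`!%:R * f (i + k)%N) (A + (F k)%:Z)) ->
  Good (\poly_(k < K) f k) i A.
Proof.
move=> hf k; rewrite coef_poly; case: ifP => _; first exact: hf.
by rewrite mulr0; exact: ord_ge0.
Qed.

Lemma lead_trunc (f : nat -> Qp) (K i : nat) (n : nat) A (x : Qp) : (i < K)%N ->
  ord_ge (i`!%:R * f i - x) A -> ord_ge (i`!%:R * (\poly_(k < K) f k)`_i - x) A.
Proof. by move=> iK; rewrite coef_poly iK. Qed.

(** Modulo p^n the series is a polynomial at integers; K0 keeps the leading coefficient inside the
    truncation. *)
Lemma phase_poly_big f n K0 : QpI0 f -> exists2 K, (K0 <= K)%N & forall m,
  phase f n m = e_padic R (1%:~R * (\poly_(k < K) f k).[m%:~R] / p%:R ^+ n).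
Proof.
move=> If; have [K hK] := QpI0_tends If n%:Z; exists (maxn K0 K) => [|m]; first exact: leq_maxl.
apply: e_padic_cong; rewrite mul1r -mulrBl.
have hK' k : (maxn K0 K <= k)%N -> ord_ge (f k) n%:Z.
  by rewrite geq_max => /andP[_]; exact: hK.
have := pseries_evalP m If hK'.
rewrite horner_poly -/(psum f m%:~R (maxn K0 K)) => h.
by have := ord_geM h (ord_ge_pz pr (- n%:Z)); rewrite subrr -exprnN.
Qed.

Lemma unit_th0 (th : Zp) (th0 : int) (u : Zp) : th \is a GRing.unit ->
  th = th0%:~R + p%:R * u -> ~~ (p%:Z %| th0)%Z.
Proof.
move=> uth thE; apply/negP => /dvdzP[k kE].
have h : (1 : int)%:~R = p%:R ^+ 1 * ((k%:~R + u) * th^-1).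
  by rewrite expr1 mulrA mulrDr -[p%:R * k%:~R]mulrC -[p%:R]/((p%:Z)%:~R : Zp) -rmorphM -kE -thE divrr.
by have := int_dvd_Zp h; rewrite dvdz1 expn1 /= => /eqP e; have := prime_gt1 pr; rewrite e.
Qed.

Lemma phase_C2 (f : nat -> Qp) (n N : nat) (A : int) (th : Zp) :
  QpI0 f -> n%:Z = A + N%:Z -> th \is a GRing.unit ->
  (forall k, ord_ge ((2 + k)`!%:R * f (2 + k)%N) (A + (F k)%:Z)) ->
  ord_ge (2%:R * f 2 - p%:R ^ A * tofrac th) (A + 1) -> C2 p N (phase f n).
Proof.
move=> If nE uth hf hl; have [K K3 hK] := phase_poly_big n 3 If.
have [th0 [u thE]] := Zp_int_approx th 1; rewrite expr1 in thE.
exists th0; first exact: unit_th0 thE.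
move=> a b m; set P := \poly_(k < K) f k in hK.
have [G1 l1] := Good_Dp b (Good_trunc K hf); rewrite -/P in G1 l1.
have [G0 l0] := Good_Dp a G1.
have lead : ord_ge ((Dp a (Dp b P))`_0 - p%:R ^ A * tofrac th) (A + 1).
  have h2 := @lead_trunc f K 2 n _ _ K3 hl; rewrite -/P in h2.
  have := ord_geD (ord_geD l0 l1) h2; rewrite !fact0 mul1r.
  by rewrite !subrKA.
have [t ht] := phase_final nE G0 uth lead thE (b * a) m.
exists t; rewrite [a * b]mulrC -ht.
have e1 : dm b (phase f n) = (fun m => e_padic R (b%:~R * (Dp b P).[m%:~R] / p%:R ^+ n)).
  apply/funext => m'; have -> : phase f n = (fun m => e_padic R (1%:~R * P.[m%:~R] / p%:R ^+ n)) by apply/funext.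
  by rewrite dm_poly mul1r.
by rewrite e1 dm_poly.
Qed.

Lemma phase_C3 (f : nat -> Qp) (n N : nat) (A : int) (th : Zp) :
  QpI0 f -> n%:Z = A + N%:Z -> th \is a GRing.unit ->
  (forall k, ord_ge ((3 + k)`!%:R * f (3 + k)%N) (A + (F k)%:Z)) ->
  ord_ge (6%:R * f 3 - p%:R ^ A * tofrac th) (A + 1) -> C3 p N (phase f n).
Proof.
move=> If nE uth hf hl; have [K K3 hK] := phase_poly_big n 4 If.
have [th0 [u thE]] := Zp_int_approx th 1; rewrite expr1 in thE.
exists th0; first exact: unit_th0 thE.
move=> a b c m; set P := \poly_(k < K) f k in hK.
have [G2 l2] := Good_Dp c (Good_trunc K hf); rewrite -/P in G2 l2.
have [G1 l1] := Good_Dp b G2.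
have [G0 l0] := Good_Dp a G1.
have lead : ord_ge ((Dp a (Dp b (Dp c P)))`_0 - p%:R ^ A * tofrac th) (A + 1).
  have h2 := @lead_trunc f K 3 n _ _ K3 hl; rewrite -/P in h2.
  have := ord_geD (ord_geD (ord_geD l0 l1) l2) h2; rewrite !fact0 mul1r.
  by rewrite !subrKA.
have [t ht] := phase_final nE G0 uth lead thE (c * b * a) m.
exists t; have -> : a * b * c = c * b * a by ring.
rewrite -ht.
have e1 : dm c (phase f n) = (fun m => e_padic R (c%:~R * (Dp c P).[m%:~R] / p%:R ^+ n)).
  apply/funext => m'; have -> : phase f n = (fun m => e_padic R (1%:~R * P.[m%:~R] / p%:R ^+ n)) by apply/funext.
  by rewrite dm_poly mul1r.
have e2 : dm b (dm c (phase f n)) = (fun m => e_padic R ((c * b)%:~R * (Dp b (Dp c P)).[m%:~R] / p%:R ^+ n)).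
  by rewrite e1; apply/funext => m'; rewrite dm_poly.
by rewrite e2 dm_poly.
Qed.

End PhaseC.
End Phase.

(** * Binomial series *)

Lemma fid_div (G : fieldType) (a b c d : G) : b != 0 -> d != 0 ->
  a * d = c * b -> a / b = c / d.
Proof. by move=> b0 d0 h; apply/eqP; rewrite eqr_div// h. Qed.

Lemma fid_addf (G : fieldType) (a b c d : G) : b != 0 -> d != 0 ->
  (a * d + c * b) / (b * d) = a / b + c / d.
Proof. by move=> b0 d0; field; rewrite b0 d0. Qed.

Lemma fid_mulf (G : fieldType) (a b c d : G) : (a * c) / (b * d) = a / b * (c / d).
Proof. by rewrite invfM mulrACA. Qed.

Section Rational.
Variables (p : nat) (pr : prime p).
Local Notation Zp := (padicZ pr).
Local Notation Qp := (padicQ pr).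

Lemma intQ_neq0 (b : int) : b != 0 -> (b%:~R : Qp) != 0.
Proof.
case: b => n; first by rewrite -lt0n => n0; exact: natQ_neq0.
by move=> _; rewrite NegzE mulrNz oppr_eq0; exact: natQ_neq0.
Qed.

Lemma ratr_frac (a b : int) : b != 0 -> ratr (a%:~R / b%:~R) = a%:~R / b%:~R :> Qp.
Proof.
move=> b0; set z : rat := _ / _; rewrite ratrE; apply: fid_div.
- by apply: intQ_neq0; rewrite denq_neq0.
- exact: intQ_neq0.
rewrite -!rmorphM /=; congr (_%:~R); apply: (@intr_inj rat); rewrite !rmorphM /=.
have b0' : (b%:~R : rat) != 0 by rewrite intr_eq0.
have d0 : ((denq z)%:~R : rat) != 0 by rewrite intr_eq0 denq_neq0.
have e1 := divq_num_den z; apply: (mulIf (invr_neq0 d0)).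
rewrite mulfK// mulrAC e1; apply: (mulIf (invr_neq0 b0')).
by rewrite mulfK.
Qed.

Lemma ratr_add (x y : rat) : ratr (x + y) = ratr x + ratr y :> Qp.
Proof.
have dx := denq_neq0 x; have dy := denq_neq0 y.
rewrite (ratrE pr x) (ratrE pr y) -fid_addf ?intQ_neq0//.
rewrite -!rmorphM -rmorphD -ratr_frac ?mulf_neq0//; congr ratr.
by rewrite rmorphD !rmorphM /= fid_addf ?intr_eq0// !divq_num_den.
Qed.

Lemma ratr_mul (x y : rat) : ratr (x * y) = ratr x * ratr y :> Qp.
Proof.
have dx := denq_neq0 x; have dy := denq_neq0 y.
rewrite (ratrE pr x) (ratrE pr y) -fid_mulf.
rewrite -!rmorphM -ratr_frac ?mulf_neq0//; congr ratr.
by rewrite !rmorphM /= fid_mulf !divq_num_den.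
Qed.

Lemma ratr_intQ (m : int) : ratr m%:~R = m%:~R :> Qp.
Proof. by have := @ratr_frac m 1 isT; rewrite !divr1. Qed.

Lemma ratr_natQ (m : nat) : ratr m%:R = m%:R :> Qp.
Proof. exact: ratr_intQ m%:Z. Qed.

Lemma ratr_oppQ (x : rat) : ratr (- x) = - ratr x :> Qp.
Proof. by rewrite -mulN1r ratr_mul (ratr_intQ (-1)) mulN1r. Qed.

(* The factors of k! times the k-th coefficient of (1 + c t)^(-y). *)
Definition bfac (y : rat) (c : Qp) (i : nat) : Qp := - (ratr y + i%:R) * c.

Lemma binom_seriesE (c : Qp) (y : rat) (k : nat) :
  k`!%:R * binom_series c (- y) k = \prod_(i < k) bfac y c i.
Proof.
have h : ratr (\prod_(i < k) (- y - i%:R)) = \prod_(i < k) (- (ratr y + i%:R)) :> Qp.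
  elim: k => [|k IH]; first by rewrite !big_ord0 (ratr_intQ 1).
  by rewrite !big_ord_recr /= ratr_mul IH -opprD ratr_oppQ ratr_add ratr_natQ.
rewrite /binom_series mulrA -ratr_natQ -ratr_mul /gen_binom mulrC mulrA.
rewrite mulrC [k`!%:R * _]mulrC mulfK ?pnatr_eq0 -?lt0n ?fact_gt0// h.
rewrite /bfac big_split /=; congr (_ * _).
by rewrite prodr_const card_ord.
Qed.

Lemma nat_unit (m : nat) : (0 < m)%N -> exists2 u : Zp, u \is a GRing.unit &
  m%:R = p%:R ^ (logn p m)%:Z * tofrac u :> Qp.
Proof.
move=> m0; have [m' pm' mE] := pfactor_coprime pr m0; exists (m'%:R).
  by apply: (int_unit pr (m := m'%:Z)); rewrite dvdzE /= -prime_coprime.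
by rewrite {1}mE natrM natrX rmorph_nat mulrC.
Qed.

Lemma ratr_unit (y : rat) : 0 < y -> exists2 u : Zp, u \is a GRing.unit &
  ratr y = p%:R ^ (ordp p y) * tofrac u :> Qp.
Proof.
move=> y0; have n0 : 0 < numq y by rewrite numq_gt0.
have d0 := denq_gt0 y.
have ex (m : int) : 0 < m -> exists2 u : Zp, u \is a GRing.unit &
    m%:~R = p%:R ^ (logn p `|m|)%:Z * tofrac u :> Qp.
  by case: m => // m m0; exact: nat_unit.
have [u uu hu] := ex _ n0; have [v vu hv] := ex _ d0.
exists (u * v^-1); first by rewrite unitrM uu unitrV.
rewrite ratrE hu hv fid_mulf /ordp expfzDr ?pQ_neq0// -invr_expz rmorphM /=.
by rewrite tofracV.
Qed.

Lemma ord_ge_exact (u : Zp) (N M : int) : u \is a GRing.unit ->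
  ord_ge (p%:R ^ N * tofrac u : Qp) M <-> M <= N.
Proof.
move=> uu; rewrite ord_ge_mulz; split=> [|MN]; last first.
  by apply: ord_geW (ord_ge_Zp u); rewrite subr_le0.
move=> h; rewrite leNgt; apply/negP => NM.
have [a ha] : ord_ge (tofrac u : Qp) 1 by apply: ord_geW h; lia.
have h1 : (1 : int)%:~R = p%:R ^+ 1 * (a * u^-1) :> Zp.
  have ua : u = p%:R * a.
    by apply/eqP; rewrite -(@tofrac_eq Zp) ha expr1z rmorphM /= rmorph_nat.
  by rewrite expr1 mulrA -ua divrr.
by have := int_dvd_Zp h1; rewrite dvdz1 expn1 /= => /eqP e; have := prime_gt1 pr; rewrite e.
Qed.

Lemma ord_ge_ratr (y : rat) (M : int) : 0 < y -> ord_ge (ratr y : Qp) M <-> M <= ordp p y.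
Proof. by move=> y0; have [u uu ->] := ratr_unit y0; exact: ord_ge_exact. Qed.

Lemma ordp_eq (y : rat) (N : int) (u : Zp) : 0 < y -> u \is a GRing.unit ->
  ratr y = p%:R ^ N * tofrac u :> Qp -> ordp p y = N.
Proof.
move=> y0 uu yE; apply/eqP; rewrite eq_le.
have h (M : int) : M <= N <-> M <= ordp p y by rewrite -(ord_ge_ratr _ y0) yE ord_ge_exact.
by apply/andP; split; [apply/h|apply/(h N)].
Qed.

Lemma ordpM (x y : rat) : 0 < x -> 0 < y -> ordp p (x * y) = ordp p x + ordp p y.
Proof.
move=> x0 y0; have [u uu uE] := ratr_unit x0; have [v vu vE] := ratr_unit y0.
apply: (@ordp_eq _ _ (u * v)); rewrite ?mulr_gt0 ?unitrM ?uu//.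
rewrite ratr_mul uE vE (@expfzDr _ _ (ordp p x)) ?pQ_neq0// (rmorphM (@tofrac Zp)) /=.
exact: mulrACA.
Qed.

(** Adding 1 preserves a negative order and creates none. Thus the scale p^(iota + kappa) in the
    class F is the same for y and y + 1. *)
Lemma iota_add1 (y : rat) : 0 < y -> iota_ p (y + 1) = iota_ p y.
Proof.
move=> y0; have y1 : 0 < y + 1 by rewrite addr_gt0.
have h (M : int) : M <= 0 -> M <= ordp p y <-> M <= ordp p (y + 1).
  move=> M0; rewrite -(ord_ge_ratr _ y0) -(ord_ge_ratr _ y1) ratr_add (ratr_intQ 1).
  have o1 : ord_ge (1%:~R : Qp) M by apply: ord_geW M0 (ord_ge_int pr 1).
  split=> [a|a]; first exact: ord_geD.
  by have := ord_geB a o1; rewrite addrK.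
have h0 : 0 <= ordp p y <-> 0 <= ordp p (y + 1) := h 0 (lexx 0).
have h1 : ordp p y <= 0 -> ordp p y <= ordp p (y + 1) by move=> /h[+ _]; apply.
have h2 : ordp p (y + 1) <= 0 -> ordp p (y + 1) <= ordp p y by move=> /h[_]; apply.
rewrite /iota_; move: (ordp p y) (ordp p (y + 1)) h0 h1 h2 => a b {h} [h0 h0'] h1 h2.
have [a0|a0] := leP 0 a; first by have := h0 a0; lia.
have [b0|b0] := leP 0 b; first by have := h0' b0; lia.
by have := h1 (ltW a0); have := h2 (ltW b0); lia.
Qed.

Lemma iota'_mul1 (y : rat) : 0 < y ->
  iota' p (y * (y + 1)) = iota' p y + iota' p (y + 1).
Proof.
move=> y0; have := iota_add1 y0; rewrite /iota' /iota_ ordpM ?addr_gt0//; lia.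
Qed.

Section Bfac.
Variables (y : rat) (kappa : nat) (omega : Zp).
Hypotheses (y0 : 0 < y) (uo : omega \is a GRing.unit).
Local Notation c := (p%:R ^ (iota_ p y + kappa%:Z) * tofrac omega : Qp).

Lemma bfac_ord i : ord_ge (bfac y c i) kappa%:Z.
Proof.
have h : ord_ge (- (ratr y + i%:R) : Qp) (- iota_ p y).
  apply/ord_geN/ord_geD; first by apply/ord_ge_ratr => //; rewrite /iota_; lia.
  by apply: ord_geW (ord_ge_nat pr i); rewrite /iota_; lia.
have h2 : ord_ge c (iota_ p y + kappa%:Z) by exists omega.
by apply: ord_geW (ord_geM h h2); lia.
Qed.

Lemma bfac0_unit : exists2 u : Zp, u \is a GRing.unit &
  bfac y c 0 = p%:R ^ (kappa%:Z + iota' p y) * tofrac u.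
Proof.
have [u uu uE] := ratr_unit y0; exists (- (u * omega)).
  by rewrite unitrN unitrM uu.
have -> : kappa%:Z + iota' p y = ordp p y + (iota_ p y + kappa%:Z).
  by rewrite /iota' /iota_; lia.
by rewrite /bfac addr0 uE [in RHS]expfzDr ?pQ_neq0// rmorphN rmorphM /= mulrN mulNr mulrACA.
Qed.

Lemma bfac1_unit : exists2 u : Zp, u \is a GRing.unit &
  bfac y c 1 = p%:R ^ (kappa%:Z + iota' p (y + 1)) * tofrac u.
Proof.
have y1 : 0 < y + 1 by rewrite addr_gt0.
have [u uu uE] := ratr_unit y1; exists (- (u * omega)).
  by rewrite unitrN unitrM uu.
have -> : kappa%:Z + iota' p (y + 1) = ordp p (y + 1) + (iota_ p y + kappa%:Z).
  by rewrite -iota_add1// /iota' /iota_; lia.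
rewrite /bfac -(ratr_natQ 1) -ratr_add uE [in RHS]expfzDr ?pQ_neq0// rmorphN rmorphM /=.
by rewrite mulrN mulNr mulrACA.
Qed.

Lemma prod_bfac_ord k : ord_ge (\prod_(i < k) bfac y c i) (k%:Z * kappa%:Z).
Proof.
elim: k => [|k IH]; first by rewrite big_ord0 mul0r; exact: ord_ge_int 1.
rewrite big_ord_recr /=; apply: ord_geW (ord_geM IH (bfac_ord k)); lia.
Qed.

End Bfac.

End Rational.

Lemma ceil_add_int (R : realType) (a b : R) (m : int) : m%:~R <= b ->
  Num.ceil a + m <= Num.ceil (a + b).
Proof.
move=> mb; rewrite -lerBrDr ceil_le_int intrD mulrNz.
have := ceil_ge (a + b); lra.
Qed.

Lemma ordp_nat (p n : nat) : ordp p n%:R = (logn p n)%:Z.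
Proof. by rewrite /ordp -[n%:R]/(n%:Z%:~R) numq_int denq_int /= logn1 subr0. Qed.

Lemma iota'_nat (p n : nat) : iota' p n%:R = (logn p n)%:Z.
Proof. by rewrite /iota' ordp_nat; apply/max_idPr. Qed.

Lemma iota'_2 (p : nat) : prime p -> iota' p 2 = (p == 2%N : nat)%:Z.
Proof. by move=> pp; rewrite iota'_nat -[2%N in LHS]expn1 logn_prime// eq_sym. Qed.

(** With x = kappa + ord tau this compares the i-th term of a symmetric difference with the first
    one. For p = 2 the orders of i! and (i - 1)! agree because i is odd; only p <= 3 leaves a
    deficit of 1. *)
Lemma odd_fact_bound (p x i : nat) : prime p -> (0 < x)%N -> odd i -> (1 < i)%N ->
  (logn p i`! + 2 * x <= i.-1 * x + (p <= 3))%N.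
Proof.
move=> pp x0 oi i1; have [j iE] : exists j, i = j.*2.+3.
  exists (i - 3)./2; have := odd_double_half (i - 3); rewrite oddB ?oi/=; last by case: i oi i1 => [|[|[]]].
  by case: i oi i1 => [|[|[|i]]] //= _ _; rewrite !subSS subn0; lia.
have h := logn_fact_le pp (n := i) (ltnW i1).
have p1 := prime_gt1 pp; have [p2|p2] := eqVneq p 2%N.
  have h2 := logn_fact_le pp (n := i.-1); rewrite p2 /= in h h2 *.
  have e : logn 2 i`! = logn 2 i.-1`!.
    by rewrite iE factS lognM ?fact_gt0// lognE /= dvdn2 /= odd_double.
  rewrite e; have {h2} := h2 _; rewrite iE /= => /(_ isT); clear e h; nia.
have [p3|p3] := eqVneq p 3%N; first by rewrite p3 iE /= in h *; nia.
have p5 : (5 <= p)%N.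
  by case: (p) pp p1 p2 p3 => [|[|[|[|[|q]]]]].
have h4 : (logn p i`! * 4 <= i.-1)%N.
  by apply: leq_trans h; rewrite leq_mul2l -ltnS (prednK (prime_gt0 pp)) p5 orbT.
by move: h4; rewrite iE /=; clear h; nia.
Qed.

(** * Second and third differences of the phases of the class F *)

Section ClassFacts.
Variables (R : realType) (p : nat) (pr : prime p).
Local Notation Zp := (padicZ pr).
Local Notation Qp := (padicQ pr).

Section OneClass.
Variables (w : int) (y : rat) (kappa : nat) (lam : R) (u : nat) (omega omega' gamma0 : Zp).
Variables (f : nat -> Qp) (g : nat -> Zp).
Hypotheses (y0 : 0 < y) (uo : omega \is a GRing.unit) (uo' : omega' \is a GRing.unit).
Hypothesis (kap1 : 1 + iota' p 2 <= kappa%:Z).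
Local Notation c := (p%:R ^ (iota_ p y + kappa%:Z) * tofrac omega : Qp).
Hypothesis hg : forall k, ord_ge (tofrac (g k)) (Num.ceil (k%:R * lam)).
Hypothesis hf : forall k, pseries_deriv f k =
    p%:R ^ w * tofrac omega' * binom_series c (- y) k
    + (if k == 0%N then p%:R ^ w * tofrac gamma0 else 0)
    + p%:R ^ (u%:Z + w) * tofrac (g k).

Lemma fact_coef s : (0 < s)%N -> s.+1`!%:R * f s.+1 =
  p%:R ^ w * tofrac omega' * \prod_(i < s) bfac y c i
  + p%:R ^ (u%:Z + w) * (s`!%:R * tofrac (g s)).
Proof.
move=> s0; rewrite factS natrM mulrAC mulrC -/(pseries_deriv f s) hf gtn_eqF// addr0.
by rewrite mulrDr mulrCA binom_seriesE mulrCA.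
Qed.

(** For p = 2 the left side is k + 1 when k > 0, which is where kappa >= 2 enters. *)
Lemma slope_kappa k : (slope_floor p k <= k * kappa)%N.
Proof.
rewrite /slope_floor; case: eqP => [->//|/eqP k0].
have p1 : (0 < p.-1)%N by have := prime_gt1 pr; case: (p) => [|[]].
have h : (k %/ p.-1 * p.-1 <= k)%N by rewrite leq_trunc_div.
have := kap1; rewrite iota'_2//; have := prime_gt1 pr.
have [->|p2] := eqVneq p 2%N => /= p1' hk; first by rewrite divn1; nia.
by have p3 : (2 <= p.-1)%N by [lia]; nia.
Qed.

(** The first s factors of the binomial coefficient give the leading term, the further ones supply
    the growth required by [slope_floor], and the perturbation g contributes only from order A + 1
    on. *)
Lemma class_good s (E : int) (theta : Zp) : (0 < s)%N ->
  \prod_(i < s) bfac y c i = p%:R ^ (s%:Z * kappa%:Z + E) * tofrac theta ->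
  s%:Z * kappa%:Z + E + 1 <= u%:Z + Num.ceil (s%:R * lam) -> rho R p <= lam ->
  let A := w + (s%:Z * kappa%:Z + E) in
  (forall k, ord_ge ((s.+1 + k)`!%:R * f (s.+1 + k)%N) (A + (slope_floor p k)%:Z)) /\
  ord_ge (s.+1`!%:R * f s.+1 - p%:R ^ A * tofrac (omega' * theta)) (A + 1).
Proof.
move=> s0 pE hu hlam A.
have p1 : (0 < p.-1)%N by have := prime_gt1 pr; case: (p) => [|[]].
have gpart k : ord_ge (p%:R ^ (u%:Z + w) * ((s + k)`!%:R * tofrac (g (s + k)%N)) : Qp)
    (A + 1 + (k %/ p.-1)%N%:Z).
  apply/ord_ge_mulz; apply: ord_geW (ord_geM (ord_ge_nat pr _) (hg _)); rewrite add0r.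
  have : Num.ceil (s%:R * lam) + (k %/ p.-1)%N%:Z <= Num.ceil ((s + k)%:R * lam).
    rewrite natrD mulrDl; apply: ceil_add_int.
    apply: le_trans (_ : k%:R * rho R p <= _); last by rewrite ler_wpM2l.
    have pE1 : (p%:R - 1 : R) = p.-1%:R by rewrite -subn1 natrB// prime_gt0.
    rewrite /rho pE1 ler_pdivlMr ?ltr0n//.
    by rewrite -[(k %/ p.-1)%N%:Z%:~R]/((k %/ p.-1)%N%:R) -natrM ler_nat leq_trunc_div.
  by rewrite /A; lia.
have lead : ord_ge (s.+1`!%:R * f s.+1 - p%:R ^ A * tofrac (omega' * theta)) (A + 1).
  have := gpart 0%N; rewrite addn0 div0n addr0 fact_coef// pE.
  have -> : p%:R ^ w * tofrac omega' * (p%:R ^ (s%:Z * kappa%:Z + E) * tofrac theta) =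
     p%:R ^ A * tofrac (omega' * theta) :> Qp.
    rewrite /A [RHS]/= (@expfzDr _ _ w) ?pQ_neq0// (rmorphM (@tofrac Zp)) /=.
    exact: mulrACA.
  by rewrite (addrC (p%:R ^ A * _)) addrK.
split=> // k; have [->|k0] := posnP k.
  rewrite addn0 /slope_floor /= addr0.
  rewrite -[X in ord_ge X _](subrK (p%:R ^ A * tofrac (omega' * theta))).
  apply: ord_geD; first by apply: ord_geW lead; lia.
  by exists (omega' * theta).
rewrite addSn fact_coef ?addn_gt0 ?s0//; apply: ord_geD; last first.
  by apply: ord_geW (gpart k); rewrite /slope_floor gtn_eqF//; lia.
rewrite big_split_ord /= pE.
have h1 : ord_ge (p%:R ^ w * tofrac omega' : Qp) w by exists omega'.
have h2 : ord_ge (p%:R ^ (s%:Z * kappa%:Z + E) * tofrac theta : Qp) (s%:Z * kappa%:Z + E) by exists theta.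
have h3 : ord_ge (\prod_(i < k) bfac y c (s + i)) (k%:Z * kappa%:Z).
  elim: (k) => [|k' IH]; first by rewrite big_ord0 mul0r; exact: ord_ge_int 1.
  rewrite big_ord_recr /=; have h := ord_geM IH (bfac_ord kappa y0 uo (s + k')).
  by apply: (ord_geW _ h); lia.
apply: ord_geW (ord_geM h1 (ord_geM h2 h3)).
have := slope_kappa k; rewrite /A; lia.
Qed.

End OneClass.

Lemma class_C2 (w : int) (y : rat) (kappa : nat) (lam : R) (u : nat) (f : nat -> Qp) (n N : nat) :
  0 < y -> 1 + iota' p 2 <= kappa%:Z -> class_F w y kappa lam u f ->
  n%:Z = w + kappa%:Z + iota' p y + N%:Z -> rho R p <= lam ->
  kappa%:Z + iota' p y + 1 <= u%:Z + Num.ceil lam -> C2 p N (phase R f n).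
Proof.
move=> y0 k1 [om [om' [uo uo' [If [gam [g [[_ hg] hf]]]]]]] nE hl hu.
have [th uth thE] := bfac0_unit kappa y0 uo.
have [] := @class_good w y kappa lam u om om' gam f g y0 uo uo' k1 hg hf 1 (iota' p y) th isT _ _ hl.
- by rewrite big_ord_recr big_ord0 /= mul1r mul1r.
- by rewrite !mul1r.
rewrite mul1r => h1 h2.
have uth2 : om' * th \is a GRing.unit by rewrite unitrM uo'.
by apply: phase_C2 If _ uth2 h1 h2; rewrite nE; lia.
Qed.

Lemma class_C3 (w : int) (y : rat) (kappa : nat) (lam : R) (u : nat) (f : nat -> Qp) (n V : nat) :
  0 < y -> 1 + iota' p 2 <= kappa%:Z -> class_F w y kappa lam u f ->
  n%:Z = w + 2 * kappa%:Z + iota' p y + iota' p (y + 1) + V%:Z -> rho R p <= lam ->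
  2 * kappa%:Z + iota' p y + iota' p (y + 1) + 1 <= u%:Z + Num.ceil (2 * lam) ->
  C3 p V (phase R f n).
Proof.
move=> y0 k1 [om [om' [uo uo' [If [gam [g [[_ hg] hf]]]]]]] nE hl hu.
have [th0 uth0 th0E] := bfac0_unit kappa y0 uo.
have [th1 uth1 th1E] := bfac1_unit kappa y0 uo.
have [] := @class_good w y kappa lam u om om' gam f g y0 uo uo' k1 hg hf 2 (iota' p y + iota' p (y + 1)) (th0 * th1) isT _ _ hl.
- rewrite !big_ord_recr big_ord0 /= mul1r th0E th1E.
  have -> : 2%:Z * kappa%:Z + (iota' p y + iota' p (y + 1)) =
    (kappa%:Z + iota' p y) + (kappa%:Z + iota' p (y + 1)) by lia.
  by rewrite [in RHS]expfzDr ?pQ_neq0// rmorphM /= mulrACA.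
- by rewrite addrA.
move=> h1 h2.
have uth2 : om' * (th0 * th1) \is a GRing.unit by rewrite !unitrM uo' uth0.
by apply: phase_C3 If _ uth2 h1 h2; rewrite nE; lia.
Qed.

End ClassFacts.

Section Binomial.
Variables (R : realType) (p : nat) (pr : prime p).
Local Notation Zp := (padicZ pr).
Local Notation Qp := (padicQ pr).

Lemma bfac_shift (y : rat) (c : Qp) (i j : nat) :
  bfac y c (i + j) = bfac (y + i%:R) c j.
Proof. by rewrite /bfac natrD ratr_add ratr_natQ addrA. Qed.

Lemma fid_split (G : fieldType) (i k C B P P' S : G) : i != 0 -> k != 0 ->
  k * S = P' -> C * (i * k) * B = P * P' -> C * B = P / i * S.
Proof.
move=> i0 k0 hS h; apply: (mulfI i0); apply: (mulfI k0).
have -> : k * (i * (C * B)) = C * (i * k) * B by ring.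
by rewrite h -hS; field.
Qed.

(** The i-th derivative of (1 + c t)^(-y) is a multiple of (1 + c t)^(-y-i); the case i = 1 is the
    passage from y to y + 1. *)
Lemma binom_series_split (c : Qp) (y : rat) (k i : nat) :
  'C(k + i, i)%:R * binom_series c (- y) (k + i)%N =
  (\prod_(j < i) bfac y c j) / i`!%:R * binom_series c (- (y + i%:R)) k.
Proof.
apply: (fid_split (natQ_neq0 pr (fact_gt0 i)) (natQ_neq0 pr (fact_gt0 k)) (binom_seriesE c _ k)).
rewrite -!natrM; have -> : ('C(k + i, i) * (i`! * k`!) = (k + i)`!)%N.
  by rewrite -(@bin_fact (k + i) i) ?leq_addl// addnK.
rewrite binom_seriesE addnC big_split_ord /=; congr (_ * _).
by apply: eq_bigr => j _; rewrite bfac_shift.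
Qed.

Lemma prod_sub_nat (z s : Zp) (a M k : nat) : z = a%:R + p%:R ^+ M * s ->
  exists s' : Zp, \prod_(j < k) (z - j%:R) = (a ^_ k)%:R + p%:R ^+ M * s'.
Proof.
move=> ->; elim: k => [|k [s' IH]].
  by exists 0; rewrite big_ord0 ffactn0 mulr0 addr0.
have [t tE] : exists t : Zp, (a ^_ k)%:R * (a%:R - k%:R) = (a ^_ k.+1)%:R + p%:R ^+ M * t.
  exists 0; rewrite mulr0 addr0 ffactnSr; have [ka|ak] := leqP k a.
    by rewrite natrM natrB.
  by rewrite ffact_small// mul0r mul0n.
exists (t + (a ^_ k)%:R * s + s' * (a%:R + p%:R ^+ M * s - k%:R)).
rewrite big_ord_recr /= IH.
set P : Zp := p%:R ^+ M; set F := (a ^_ k)%:R in tE *; set F' := (a ^_ k.+1)%:R in tE *.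
have -> : F' = F * (a%:R - k%:R) - P * t by rewrite tE addrK.
by ring.
Qed.

(** Replace z by a natural number congruent to it modulo the power of p in k!; for it the quotient
    is an ordinary binomial coefficient. *)
Lemma binom_int_ord (z : Zp) k : ord_ge ((\prod_(j < k) (tofrac z - j%:R)) / k`!%:R : Qp) 0.
Proof.
have [a [s zE]] := Zp_int_approx z (logn p k`!).
have [b [s2 bE]] : exists (b : nat) (s2 : Zp), z = b%:R + p%:R ^+ (logn p k`!) * s2.
  have [c cE] : exists c : nat, a + (p ^ logn p k`!)%N%:Z * (absz a)%:Z = c%:Z.
    have : (0 < p ^ logn p k`!)%N by rewrite expn_gt0 prime_gt0.
    move: (p ^ _)%N => P P0; exists (absz (a + P%:Z * (absz a)%:Z)); nia.
  exists c, (s - (absz a)%:R).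
  have -> : (c%:R : Zp) = a%:~R + p%:R ^+ (logn p k`!) * (absz a)%:R.
    by rewrite -[LHS]/(c%:Z%:~R) -cE rmorphD rmorphM /= -!pmulrn natrX.
  by rewrite zE -[in RHS]addrA -mulrDr (addrC _ (s - _)) subrK.
have [s' hs] := prod_sub_nat k bE.
have -> : \prod_(j < k) (tofrac z - j%:R) = tofrac (\prod_(j < k) (z - j%:R)) :> Qp.
  by rewrite rmorph_prod; apply: eq_bigr => j _; rewrite rmorphB /= rmorph_nat.
rewrite hs rmorphD rmorphM rmorphXn /= !rmorph_nat mulrDl; apply: ord_geD.
  rewrite -bin_ffact natrM mulfK ?natQ_neq0 ?fact_gt0//; exact: ord_ge_nat.
have h1 : ord_ge (p%:R ^+ logn p k`! * tofrac s' : Qp) (logn p k`!)%:Z by exists s'.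
by have := ord_geM h1 (ord_ge_natV pr (fact_gt0 k)); rewrite subrr.
Qed.

(** The origin of rho_p(y): for ord y = 0 the binomial coefficients are p-adic integers, otherwise
    the order of k! is lost, at most k rho_p. *)
Lemma binom_series_ord (y : rat) (kappa : nat) (omega : Zp) (lam : R) (i k : nat) :
  0 < y -> omega \is a GRing.unit -> lam <= kappa%:R - rhoy R p y ->
  ord_ge (binom_series (p%:R ^ (iota_ p y + kappa%:Z) * tofrac omega : Qp) (- (y + i%:R)) k)
    (Num.ceil (k%:R * lam)).
Proof.
move=> y0 uo hl; set c := (X in binom_series X).
have [->|k0] := posnP k.
  rewrite mul0r ceil0 /binom_series expr0 mulr1 /gen_binom big_ord0 fact0 divr1.
  by rewrite (ratr_intQ pr 1); exact: ord_ge_int 1.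
have kB : k`!%:R * binom_series c (- (y + i%:R)) k = \prod_(j < k) bfac y c (i + j).
  by rewrite binom_seriesE; apply: eq_bigr => j _; rewrite bfac_shift.
have [hy|hy] := eqVneq (ordp p y) 0.
  have lk : Num.ceil (k%:R * lam) <= k%:Z * kappa%:Z.
    rewrite ceil_le_int rmorphM /= ler_wpM2l//.
    by apply: le_trans hl _; rewrite /rhoy hy eqxx subr0.
  apply: ord_geW lk _; rewrite -[_ * _]add0r /binom_series; apply: ord_geM.
    have [u uu uE] := ratr_unit pr y0; rewrite hy expr0z mul1r in uE.
    have := binom_int_ord (- (u + i%:R)) k.
    have -> : \prod_(j < k) (tofrac (- (u + i%:R)) - j%:R) = ratr (\prod_(j < k) (- (y + i%:R) - j%:R)) :> Qp.
      elim: (k) => [|k' IH]; first by rewrite !big_ord0 (ratr_intQ pr 1).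
      rewrite !big_ord_recr /= ratr_mul -IH; congr (_ * _).
      rewrite ratr_add ratr_oppQ ratr_oppQ ratr_add !ratr_natQ uE rmorphN rmorphD /= rmorph_nat.
      by [].
    have e : ratr (\prod_(j < k) (- (y + i%:R) - j%:R)) = ratr (gen_binom (- (y + i%:R)) k) * k`!%:R :> Qp.
      by rewrite -ratr_natQ -ratr_mul /gen_binom divfK// pnatr_eq0 -lt0n fact_gt0.
    by rewrite e mulfK// natQ_neq0 ?fact_gt0.
  apply: ord_geX; exists omega; rewrite /c.
  by rewrite /iota_ hy oppr0 maxxx add0r.
have h3 : ord_ge (\prod_(j < k) bfac y c (i + j)) (k%:Z * kappa%:Z).
  elim: (k) => [|k' IH]; first by rewrite big_ord0 mul0r; exact: ord_ge_int 1.
  rewrite big_ord_recr /=; have h := ord_geM IH (bfac_ord kappa y0 uo (i + k')).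
  by apply: (ord_geW _ h); lia.
have := ord_geM h3 (ord_ge_natV pr (fact_gt0 k)).
rewrite -kB mulrAC mulfV ?natQ_neq0 ?fact_gt0// mul1r; apply: ord_geW.
rewrite ceil_le_int; apply: le_trans (_ : k%:R * (kappa%:R - rho R p) <= _).
  by rewrite ler_wpM2l//; apply: le_trans hl _; rewrite /rhoy hy.
have := logn_fact_le pr k0; have p1 : (0 < p.-1)%N by have := prime_gt1 pr; case: (p) => [|[]].
have pE1 : (p%:R - 1 : R) = p.-1%:R by rewrite -subn1 natrB// prime_gt0.
move=> h; rewrite /rho pE1 intrB rmorphM /= mulrBr lerD2l lerN2.
rewrite ler_pdivlMr ?ltr0n// -[(Posz _)%:~R]/((logn p k`!)%:R) -natrM ler_nat.
by apply: leq_trans h _; exact: leq_pred.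
Qed.

End Binomial.

(** * Symmetric differences *)

Lemma fid_symdiff (G : fieldType) (eG pG Q ep em pp pm : G) : Q = pp - pm ->
  eG - (ep - em) = (eG - pG) + (pG - Q) - ((ep - pp) - (em - pm)).
Proof. by move=> ->; ring. Qed.

Lemma fid_lead (G : fieldType) (A B D o t u S : G) :
  A * o * (B * t * S) * (D * u) = A * B * D * (o * t * u) * S.
Proof. by ring. Qed.

Lemma fid_terms (G : fieldType) (C A B X d : G) :
  C * (A * B + X) * d = A * (C * B) * d + C * X * d.
Proof. by ring. Qed.

Section SymDiff.
Variables (R : realType) (p : nat) (pr : prime p).
Local Notation Zp := (padicZ pr).
Local Notation Qp := (padicQ pr).
Variable tau : nat.
Hypothesis tau0 : (0 < tau)%N.

(** The difference is taken symmetrically so that even orders cancel and the first error term is of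
    order 3. *)
Definition dlt (i : nat) : Qp := tau%:R ^+ i - (- tau%:R) ^+ i.

(* The coefficients of f(t + tau) - f(t - tau), with Taylor expansions cut at I. *)
Definition sdiff (I : nat) (f : nat -> Qp) (k : nat) : Qp :=
  \sum_(1 <= i < I) 'C(k + i, i)%:R * f (k + i)%N * dlt i.

Lemma dlt_even i : ~~ odd i -> dlt i = 0.
Proof. by move=> oi; rewrite /dlt exprNn -signr_odd (negbTE oi) expr0 mul1r subrr. Qed.

Lemma dlt_odd i : odd i -> dlt i = (2 * tau)%N%:R * tau%:R ^+ i.-1.
Proof.
move=> oi; have i0 : (0 < i)%N by case: i oi.
rewrite /dlt exprNn -signr_odd oi expr1 mulN1r opprK natrM -mulrA -exprS prednK//.
by rewrite mulr_natl mulr2n.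
Qed.

Lemma dlt_ord i : ord_ge (dlt i) ((logn p (2 * tau))%:Z + i.-1%:Z * (logn p tau)%:Z).
Proof.
have [oi|oi] := boolP (odd i); last by rewrite dlt_even//; exact: ord_ge0.
rewrite dlt_odd//.
have h (m : nat) : (0 < m)%N -> ord_ge (m%:R : Qp) (logn p m)%:Z.
  by move=> m0; have [u _ ->] := nat_unit pr m0; exists u.
by apply: ord_geM; [apply: h; rewrite muln_gt0|apply/ord_geX/h].
Qed.

Lemma sdiff_deriv I f k : pseries_deriv (sdiff I f) k =
  \sum_(1 <= i < I) 'C(k + i, i)%:R * pseries_deriv f (k + i)%N * dlt i.
Proof.
rewrite /pseries_deriv /sdiff mulr_sumr; apply: eq_bigr => i _.
rewrite !mulrA -!natrM addSn; congr (_%:R * _ * _).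
have := mul_bin_diag (k + i).+1 k; rewrite /= => h.
have e1 : ('C((k + i).+1, i) = 'C((k + i).+1, k.+1))%N.
  by rewrite -(@bin_sub (k + i).+1 k.+1) ?ltnS ?leq_addr// subSS addKn.
have e2 : ('C(k + i, i) = 'C(k + i, k))%N.
  by rewrite -(@bin_sub (k + i) k) ?leq_addr// addKn.
by rewrite e1 e2 -h mulnC.
Qed.

Lemma sdiff_tends I f : tends_to0 f -> tends_to0 (sdiff I f).
Proof.
move=> hf N; have [K hK] := hf N; exists K => k kK; apply: ord_ge_sum => i _.
have d0 : ord_ge (dlt i) 0 by apply: ord_geW (dlt_ord i).
have := ord_geM (ord_geM (ord_ge_nat pr 'C(k + i, i)) (hK (k + i)%N (leq_trans kK (leq_addr _ _)))) d0.
by rewrite add0r addr0.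
Qed.

(** From I on the coefficients of f vanish modulo p^n, so the truncated Taylor expansions give the
    phase exactly. *)
Lemma sdiff_phase f n : QpI0 f -> exists2 I, (1 < I)%N & forall m,
  phase R (sdiff I f) n m = dm (2 * tau)%N%:Z (phase R f n) (m - tau%:Z).
Proof.
move=> If; have ft := QpI0_tends If; have [K0 hK0] := ft n%:Z.
set K := maxn 2 K0; have hK k : (K <= k)%N -> ord_ge (f k) n%:Z.
  by rewrite geq_max => /andP[_]; exact: hK0.
exists K; first exact: leq_maxl.
move=> m; set G := sdiff K f; have IG : QpI0 G by apply/tends_QpI0/sdiff_tends.
have d0 i : ord_ge (dlt i) 0 by apply: ord_geW (dlt_ord i).
have hG k : (K <= k)%N -> ord_ge (G k) n%:Z.
  move=> kK; apply: ord_ge_sum => i _.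
  have := ord_geM (ord_geM (ord_ge_nat pr 'C(k + i, i)) (hK (k + i)%N (leq_trans kK (leq_addr _ _)))) (d0 i).
  by rewrite add0r addr0.
pose P : {poly Qp} := \poly_(k < K) f k.
pose Q : {poly Qp} := \sum_(1 <= i < K) dlt i *: P^`N(i).
have sP : (size P <= K)%N := size_poly _ _.
have QE : Q.[m%:~R] = P.[(m + tau%:Z)%:~R] - P.[(m - tau%:Z)%:~R].
  rewrite !rmorphD rmorphN /= !(nderiv_taylor_wide (mulrC _ _) sP).
  rewrite -sumrB -(big_mkord xpredT (fun i => P^`N(i).[m%:~R] * _ ^+ i - P^`N(i).[m%:~R] * _ ^+ i)).
  rewrite big_ltn ?(leq_trans _ (leq_maxl _ _))// !expr0 subrr add0r horner_sum.
  by apply: eq_bigr => i _; rewrite hornerZ -mulrBr mulrC.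
have Qk k : Q`_k = \sum_(1 <= i < K) 'C(k + i, i)%:R * P`_(k + i) * dlt i.
  rewrite coef_sum; apply: eq_bigr => i _; rewrite coefZ coef_nderivn addnC.
  by rewrite mulrC mulr_natl.
have sQ : (size Q <= K)%N.
  apply/leq_sizeP => k kK; rewrite Qk big1// => i _.
  by rewrite coef_poly ltnNge (leq_trans kK (leq_addr _ _)) /= mulr0 mul0r.
have hQ : ord_ge (psum G m%:~R K - Q.[m%:~R]) n%:Z.
  rewrite (horner_coef_wide _ sQ) -sumrB; apply: ord_ge_sum => k _.
  rewrite -mulrBl -[n%:Z]addr0; apply: ord_geM; last first.
    by rewrite -[0](mulr0 (Posz k)); apply: ord_geX; exact: ord_ge_int.
  rewrite /G /sdiff Qk -sumrB; apply: ord_ge_sum => i _; rewrite -mulrBl -mulrBr.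
  rewrite -[n%:Z]addr0; apply: ord_geM (d0 i); rewrite -[n%:Z]add0r.
  apply: ord_geM (ord_ge_nat pr _) _; rewrite coef_poly; case: ltnP => kK.
    by rewrite subrr; exact: ord_ge0.
  by rewrite subr0; exact: hK.
have psP (t : int) : psum f t%:~R K = P.[t%:~R] by rewrite horner_poly.
have e1 := pseries_evalP m IG hG.
have e2 := pseries_evalP (m + tau%:Z) If hK; have e3 := pseries_evalP (m - tau%:Z) If hK.
rewrite !psP in e2 e3.
have e4 := ord_geB (ord_geD e1 hQ) (ord_geB e2 e3).
rewrite -(fid_symdiff _ _ _ _ QE) in e4.
rewrite /dm /phase; have -> : m - tau%:Z + (2 * tau)%N%:Z = m + tau%:Z by lia.
rewrite -e_padicN -e_padicD -mulrBl; apply: e_padic_cong; rewrite -mulrBl.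
have := ord_geM e4 (ord_ge_pz pr (- n%:Z)); rewrite (subrr n%:Z) -exprnN.
by [].
Qed.


Section SdiffClass.
Variables (w : int) (y : rat) (kappa : nat) (lam lamt : R) (u u' : nat).
Variables (omega omega' gamma0 : Zp) (f : nat -> Qp) (g : nat -> Zp).
Hypotheses (y0 : 0 < y) (uo : omega \is a GRing.unit) (uo' : omega' \is a GRing.unit).
Hypothesis kap0 : (0 < kappa)%N.
Local Notation c := (p%:R ^ (iota_ p y + kappa%:Z) * tofrac omega : Qp).
Hypothesis hg : forall k, ord_ge (tofrac (g k)) (Num.ceil (k%:R * lam)).
Hypothesis hf : forall k, pseries_deriv f k =
    p%:R ^ w * tofrac omega' * binom_series c (- y) k
    + (if k == 0%N then p%:R ^ w * tofrac gamma0 else 0)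
    + p%:R ^ (u%:Z + w) * tofrac (g k).
Hypotheses (lamt1 : lamt <= kappa%:R - rhoy R p y) (lamt2 : lamt <= lam) (lamt0 : 0 < lamt).
Hypothesis u'1 : (u' + (p <= 3) <= 2 * (kappa + logn p tau))%N.
Hypothesis u'2 : u'%:Z + kappa%:Z + iota' p y <= u%:Z + Num.floor lam.
Local Notation T := (logn p (2 * tau)).
Local Notation w' := (w + kappa%:Z + iota' p y + T%:Z).

Lemma sdiff_main_ord i k : (1 < i)%N ->
  ord_ge (p%:R ^ w * tofrac omega' *
    ('C(k + i, i)%:R * binom_series c (- y) (k + i)%N) * dlt i)
    (u'%:Z + w' + Num.ceil (k%:R * lamt)).
Proof.
move=> i1; have [oi|oi] := boolP (odd i); last by rewrite dlt_even// mulr0; exact: ord_ge0.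
rewrite binom_series_split.
have h0 : ord_ge (p%:R ^ w * tofrac omega' : Qp) w by exists omega'.
have [th uth thE] := bfac0_unit kappa y0 uo.
have h1 : ord_ge (\prod_(j < i) bfac y c j) (kappa%:Z + iota' p y + i.-1%:Z * kappa%:Z).
  case: i i1 {oi} => // i _; rewrite big_ord_recl /=; apply: ord_geM; first by rewrite thE; exists th.
  elim: (i) => [|i' IH]; first by rewrite big_ord0 mul0r; exact: ord_ge_int 1.
  rewrite big_ord_recr /=; have h := ord_geM IH (bfac_ord kappa y0 uo (bump 0 i')).
  by apply: (ord_geW _ h); lia.
have h2 := ord_ge_natV pr (fact_gt0 i).
have h3 := binom_series_ord i k y0 uo lamt1.
apply: ord_geW (ord_geM (ord_geM h0 (ord_geM (ord_geM h1 h2) h3)) (dlt_ord i)).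
have x0 : (0 < kappa + logn p tau)%N by rewrite addn_gt0 kap0.
have := odd_fact_bound pr x0 oi i1; move: u'1; rewrite mulnDr.
move: (logn p i`!) (p <= 3)%N (logn p tau) (i.-1) => a b t j.
move: (iota' p y) (Num.ceil _) => io cl; move: (logn p _) => t2; clear; nia.
Qed.

Lemma sdiff_rest_ord i k : (0 < i)%N ->
  ord_ge ('C(k + i, i)%:R * (p%:R ^ (u%:Z + w) * tofrac (g (k + i)%N)) * dlt i)
    (u'%:Z + w' + Num.ceil (k%:R * lamt)).
Proof.
move=> i0.
have h1 : ord_ge (p%:R ^ (u%:Z + w) * tofrac (g (k + i)%N) : Qp) (u%:Z + w + Num.ceil ((k + i)%:R * lam)).
  exact: ord_geM (ord_ge_pz pr _) (hg _).
apply: ord_geW (ord_geM (ord_geM (ord_ge_nat pr _) h1) (dlt_ord i)).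
have lam0 : 0 < lam by apply: lt_le_trans lamt0 _; move: lamt2.
have : Num.ceil (k%:R * lamt) + Num.floor lam <= Num.ceil ((k + i)%:R * lam).
  apply: (@le_trans _ _ (Num.ceil (k%:R * lamt + lam))).
    by apply: ceil_add_int; exact: floor_le.
  apply: le_ceil; rewrite natrD mulrDl lerD//.
    by rewrite ler_wpM2l//; move: lamt2.
  by rewrite -[leLHS]mul1r ler_pM2r// ler1n.
by have := u'2; move: (iota' p y) (Num.ceil _) (Num.ceil _) (Num.floor _) (logn p _) (logn p _) => a b c' d t2 t; clear; nia.
Qed.

(** The Taylor term i = 1 is the main part for y + 1. The conditions [u'1] and [u'2] push the terms
    i >= 3 and those from g into the new perturbation of slope lamt. *)
Lemma sdiff_class I : QpI0 f -> (1 < I)%N ->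
  class_F w' (y + 1) kappa lamt u' (sdiff I f).
Proof.
move=> If I1; have IG : QpI0 (sdiff I f) by apply/tends_QpI0/sdiff_tends/QpI0_tends.
have [th uth thE] := bfac0_unit kappa y0 uo.
have [u2 uu2 u2E] : exists2 u2 : Zp, u2 \is a GRing.unit & (2 * tau)%N%:R = p%:R ^ T%:Z * tofrac u2 :> Qp.
  by apply: nat_unit; rewrite muln_gt0.
have hR k : ord_ge (pseries_deriv (sdiff I f) k -
    p%:R ^ w' * tofrac (omega' * th * u2) * binom_series c (- (y + 1)) k)
    (u'%:Z + w' + Num.ceil (k%:R * lamt)).
  rewrite sdiff_deriv.
  have tE i : (0 < i)%N -> 'C(k + i, i)%:R * pseries_deriv f (k + i)%N * dlt i =
     p%:R ^ w * tofrac omega' * ('C(k + i, i)%:R * binom_series c (- y) (k + i)%N) * dlt i +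
     'C(k + i, i)%:R * (p%:R ^ (u%:Z + w) * tofrac (g (k + i)%N)) * dlt i.
    move=> i0; rewrite hf gtn_eqF ?addn_gt0 ?i0 ?orbT// addr0.
    exact: fid_terms.
  rewrite (eq_big_nat _ _ (F2 := fun i => p%:R ^ w * tofrac omega' * ('C(k + i, i)%:R * binom_series c (- y) (k + i)%N) * dlt i +
     'C(k + i, i)%:R * (p%:R ^ (u%:Z + w) * tofrac (g (k + i)%N)) * dlt i)); last first.
    by move=> i /andP[i0 _]; exact: tE.
  rewrite big_split /= big_ltn//.
  have -> : p%:R ^ w * tofrac omega' * ('C(k + 1, 1)%:R * binom_series c (- y) (k + 1)%N) * dlt 1 =
     p%:R ^ w' * tofrac (omega' * th * u2) * binom_series c (- (y + 1)) k.
    rewrite binom_series_split big_ord_recr big_ord0 /= mul1r divr1 thE dlt_odd// expr0 mulr1 u2E.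
    have -> : p%:R ^ w' = p%:R ^ w * p%:R ^ (kappa%:Z + iota' p y) * p%:R ^ T%:Z :> Qp.
      by rewrite -!expfzDr ?pQ_neq0//; congr (_ ^ _); rewrite !addrA.
    rewrite !rmorphM /=; exact: fid_lead.
  set S2 := \sum_(2 <= i < I) _; set S3 := \sum_(1 <= i < I) _.
  rewrite -addrA addrAC subrr add0r; apply: ord_geD.
    by rewrite /S2 big_nat; apply: ord_ge_sum => i /andP[i1 _]; exact: sdiff_main_ord.
  by rewrite /S3 big_nat; apply: ord_ge_sum => i /andP[i1 _]; exact: sdiff_rest_ord.
have cl0 k : 0 <= Num.ceil (k%:R * lamt).
  by rewrite ceil_ge0; apply: lt_le_trans (_ : 0 <= _); [rewrite ltrN10|rewrite mulr_ge0 ?ler0n ?ltW//; move: lamt0].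
have ex k : exists a : Zp, pseries_deriv (sdiff I f) k -
    p%:R ^ w' * tofrac (omega' * th * u2) * binom_series c (- (y + 1)) k =
    p%:R ^ (u'%:Z + w') * tofrac a /\ ord_ge (tofrac a) (Num.ceil (k%:R * lamt)).
  have [a ha] := hR k.
  have [b hb] : ord_ge (p%:R ^ Num.ceil (k%:R * lamt) * tofrac a : Qp) 0.
    by apply: (ord_geW (cl0 k)); exists a.
  exists b; rewrite expr0z mul1r in hb; rewrite -hb; split; last by exists a.
  by rewrite ha expfzDr ?pQ_neq0// mulrA.
have [g' hg'] := boolp.choice ex.
exists omega, (omega' * th * u2); split=> //; first by rewrite !unitrM uo' uth uu2.
(* The new gamma0 is 0: the old one sits in the coefficient 0 of f', which the terms i >= 1 do not
   reach. *)
split=> //; exists 0, g'; split.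
  split=> [N|k]; last exact: (hg' k).2.
  exists (Num.bound (`|N|%:~R / lamt)) => k hk; apply: ord_geW (hg' k).2.
  rewrite -[leLHS](@intrKceil R); apply: le_ceil.
  have l0 : 0 < lamt by move: lamt0.
  have h1 : `|N|%:~R / lamt < (Num.bound (`|N|%:~R / lamt))%:R.
    by apply: archi_boundP; apply: divr_ge0; [rewrite ler0z|exact: ltW].
  have h2 : `|N|%:~R < k%:R * lamt.
    by rewrite -ltr_pdivrMr//; apply: lt_le_trans h1 _; rewrite ler_nat.
  apply: le_trans (ltW h2); rewrite ler_int; exact: ler_norm.
move=> k; have [h _] := hg' k; rewrite iota_add1// -h rmorph0 mulr0 if_same addr0.
by rewrite addrC subrK.
Qed.

End SdiffClass.
End SymDiff.

(** * Lower bounds for a datum *)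

Section MeanSquare.
Variable R : realType.
Local Notation C := (R[i]).

(** Parseval; X <= Q makes distinct indices below X incongruent modulo Q. *)
Lemma twist_mean_square (Q X : nat) (a : nat -> C) : (0 < Q)%N -> (X <= Q)%N ->
  (forall j, nrm (a j) = 1) ->
  \sum_(t < Q) nrm (\sum_(j < X) a j * ez R Q (t%:Z * j%:Z)) ^+ 2 = Q%:R * X%:R.
Proof.
move=> Q0 XQ ua; apply: (@complexI R); rewrite rmorph_sum /=.
transitivity (\sum_(j < X) \sum_(i < X) a j * (a i)^*%C *
   \sum_(t < Q) ez R Q (t%:Z * (j%:Z - i%:Z)) : C).
  under eq_bigr => t _.
    rewrite nrm_sqr conj_sum mulr_suml.
    under eq_bigr => j _.
      rewrite mulr_sumr.
      under eq_bigr => i _.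
        have -> : a j * ez R Q (t%:Z * j%:Z) * (a i * ez R Q (t%:Z * i%:Z))^*%C =
           a j * (a i)^*%C * ez R Q (t%:Z * (j%:Z - i%:Z)) :> C.
          rewrite conjM -ezN mulrACA -ezD; congr (_ * ez _ _ _); ring.
        over.
      over.
    over.
  rewrite exchange_big /=; apply: eq_bigr => j _; rewrite exchange_big /=.
  by apply: eq_bigr => i _; rewrite mulr_sumr.
transitivity (\sum_(j < X) (Q%:R : C)); last first.
  by rewrite sumr_const card_ord rmorphM !rmorph_nat /= mulr_natr.
apply: eq_bigr => j _; rewrite (bigD1 j)//= subrr.
rewrite [X in _ + X]big1 ?addr0 => [|i ij].
  have -> : a j * (a j)^*%C = 1 :> C by rewrite -nrm_sqr ua expr1n.
  by rewrite ez_orth// dvdz0 mul1r.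
rewrite ez_orth// ifF ?mulr0//; apply/negbTE/negP => /dvdzP[k kE].
have iX := ltn_ord i; have jX := ltn_ord j.
have : k = 0 by nia.
by move=> k0; move: ij; rewrite -val_eqE /= => /eqP; apply; move: kE; rewrite k0; lia.
Qed.

End MeanSquare.

Lemma fid_base (G : fieldType) (b0 b1 x t S : G) :
  b0 * x ^+ 0 + ((b1 + t) * x ^+ 1 + S) = b0 * x ^+ 0 + ((b1 + 0) * x ^+ 1 + S) + t * x.
Proof. by rewrite expr1; ring. Qed.

Lemma fid_base2 (G : fieldType) (e0 e1 s tm q : G) :
  (e0 - (s + tm) - (e1 - s)) / q = e0 / q - (e1 / q + tm / q).
Proof. by ring. Qed.

Section Base.
Variables (R : realType) (p : nat) (pr : prime p).
Local Notation Zp := (padicZ pr).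
Local Notation Qp := (padicQ pr).
Local Notation C := (R[i]).

Lemma exp_sumE (f : nat -> Qp) n M (B : R) :
  exp_sum f n M B = isum (phase R f n) (M + 1) (Num.truncn B).
Proof.
rewrite /exp_sum /isum; apply: eq_bigr => i _; rewrite /phase.
by rewrite -addrA -PoszD add1n.
Qed.

Variables (y : rat) (kappa : nat).
Hypotheses (y0 : 0 < y) (kap1 : 1 + iota' p 2 <= kappa%:Z).
Local Notation c := (p%:R ^ (iota_ p y + kappa%:Z) * tofrac 1 : Qp).

Definition base0 (k : nat) : Qp := if k is k'.+1 then binom_series c (- y) k' / k%:R else 0.
(* A series with derivative (1 + c X)^(-y) + t. *)
Definition base (t : int) (k : nat) : Qp := base0 k + (if k == 1%N then t%:~R else 0).

Lemma base0_ord k : ord_ge (base0 k.+1) (k%:Z * kappa%:Z - (k %/ p.-1)%N%:Z).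
Proof.
rewrite /base0; have -> : binom_series c (- y) k / k.+1%:R = (\prod_(i < k) bfac y c i) / (k.+1`!)%:R :> Qp.
  rewrite -binom_seriesE; apply: fid_div; rewrite ?natQ_neq0 ?fact_gt0//.
  by rewrite factS natrM mulrCA [RHS]mulrC; congr (_ * _); exact: mulrC.
have h : ord_ge (\prod_(i < k) bfac y c i) (k%:Z * kappa%:Z).
  by apply: prod_bfac_ord => //; exact: unitr1.
by have := ord_geM h (ord_ge_factV pr (ltn0Sn k)).
Qed.

Lemma kap_slope k : (k <= 2 * (k * kappa - k %/ p.-1))%N /\ (k %/ p.-1 <= k * kappa)%N.
Proof.
have p1 : (0 < p.-1)%N by have := prime_gt1 pr; case: (p) => [|[]].
have h : (k %/ p.-1 * p.-1 <= k)%N by rewrite leq_trunc_div.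
have := kap1; rewrite iota'_2//; have := prime_gt1 pr.
have [->|p2] := eqVneq p 2%N => /= p1' hk; first by rewrite divn1; nia.
have p3 : (2 <= p.-1)%N by lia.
have h2 : (k %/ p.-1 * 2 <= k)%N by apply: leq_trans h; rewrite leq_mul2l p3 orbT.
have h3 : (k <= k * kappa)%N by rewrite leq_pmulr//; lia.
by move: h2 h3; move: (_ %/ _)%N (k * kappa)%N => q Q; clear; lia.
Qed.

Lemma base_I0 t : QpI0 (base t).
Proof.
apply: tends_QpI0 => N; exists (2 * `|N|%N + 2)%N => -[|[|k]] hk; rewrite ?addnS// in hk *.
rewrite /base /= addr0; apply: ord_geW (base0_ord k.+1).
by have [h1 h2] := kap_slope k.+1; lia.
Qed.

Lemma base_class t (lam : R) (u : nat) : 0 <= lam -> class_F 0 y kappa lam u (base t).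
Proof.
move=> l0; exists 1, 1; split; rewrite ?unitr1//; split; first exact: base_I0.
exists (t%:~R), (fun=> 0); split.
  by split=> [N|k]; [exists 0%N => k _|]; rewrite rmorph0; exact: ord_ge0.
move=> k; rewrite /pseries_deriv /base /base0 (rmorph1 (@tofrac Zp)) rmorph0 mulr0 addr0 expr0z !mul1r.
rewrite mulrDr; congr (_ + _); first by rewrite mulrC divfK// natQ_neq0.
by case: k => [|k] /=; rewrite ?mulr0// mul1r rmorph_int.
Qed.

(** The freedom of gamma0 in the class F amounts to arbitrary linear twists. *)
Lemma base_phase t n m : phase R (base t) n m = phase R (base 0) n m * ez R (p ^ n) (t * m).
Proof.
have [K0 hK0] := QpI0_tends (base_I0 t) n%:Z; have [K1 hK1] := QpI0_tends (base_I0 0) n%:Z.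
set K := maxn 2 (maxn K0 K1).
have h0 k : (K <= k)%N -> ord_ge (base t k) n%:Z.
  by rewrite !geq_max => /and3P[_ h _]; exact: hK0.
have h1 k : (K <= k)%N -> ord_ge (base 0 k) n%:Z.
  by rewrite !geq_max => /and3P[_ _ h]; exact: hK1.
have e0 := pseries_evalP m (base_I0 t) h0; have e1 := pseries_evalP m (base_I0 0) h1.
have ps : psum (base t) m%:~R K = psum (base 0) m%:~R K + (t * m)%:~R.
  have [k ->] : exists k, K = k.+2 by exists (K - 2)%N; rewrite /K; lia.
  rewrite /psum !(big_ord_recl k.+1) !(big_ord_recl k) /= /base /=.
  have e (j : nat) (r s : int) : (base0 (bump 0 (bump 0 j)) + (if bump 0 (bump 0 j) == 1%N then r%:~R else 0)) =
       (base0 (bump 0 (bump 0 j)) + (if bump 0 (bump 0 j) == 1%N then s%:~R else 0)).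
    by rewrite /bump /= !add1n.
  under eq_bigr => j _ do rewrite (e j t 0).
  rewrite addr0 rmorphM /=; exact: fid_base.
rewrite ps in e0; rewrite -e_padic_ez -e_padicD; apply: e_padic_cong.
have := ord_geM (ord_geB e0 e1) (ord_ge_pz pr (- n%:Z)); rewrite subrr -exprnN.
by rewrite fid_base2.
Qed.

(* The second bound is the mean square over the linear twists t modulo p^n. *)
Lemma base_lower (lam : R) (u n X : nat) (E : R -> R) : 0 <= lam -> (0 < X)%N -> (X <= p ^ n)%N ->
  (forall f : nat -> Qp, class_F 0 y kappa lam u f -> forall (M : int) (B : R), 0 < B -> B <= X%:R ->
    `|exp_sum f n M B| <= (E B)%:C%C) ->
  1 <= E 1 /\ Num.sqrt X%:R <= E X%:R.
Proof.
move=> l0 X0 Xp hE.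
have hE' t M (b : nat) : (0 < b)%N -> (b <= X)%N -> nrm (isum (phase R (base t) n) (M + 1) b) <= E b%:R.
  move=> b0 bX; have := hE _ (base_class t u l0) M b%:R; rewrite ltr0n ler_nat => /(_ b0 bX).
  by rewrite exp_sumE natrK nrmE lecR.
split.
  have := hE' 0 0 1%N isT X0; rewrite /isum big_ord_recr big_ord0 /= add0r addr0 phase_uni.
  by rewrite mulr1n.
have p0 : (0 < p ^ n)%N by rewrite expn_gt0 prime_gt0.
have ms := @twist_mean_square R (p ^ n) X (fun j => phase R (base 0) n (0 + 1 + j%:Z)) p0 Xp (fun j => phase_uni _ _ _ _).
have hX t : nrm (\sum_(j < X) phase R (base 0) n (0 + 1 + j%:Z) * ez R (p ^ n) (t * j%:Z)) <= E X%:R.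
  have := hE' t 0 X X0 (leqnn X); congr (_ <= _).
  rewrite /isum; under eq_bigr => j _.
    rewrite base_phase; have -> : t * (0 + 1 + j%:Z) = t * j%:Z + t by ring.
    rewrite ezD mulrA; over.
  by rewrite -mulr_suml nrmM nrm_ez mulr1.
have E0 : 0 <= E X%:R := le_trans (nrm_ge0 _) (hX 0).
have h : (p ^ n)%:R * X%:R <= (p ^ n)%:R * E X%:R ^+ 2.
  rewrite -ms; apply: (@le_trans _ _ (\sum_(t < p ^ n) E X%:R ^+ 2)).
    by apply: ler_sum => t _; rewrite ler_pXn2r ?nnegrE ?nrm_ge0// hX.
  by rewrite sumr_const card_ord mulr_natl.
rewrite ler_pM2l ?ltr0n// in h.
by rewrite -[leRHS]ger0_norm// -sqrtr_sqr ler_wsqrtr.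
Qed.

End Base.

(** * Well-formedness of the transformed data *)

Section WellFormed.
Variable R : realType.
Implicit Types (y : rat) (p kappa : nat) (lam : R).

Lemma admissibleW y y' p kappa lam : 0 < y' -> admissible y p kappa lam -> admissible y' p kappa lam.
Proof. by move=> y'0 [_ ? ? ?]. Qed.

(** The values at y = 1 serve as the generic function. *)
Lemma J1_intro (T : Type) (Y : T -> Prop) (g : rat -> nat -> nat -> R -> T) :
  (forall y p kappa lam, admissible y p kappa lam -> Y (g y p kappa lam)) ->
  (forall y, 0 < y -> exists P0 : seq nat, forall p kappa lam, admissible y p kappa lam ->
    p \notin P0 -> g y p kappa lam = g 1 p kappa lam) -> J1 Y g.
Proof. by move=> hY hg; split=> //; exists (g 1). Qed.

Lemma J_intro (T : Type) (Y : T -> Prop) (g : rat -> nat -> T) :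
  (forall y p, 0 < y -> prime p -> Y (g y p)) ->
  (forall y, 0 < y -> exists P0 : seq nat, forall p, prime p ->
    p \notin P0 -> g y p = g 1 p) -> J Y g.
Proof. by move=> hY hg; split=> //; exists (g 1). Qed.

Lemma J1_elim (T : Type) (Y : T -> Prop) (g : rat -> nat -> nat -> R -> T) y1 y2 :
  J1 Y g -> 0 < y1 -> 0 < y2 -> exists P0 : seq nat, forall p kappa lam,
    admissible y1 p kappa lam -> p \notin P0 -> g y1 p kappa lam = g y2 p kappa lam.
Proof.
move=> [_ [g0 hg]] h1 h2; have [P1 hP1] := hg _ h1; have [P2 hP2] := hg _ h2.
exists (P1 ++ P2) => p kappa lam ad; rewrite mem_cat negb_or => /andP[n1 n2].
by rewrite hP1// hP2//; exact: admissibleW ad.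
Qed.

Lemma J_elim (T : Type) (Y : T -> Prop) (g : rat -> nat -> T) y1 y2 :
  J Y g -> 0 < y1 -> 0 < y2 -> exists P0 : seq nat, forall p,
    prime p -> p \notin P0 -> g y1 p = g y2 p.
Proof.
move=> [_ [g0 hg]] h1 h2; have [P1 hP1] := hg _ h1; have [P2 hP2] := hg _ h2.
exists (P1 ++ P2) => p pp; rewrite mem_cat negb_or => /andP[n1 n2].
by rewrite hP1// hP2.
Qed.

Lemma ordp_generic y : 0 < y -> exists P0 : seq nat, forall p, p \notin P0 -> ordp p y = 0.
Proof.
move=> y0; exists (primes `|numq y| ++ primes `|denq y|) => p.
rewrite mem_cat negb_or -!logn_gt0 -!eqn0Ngt /ordp => /andP[/eqP -> /eqP ->].
by rewrite subrr.
Qed.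

Lemma iota'_ge0 (y : rat) (p : nat) : 0 <= iota' p y.
Proof. by rewrite /iota' le_max lexx. Qed.

Lemma rho_gt0 p : prime p -> 0 < rho R p.
Proof. by move=> pp; rewrite invr_gt0 subr_gt0 ltr1n prime_gt1. Qed.

Lemma kappa_rhoy_gt0 y p kappa lam : admissible y p kappa lam -> rhoy R p y < kappa%:R.
Proof.
move=> [_ pp k1 _]; rewrite iota'_2// in k1; have p1 := prime_gt1 pp.
have k0 : (0 : R) < kappa%:R by rewrite ltr0n; lia.
rewrite /rhoy; case: ifP => // _.
apply: (@lt_le_trans _ _ (1 + (p == 2%N : nat)%:R)).
  have [->|p2] := eqVneq p 2%N; first by rewrite /rho (_ : 2 - 1 = 1 :> R); [rewrite invr1 ltrDl|lra].
  have p3 : (3 <= p%:R :> R) by rewrite ler_nat; lia.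
  by rewrite /rho addr0 invf_lt1; lra.
by rewrite -[1]/(1%:R) -natrD ler_nat; lia.
Qed.

(** Since rho_p (p - 1) = 1, both kappa and kappa - rho_p are multiples of rho_p; [kappa_rhoy_gt0]
    makes the multiplier positive. *)
Lemma lamt_admissible y y1 p kappa lam : 0 < y1 -> admissible y p kappa lam ->
  admissible y1 p kappa (lamt y p kappa lam).
Proof.
move=> y10 ad; have := kappa_rhoy_gt0 ad; case: ad => [y0 pp k1 [j [j0 lE]]] kr.
split=> //; rewrite /lamt; case: leP => _; last by exists j.
have r0 := rho_gt0 pp; have p1 := prime_gt1 pp.
have kp : (0 < kappa)%N by have := iota'_ge0 2 p; lia.
have rp : rho R p * (p.-1)%:R = 1.
  have pE1 : (p%:R - 1 : R) = p.-1%:R by rewrite -subn1 natrB// prime_gt0.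
  by rewrite /rho pE1 mulVf// pnatr_eq0; lia.
move: kr; rewrite /rhoy; case: ifP => _ kr.
  have e : kappa%:R - rho R p = rho R p * (kappa * p.-1 - 1)%N%:R.
    rewrite natrB; last by rewrite muln_gt0; lia.
    by rewrite natrM mulrBr mulrCA rp !mulr1.
  exists (kappa * p.-1 - 1)%N; split=> //.
  by rewrite -(ltr0n R) -(pmulr_rgt0 _ r0) -e subr_gt0.
exists (kappa * p.-1)%N; split; first by rewrite muln_gt0; lia.
by rewrite natrM mulrCA rp mulr1 subr0.
Qed.

Lemma le_maxl_head (T : orderType ring_display) (x : T) s : x <= maxl x s.
Proof. by elim: s => //= z s IH; rewrite le_max IH orbT. Qed.

Lemma pm_ge (T : orderType ring_display) (g : rat -> T) y : g y <= pm g y.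
Proof. by rewrite /pm le_max lexx. Qed.

Section Transforms.
Variable q : exponent_tuple R.
Hypothesis wf : well_formed q.

(** The common reference point is 2 = 1 + 1, the shifted argument that belongs to y = 1. *)
Lemma generic_agree y : 0 < y -> exists P0 : seq nat, forall p, prime p -> p \notin P0 ->
  [/\ iota' p y = 0, iota' p (y * (y + 1)) = 0 & ordp p y = 0] /\
  [/\ ordp p y^-1 = 0, iota' p (y + 1) = 0 & iota' p (y^-1 + 1) = 0] /\
  [/\ ekappa0 q (y + 1) p = ekappa0 q 2 p, ekappa0 q (y^-1 + 1) p = ekappa0 q 2 p,
      elambda0 q (y + 1) p = elambda0 q 2 p & elambda0 q (y^-1 + 1) p = elambda0 q 2 p] /\
  forall kappa lam, admissible 1 p kappa lam ->
  [/\ er q (y + 1) p kappa lam = er q 2 p kappa lam,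
      er q (y^-1 + 1) p kappa lam = er q 2 p kappa lam,
      en0 q (y + 1) p kappa lam = en0 q 2 p kappa lam &
      en0 q (y^-1 + 1) p kappa lam = en0 q 2 p kappa lam] /\
  (eu0 q (y + 1) p kappa lam = eu0 q 2 p kappa lam /\
   eu0 q (y^-1 + 1) p kappa lam = eu0 q 2 p kappa lam).
Proof.
move=> y0; case: wf => _ [[Jr Jn Ju Jk Jl] _].
have i0 : 0 < y^-1 by rewrite invr_gt0.
have y1 : 0 < y + 1 by rewrite addr_gt0.
have i1 : 0 < y^-1 + 1 by rewrite addr_gt0.
have t0 : (0 : rat) < 2 by [].
have [S1 h1] := ordp_generic y0; have [S2 h2] := ordp_generic i0.
have [S3 h3] := ordp_generic y1; have [S4 h4] := ordp_generic i1.
have [S5 h5] := ordp_generic (mulr_gt0 y0 y1).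
have [S6 h6] := J_elim Jk y1 t0; have [S7 h7] := J_elim Jk i1 t0.
have [S8 h8] := J_elim Jl y1 t0; have [S9 h9] := J_elim Jl i1 t0.
have [S10 h10] := J1_elim Jr y1 t0; have [S11 h11] := J1_elim Jr i1 t0.
have [S12 h12] := J1_elim Jn y1 t0; have [S13 h13] := J1_elim Jn i1 t0.
have [S14 h14] := J1_elim Ju y1 t0; have [S15 h15] := J1_elim Ju i1 t0.
exists (flatten [:: S1; S2; S3; S4; S5; S6; S7; S8; S9; S10; S11; S12; S13; S14; S15]).
move=> p pp; rewrite /= cats0 !mem_cat !negb_or.
move=> /and4P[n1 n2 n3 /and4P[n4 n5 n6 /and4P[n7 n8 n9 /and4P[n10 n11 n12 /and3P[n13 n14 n15]]]]].
split; first by rewrite /iota' h1// h5.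
split; first by rewrite /iota' h2// h3// h4.
split; first by rewrite h6// h7// h8// h9.
move=> kappa lam ad; have a1 := admissibleW y1 ad; have a2 := admissibleW i1 ad.
by rewrite h10// h11// h12// h13// h14// h15.
Qed.

Lemma lamt_generic y p kappa lam : ordp p y = 0 -> lamt y p kappa lam = Num.min (kappa%:R - 0) lam.
Proof. by rewrite /lamt /rhoy => ->; rewrite eqxx. Qed.

Lemma generic_pair y z : 0 < y -> 0 < z -> exists P0 : seq nat, forall p kappa lam,
    admissible y p kappa lam -> p \notin P0 ->
  [/\ r_new q y p kappa lam = r_new q z p kappa lam,
      n0_new q y p kappa lam = n0_new q z p kappa lam &
      u0_new q y p kappa lam = u0_new q z p kappa lam].
Proof.
move=> y0 z0; have [P1 h1] := generic_agree y0; have [P2 h2] := generic_agree z0.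
exists (P1 ++ P2) => p kappa lam ad; rewrite mem_cat negb_or => /andP[n1 n2].
have pp : prime p by case: ad.
have [[a1 a2 a3] [[a4 a5 a6] [_ A]]] := h1 p pp n1; have [[b1 b2 b3] [[b4 b5 b6] [_ B]]] := h2 p pp n2.
have ly := lamt_generic kappa lam a3; have l1 := lamt_generic kappa lam b3.
have adl := lamt_admissible ltr01 ad; rewrite ly in adl.
have [[A1 A2 A3 A4] [A5 A6]] := A _ _ adl; have [[B1 B2 B3 B4] [B5 B6]] := B _ _ adl.
have ry : r_pm q y p kappa lam = r_pm q z p kappa lam.
  by rewrite /r_pm /pm ly l1 A1 A2 B1 B2.
have uy : u_excess q y p kappa lam y = u_excess q z p kappa lam z.
  by rewrite /u_excess /eps ly l1 A5 B5 a3 b3.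
have uy' : u_excess q y p kappa lam y^-1 = u_excess q z p kappa lam z^-1.
  by rewrite /u_excess /eps ly l1 A6 B6 a4 b4.
split.
- by rewrite /r_new ry a5 a6 b5 b6.
- rewrite /n0_new /eps_u /pm uy uy' ry ly l1 A3 A4 B3 B4 /eps a3 a4 b3 b4.
  generalize (iota' p 12) (iota' p 2) => i12 i2.
  by rewrite a1 b1 a5 a6 b5 b6.
- by rewrite /u0_new ly l1 A5 A6 B5 B6 a1 a2 b1 b2 a6 b6.
Qed.

Lemma generic_pair0 y z : 0 < y -> 0 < z -> exists P0 : seq nat, forall p, prime p -> p \notin P0 ->
  kappa0_new q y p = kappa0_new q z p /\ lambda0_new q y p = lambda0_new q z p.
Proof.
move=> y0 z0; have [P1 h1] := generic_agree y0; have [P2 h2] := generic_agree z0.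
exists (P1 ++ P2) => p pp; rewrite mem_cat negb_or => /andP[n1 n2].
have [[a1 a2 a3] [[a4 a5 a6] [[A1 A2 A3 A4] _]]] := h1 p pp n1.
have [[b1 b2 b3] [[b4 b5 b6] [[B1 B2 B3 B4] _]]] := h2 p pp n2.
by rewrite /kappa0_new /lambda0_new /pm /rhoy a3 b3 A1 A2 A3 A4 B1 B2 B3 B4.
Qed.

Lemma transform_exponents : 0 <= ek q <= 2^-1 -> 2^-1 <= el q <= 1 ->
  0 <= k_new q <= 2^-1 /\ 2^-1 <= l_new q <= 1.
Proof.
rewrite /k_new /l_new; move: (ek q) (el q) => k l /andP[k0 k1] /andP[l0 l1].
have hh : (2^-1 : R) * 2 = 1 by rewrite mulVf.
have d0 : 0 < 2 * (k + 1) by lra.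
have ne := gt_eqF d0.
rewrite divr_ge0 ?(ltW d0)//= !ler_pdivrMr// ler_pdivlMr//; split; lra.
Qed.

Lemma wf_generic : well_formed (transform_generic q).
Proof.
have [[hk hl hd] [[Jr Jn Ju Jk Jl] hn]] := wf.
have [hk' hl'] := transform_exponents hk hl.
have n0gt y p kappa lam : admissible y p kappa lam -> kappa%:Z + iota' p y < n0_new q y p kappa lam.
  move=> ad; rewrite /n0_new ltrDl; case: (ad) => y0 pp k1 _.
  have k0 : (0 < kappa)%N.
    by move: k1 (iota'_ge0 2 p); generalize (iota' p 2) => z; clear; lia.
  rewrite -(ltr_int R); apply: lt_le_trans (ceil_ge _).
  apply: lt_le_trans (le_maxl_head _ _); apply: lt_le_trans (pm_ge _ _).
  have i1 : 0 <= (iota' p (y + 1))%:~R :> R by rewrite ler0z /iota' le_max lexx.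
  have i2 : 0 <= (iota' p 12)%:~R :> R by rewrite ler0z /iota' le_max lexx.
  have k0R : 0 < kappa%:R :> R by rewrite ltr0n.
  lra.
split; first by split=> //=; rewrite divr_ge0// le_max ler01.
split=> //; split=> /=.
- apply: J1_intro => // y y0; have [P0 h] := generic_pair y0 (ltr01 : 0 < 1 :> rat).
  by exists P0 => p kappa lam ad nP; have [] := h p kappa lam ad nP.
- apply: J1_intro => [y p kappa lam ad|y y0].
    apply: le_lt_trans (n0gt _ _ _ _ ad); rewrite addr_ge0 ?ler0z//.
    by rewrite /iota' le_max lexx.
  have [P0 h] := generic_pair y0 (ltr01 : 0 < 1 :> rat).
  by exists P0 => p kappa lam ad nP; have [] := h p kappa lam ad nP.
- apply: J1_intro => [y p kappa lam ad|y y0].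
    by apply: lt_le_trans (le_maxl_head _ _).
  have [P0 h] := generic_pair y0 (ltr01 : 0 < 1 :> rat).
  by exists P0 => p kappa lam ad nP; have [] := h p kappa lam ad nP.
- apply: J_intro => [y p y0 pp|y y0].
    rewrite /kappa0_new -(ltr_int R); apply: lt_le_trans (ceil_ge _).
    apply: lt_le_trans (le_maxl_head _ _).
    by rewrite ltr_int ltr_pwDl// /iota' le_max lexx.
  by have [P0 h] := generic_pair0 y0 (ltr01 : 0 < 1 :> rat); exists P0 => p pp nP; have [] := h p pp nP.
- apply: J_intro => [y p y0 pp|y y0].
    by rewrite /lambda0_new le_max mulr_ge0 ?orbT// ltW// rho_gt0.
  by have [P0 h] := generic_pair0 y0 (ltr01 : 0 < 1 :> rat); exists P0 => p pp nP; have [] := h p pp nP.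
Qed.

Lemma wf_k0 : well_formed (transform_k0 q).
Proof.
have [[hk hl hd] [[Jr Jn Ju Jk Jl] hn]] := wf.
have [hk' hl'] := transform_exponents hk hl.
split; first by split=> //=; rewrite divr_ge0.
split=> //; split=> //=.
apply: J1_intro => // y y0; have [P0 h] := J1_elim Jr y0 (ltr01 : 0 < 1 :> rat).
by exists P0 => p kappa lam ad nP; rewrite (h p kappa lam ad nP).
Qed.

Lemma iota'_1 (p : nat) : iota' p 1 = 0.
Proof. by rewrite /iota' /ordp /= !logn1. Qed.

Lemma wf_l1 : well_formed (transform_l1 q).
Proof.
have [[hk hl hd] _] := wf; have [hk' hl'] := transform_exponents hk hl.
have k0 : 0 <= ek q by case/andP: hk.
split; first by split=> //=; rewrite divr_ge0// addr_ge0.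
have n0gt y (p : nat) (kappa : nat) : kappa%:Z + iota' p y < kappa%:Z + iota' p y + 1 + iota' p 12.
  by have := iota'_ge0 12 p; lia.
have gen y : 0 < y -> exists P0 : seq nat, forall p, p \notin P0 -> iota' p y = 0.
  by move=> y0; have [P0 h] := ordp_generic y0; exists P0 => p /h; rewrite /iota' => ->.
split; last by move=> y p kappa lam _ /=; exact: n0gt.
split=> /=.
- by apply: J1_intro => // y y0; exists [::].
- apply: J1_intro => [y p kappa lam _|y y0].
    by have := iota'_ge0 12 p; have := iota'_ge0 y p; lia.
  by have [P0 h] := gen y y0; exists P0 => p kappa lam _ /h ->; rewrite iota'_1.
- apply: J1_intro => [y p kappa lam _|y y0]; first by rewrite lt_max ltr01 orbT.
  by have [P0 h] := gen y y0; exists P0 => p kappa lam _ /h ->; rewrite iota'_1.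
- apply: J_intro => [y p _ _|y y0]; last by exists [::].
  by have := iota'_ge0 4 p; lia.
- by apply: J_intro => [y p _ pp|y y0]; [rewrite ltW// rho_gt0|exists [::]].
Qed.

End Transforms.
End WellFormed.

(** * The three cases *)

Lemma maxl4_le (T : orderType ring_display) (x a b c d Z : T) : maxl x [:: a; b; c; d] <= Z ->
  [/\ x <= Z, a <= Z, b <= Z, c <= Z & d <= Z].
Proof. by rewrite /= !ge_max => /andP[? /andP[? /andP[? /andP[? ?]]]]; split. Qed.

Lemma maxl3_le (T : orderType ring_display) (x a b c Z : T) : maxl x [:: a; b; c] <= Z ->
  [/\ x <= Z, a <= Z, b <= Z & c <= Z].
Proof. by rewrite /= !ge_max => /andP[? /andP[? /andP[? ?]]]; split. Qed.

Lemma maxl5_le (T : orderType ring_display) (x a b c d f Z : T) : maxl x [:: a; b; c; d; f] <= Z ->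
  [/\ x <= Z, a <= Z & b <= Z] /\ [/\ c <= Z, d <= Z & f <= Z].
Proof. by rewrite /= !ge_max => /andP[? /andP[? /andP[? /andP[? /andP[? ?]]]]]; split. Qed.

Lemma pm_le (T : orderType ring_display) (g : rat -> T) y Z : pm g y <= Z -> g y <= Z.
Proof. exact/le_trans/pm_ge. Qed.

Section RealFacts.
Variable R : realType.

Lemma powR_sq (a x : R) : (a `^ x) ^+ 2 = a `^ (2 * x).
Proof. by rewrite -powR_mulrn ?powR_ge0// -powRrM mulrC. Qed.

Lemma powR_div (a b t : R) : 0 <= a -> 0 < b -> (a / b) `^ t = a `^ t * b `^ (- t).
Proof.
move=> a0 b0; rewrite powRM ?invr_ge0 ?(ltW b0)// -powR_inv1 ?(ltW b0)// -powRrM.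
by rewrite mulN1r.
Qed.

Lemma ln_pX (p n : nat) : prime p -> ln (p ^ n)%:R = n%:R * ln p%:R :> R.
Proof. by move=> pp; rewrite natrX lnXn ?ltr0n ?prime_gt0// mulr_natl. Qed.

Lemma pX_expz (p n : nat) (z : int) : z = n%:Z -> (p%:R ^ z : R) = (p ^ n)%:R.
Proof. by move=> ->; rewrite -exprnP natrX. Qed.

Lemma ln_ge0_nat (p : nat) : prime p -> 1 <= 2 * ln p%:R :> R.
Proof.
move=> pp; apply: le_trans (ln2_ge R) _; rewrite ler_pM2l//.
by rewrite ler_ln ?posrE ?ltr0n ?prime_gt0// ler_nat prime_gt1.
Qed.

(** The square root of [main_bound], with D weakened to kap + mn, the integer b to the real B, and
    delta to max(1, delta), which is possible because N ln p >= 1. *)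
Lemma final_ineq (p N D b : nat) (k l delta Cd K r mn kap B S : R) : prime p -> (2 <= N)%N ->
  0 < k -> 1 <= Cd -> 0 <= delta -> 0 < K -> kap + mn <= D%:R -> (0 < b)%N -> 0 < l + 1 ->
  b%:R <= B -> 0 <= S ->
  S ^+ 2 <= K * (b%:R * ((Cd * (N%:R * ln p%:R) `^ delta) *
    (p%:R `^ ((r + k + k * (N%:R - D%:R)) / (k + 1)) * b%:R `^ ((l - k) / (k + 1))))) ->
  S <= (K * Cd + 1) * (p%:R `^ ((r + k * (1 - kap - mn)) / (2 * (k + 1))) *
     ((p ^ N)%:R / B) `^ (k / (2 * (k + 1))) * B `^ ((k + l + 1) / (2 * (k + 1)))
     * ln (p ^ N)%:R `^ (Num.max 1 delta / 2)).
Proof.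
move=> pp N2 k0 Cd1 d0 K0 hD b0 l1 bB S0 hS.
have bR : 0 < b%:R :> R by rewrite ltr0n.
have B0 : 0 < B := lt_le_trans bR bB.
have k1 : 0 < k + 1 by lra.
have pR : 0 < p%:R :> R by rewrite ltr0n prime_gt0.
have Cd0 : 0 <= Cd by lra.
have KC : 0 < K * Cd by rewrite mulr_gt0//; lra.
set T := (X in S <= X).
have T0 : 0 <= T.
  by rewrite /T !mulr_ge0 ?powR_ge0//; lra.
rewrite -(@ler_pXn2r _ 2) ?nnegrE//; apply: le_trans hS _.
rewrite /T !exprMn !powR_sq ln_pX// powR_div//; set L := N%:R * ln p%:R.
have L1 : 1 <= L.
  have h1 := ln_ge0_nat pp; have N2R : 2 <= N%:R :> R by rewrite ler_nat.
  have l0 := ln_p_gt0 R pp; apply: le_trans h1 _; rewrite /L ler_pM2r//.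
have -> : (p ^ N)%:R `^ (2 * (k / (2 * (k + 1)))) = p%:R `^ (N%:R * (2 * (k / (2 * (k + 1))))) :> R.
  by rewrite [in RHS]powRrM pwn natrX.
have e1 : b%:R * ((Cd * L `^ delta) * (p%:R `^ ((r + k + k * (N%:R - D%:R)) / (k + 1)) * b%:R `^ ((l - k) / (k + 1))))
   = Cd * L `^ delta * (p%:R `^ ((r + k + k * (N%:R - D%:R)) / (k + 1)) * b%:R `^ ((l + 1) / (k + 1))).
  have -> : (l + 1) / (k + 1) = 1 + (l - k) / (k + 1) :> R by field; rewrite gt_eqF.
  have -> : b%:R `^ (1 + (l - k) / (k + 1)) = b%:R * b%:R `^ ((l - k) / (k + 1)) :> R.
    by rewrite powRD ?powRr1 ?(ltW bR)// (gt_eqF bR) implybT.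
  by ring.
rewrite e1.
have e2 : B `^ (- (2 * (k / (2 * (k + 1))))) * B `^ (2 * ((k + l + 1) / (2 * (k + 1)))) = B `^ ((l + 1) / (k + 1)).
  rewrite -powRD; last by rewrite (gt_eqF B0) implybT.
  by congr (_ `^ _); field; rewrite gt_eqF.
have e3 : p%:R `^ (2 * ((r + k * (1 - kap - mn)) / (2 * (k + 1)))) * p%:R `^ (N%:R * (2 * (k / (2 * (k + 1)))))
   = p%:R `^ ((r + k * (1 - kap - mn) + k * N%:R) / (k + 1)) :> R.
  rewrite -(pwD pp); congr (_ `^ _); field; by rewrite gt_eqF.
have -> : (K * Cd + 1) ^+ 2 * (p%:R `^ (2 * ((r + k * (1 - kap - mn)) / (2 * (k + 1)))) *
   (p%:R `^ (N%:R * (2 * (k / (2 * (k + 1))))) * B `^ (- (2 * (k / (2 * (k + 1)))))) *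
   B `^ (2 * ((k + l + 1) / (2 * (k + 1)))) * L `^ (2 * (Num.max 1 delta / 2))) =
   (K * Cd + 1) ^+ 2 * L `^ (2 * (Num.max 1 delta / 2)) *
   (p%:R `^ ((r + k * (1 - kap - mn) + k * N%:R) / (k + 1)) * B `^ ((l + 1) / (k + 1))).
  by rewrite -e2 -e3; ring.
have hq : K * Cd <= (K * Cd + 1) ^+ 2 by rewrite expr2; nra.
move: hq; move: ((K * Cd + 1) ^+ 2) => Q2 hq.
rewrite -[leRHS]mulrA -[Cd * _ * _]mulrA [leLHS]mulrA; apply: ler_pM => //; rewrite ?mulr_ge0 ?powR_ge0//.
  exact: ltW.
apply: ler_pM; rewrite ?powR_ge0 ?mulr_ge0 ?powR_ge0//.
  apply: ler_powR => //; rewrite mulrC divfK ?pnatr_eq0//.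
  by rewrite le_max lexx orbT.
apply: ler_pM; rewrite ?powR_ge0//.
  apply: (pw_le pp); rewrite ler_pM2r ?invr_gt0//.
  have : k * (kap + mn) <= k * D%:R by rewrite ler_pM2l.
  clear; lra.
apply: ge0_ler_powR; rewrite ?nnegrE ?(ltW bR) ?(ltW B0)//.
by rewrite divr_ge0 ?(ltW k1) ?(ltW l1).
Qed.

(** The constant and the logarithm are replaced by one factor that does not depend on the order of
    the shift, the [Lam] of [main_bound]. *)
Lemma datum_rescale (p X N : nat) (C r1 r k l delta B : R) : prime p -> 0 < C -> r1 <= r ->
  0 <= delta -> (X <= N)%N -> 0 < B ->
  C * (p%:R `^ r1 * ((p ^ X)%:R / B) `^ k * B `^ l * ln (p ^ X)%:R `^ delta) <=
  (Num.max 1 C * (N%:R * ln p%:R) `^ delta) * p%:R `^ r * ((p ^ X)%:R / B) `^ k * B `^ l.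
Proof.
move=> pp C0 rr d0 XN B0; have l0 := ln_p_gt0 R pp.
set u := _ `^ k; set v := B `^ l.
have -> : C * (p%:R `^ r1 * u * v * ln (p ^ X)%:R `^ delta) = C * ln (p ^ X)%:R `^ delta * p%:R `^ r1 * u * v by ring.
have u0 : 0 <= u by exact: powR_ge0.
have v0 : 0 <= v by exact: powR_ge0.
apply: ler_wpM2r => //; apply: ler_wpM2r => //.
apply: ler_pM; rewrite ?mulr_ge0 ?powR_ge0 ?(ltW C0)//; last exact: (pw_le pp).
apply: ler_pM; rewrite ?powR_ge0 ?(ltW C0)//; first by rewrite le_max lexx orbT.
rewrite ln_pX//; apply: ge0_ler_powR => //; rewrite ?nnegrE ?mulr_ge0 ?ler0n ?(ltW l0)//.
by rewrite ler_pM2r// ler_nat.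
Qed.

(** The exponent on the left is the least order of h = 2 tau for which the hypothesis [u'1] of
    [sdiff_class] holds; rounding and the terms for p <= 3 cost only a bounded factor. *)
Lemma chi_bound (p u' kappa : nat) (ux : R) : prime p ->
  (u'%:R - kappa%:R + (p == 2%N)%:R) <= ux -> ((p == 2%N) + 1 <= kappa)%N ->
  (p ^ (((u' + (p <= 3)).+1)./2 - kappa + (p == 2%N)))%:R <= 81%:R * p%:R `^ (Num.max 0 ux / 2).
Proof.
move=> pp hux k2; have p0 := prime_gt0 pp.
set x := (_ - kappa + _)%N; set M := Num.max 0 ux.
have h : x%:R <= M / 2 + (p <= 3)%N%:R :> R.
  have M0 : 0 <= M by rewrite le_max lexx.
  have M1 : ux <= M by rewrite le_max lexx orbT.
  have e2 : ((p == 2%N) <= (p <= 3)%N)%N by case: eqP => // ->.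
  have hn : (2 * x + kappa <= u' + (p == 2%N) + 2 * (p <= 3)%N)%N \/ (x <= (p <= 3)%N)%N.
    have := odd_double_half (u' + (p <= 3)%N).+1; rewrite /x.
    have : (odd (u' + (p <= 3)%N).+1 <= 1)%N by case: odd.
    move: e2 k2; move: (half _) => a; move: (nat_of_bool (odd _)) => o.
    by move: (nat_of_bool (p == 2%N)) (nat_of_bool (p <= 3)%N) => s t; clear; lia.
  case: hn => hn; last first.
    have : x%:R <= (p <= 3)%N%:R :> R by rewrite ler_nat.
    by move: M0; clear; lra.
  have : (2 * x + kappa)%N%:R <= (u' + (p == 2%N) + 2 * (p <= 3)%N)%N%:R :> R by rewrite ler_nat.
  rewrite (natrD R (2 * x)) (natrD R (u' + _)) (natrD R u') !(natrM R 2); move: hux M1; clear; lra.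
rewrite natrX -pwn; apply: le_trans (pw_le pp h) _.
rewrite (pwD pp) mulrC ler_pM2r ?powR_gt0 ?ltr0n// pwn -natrX ler_nat.
by case: (leqP p 3) => p3; rewrite ?expn0 ?expn1//; apply: leq_trans p3 _.
Qed.

End RealFacts.

Lemma int_nat (z : int) : 0 <= z -> exists m : nat, z = m%:Z.
Proof. by case: z => // m; exists m. Qed.

Section Generic.
Variable R : realType.

Section NewConditions.
Variables (q : exponent_tuple R) (y : rat) (p kappa : nat) (lam : R) (n u : nat) (w : int).
Hypothesis wf : well_formed q.
Hypothesis ad : admissible y p kappa lam.
Local Notation lt := (lamt y p kappa lam).
Local Notation k := (ek q).
Local Notation l := (el q).

Lemma lamt_conditions : (kappa0_new q y p <= kappa%:Z) -> lambda0_new q y p <= lam ->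
  [/\ ekappa0 q (y + 1) p <= kappa%:Z, elambda0 q (y + 1) p <= lt, rho R p <= lam &
      [/\ 0 < lt, lt <= kappa%:R - rhoy R p y & lt <= lam]].
Proof.
move=> hk hl; have pp : prime p by case: ad.
have r0 := rho_gt0 R pp.
have := hk; rewrite /kappa0_new ceil_le_int => /maxl3_le[_ h1 h2 h3].
move: hl; rewrite /lambda0_new ge_max => /andP[h4 h5].
have {}h1 := pm_le h1; have {}h2 := pm_le h2; have {}h4 := pm_le h4.
have kE : (kappa%:Z%:~R : R) = kappa%:R by [].
rewrite kE in h2 h3.
split; first by move: h1; rewrite ler_int.
- by rewrite /lamt le_min h4 andbT lerBrDl.
- by move: h5 r0; lra.
split.
- by rewrite /lamt lt_min; apply/andP; split; [move: h3 r0; lra|move: h5 r0; lra].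
- by rewrite /lamt ge_min lexx.
- by rewrite /lamt ge_min lexx orbT.
Qed.

(** In terms of N0 = n0(y + 1) - D and N = n - w - kappa - iota'(y) the entries of the new n0 become
    the hypotheses of [main_bound]. *)
Lemma generic_params : (w + n0_new q y p kappa lam <= n%:Z) ->
  exists D N0 N : nat, [/\ D%:Z = kappa%:Z + iota' p (y + 1),
    en0 q (y + 1) p kappa lt = N0%:Z + D%:Z, (0 < N0)%N, (0 < D)%N &
    n%:Z = w + kappa%:Z + iota' p y + N%:Z] /\
    [/\ (2 * D <= N)%N, (N0 + 2 * D <= N + 1)%N, (3 * N0 + 2 * D <= 2 * N + 3)%N,
     (2 * (r_pm q y p kappa lam + D%:R) + (k - 1)) / (1 - l) <= N%:R &
     eps_u q y p kappa lam * ((2 * k + 1 - l) / k * (u_excess q y p kappa lam y)%:~R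
             - (r_pm q y p kappa lam - 1) / (k * (k + 1))
             + D%:R / (k + 1)) <= N%:R].
Proof.
case: wf => _ [_ hnk]; case: (ad) => y0 pp k1 _; have y1 : 0 < y + 1 by rewrite addr_gt0.
have i2 := iota'_ge0 2 p; have kp : (0 < kappa)%N by move: k1 i2; generalize (iota' p 2) => z; clear; lia.
have ad1 := lamt_admissible y1 ad; have hD0 := hnk _ _ _ _ ad1.
have i1 := iota'_ge0 (y + 1) p.
have [D DE] : exists D : nat, D%:Z = kappa%:Z + iota' p (y + 1).
  by exists (absz (kappa%:Z + iota' p (y + 1))); rewrite gez0_abs// addr_ge0.
have D0 : (0 < D)%N by move: DE i1 kp; generalize (iota' p (y + 1)) => z; clear; lia.
rewrite -DE in hD0.
have [N0 N0E] : exists N0 : nat, en0 q (y + 1) p kappa lt = N0%:Z + D%:Z.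
  have [|N NE] := @int_nat (en0 q (y + 1) p kappa lt - D%:Z); first by rewrite subr_ge0 ltW.
  by exists N; rewrite -NE subrK.
have N00 : (0 < N0)%N by move: hD0; rewrite N0E; clear; lia.
rewrite /n0_new => hn; set c := Num.ceil _ in hn.
have c0 : 0 <= c.
  rewrite /c ceil_ge0; apply: (@lt_le_trans _ _ 0); first by rewrite ltrN10.
  apply: le_trans (le_maxl_head _ _); apply: le_trans (pm_ge _ _).
  by rewrite !addr_ge0 ?mulr_ge0 ?ler0n ?ler0z ?iota'_ge0.
have [N NE] : exists N : nat, n%:Z = w + kappa%:Z + iota' p y + N%:Z.
  have [|N NE] := @int_nat (n%:Z - w - kappa%:Z - iota' p y); first by move: hn c0; clear; lia.
  by exists N; move: NE; clear; lia.
have : c <= N%:Z by move: hn NE; clear; lia.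
rewrite /c ceil_le_int -[(N%:Z)%:~R]/(N%:R : R) => /maxl5_le[[h1 h2 h3] [_ h5 h6]].
have {}h1 := pm_le h1; have {}h2 := pm_le h2; have {}h3 := pm_le h3.
have {}h5 := pm_le h5; have {}h6 := pm_le h6.
have DR : (D%:R : R) = kappa%:R + (iota' p (y + 1))%:~R by rewrite -[D%:R]/((D%:Z)%:~R) DE intrD.
have NR : (en0 q (y + 1) p kappa lt)%:~R = N0%:R + D%:R :> R by rewrite N0E intrD.
have i12 : 0 <= (iota' p 12)%:~R :> R by rewrite ler0z iota'_ge0.
exists D, N0, N; split=> //; split.
- by rewrite -(ler_nat R) (natrM R 2) DR; move: h1 i12; lra.
- rewrite -(ler_nat R) (natrD R N0) (natrM R 2) natrD; move: h2; rewrite NR DR; lra.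
- rewrite -(ler_nat R) (natrD R (3 * N0)) !(natrM R) natrD (natrM R 2); move: h3; rewrite NR DR; lra.
- by rewrite DR (addrA (r_pm _ _ _ _ _)).
- by rewrite DR.
Qed.

Lemma generic_u : (u0_new q y p kappa lam <= u%:Z) -> rho R p <= lam ->
  exists2 u' : nat, eu0 q (y + 1) p kappa lt = u'%:Z & [/\ (0 < u')%N,
    u'%:Z + kappa%:Z + iota' p y <= u%:Z + Num.floor lam,
    kappa%:Z + iota' p y + 1 <= u%:Z + Num.ceil lam &
    (lt <= lam -> 2 * kappa%:Z + iota' p y + iota' p (y + 1) + 1 <= u%:Z + Num.ceil (2 * lam))].
Proof.
move=> hu _; case: wf => _ [[_ _ [hu0 _] _ _] _]; case: (ad) => y0 pp k1 _.
have y1 : 0 < y + 1 by rewrite addr_gt0.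
have U0 := hu0 _ _ _ _ (lamt_admissible y1 ad).
have [h0 h1 _ h3 _] := maxl4_le hu; rewrite iota'_mul1// in h3.
exists (absz (eu0 q (y + 1) p kappa lt)); first by rewrite gez0_abs ?ltW.
rewrite absz_gt0 gt_eqF ?U0// gez0_abs ?(ltW U0)//.
have fc : Num.floor lam <= Num.ceil lam.
  by rewrite -(ler_int R); apply: le_trans (floor_le _) (ceil_ge _).
split=> //.
- by move: h1; lia.
- by move: h1 fc U0; lia.
move=> ll; have : Num.floor lam + Num.floor lt <= Num.ceil (2 * lam).
  rewrite -(ler_int R) intrD; apply: le_trans (ceil_ge _).
  by have := floor_le lam; have := floor_le lt; move: ll; lra.
by move: h3; lia.
Qed.

End NewConditions.

Lemma admissible_kappa (y : rat) (p kappa : nat) (lam : R) :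
  admissible y p kappa lam -> ((p == 2%N) + 1 <= kappa)%N.
Proof.
by case=> _ pp k1 _; rewrite iota'_2// in k1; move: (nat_of_bool _) k1 => b; clear; lia.
Qed.

Lemma datum_generic (q : exponent_tuple R) : padic_exponent_datum q ->
  0 < ek q <= 2^-1 -> 2^-1 <= el q < 1 -> padic_exponent_datum (transform_generic q).
Proof.
move=> [wf [C C0 hC]] /andP[k0 k1] /andP[l0 l1]; split; first exact: wf_generic.
have hh : (2^-1 : R) * 2 = 1 by rewrite mulVf.
have d0 : 0 <= edelta q by case: wf => -[].
have k2 : 2 * ek q <= 1 by move: k1 hh; lra.
have m0 : 0 <= el q - 2^-1 by rewrite subr_ge0.
have m1 : 2 * (el q - 2^-1) < 1 by move: l1 hh; lra.
have lE : el q = el q - 2^-1 + 1 / 2 by move: hh; lra.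
have Cd1 : 1 <= Num.max 1 C by rewrite le_max lexx.
have [K K0 hK] := main_bound k0 k2 m0 m1 lE d0 Cd1.
exists (K * Num.max 1 C + 1).
  by apply: addr_gt0 => //; apply: mulr_gt0 => //; apply: lt_le_trans Cd1.
move=> p pr y w kappa lam n u ad n0 u0 hk hl hn hu f hf M B X B0 BX.
rewrite /= in hk hl hn hu *.
rewrite exp_sumE nrmE lecR; set b := Num.truncn B.
have bB : b%:R <= B by rewrite /b truncn_le ltW.
have [b0|b0] := posnP b.
  rewrite b0 /isum big_ord0 nrm0 !mulr_ge0 ?powR_ge0//.
  by rewrite addr_ge0// mulr_ge0 ?(ltW K0)//; apply: le_trans Cd1.
have [D [N0 [N [[DE N0E N00 D0 NE] [g1 g2 g3 g5 g6]]]]] := generic_params wf ad hn.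
have XE : X = (p ^ N)%:R by apply: pX_expz; move: NE; clear; lia.
have [c1 c2 c3 [c4 c5 c6]] := lamt_conditions ad hk hl.
have [u' u'E [u'0 e1 e2 e3]] := generic_u wf ad hu c3.
have {}e3 := e3 c6.
case: (ad) => y0 _ kp lp; have y1 : 0 < y + 1 by rewrite addr_gt0.
have ad1 := lamt_admissible y1 ad.
have kk := admissible_kappa ad; have kap0 : (0 < kappa)%N by move: kk; clear; lia.
set lt := lamt y p kappa lam in c1 c2 c4 c5 c6 ad1 N0E u'E *.
have hDN : (D <= N)%N by move: g1; clear; lia.
have c2' : C2 p N (phase R f n) := class_C2 y0 kp hf NE c3 e2.
have c3' : C3 p (N - D) (phase R f n).
  by apply: (class_C3 y0 kp hf _ c3 e3); rewrite NE -subzn//; move: DE; clear; lia.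
have rr : er q (y + 1) p kappa lt <= r_pm q y p kappa lam by exact: pm_ge.
have dat (w1 : int) (V : nat) (f1 : nat -> padicQ pr) (n1 : nat) : (0 < n1)%N ->
    (n1%:Z = w1 + D%:Z + V%:Z) -> (N0 <= V)%N -> (V <= N)%N ->
    class_F w1 (y + 1) kappa lt u' f1 -> forall (M1 : int) (B1 : R), 0 < B1 -> B1 <= (p ^ V)%:R ->
    `|exp_sum f1 n1 M1 B1| <= (Num.max 1 C * (N%:R * ln p%:R) `^ edelta q * p%:R `^ r_pm q y p kappa lam *
       ((p ^ V)%:R / B1) `^ ek q * B1 `^ el q)%:C%C.
  move=> n10 n1E NV VN hf1 M1 B1 B10 B1V.
  have X1 : (p%:R ^ (n1%:Z - w1 - kappa%:Z - iota' p (y + 1)) : R) = (p ^ V)%:R.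
    by apply: pX_expz; move: n1E DE; clear; lia.
  have hn1 : w1 + en0 q (y + 1) p kappa lt <= n1%:Z by rewrite N0E; move: n1E NV; clear; lia.
  have hu1 : eu0 q (y + 1) p kappa lt <= u'%:Z by rewrite u'E.
  have := hC p pr (y + 1) w1 kappa lt n1 u' ad1 n10 u'0 c1 c2 hn1 hu1 f1 hf1 M1 B1; rewrite /= X1.
  move=> /(_ B10 B1V) h; apply: le_trans h _; rewrite lecR; exact: datum_rescale.
(* The datum for y + 1 with w = 0 at the least admissible n = N0 + D, where the maximal length is
   p^N0. *)
have [LB1 LB2] : 1 <= Num.max 1 C * (N%:R * ln p%:R) `^ edelta q * p%:R `^ (r_pm q y p kappa lam + ek q * N0%:R) /\
   1 <= Num.max 1 C * (N%:R * ln p%:R) `^ edelta q * p%:R `^ (r_pm q y p kappa lam + (el q - 2^-1) * N0%:R).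
  have n1E : (N0 + D)%N%:Z = 0 + D%:Z + N0%:Z by clear; lia.
  have N0N : (N0 <= N)%N by move: g2 D0; clear; lia.
  have pos : (0 < N0 + D)%N by rewrite addn_gt0 N00.
  have pN : (p ^ N0 <= p ^ (N0 + D))%N by rewrite leq_pexp2l ?prime_gt0// leq_addr.
  have pN0 : (0 < p ^ N0)%N by rewrite expn_gt0 prime_gt0.
  have [] := base_lower y1 kp (ltW c4) pN0 pN (fun f1 h => dat 0 N0 f1 (N0 + D)%N pos n1E (leqnn _) N0N h).
  move: (_ * _ `^ edelta q) => La; have pNe : (p ^ N0)%:R = p%:R `^ N0%:R :> R by rewrite pwn natrX.
  rewrite pNe divr1 powR1 mulr1 -powRrM => h1 h2; split.
    by rewrite (pwD pr) mulrA [ek q * _]mulrC.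
  rewrite divff ?gt_eqF ?powR_gt0 ?ltr0n ?prime_gt0// powR1 mulr1 -powRrM in h2.
  rewrite -powR12_sqrt ?powR_ge0// -powRrM in h2.
  rewrite (pwD pr) mulrA; have P0 : 0 < p%:R `^ (N0%:R / 2) :> R by apply: powR_gt0; rewrite ltr0n prime_gt0.
  rewrite -(ler_pM2r P0) mul1r -[leRHS]mulrA -(pwD pr); apply: le_trans h2 _.
  by rewrite le_eqVlt; apply/orP; left; apply/eqP; congr (_ * _ `^ _); field.
have ex : exists2 ex : R, (p ^ (((u' + (p <= 3)).+1)./2 - kappa + (p == 2%N)))%:R <= 81%:R * p%:R `^ ex &
    ex <= 0 \/ (2 * ek q + 1 - el q) * (2 * ex) - (r_pm q y p kappa lam - 1) / (ek q + 1) + ek q * D%:R / (ek q + 1) <= ek q * N%:R.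
  exists (Num.max 0 (u_excess q y p kappa lam y)%:~R / 2).
    apply: chi_bound => //; rewrite /u_excess -/lt u'E iota'_2//.
    have e0 : 0 <= eps p y by rewrite /eps.
    rewrite !intrD mulrNz -[(u'%:Z)%:~R]/(u'%:R) -[(kappa%:Z)%:~R]/(kappa%:R) -[((_ : nat)%:Z)%:~R]/((p == 2%N : nat)%:R).
    by rewrite lerDl ler0z.
  have [ux|ux] := leP (u_excess q y p kappa lam y) 0.
    by left; rewrite max_l ?lerz0// mul0r.
  right; rewrite max_r ?ler0z ?(ltW ux)//.
  have eu1 : eps_u q y p kappa lam = 1.
    by rewrite /eps_u leNgt (lt_le_trans ux (pm_ge _ _)).
  rewrite eu1 mul1r in g6; move: g6; rewrite -(ler_pM2l k0); apply: le_trans.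
  rewrite le_eqVlt; apply/orP; left; apply/eqP.
  by field; rewrite !gt_eqF//; apply: addr_gt0.
have hmain := hK p N D N0 _ (r_pm q y p kappa lam) (phase R f n) pr D0 N00 g1 g2 g3 _ LB1 LB2 (phase_uni _ _ _) c2' c3' _ ex (M + 1) b b0 _.
have kapmn : kappa%:R + (Num.min (iota' p (y + 1)) (iota' p (y^-1 + 1)))%:~R <= D%:R :> R.
  rewrite -[D%:R]/((D%:Z)%:~R) DE intrD lerD2l ler_int; by rewrite ge_min lexx.
rewrite XE; apply: (@final_ineq _ p N D b (ek q) (el q) (edelta q) (Num.max 1 C) K (r_pm q y p kappa lam) _ _ B) => //.
- by move: g1 D0; clear; lia.
- by apply: addr_gt0 => //; apply: lt_le_trans l0; rewrite invr_gt0.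
- exact: nrm_ge0.
apply: hmain.
- by rewrite ler_pdivrMr ?subr_gt0// in g5; rewrite -addrA [leRHS]mulrC.
- move=> h B1 M1 h0 hodd hchi hV B10 B1V.
  have [tau tauE] : exists tau, h = (2 * tau)%N by exists h./2; rewrite mul2n -[LHS]odd_double_half (negbTE hodd).
  have tau0 : (0 < tau)%N by move: h0; rewrite tauE; clear; lia.
  have lh : (logn p h = (p == 2%N) + logn p tau)%N.
    by rewrite tauE lognM// -[2%N in LHS]expn1 logn_prime// eq_sym.
  have hu' : (u' + (p <= 3) <= 2 * (kappa + logn p tau))%N.
    move: hchi; rewrite lh => hchi; have := odd_double_half (u' + (p <= 3)).+1.
    have : (odd (u' + (p <= 3)%N).+1 <= 1)%N by case: odd.
    move: hchi; move: (half _) => a; move: (nat_of_bool (odd _)) => o.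
    by move: (nat_of_bool (p == 2%N)) (nat_of_bool (p <= 3)%N) => s t; clear; lia.
  case: hf => om [om' [uo uo' [If [gam [g [[_ hg] hfd]]]]]].
  have [I I1 hI] := @sdiff_phase R p pr tau tau0 f n If.
  have cl := sdiff_class tau0 y0 uo uo' kap0 hg hfd c5 c6 c4 hu' e1 If I1.
  rewrite -tauE in cl hI.
  have hV2 : (D + logn p h <= N)%N by move: hV; clear -hDN; lia.
  have V1 : n%:Z = w + kappa%:Z + iota' p y + (logn p h)%:Z + D%:Z + (N - D - logn p h)%N%:Z.
    by rewrite NE; move: hV2; clear; lia.
  have V2 : (N0 <= N - D - logn p h)%N by move: hV; clear; lia.
  have V3 : (N - D - logn p h <= N)%N by clear; lia.
  have := dat _ _ _ n n0 V1 V2 V3 cl (M1 + tau%:Z - 1) B1%:R; rewrite ltr0n ler_nat => /(_ B10 B1V).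
  rewrite exp_sumE natrK nrmE lecR subrK; congr (nrm _ <= _).
  apply: eq_bigr => i _; rewrite hI; congr (dm _ _ _); clear; lia.
- by rewrite -(ler_nat R); apply: le_trans bB _; rewrite -XE.
Qed.

End Generic.

(** * The Polya-Vinogradov inequality for phases with prescribed second differences *)

Section PolyaVinogradov.
Variable R : realType.
Local Notation C := (R[i]).
Local Notation e := (@e R).

Lemma eX (x : R) (n : nat) : e (x * n%:R) = e x ^+ n.
Proof.
elim: n => [|n IH]; first by rewrite mulr0 e0.
by rewrite exprS -IH -eD -natr1 mulrDr mulr1 addrC.
Qed.

Lemma nrm_geom (x : R) (b : nat) :
  nrm (\sum_(i < b) e (x * i%:R)) * nrm (1 - e x) <= 2.
Proof.
rewrite -nrmM; under eq_bigr => i _ do rewrite eX.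
have -> : (\sum_(i < b) e x ^+ i) * (1 - e x) = 1 - e x ^+ b.
  by rewrite -opprB -[RHS]opprB subrX1 mulrN mulrC.
apply: le_trans (nrmD _ _) _; rewrite nrmN -eX nrm_e.
by rewrite -(e0 R) nrm_e; lra.
Qed.

(* 1/a, replaced by 1 at a = 0. *)
Definition hw (a : nat) : R := if a == 0%N then 1 else a%:R^-1.

Lemma hw_sum (Q : nat) : \sum_(a < Q.+2) hw a <= 2 + ln Q.+1%:R.
Proof.
elim: Q => [|Q IH].
  by rewrite !big_ord_recr big_ord0 /= /hw /= add0r ln1 invr1; lra.
rewrite big_ord_recr /=; apply: le_trans (_ : 2 + ln Q.+1%:R + hw Q.+2 <= _); first by rewrite lerD2r.
rewrite -addrA lerD2l /hw /=.
have q0 : 0 < Q.+2%:R :> R by rewrite ltr0n.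
have -> : Q.+1%:R = Q.+2%:R * (1 - Q.+2%:R^-1) :> R.
  by rewrite mulrBr mulr1 divff ?gt_eqF// -[in RHS]natr1 addrK.
have q1 : Q.+2%:R^-1 < 1 :> R by rewrite invf_lt1// ltr1n.
rewrite lnM ?posrE ?subr_gt0//.
have : ln (1 + - Q.+2%:R^-1) <= - Q.+2%:R^-1 :> R by apply: le_ln1Dx; rewrite ltrN2.
by rewrite -addrA gerDl -lerBrDr sub0r.
Qed.

(** The two weights measure the distances of (a + t)/Q from 0 and from 1. At a = 0 and a = Q - 1,
    where these may be arbitrarily small, the trivial bound is used. *)
Lemma geom_le (Q a b : nat) (t : R) : (1 < Q)%N -> (a < Q)%N -> (b <= Q)%N -> 0 <= t < 1 ->
  nrm (\sum_(i < b) e ((a%:R + t) / Q%:R * i%:R)) <= Q%:R * (hw a + hw (Q.-1 - a)).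
Proof.
move=> Q1 aQ bQ /andP[t0 t1]; set x := (a%:R + t) / Q%:R; set S := nrm _.
have Q0 : 0 < Q%:R :> R by rewrite ltr0n ltnW.
have hw0 c : 0 <= hw c by rewrite /hw; case: eqP => // _; rewrite invr_ge0.
have triv : S <= Q%:R.
  apply: le_trans (nrm_sum _ _ _) _; rewrite (eq_bigr (fun=> 1)) => [|i _]; last exact: nrm_e.
  by rewrite sumr_const card_ord ler_nat.
have S0 : 0 <= S by exact: nrm_ge0.
have [a0|a0] := posnP a.
  apply: le_trans triv _; rewrite -[leLHS]mulr1 ler_pM2l// a0 {1}/hw eqxx lerDl//.
have [aQ1|aQ1] := eqVneq a Q.-1.
  by apply: le_trans triv _; rewrite -[leLHS]mulr1 ler_pM2l// aQ1 subnn /hw eqxx lerDr -/(hw _).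
have ha : hw a = a%:R^-1 by rewrite /hw gtn_eqF.
have c0 : (0 < Q.-1 - a)%N by move: aQ aQ1; clear; lia.
have hc : hw (Q.-1 - a) = (Q%:R - 1 - a%:R)^-1.
  rewrite /hw gtn_eqF// natrB; last by move: c0; clear; lia.
  by rewrite -subn1 natrB// ltnW.
have aR : 1 <= a%:R :> R by rewrite ler1n.
have cR : 0 < Q%:R - 1 - a%:R :> R.
  have : (a + 2)%N%:R <= Q%:R :> R by rewrite ler_nat; move: c0; clear; lia.
  by rewrite natrD; lra.
have geo := nrm_geom x b; rewrite -/S in geo.
have x0 : 0 < x by rewrite divr_gt0//; lra.
rewrite mulrDr ha hc; have [xh|xh] := leP x 2^-1.
  apply: le_trans (_ : Q%:R / a%:R <= _); last first.
    by rewrite lerDl mulr_ge0 ?invr_ge0 ?ltW.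
  have h1 : 2 * x <= nrm (1 - e x) by apply: nrm_1Be; rewrite x0.
  have h2 : S * x <= 1 by have := ler_wpM2l S0 h1; move: geo; lra.
  rewrite ler_pdivlMr; last by lra.
  move: h2; rewrite /x mulrA ler_pdivrMr// mul1r; apply: le_trans.
  by rewrite ler_wpM2l// lerDl.
have xl : 1 - x = (Q%:R - a%:R - t) / Q%:R.
  by rewrite /x; field; rewrite gt_eqF.
have x1 : 0 < 1 - x by rewrite xl divr_gt0//; lra.
have hh : (2^-1 : R) * 2 = 1 by rewrite mulVf.
have h1 : 2 * (1 - x) <= nrm (1 - e x).
  have -> : nrm (1 - e x) = nrm (1 - e (1 - x)).
    have -> : 1 - e x = - (e x * (1 - e (- x))) by rewrite mulrBr mulr1 -eD subrr e0 opprB.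
    have e1 : e 1 = 1 := e_nat R 1.
    by rewrite nrmN nrmM nrm_e mul1r [e (1 - x)]eD e1 mul1r.
  by apply: nrm_1Be; rewrite x1; move: xh hh; lra.
have h2 : S * (1 - x) <= 1 by have := ler_wpM2l S0 h1; move: geo; lra.
apply: le_trans (_ : Q%:R / (Q%:R - 1 - a%:R) <= _); last first.
  by rewrite lerDr mulr_ge0 ?invr_ge0 ?(ltW Q0)//; lra.
rewrite ler_pdivlMr//; move: h2; rewrite xl mulrA ler_pdivrMr// mul1r; apply: le_trans.
by rewrite ler_wpM2l//; lra.
Qed.

Section Phase.
Variables (p N : nat) (g : int -> C) (t : R).
Hypotheses (pp : prime p) (N0 : (0 < N)%N) (ug : uni g) (hC2 : C2 p N g).
Hypotheses (t01 : 0 <= t < 1) (gt : forall m, dm (p ^ N)%N%:Z g m = e t).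
Local Notation Q := (p ^ N)%N.

Let Q0 : (0 < Q)%N. Proof. by rewrite expn_gt0 prime_gt0. Qed.

(* Multiplying by a linear phase makes g periodic modulo p^N. *)
Definition twist (m : int) : C := g m * e (- (t / Q%:R * m%:~R)).

Lemma twist_per m : twist (m + Q%:Z) = twist m.
Proof.
rewrite /twist (dm_shift _ _ ug) gt rmorphD /= mulrDr opprD eD.
have -> : t / Q%:R * (Q%:Z)%:~R = t by rewrite -[(Q%:Z)%:~R]/(Q%:R : R) divfK// pnatr_eq0 -lt0n.
by rewrite [X in _ * X = _]mulrC mulrACA -eD subrr e0 mul1r.
Qed.

Lemma dm_sum_zero (s : nat) : (0 < s < Q)%N -> \sum_(m < Q) dm s%:Z g m%:Z = 0.
Proof.
move=> /andP[s0 sQ].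
have vs : (logn p s < N)%N.
  by rewrite -(ltn_exp2l _ _ (prime_gt1 pp)); apply: leq_ltn_trans sQ; rewrite dvdn_leq// pfactor_dvdnn.
have [s' cs sE] := pfactor_coprime pp s0.
have [th nth hth] := C2_unit pp N0 hC2.
have ns' : ~~ (p%:Z %| s'%:Z)%Z by rewrite dvdzE /= -prime_coprime.
have per m : dm s%:Z g (m + Q%:Z) = dm s%:Z g m.
  by rewrite (dm_shift _ _ (dm_uni _ ug)) (C2_triv (k := s%:Z) _ hC2)// mul1r.
have e1 : (p ^ (N.-1 - logn p s) * s = p ^ N.-1 * s')%N.
  have -> : (p ^ N.-1 = p ^ (N.-1 - logn p s) * p ^ logn p s)%N.
    by rewrite -expnD subnK// -ltnS prednK.
  by rewrite -mulnA; congr (_ * _)%N; rewrite [RHS]mulnC; exact: sE.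
have sh m : dm s%:Z g (m + (p ^ (N.-1 - logn p s))%N%:Z) = ez R p (s'%:Z * th) * dm s%:Z g m.
  rewrite (dm_shift _ _ (dm_uni _ ug)); congr (_ * _); apply: hth.
  by rewrite -PoszM e1 PoszM.
have := sum_shift_zero per sh => /eqP; rewrite -subr_eq0 -[X in X - _]mul1r -mulrBl mulf_eq0 subr_eq0 eq_sym.
by rewrite (negbTE (ez_p_neq1 _ pp _)) ?Euclid_dvdzM ?negb_or ?ns'//= => /eqP.
Qed.

(** As for a Gauss sum, every correlation except that of the shift 0 vanishes, by [dm_sum_zero]. *)
Lemma twist_fhat a : nrm (fhat Q twist a) <= Num.sqrt Q%:R.
Proof.
suff h : nrm (fhat Q twist a) ^+ 2 <= Q%:R.
  by rewrite -[leLHS]ger0_norm ?nrm_ge0// -sqrtr_sqr ler_wsqrtr.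
set G := fun m : int => twist m * ez R Q (- (a * m)).
have perG m : G (m + Q%:Z) = G m.
  rewrite /G twist_per; congr (_ * _); apply: (@ez_cong _ _ _ _ (- a)); ring.
apply: le_trans (nrm_sqr_sum_period perG) _.
have GE (s : nat) (m : int) : G (m + s%:Z) * (G m)^*%C =
    dm s%:Z g m * (e (- (t / Q%:R * s%:R)) * ez R Q (- (a * s%:Z))) :> C.
  rewrite /G /twist /dm !conjM -ezN opprK -eN opprK.
  have -> : ez R Q (- (a * s%:Z)) = ez R Q (- (a * (m + s%:Z))) * ez R Q (a * m).
    by rewrite -ezD; congr ez; ring.
  have -> : e (- (t / Q%:R * s%:R)) = e (- (t / Q%:R * (m + s%:Z)%:~R)) * e (t / Q%:R * m%:~R).
    by rewrite -eD; congr (Defs.e _); rewrite rmorphD /= -[(s%:Z)%:~R]/(s%:R : R); ring.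
  by ring.
have tn (s : nat) : nrm (\sum_(m < Q) G (m%:Z + s%:Z) * (G m%:Z)^*%C) =
    nrm (\sum_(m < Q) dm s%:Z g m%:Z).
  rewrite (eq_bigr _ (fun (m : 'I_Q) _ => GE s m)) -mulr_suml !nrmM nrm_e nrm_ez !mulr1 //.
rewrite (bigD1 (Ordinal Q0))//= [X in _ + X]big1 ?addr0 => [|s s0]; last first.
  rewrite tn dm_sum_zero ?nrm0// ltn_ord andbT lt0n.
  by apply: contra s0 => /eqP h; apply/eqP/val_inj.
rewrite (tn 0%N); apply: le_trans (nrm_sum _ _ _) _.
rewrite (eq_bigr (fun=> 1)) => [|m _]; last exact: (dm_uni _ ug).
by rewrite sumr_const card_ord.
Qed.

(** Completion of the sum; the constant 12 covers 2 (2 + ln Q), by 1 <= 2 ln Q. *)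
Lemma pv_bound (M : int) (b : nat) : (b <= Q)%N ->
  nrm (isum g M b) <= 12%:R * (Num.sqrt Q%:R * ln Q%:R).
Proof.
move=> bQ; have QR : 0 < Q%:R :> R by rewrite ltr0n.
have Q1 : (1 < Q)%N by apply: leq_trans (prime_gt1 pp) _; rewrite -[X in (X <= _)%N]expn1 leq_pexp2l// prime_gt0.
have -> : isum g M b = \sum_(a < Q) (Q%:R^-1 * fhat Q twist a%:Z * e ((a%:R + t) / Q%:R * M%:~R)) *
   \sum_(i < b) e ((a%:R + t) / Q%:R * i%:R).
  rewrite /isum; under [RHS]eq_bigr => a _ do rewrite mulr_sumr.
  rewrite exchange_big /=; apply: eq_bigr => i _.
  have -> : g (M + i%:Z) = twist (M + i%:Z) * e (t / Q%:R * (M + i%:Z)%:~R).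
    by rewrite /twist -mulrA -eD addNr e0 mulr1.
  rewrite (fourier_inv _ Q0 twist_per) mulr_sumr mulr_suml; apply: eq_bigr => a _.
  rewrite -!mulrA; congr (_ * (_ * _)); rewrite /ez -!eD; congr (Defs.e _).
  rewrite rmorphM rmorphD /= -[(i%:Z)%:~R]/(i%:R : R) -[((nat_of_ord a)%:Z)%:~R]/((nat_of_ord a)%:R : R).
  by ring.
apply: le_trans (nrm_sum _ _ _) _.
apply: le_trans (_ : \sum_(a < Q) Num.sqrt Q%:R * (hw a + hw (Q.-1 - a)) <= _).
  apply: ler_sum => a _; rewrite !nrmM nrm_e mulr1.
  have h1 := twist_fhat a%:Z; have h2 := geom_le Q1 (ltn_ord a) bQ t01.
  have -> : nrm (Q%:R^-1 : C) = Q%:R^-1 by rewrite /nrm Normc.normcV -/(nrm _) nrm_nat.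
  apply: le_trans (_ : Q%:R^-1 * Num.sqrt Q%:R * (Q%:R * (hw a + hw (Q.-1 - a))) <= _).
    by apply: ler_pM => //; rewrite ?nrm_ge0 ?mulr_ge0 ?nrm_ge0 ?invr_ge0 ?(ltW QR)// ler_wpM2l ?invr_ge0 ?(ltW QR).
  by rewrite le_eqVlt; apply/orP; left; apply/eqP; field; rewrite gt_eqF.
rewrite -mulr_sumr big_split /=.
have -> : \sum_(a < Q) hw (Q.-1 - a) = \sum_(a < Q) hw a.
  rewrite (reindex_inj rev_ord_inj) /=; apply: eq_bigr => a _; congr hw.
  by have := ltn_ord a; lia.
have [q' qE] : exists q', Q = q'.+2 by exists (Q - 2)%N; lia.
have := hw_sum q'; rewrite -qE => hs.
have l1 : 1 <= 2 * ln Q%:R :> R.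
  apply: le_trans (ln2_ge R) _; rewrite ler_pM2l//.
  by rewrite ler_ln ?posrE ?ltr0n// ler_nat.
have l2 : ln q'.+1%:R <= ln Q%:R :> R by rewrite ler_ln ?posrE ?ltr0n// ler_nat qE.
rewrite mulrCA ler_wpM2l ?sqrtr_ge0//; lra.
Qed.

End Phase.
End PolyaVinogradov.

(** * The cases k = 0 and l = 1 *)

Section Boundary.
Variable R : realType.

Lemma exp_sum_le p (pr : prime p) (f : nat -> padicQ pr) n M (B : R) : 0 <= B ->
  nrm (isum (phase R f n) M (Num.truncn B)) <= B.
Proof.
move=> B0; apply: le_trans (isum_le _ _ (phase_uni R f n)) _.
by rewrite truncn_le.
Qed.

Lemma datum_k0 (q : exponent_tuple R) : padic_exponent_datum q ->
  ek q = 0 -> padic_exponent_datum (transform_k0 q).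
Proof.
move=> [wf [C C0 hC]] k0; split; first exact: wf_k0.
(* The bound is proved in squared form, where C <= (C + 1)^2 is needed. *)
exists (C + 1); first by apply: addr_gt0.
move=> p pr y w kappa lam n u ad n0 u0 hk hl hn hu f hf M B X B0 BX.
rewrite /= in hk hl hn hu *.
have := hC p pr y w kappa lam n u ad n0 u0 hk hl hn hu f hf M B B0 BX.
rewrite exp_sumE nrmE !lecR -/X; set S := nrm _.
have SB : S <= B by apply: exp_sum_le; exact: ltW.
have S0 : 0 <= S by exact: nrm_ge0.
have X0 : 0 <= X by exact: le_trans (ltW B0) BX.
have -> : k_new q = 0 by rewrite /k_new k0 mul0r.
have -> : l_new q = (el q + 1) / 2 by rewrite /l_new k0 !add0r mulr1.
rewrite k0 !powRr0 !mulr1 => hS.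
rewrite -(@ler_pXn2r _ 2) ?nnegrE ?mulr_ge0 ?powR_ge0//; last by apply: addr_ge0 => //; exact: ltW.
rewrite !exprMn !powR_sq expr2.
have h : S * S <= C * (p%:R `^ er q y p kappa lam * B `^ el q * ln X `^ edelta q) * B by apply: ler_pM.
apply: le_trans h _.
have e2 x : 2 * (x / 2) = x :> R by rewrite mulrC divfK.
rewrite !e2 powRD; last by rewrite (gt_eqF B0) implybT.
rewrite powRr1 ?(ltW B0)//.
set a := p%:R `^ _; set b := B `^ _; set c := ln X `^ _.
have -> : C * (a * b * c) * B = C * (a * (b * B) * c) by ring.
apply: ler_wpM2r; first by rewrite !mulr_ge0 ?powR_ge0 ?(ltW B0).
by nra.
Qed.

Lemma min_interp (k S A B : R) : 0 <= k -> 0 <= S -> S <= A -> S <= B ->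
  S <= A `^ (k / (k + 1)) * B `^ (1 / (k + 1)).
Proof.
move=> k0 S0 SA SB; have k1 : 0 < k + 1 by lra.
have [->|Sn] := eqVneq S 0; first by rewrite mulr_ge0 ?powR_ge0.
have Sp : 0 < S by rewrite lt_def Sn.
have -> : S = S `^ (k / (k + 1)) * S `^ (1 / (k + 1)).
  rewrite -powRD; last by rewrite (negbTE Sn) implybT.
  by rewrite -mulrDl divff ?gt_eqF// powRr1.
apply: ler_pM; rewrite ?powR_ge0//; apply: ge0_ler_powR;
  rewrite ?nnegrE ?divr_ge0 ?(ltW k1) ?(le_trans S0 SA) ?(le_trans S0 SB)//.
Qed.

(** The linear coefficient of f is arbitrary, so p^N need not be a period; but the second
    differences make the ratio under this translation constant. *)
Lemma phase_quasiperiod p (pr : prime p) (f : nat -> padicQ pr) (n N : nat) : C2 p N (phase R f n) ->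
  exists2 t : R, 0 <= t < 1 & forall m, dm (p ^ N)%N%:Z (phase R f n) m = e t.
Proof.
move=> hC2; have ug := @phase_uni p pr R f n.
have cst m : dm (p ^ N)%N%:Z (phase R f n) m = dm (p ^ N)%N%:Z (phase R f n) 0.
  rewrite -[m in LHS]add0r (dm_shift _ _ (dm_uni _ ug)) (C2_triv (k := m) _ hC2) ?mul1r//.
  by rewrite mulrC.
have [z hz] : exists z : padicQ pr, dm (p ^ N)%N%:Z (phase R f n) 0 = e_padic R z.
  by rewrite /dm /phase -e_padicN -e_padicD; eexists.
have [a [m ham]] := Qp_approx z; have hze := e_padicE R ham.
pose x : R := a%:~R / (p ^ m)%:R.
exists (x - (Num.floor x)%:~R).
  by rewrite subr_ge0 floor_le ltrBlDl -intrD1 floorD1_gt.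
move=> m'; rewrite cst hz hze /ez -/x eD.
by rewrite -mulrNz e_int mulr1.
Qed.

Lemma datum_l1 (q : exponent_tuple R) : padic_exponent_datum q ->
  el q = 1 -> padic_exponent_datum (transform_l1 q).
Proof.
move=> [wf _] l1; split; first exact: wf_l1.
have k0 : 0 <= ek q by case: wf => -[/andP[]].
(* The constant of [pv_bound] enters with the exponent k / (k + 1) <= 1. *)
exists 12%:R => // p pr y w kappa lam n u ad n0 u0 hk hl hn hu f hf M B X B0 BX.
rewrite /= in hk hl hn hu *.
rewrite exp_sumE nrmE lecR.
have i12 := iota'_ge0 12 p.
case: (ad) => y0 _ kp _.
have [N NE] : exists N : nat, n%:Z = w + kappa%:Z + iota' p y + N%:Z.
  have [|N NE] := @int_nat (n%:Z - w - kappa%:Z - iota' p y).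
    by move: hn i12; generalize (iota' p 12) => z; clear; lia.
  by exists N; move: NE; clear; lia.
have N0 : (0 < N)%N by move: hn i12 NE; generalize (iota' p 12) => z; clear; lia.
have XE : X = (p ^ N)%:R by apply: pX_expz; move: NE; clear; lia.
have fc : Num.floor lam <= Num.ceil lam.
  by rewrite -(ler_int R); apply: le_trans (floor_le _) (ceil_ge _).
have hu' : kappa%:Z + iota' p y + 1 <= u%:Z + Num.ceil lam.
  have : kappa%:Z - Num.floor lam + iota' p y + 1 <= u%:Z by move: hu; rewrite ge_max => /andP[].
  by move: fc; clear; lia.
have hC2 := class_C2 y0 kp hf NE hl hu'.
have [t t01 ht] := phase_quasiperiod hC2.
have bN : (Num.truncn B <= p ^ N)%N.
  by rewrite -(ler_nat R) -XE; apply: le_trans BX; rewrite truncn_le ltW.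
have h1 := pv_bound pr N0 (@phase_uni p pr R f n) hC2 t01 ht (M + 1) bN.
have h2 := exp_sum_le f n (M + 1) (ltW B0).
apply: le_trans (min_interp k0 (nrm_ge0 _) h1 h2) _.
have k1 : 0 < ek q + 1 by lra.
have Q0 : 0 < (p ^ N)%:R :> R by rewrite ltr0n expn_gt0 prime_gt0.
have l0 : 0 <= ln (p ^ N)%:R :> R by rewrite ln_ge0// ler1n expn_gt0 prime_gt0.
rewrite XE powRr0 [1 * (_ `^ _)]mul1r -powR12_sqrt ?(ltW Q0)//.
have hs := mulr_ge0 (powR_ge0 ((p ^ N)%:R : R) 2^-1) l0.
rewrite (powRM _ (ler0n R 12) hs) (powRM _ (powR_ge0 _ _) l0) -powRrM.
rewrite /k_new /l_new l1 powR_div ?(ltW Q0)//.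
have -> : 1 / (ek q + 1) = - (ek q / (2 * (ek q + 1))) + (ek q + 1 + 1) / (2 * (ek q + 1)).
  by field; rewrite gt_eqF.
rewrite powRD; last by rewrite (gt_eqF B0) implybT.
have -> : 2^-1 * (ek q / (ek q + 1)) = ek q / (2 * (ek q + 1)) by field; rewrite gt_eqF.
set a := 12%:R `^ _; set b := (p ^ N)%:R `^ _; set c := ln _ `^ _; set d := B `^ _; set f1 := B `^ _.
have -> : a * (b * c) * (d * f1) = a * (b * d * f1 * c) by ring.
apply: ler_wpM2r; first by rewrite !mulr_ge0 ?powR_ge0.
rewrite /a -[leRHS]powRr1 ?ler0n//; apply: ler_powR; first by rewrite ler1n.
by rewrite ler_pdivrMr// mul1r lerDl.
Qed.

End Boundary.

Theorem theorem5 (R : realType) (q : exponent_tuple R) :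
  padic_exponent_datum q ->
  [/\ (0 < ek q <= 2^-1 -> 2^-1 <= el q < 1 ->
         padic_exponent_datum (transform_generic q)),
      (ek q = 0 -> padic_exponent_datum (transform_k0 q)) &
      (el q = 1 -> padic_exponent_datum (transform_l1 q))].
Proof.
by move=> hq; split; [exact: datum_generic|exact: datum_k0|exact: datum_l1].
Qed.
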